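(* Let $n\geq 2$ and $\tau\in(0,\sqrt[2n]{2}-1)$. Let $(V,\omega)$ be the monotone symplectic manifold obtained by symplectically blowing up the unit ball in $\mathbb{R}^{2n}$, and for $t>0$ let $U_t\subset V$ be the corresponding blowup of $B_{1+t}$. For symplectic manifolds $(W,\omega)$ of dimension $2n$ set $$c^{\tau}(W,\omega)=\sup\big\{\pi r^2\mid \text{there is a symplectic embedding } r\big(\overline{B_{1+\tau}}\setminus B_1\big)\hookrightarrow (W,\omega)\big\}.$$ Then the function $(0,\infty)\ni t\mapsto c^{\tau}(U_t)$ is discontinuous at $t=\tau$.
   Context: $\mathbb{R}^{2n}$ has coordinates $(x_1,y_1,\ldots,x_n,y_n)$ and standard symplectic form $\omega_{\mathrm{st}}=\sum_j \mathrm{d}x_j\wedge \mathrm{d}y_j$; $B_r\subset\mathbb{R}^{2n}$ is the open ball of radius $r$ centred at $0$, and $r(\overline{B_{1+\tau}}\setminus B_1)=\overline{B_{r(1+\tau)}}\setminus B_r$ for $r>0$. The symplectic blowup of $\mathbb{R}^{2n}$ (resp. $B_{1+t}$) along the unit ball is the symplectic manifold obtained by removing the open ball $B_1$ and collapsing the boundary sphere $\partial B_1$ along the fibres of the Hopf fibration $\partial B_1\to\mathbb{C}P^{n-1}$. Thus it contains an exceptional divisor $\mathbb{C}P^{n-1}$ whose lines have symplectic area $\pi$, and the complement of the exceptional divisor is symplectomorphic to $\mathbb{R}^{2n}\setminus\overline{B_1}$ (resp. $B_{1+t}\setminus\overline{B_1}$) with $\omega_{\mathrm{st}}$. A symplectic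 embedding of the closed shell $r(\overline{B_{1+\tau}}\setminus B_1)$ means a symplectic embedding of some open neighbourhood of it in $\mathbb{R}^{2n}$ into $(W,\omega)$. *)

(* Defs.v *)
From mathcomp Require Import all_boot all_order all_algebra.
From mathcomp Require Import all_classical all_reals all_analysis.
From mathcomp Require Import ring lra.

Set Implicit Arguments.
Unset Strict Implicit.
Unset Printing Implicit Defensive.

Import Order.TTheory GRing.Theory Num.Theory.
Import numFieldNormedType.Exports.

Local Open Scope classical_set_scope.
Local Open Scope ring_scope.

(* The space R^(2n) is 'M[R]_(n, 2): row j of z is (z j 0, z j 1) = (x_j, y_j),
   also read as the complex number x_j + i y_j.  The library's norm on matrices
   is the maximum norm, hence the separate Euclidean norm (the topologies
   agree). *)

Definition omega_st (R : realType) (n : nat) (v w : 'M[R]_(n, 2)) : R :=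
  \sum_(j < n) (v j 0 * w j 1 - v j 1 * w j 0).

Definition enorm (R : realType) (n : nat) (z : 'M[R]_(n, 2)) : R :=
  Num.sqrt (\sum_(j < n) (z j 0 ^+ 2 + z j 1 ^+ 2)).

Definition eball (R : realType) (n : nat) (r : R) : set 'M[R]_(n, 2) :=
  [set z | enorm z < r].

Definition ecball (R : realType) (n : nat) (r : R) : set 'M[R]_(n, 2) :=
  [set z | enorm z <= r].

Arguments eball {R} n r.
Arguments ecball {R} n r.

Fixpoint Ck (R : realType) (V : normedModType R) (k : nat) (A : set V)
    (f : V -> R) : Prop :=
  if k is k'.+1 then
    (forall x, A x -> differentiable f x) /\
    (forall v, Ck k' A (fun x => 'D_v f x))
  else forall x, A x -> {for x, continuous f}.

Definition smooth (R : realType) (V : normedModType R) (A : set V)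
  (f : V -> R) : Prop := forall k, Ck k A f.

Definition smooth_mx (R : realType) (V : normedModType R) (m n : nat)
    (A : set V) (f : V -> 'M[R]_(m, n)) : Prop :=
  forall i j, smooth A (fun x => f x i j).

Section SmoothTheory.
Context {R : realType} {V : normedModType R}.
Implicit Types (A : set V) (f g : V -> R).

Lemma near_eq_differentiable f g x :
  (\near x, f x = g x) -> differentiable f x -> differentiable g x.
Proof.
move=> fg df; have fgx : f x = g x by exact: (nbhs_singleton fg).
have dfx := diff_locally df.
have dg : g \o shift x = cst (g x) + 'd f x +o_ 0 id.
  apply/eqaddoE/eqaddoP => _/posnumP[e].
  have /eqaddoP/(_ e%:num)/(_ [gt0 of e%:num]) := dfx.
  have nfg : \forall y \near (0 : V), f (y + x) = g (y + x).
    move: fg; rewrite (near_shift 0) subr0 => fg.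
    by near=> y; have := near fg y; rewrite /= ; apply.
  apply: filter_app; apply: filterS nfg => y yfg.
  rewrite (_ : (f \o shift x - (cst (f x) + 'd f x)) y =
               (g \o shift x - (cst (g x) + 'd f x)) y) //.
  by rewrite -[LHS]/(f (y + x) - (f x + 'd f x y)) yfg fgx.
have cd := diff_continuous df.
by apply/diff_locallyP; rewrite (diff_unique cd dg).
Unshelve. all: by end_near. Qed.

Lemma open_near_eq A f g x : open A -> {in A, f =1 g} -> A x ->
  \near x, f x = g x.
Proof.
move=> oA fg Ax; have : \near x, A x by exact: open_nbhs_nbhs.
by apply: filterS => y Ay; apply: fg; rewrite inE.
Qed.

Lemma Ck_ext k A f g : open A -> {in A, f =1 g} -> Ck k A f -> Ck k A g.
Proof.
elim: k f g => [|k IH] f g oA fg /=.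
  move=> cf x Ax; have nfg := open_near_eq oA fg Ax.
  rewrite /prop_for /continuous_at -(fg x) ?inE//.
  by apply: cvg_trans (cf _ Ax); exact: near_eq_cvg.
move=> [df cf]; split=> [x Ax|v].
  by apply: near_eq_differentiable (df _ Ax); exact: open_near_eq oA fg Ax.
apply: IH (cf v) => // x /[!inE] Ax.
by apply: near_eq_derive; exact: open_near_eq oA fg Ax.
Qed.

Lemma CkW k A f : Ck k.+1 A f -> Ck k A f.
Proof.
elim: k f => [|k IH] f /= [df cf].
  by move=> x /df /differentiable_continuous.
by split=> // v; apply: IH.
Qed.

Lemma Ck_cst k A c : Ck k A (cst c).
Proof.
elim: k c => [|k IH] c /=; first by move=> x _; exact: cst_continuous.
split=> [x _|v]; first exact: differentiable_cst.
rewrite [X in Ck k A X](_ : _ = cst 0) //.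
by apply/funext => x; exact: derive_cst.
Qed.

Lemma CkD k A f g : open A -> Ck k A f -> Ck k A g -> Ck k A (f \+ g).
Proof.
move=> oA; elim: k f g => [|k IH] f g /=.
  by move=> cf cg x Ax; apply: cvgD; [exact: cf|exact: cg].
move=> [df cf] [dg cg]; split=> [x Ax|v].
  by apply: differentiableD; [exact: df|exact: dg].
apply: Ck_ext (IH _ _ (cf v) (cg v)) => // x /[!inE] Ax /=.
by rewrite deriveD//; apply: diff_derivable; [exact: df|exact: dg].
Qed.

Lemma CkM k A f g : open A -> Ck k A f -> Ck k A g -> Ck k A (f \* g).
Proof.
move=> oA; elim: k f g => [|k IH] f g.
  by move=> cf cg x Ax; apply: cvgM; [exact: cf|exact: cg].
move=> kf kg; have [df cf] := kf; have [dg cg] := kg; split=> [x Ax|v].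
  by apply: differentiableM; [exact: df|exact: dg].
have h1 := IH _ _ (CkW kf) (cg v); have h2 := IH _ _ (CkW kg) (cf v).
apply: Ck_ext (CkD oA h1 h2) => // x /[!inE] Ax /=.
by rewrite deriveM//; apply: diff_derivable; [exact: df|exact: dg].
Qed.

Lemma CkN k A f : open A -> Ck k A f -> Ck k A (\- f).
Proof.
move=> oA kf; apply: Ck_ext (CkM oA (Ck_cst k A (-1)) kf) => // x _ /=.
by rewrite /cst mulN1r.
Qed.

Lemma CkV k A f : open A -> (forall x, A x -> f x != 0) ->
  Ck k A f -> Ck k A (fun x => (f x)^-1).
Proof.
move=> oA f0; elim: k => [|k IH].
  by move=> cf x Ax; apply: cvgV; [exact: f0|exact: cf].
move=> kf; have [df cf] := kf; have kV := IH (CkW kf).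
split=> [x Ax|v]; first by apply: differentiableV; [exact: df|exact: f0].
apply: Ck_ext (CkN oA (CkM oA (CkM oA kV kV) (cf v))) => // x /[!inE] Ax /=.
rewrite (deriveV (f0 _ Ax)); last by apply: diff_derivable; exact: df.
by rewrite -exprVn expr2 scaleNr.
Qed.

Lemma Ck_sqrt k A f : open A -> (forall x, A x -> 0 < f x) ->
  Ck k A f -> Ck k A (fun x => Num.sqrt (f x)).
Proof.
move=> oA f0; elim: k => [|k IH].
  move=> cf x Ax; apply: (@continuous_comp _ _ _ f Num.sqrt); first exact: cf.
  exact: sqrt_continuous.
move=> kf; have [df cf] := kf; have kS := IH (CkW kf).
have dS x : A x -> differentiable (Num.sqrt : R -> R) (f x).
  move=> Ax; apply/derivable1_diffP.
  by have := is_derive1_sqrt (f0 _ Ax) => -[].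
split=> [x Ax|v].
  by apply: (@differentiable_comp _ _ _ _ f Num.sqrt); [exact: df|exact: dS].
have S0 x : A x -> 2 * Num.sqrt (f x) != 0.
  by move=> Ax; rewrite mulf_neq0 // gt_eqF // sqrtr_gt0 f0.
have kV := CkV oA S0 (CkM oA (Ck_cst k A 2) kS).
apply: Ck_ext (CkM oA (cf v) kV) => // x /[!inE] Ax /=.
have dc : differentiable (Num.sqrt \o f) x.
  by apply: differentiable_comp; [exact: df|exact: dS].
rewrite -[RHS]/('D_v (Num.sqrt \o f) x) (deriveE _ dc).
rewrite diff_comp; [|exact: df|exact: dS].
have [dS1 dSv] := is_derive1_sqrt (f0 _ Ax).
by rewrite /= (deriv1E dS1) /= derive1E dSv -(deriveE _ (df _ Ax)).
Qed.

Lemma Ck_linear k A (f : {linear V -> R}) : continuous f -> Ck k A f.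
Proof.
move=> cf; case: k => [|k]; first by move=> x _; exact: cf.
split=> [x _|v]; first exact: linear_differentiable.
rewrite [X in Ck k A X](_ : _ = cst (f v)); first exact: Ck_cst.
apply/funext => x; rewrite deriveE ?diff_lin //.
exact: linear_differentiable.
Qed.

Lemma Ck_sum k A n (f : 'I_n -> V -> R) : open A ->
  (forall i, Ck k A (f i)) -> Ck k A (fun x => \sum_(i < n) f i x).
Proof.
move=> oA kf; have h : forall m (g : 'I_m -> V -> R), (forall i, Ck k A (g i)) ->
    Ck k A (fun x => \sum_(i < m) g i x).
  elim=> [|m IH] g kg.
    apply: Ck_ext (Ck_cst k A 0) => // x _; by rewrite big_ord0.
  have h1 := IH _ (fun i => kg (lift ord0 i)).
  apply: Ck_ext (CkD oA (kg ord0) h1) => // x _ /=.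
  by rewrite big_ord_recl.
exact: h.
Qed.

Lemma smooth_ext A f g : open A -> {in A, f =1 g} -> smooth A f -> smooth A g.
Proof. by move=> oA fg sf k; apply: Ck_ext (sf k). Qed.

Lemma smooth_cst A c : smooth A (cst c).
Proof. by move=> k; exact: Ck_cst. Qed.

Lemma smoothD A f g : open A -> smooth A f -> smooth A g ->
  smooth A (fun x => f x + g x).
Proof. by move=> oA sf sg k; exact: CkD. Qed.

Lemma smoothM A f g : open A -> smooth A f -> smooth A g ->
  smooth A (fun x => f x * g x).
Proof. by move=> oA sf sg k; exact: CkM. Qed.

Lemma smoothN A f : open A -> smooth A f -> smooth A (fun x => - f x).
Proof. by move=> oA sf k; exact: CkN. Qed.

Lemma smoothB A f g : open A -> smooth A f -> smooth A g ->
  smooth A (fun x => f x - g x).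
Proof. by move=> oA sf sg; apply: smoothD => //; exact: smoothN. Qed.

Lemma smoothV A f : open A -> (forall x, A x -> f x != 0) -> smooth A f ->
  smooth A (fun x => (f x)^-1).
Proof. by move=> oA f0 sf k; exact: CkV. Qed.

Lemma smooth_sqrt A f : open A -> (forall x, A x -> 0 < f x) -> smooth A f ->
  smooth A (fun x => Num.sqrt (f x)).
Proof. by move=> oA f0 sf k; exact: Ck_sqrt. Qed.

Lemma smooth_sum A n (f : 'I_n -> V -> R) : open A ->
  (forall i, smooth A (f i)) -> smooth A (fun x => \sum_(i < n) f i x).
Proof. by move=> oA sf k; apply: Ck_sum => // i; exact: sf. Qed.

Lemma smooth_derivable A f x v : smooth A f -> A x -> derivable f x v.
Proof. by move=> /(_ 1%N)[df _] Ax; apply: diff_derivable; exact: df. Qed.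

Lemma smooth_continuous A f x : smooth A f -> A x -> {for x, continuous f}.
Proof. by move=> /(_ 0%N); apply. Qed.

Lemma smooth_sub A B f : B `<=` A -> smooth A f -> smooth B f.
Proof.
move=> BA sf k; have := sf k; elim: k {sf} f => [|k IH] f /=.
  by move=> cf x /BA; exact: cf.
by move=> [df cf]; split=> [x /BA|v]; [exact: df|exact: IH].
Qed.

End SmoothTheory.

Lemma smooth_coord (R : realType) (m n : nat) (A : set 'M[R]_(m, n)) i j :
  smooth A (fun x : 'M[R]_(m, n) => x i j).
Proof.
move=> k.
have @f : {linear 'M[R]_(m, n) -> R}.
  by exists (fun N : 'M[R]_(_, _) => N i j); do 2![eexists]; do ?[constructor];
     rewrite ?mxE// => ? *; rewrite ?mxE//; move=> ?; rewrite !mxE.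
by rewrite (_ : (fun _ => _) = f) //; apply: Ck_linear; exact: coord_continuous.
Qed.

(* Openness for the topology generated by an atlas. *)
Definition atlas_open (R : realType) (n : nat) (T I : Type) (dom : I -> set T)
    (chart : I -> T -> 'M[R]_(n, 2)) (A : set T) : Prop :=
  forall i, open [set chart i p | p in dom i `&` A].

(* A symplectic manifold of dimension 2n, given by a smooth atlas together with
   the local expressions of its 2-form: [sm_form i x v w] is the value at the
   point x of the image of the i-th chart on the vectors v, w.  The underlying
   set is the subset [sm_set] of the type [sm_pt], and its topology is the one
   generated by the atlas; [sm_par i] inverts [sm_chart i]. *)
Record symplecticManifold (R : realType) (n : nat) := SymplecticManifold {
  sm_pt : Type ;
  sm_set : set sm_pt ;
  sm_idx : Type ;
  sm_dom : sm_idx -> set sm_pt ;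
  sm_chart : sm_idx -> sm_pt -> 'M[R]_(n, 2) ;
  sm_par : sm_idx -> 'M[R]_(n, 2) -> sm_pt ;
  sm_form : sm_idx -> 'M[R]_(n, 2) -> 'M[R]_(n, 2) -> 'M[R]_(n, 2) -> R ;
  sm_cover : sm_set = \bigcup_i sm_dom i ;
  sm_countable : exists2 D : set sm_idx,
    countable D & sm_set `<=` \bigcup_(i in D) sm_dom i ;
  sm_chartK : forall i p, sm_dom i p -> sm_par i (sm_chart i p) = p ;
  sm_overlap : forall i j, open [set sm_chart i p | p in sm_dom i `&` sm_dom j] ;
  sm_transition : forall i j,
    smooth_mx [set sm_chart i p | p in sm_dom i `&` sm_dom j]
              (sm_chart j \o sm_par i) ;
  sm_hausdorff : forall p q, sm_set p -> sm_set q -> p <> q ->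
    exists A B, [/\ atlas_open sm_dom sm_chart A,
      atlas_open sm_dom sm_chart B, A p, B q & A `&` B = set0] ;
  sm_form_linear : forall i p, sm_dom i p -> forall a u v w,
    sm_form i (sm_chart i p) (a *: u + v) w =
    a * sm_form i (sm_chart i p) u w + sm_form i (sm_chart i p) v w ;
  sm_form_antisym : forall i p, sm_dom i p -> forall v w,
    sm_form i (sm_chart i p) v w = - sm_form i (sm_chart i p) w v ;
  sm_form_nondegenerate : forall i p, sm_dom i p -> forall v,
    (forall w, sm_form i (sm_chart i p) v w = 0) -> v = 0 ;
  sm_form_smooth : forall i v w,
    smooth (sm_chart i @` sm_dom i) (fun x => sm_form i x v w) ;
  sm_form_closed : forall i p, sm_dom i p -> forall u v w,
    'D_u (fun x => sm_form i x v w) (sm_chart i p) +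
    'D_v (fun x => sm_form i x w u) (sm_chart i p) +
    'D_w (fun x => sm_form i x u v) (sm_chart i p) = 0 ;
  sm_form_compat : forall i j p, sm_dom i p -> sm_dom j p -> forall v w,
    sm_form j (sm_chart j p) ('D_v (sm_chart j \o sm_par i) (sm_chart i p))
                             ('D_w (sm_chart j \o sm_par i) (sm_chart i p)) =
    sm_form i (sm_chart i p) v w
}.

Arguments sm_set {R n} s _.
Arguments sm_dom {R n} s _ _.
Arguments sm_chart {R n} s _ _.
Arguments sm_par {R n} s _ _.
Arguments sm_form {R n} s _ _ _ _.

Definition sm_open (R : realType) (n : nat) (M : symplecticManifold R n)
    (A : set (sm_pt M)) : Prop :=
  A `<=` sm_set M /\ atlas_open (sm_dom M) (sm_chart M) A.

Section OpenSubmanifold.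
Context {R : realType} {n : nat} (M : symplecticManifold R n).
Variables (U : set (sm_pt M)) (oU : sm_open U).

Let dom i := sm_dom M i `&` U.
Let chart := sm_chart M.

Let chartI i (A B : set (sm_pt M)) : A `<=` sm_dom M i ->
  B `<=` sm_dom M i ->
  chart i @` (A `&` B) = chart i @` A `&` chart i @` B.
Proof.
move=> Ai Bi; apply/seteqP; split=> [_ [p [Ap Bp] <-]|x]; first by split; exists p.
move=> [[p Ap <-] [q Bq qp]]; exists p => //; split => //.
by rewrite -(sm_chartK (Ai _ Ap)) -[sm_chart _ _ _]/(chart i p) -qp (sm_chartK (Bi _ Bq)).
Qed.

Let sub_open A : atlas_open (sm_dom M) chart A -> atlas_open dom chart A.
Proof.
move=> oA i; rewrite (_ : _ `&` A =
    (sm_dom M i `&` A) `&` (sm_dom M i `&` U)).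
  rewrite chartI; [|exact: subIsetl|exact: subIsetl].
  by apply: openI; [exact: oA|exact: oU.2].
by apply/seteqP; split=> p /= [[? ?] ?].
Qed.

Let overlapE i j : [set chart i p | p in dom i `&` dom j] =
  [set chart i p | p in sm_dom M i `&` sm_dom M j] `&`
  [set chart i p | p in sm_dom M i `&` U].
Proof.
rewrite -chartI; [|exact: subIsetl|exact: subIsetl]; congr (_ @` _).
by apply/seteqP; split=> p /= [[? ?] [? ?]].
Qed.

Let cover : U = \bigcup_i dom i.
Proof.
apply/seteqP; split=> [p Up|p [i _ []//]].
by have := oU.1 _ Up; rewrite sm_cover => -[i _ ip]; exists i.
Qed.

Let cntbl : exists2 D : set (sm_idx M), countable D & U `<=` \bigcup_(i in D) dom i.
Proof.
have [D cD MD] := sm_countable M; exists D => // p Up.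
by have [i Di ip] := MD _ (oU.1 _ Up); exists i.
Qed.

Let transition i j : smooth_mx [set chart i p | p in dom i `&` dom j]
  (chart j \o sm_par M i).
Proof.
move=> k l; apply: smooth_sub (sm_transition i j k l).
by rewrite overlapE; exact: subIsetl.
Qed.

Let hausdorff p q : U p -> U q -> p <> q -> exists A B,
  [/\ atlas_open dom chart A, atlas_open dom chart B, A p, B q & A `&` B = set0].
Proof.
move=> Up Uq pq.
have [A [B [oA oB Ap Bq AB]]] := sm_hausdorff (oU.1 _ Up) (oU.1 _ Uq) pq.
by exists A, B; split=> //; exact: sub_open.
Qed.

Definition open_submanifold : symplecticManifold R n.
Proof.
refine (@SymplecticManifold R n (sm_pt M) U (sm_idx M) dom chart
  (sm_par M) (sm_form M) cover cntbl _ _ transition hausdorff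
  _ _ _ _ _ _).
- by move=> i p [ip _]; exact: sm_chartK.
- by move=> i j; rewrite overlapE; apply: openI; [exact: sm_overlap|exact: oU.2].
- by move=> i p [ip _]; exact: sm_form_linear.
- by move=> i p [ip _]; exact: sm_form_antisym.
- by move=> i p [ip _]; exact: sm_form_nondegenerate.
- move=> i v w; apply: smooth_sub (sm_form_smooth i v w).
  by apply: image_subset; exact: subIsetl.
- by move=> i p [ip _]; exact: sm_form_closed.
- by move=> i j p [ip _] [jp _]; exact: sm_form_compat.
Defined.

End OpenSubmanifold.

(* A symplectic embedding of the open set O of (R^(2n), omega_st) into M: a
   smooth symplectic map (its differential is therefore injective) which is a
   homeomorphism onto its image.  Only the values of f on O matter. *)
Definition symplectic_embedding (R : realType) (n : nat)
    (M : symplecticManifold R n) (O : set 'M[R]_(n, 2))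
    (f : 'M[R]_(n, 2) -> sm_pt M) : Prop :=
  [/\ f @` O `<=` sm_set M,
      {in O &, injective f},
      forall i, open (O `&` f @^-1` sm_dom M i) /\
        smooth_mx (O `&` f @^-1` sm_dom M i) (sm_chart M i \o f),
      forall A, open A -> A `<=` O ->
        exists2 B, sm_open B & f @` A = B `&` f @` O
    & forall i x, O x -> sm_dom M i (f x) -> forall v w,
        sm_form M i (sm_chart M i (f x)) ('D_v (sm_chart M i \o f) x)
                                     ('D_w (sm_chart M i \o f) x) =
        omega_st v w].

Arguments symplectic_embedding {R n} M O f.

Definition closed_shell (R : realType) (n : nat) (tau r : R) :
    set 'M[R]_(n, 2) :=
  [set r *: z | z in ecball n (1 + tau) `\` eball n 1].

Arguments closed_shell {R} n tau r.

Definition shell_embeds (R : realType) (n : nat) (tau : R)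
    (M : symplecticManifold R n) (r : R) : Prop :=
  exists O (f : 'M[R]_(n, 2) -> sm_pt M), [/\ open O, closed_shell n tau r `<=` O &
    symplectic_embedding M O f].

Definition shell_capacity (R : realType) (n : nat) (tau : R)
    (M : symplecticManifold R n) : \bar R :=
  ereal_sup [set (pi * r ^+ 2)%:E | r in [set r | 0 < r /\ shell_embeds tau M r]].

(* Multiplication of z, seen in C^n, by the complex number a + i b. *)
Definition crot (R : realType) (n : nat) (a b : R) (z : 'M[R]_(n, 2)) :
    'M[R]_(n, 2) :=
  \matrix_(k, l) (if l == 0 then a * z k 0 - b * z k 1
                  else b * z k 0 + a * z k 1).

(* A point of the blowup is an equivalence class of points outside the open unit
   ball: a singleton off the unit sphere, a Hopf circle on the unit sphere. *)
Definition collapse (R : realType) (n : nat) (z : 'M[R]_(n, 2)) :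
    set 'M[R]_(n, 2) :=
  [set z' | z' = z \/
    (enorm z = 1 /\ exists a b, a ^+ 2 + b ^+ 2 = 1 /\ z' = crot a b z)].

Definition blowup_set (R : realType) (n : nat) : set (set 'M[R]_(n, 2)) :=
  [set collapse z | z in ~` eball n 1].

Arguments blowup_set R n : clear implicits.

(* The smooth structure near the exceptional divisor is that of the symplectic
   cut: the class of z corresponds to the class of (z, sqrt (|z|^2 - 1)) in
     {(z, w) in C^n x C : |z|^2 - |w|^2 = 1} / S^1,
   where e^(i theta) acts by (e^(i theta) z, e^(-i theta) w), with the reduction
   of the standard form.  The chart [None] is the inclusion of the complement of
   the divisor, on which w can be made positive.  The chart [Some j] covers
   z_j != 0: one rotates (z, w) so that z_j > 0 and replaces the coordinate z_j
   by w; the divisor becomes the locus where the j-th coordinate vanishes.  The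
   2-form is omega_st in all these charts. *)
Definition blowup_dom (R : realType) (n : nat) (a : option 'I_n) :
    set (set 'M[R]_(n, 2)) :=
  if a is Some j then [set collapse z | z in [set z | 1 <= enorm z /\ row j z != 0]]
  else [set collapse z | z in [set z | 1 < enorm z]].

Definition cut_chart (R : realType) (n : nat) (a : option 'I_n)
    (z : 'M[R]_(n, 2)) : 'M[R]_(n, 2) :=
  if a is Some j then
    let m := enorm (row j z) in
    let w := Num.sqrt (enorm z ^+ 2 - 1) in
    \matrix_(k, l) (if k == j then w * (z j l / m)
                    else crot (z j 0 / m) (- (z j 1 / m)) z k l)
  else z.

Definition blowup_chart (R : realType) (n : nat) (a : option 'I_n)
  (p : set 'M[R]_(n, 2)) : 'M[R]_(n, 2) := cut_chart a (get p).

(* The inverse charts: from the coordinates u in the chart a one recovers z and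
   w = cut_w0 + i cut_w1, then rotates so that w becomes nonnegative. *)
Definition cut_z (R : realType) (n : nat) (a : option 'I_n)
    (u : 'M[R]_(n, 2)) : 'M[R]_(n, 2) :=
  if a is Some j then
    \matrix_(k, l) (if k == j then
        if l == 0 then Num.sqrt (1 + 2 * enorm (row j u) ^+ 2 - enorm u ^+ 2)
        else 0
      else u k l)
  else u.

Definition cut_w0 (R : realType) (n : nat) (a : option 'I_n)
    (u : 'M[R]_(n, 2)) : R :=
  if a is Some j then u j 0 else Num.sqrt (enorm u ^+ 2 - 1).

Definition cut_w1 (R : realType) (n : nat) (a : option 'I_n)
    (u : 'M[R]_(n, 2)) : R :=
  if a is Some j then u j 1 else 0.

Definition cut_class (R : realType) (n : nat) (z : 'M[R]_(n, 2)) (w0 w1 : R) :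
    set 'M[R]_(n, 2) :=
  let m := Num.sqrt (w0 ^+ 2 + w1 ^+ 2) in
  collapse (if m == 0 then z else crot (w0 / m) (w1 / m) z).

Definition blowup_par (R : realType) (n : nat) (a : option 'I_n)
    (u : 'M[R]_(n, 2)) : set 'M[R]_(n, 2) :=
  cut_class (cut_z a u) (cut_w0 a u) (cut_w1 a u).

Section BlowupTheory.
Context {R : realType} {n : nat}.
Implicit Types (a b : option 'I_n) (z u : 'M[R]_(n, 2)) (c s w : R).

Definition csq z (j : 'I_n) := z j 0 ^+ 2 + z j 1 ^+ 2.
Definition sqn z := \sum_(j < n) csq z j.

Lemma csq_ge0 z j : 0 <= csq z j.
Proof. by rewrite addr_ge0 // sqr_ge0. Qed.

Lemma sqn_ge0 z : 0 <= sqn z.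
Proof. by apply: sumr_ge0 => j _; exact: csq_ge0. Qed.

Lemma enorm2 z : enorm z ^+ 2 = sqn z.
Proof. by rewrite sqr_sqrtr // sqn_ge0. Qed.

Lemma enorm_rowE z j : enorm (row j z) = Num.sqrt (csq z j).
Proof. by rewrite /enorm big_ord1 !mxE. Qed.

Lemma enorm_row2 z j : enorm (row j z) ^+ 2 = csq z j.
Proof. by rewrite enorm_rowE sqr_sqrtr // csq_ge0. Qed.

Lemma enorm_ge1 z : (1 <= enorm z) = (1 <= sqn z).
Proof. by rewrite -enorm2 expr_ge1 // sqrtr_ge0. Qed.

Lemma enorm_gt1 z : (1 < enorm z) = (1 < sqn z).
Proof. by rewrite -enorm2 expr_gt1 // sqrtr_ge0. Qed.

Lemma enorm_eq1 z : enorm z = 1 <-> sqn z = 1.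
Proof.
rewrite -enorm2; split=> [->|/eqP]; first by rewrite expr1n.
by rewrite sqrp_eq1 ?sqrtr_ge0 // => /eqP.
Qed.

Lemma row_neq0 z j : (row j z != 0) = (csq z j != 0).
Proof.
congr (~~ _); apply/eqP/eqP => [h|].
  have := congr1 (fun A : 'rV_2 => A 0 0) h; have := congr1 (fun A : 'rV_2 => A 0 1) h.
  by rewrite !mxE /csq => -> ->; rewrite expr0n addr0.
move/eqP; rewrite paddr_eq0 ?sqr_ge0 // !sqrf_eq0 => /andP[/eqP h0 /eqP h1].
apply/matrixP => i l; rewrite !mxE; case: (unliftP 0 l) => [l'|] ->; last by [].
by rewrite (ord1 l') (_ : lift _ _ = 1) //; apply: val_inj.
Qed.

Lemma ord2P (P : 'I_2 -> Prop) : P 0 -> P 1 -> forall l, P l.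
Proof.
move=> P0 P1 l; case: (unliftP 0 l) => [l'|] ->; last by [].
by rewrite (ord1 l') (_ : lift _ _ = 1) //; apply: val_inj.
Qed.

Lemma mxP2 z z' : (forall k, z k 0 = z' k 0 /\ z k 1 = z' k 1) -> z = z'.
Proof. by move=> h; apply/matrixP => k; apply: ord2P; apply h. Qed.

Lemma crot0 c s z k : crot c s z k 0 = c * z k 0 - s * z k 1.
Proof. by rewrite mxE. Qed.
Lemma crot1 c s z k : crot c s z k 1 = s * z k 0 + c * z k 1.
Proof. by rewrite mxE. Qed.

Lemma crot_id z : crot 1 0 z = z.
Proof. by apply: mxP2 => k; rewrite crot0 crot1; split; ring. Qed.

Lemma crotM c s c' s' z :
  crot c s (crot c' s' z) = crot (c * c' - s * s') (c * s' + s * c') z.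
Proof. by apply: mxP2 => k; rewrite !(crot0, crot1); split; ring. Qed.

Lemma csq_crot c s z j : c ^+ 2 + s ^+ 2 = 1 -> csq (crot c s z) j = csq z j.
Proof.
move=> cs; rewrite /csq crot0 crot1 -[RHS]mul1r -cs; ring.
Qed.

Lemma sqn_crot c s z : c ^+ 2 + s ^+ 2 = 1 -> sqn (crot c s z) = sqn z.
Proof. by move=> cs; apply: eq_bigr => j _; rewrite csq_crot. Qed.

Lemma collapse_crot c s z : c ^+ 2 + s ^+ 2 = 1 -> sqn z = 1 ->
  collapse (crot c s z) = collapse z.
Proof.
move=> cs z1; have e1 : enorm z = 1 by apply/enorm_eq1.
have e1' : enorm (crot c s z) = 1 by apply/enorm_eq1; rewrite sqn_crot.
apply/seteqP; split=> z' /=.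
  move=> [->|[_ [a [b [ab ->]]]]]; first by right; split=> //; exists c, s.
  right; split=> //; exists (a * c - b * s), (a * s + b * c); split.
    by rewrite -[RHS]mulr1 -{1}ab -cs; ring.
  by rewrite crotM.
move=> [->|[_ [a [b [ab ->]]]]]; right; split=> //.
  exists c, (- s); split; first by rewrite sqrrN.
  rewrite crotM -{1}[z]crot_id; congr crot; last by ring.
  by rewrite -cs; ring.
exists (a * c + b * s), (b * c - a * s); split.
  by rewrite -[RHS]mulr1 -{1}ab -cs; ring.
rewrite crotM; congr crot.
  by rewrite -[LHS]mulr1 -cs; ring.
by rewrite -[LHS]mulr1 -cs; ring.
Qed.

Lemma collapse_refl z : collapse z z. Proof. by left. Qed.

Lemma get_collapse z : collapse z (get (collapse z)).
Proof. exact: (getPex (ex_intro _ z (collapse_refl z))). Qed.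

Definition cut_nz b z w0 w1 :=
  if b is Some j then csq z j != 0 else w0 ^+ 2 + w1 ^+ 2 != 0.

Definition phc b z w0 w1 : R :=
  if b is Some j then z j 0 / Num.sqrt (csq z j)
  else w0 / Num.sqrt (w0 ^+ 2 + w1 ^+ 2).

Definition phs b z w0 w1 : R :=
  if b is Some j then - (z j 1 / Num.sqrt (csq z j))
  else w1 / Num.sqrt (w0 ^+ 2 + w1 ^+ 2).

Definition cut_coord b z w0 w1 : 'M[R]_(n, 2) :=
  let c := phc b z w0 w1 in let s := phs b z w0 w1 in
  if b is Some j then
    \matrix_(k, l) (if k == j then if l == 0 then c * w0 + s * w1
                                   else - s * w0 + c * w1
                    else crot c s z k l)
  else crot c s z.

Lemma ph_unit b z w0 w1 : cut_nz b z w0 w1 ->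
  phc b z w0 w1 ^+ 2 + phs b z w0 w1 ^+ 2 = 1.
Proof.
case: b => [j|] /= nv; rewrite ?sqrrN !expr_div_n -mulrDl.
  by rewrite sqr_sqrtr ?csq_ge0 // divff.
by rewrite sqr_sqrtr ?divff // addr_ge0 // sqr_ge0.
Qed.

Lemma csqw c s w0 w1 : c ^+ 2 + s ^+ 2 = 1 ->
  (c * w0 + s * w1) ^+ 2 + (- s * w0 + c * w1) ^+ 2 = w0 ^+ 2 + w1 ^+ 2.
Proof. by move=> cs; rewrite -[RHS]mul1r -cs; ring. Qed.

Lemma cut_nz_act b z w0 w1 c s : c ^+ 2 + s ^+ 2 = 1 ->
  cut_nz b (crot c s z) (c * w0 + s * w1) (- s * w0 + c * w1) = cut_nz b z w0 w1.
Proof. by move=> cs; case: b => [j|] /=; rewrite ?csq_crot // csqw. Qed.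

Lemma ph_act b z w0 w1 c s : c ^+ 2 + s ^+ 2 = 1 ->
  phc b (crot c s z) (c * w0 + s * w1) (- s * w0 + c * w1) =
    phc b z w0 w1 * c + phs b z w0 w1 * s /\
  phs b (crot c s z) (c * w0 + s * w1) (- s * w0 + c * w1) =
    phs b z w0 w1 * c - phc b z w0 w1 * s.
Proof.
move=> cs; case: b => [j|]; rewrite /phc /phs ?csq_crot // ?csqw // ?crot0 ?crot1.
  by split; ring.
by split; ring.
Qed.

Lemma cut_coord_act b z w0 w1 c s : c ^+ 2 + s ^+ 2 = 1 ->
  cut_coord b (crot c s z) (c * w0 + s * w1) (- s * w0 + c * w1) = cut_coord b z w0 w1.
Proof.
move=> cs; rewrite /cut_coord; have [-> ->] := ph_act b z w0 w1 cs.
set C := phc b z w0 w1; set S := phs b z w0 w1.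
have E : crot (C * c + S * s) (S * c - C * s) (crot c s z) = crot C S z.
  rewrite crotM; congr crot; rewrite -[RHS]mulr1 -cs; ring.
rewrite E; case: b @C @S E => [j|] C S E //.
apply/matrixP => k l; rewrite !mxE; case: eqP => [_|//].
by case: (l == 0); rewrite -[RHS]mulr1 -cs; ring.
Qed.

Definition cut_img a u : R :=
  if a is Some j then 1 + 2 * csq u j - sqn u else sqn u - 1.

Lemma cut_z0 j u : cut_z (Some j) u j 0 = Num.sqrt (cut_img (Some j) u).
Proof. by rewrite mxE !eqxx enorm_row2 enorm2. Qed.
Lemma cut_z1 j u : cut_z (Some j) u j 1 = 0.
Proof. by rewrite mxE eqxx. Qed.
Lemma cut_zk j u k l : k != j -> cut_z (Some j) u k l = u k l.
Proof. by move=> kj; rewrite mxE (negPf kj). Qed.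

Definition cut_level z w0 w1 := sqn z - (w0 ^+ 2 + w1 ^+ 2) = 1.

Lemma sqn_split z j : sqn z = csq z j + \sum_(k < n | k != j) csq z k.
Proof. by rewrite /sqn (bigD1 j). Qed.

Lemma cut_levelP a u : 0 < cut_img a u -> cut_level (cut_z a u) (cut_w0 a u) (cut_w1 a u).
Proof.
rewrite /cut_level; case: a => [j|] h; rewrite /cut_w0 /cut_w1.
  rewrite (sqn_split _ j) {1}/csq cut_z0 cut_z1 sqr_sqrtr ?ltW //.
  rewrite (eq_bigr (csq u)) => [|k kj]; last by rewrite /csq !cut_zk.
  rewrite /cut_img.
  have := sqn_split u j; rewrite /csq /= => ->; rewrite /csq; ring.
by rewrite expr0n /= addr0 enorm2 sqr_sqrtr ?ltW // opprB addrC subrK.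
Qed.

Lemma cut_coord_cut a u : 0 < cut_img a u -> cut_coord a (cut_z a u) (cut_w0 a u) (cut_w1 a u) = u.
Proof.
move=> h; have sn0 : Num.sqrt (cut_img a u) != 0 by rewrite gt_eqF // sqrtr_gt0.
have [c1 s0] : phc a (cut_z a u) (cut_w0 a u) (cut_w1 a u) = 1 /\
    phs a (cut_z a u) (cut_w0 a u) (cut_w1 a u) = 0.
  case: a h sn0 => [j|] h sn0; rewrite /phc /phs /csq.
    rewrite cut_z0 cut_z1 expr0n addr0 sqrtr_sqr ger0_norm ?sqrtr_ge0 //.
    by rewrite mul0r oppr0 divff.
  rewrite /cut_w0 /cut_w1 enorm2 expr0n addr0 sqrtr_sqr ger0_norm ?sqrtr_ge0 //.
  by rewrite mul0r divff.
rewrite /cut_coord c1 s0 crot_id; case: a h sn0 {c1 s0} => [j|] h sn0 //.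
apply: mxP2 => k; rewrite !mxE /=; case: eqP => [->|_] //.
by split; ring.
Qed.

Lemma cut_of_coord a z w0 w1 : cut_level z w0 w1 -> cut_nz a z w0 w1 ->
  let u := cut_coord a z w0 w1 in
  let c := phc a z w0 w1 in let s := phs a z w0 w1 in
  [/\ 0 < cut_img a u, cut_z a u = crot c s z,
      cut_w0 a u = c * w0 + s * w1 & cut_w1 a u = - s * w0 + c * w1].
Proof.
move=> mo nv u c s; have cs : c ^+ 2 + s ^+ 2 = 1 := ph_unit nv.
case: a nv @u @c @s cs => [j|] nv u c s cs.
  have uj0 : u j 0 = c * w0 + s * w1 by rewrite mxE eqxx.
  have uj1 : u j 1 = - s * w0 + c * w1 by rewrite mxE eqxx.
  have uk k l : k != j -> u k l = crot c s z k l.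
    by move=> kj; rewrite mxE (negPf kj).
  have E : cut_img (Some j) u = csq z j.
    rewrite /cut_img (sqn_split u j) (eq_bigr (csq z)); last first.
      by move=> k kj; rewrite /csq !uk //; exact: csq_crot.
    move: mo; rewrite /cut_level (sqn_split z j) => mo.
    have -> : csq u j = w0 ^+ 2 + w1 ^+ 2 by rewrite /csq uj0 uj1 csqw.
    by move: mo; set S := \sum_(_ < _ | _) _; lra.
  have z0 : 0 < csq z j by rewrite lt_def csq_ge0 andbT.
  split=> //; first by rewrite E.
  have sn0 : Num.sqrt (csq z j) != 0 by rewrite gt_eqF // sqrtr_gt0.
  apply: mxP2 => k; rewrite crot0 crot1; have [->|kj] := eqVneq k j.
    rewrite cut_z0 cut_z1 E /c /s /phc /phs; split; last by ring.
    have -> : z j 0 / Num.sqrt (csq z j) * z j 0 -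
        - (z j 1 / Num.sqrt (csq z j)) * z j 1 = csq z j / Num.sqrt (csq z j).
      by rewrite /csq; ring.
    by rewrite -{2}[csq z j]sqr_sqrtr ?csq_ge0 // expr2 mulfK.
  by rewrite !cut_zk // !uk // crot0 crot1.
have E : sqn u - 1 = w0 ^+ 2 + w1 ^+ 2.
  rewrite /u /cut_coord sqn_crot //; move: mo; rewrite /cut_level => mo.
  by move: mo; lra.
have w_gt0 : 0 < w0 ^+ 2 + w1 ^+ 2.
  by rewrite lt_def; apply/andP; split=> //; rewrite addr_ge0 // sqr_ge0.
have sn0 : Num.sqrt (w0 ^+ 2 + w1 ^+ 2) != 0 by rewrite gt_eqF // sqrtr_gt0.
split=> //=; first by rewrite E.
  rewrite enorm2 E /c /s /phc /phs.
  have -> : w0 / Num.sqrt (w0 ^+ 2 + w1 ^+ 2) * w0 +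
      w1 / Num.sqrt (w0 ^+ 2 + w1 ^+ 2) * w1 =
      (w0 ^+ 2 + w1 ^+ 2) / Num.sqrt (w0 ^+ 2 + w1 ^+ 2) by ring.
  by rewrite -{2}[w0 ^+ 2 + w1 ^+ 2]sqr_sqrtr ?ltW // expr2 mulfK.
by rewrite /c /s /phc /phs; ring.
Qed.

Definition cut_wr z := Num.sqrt (sqn z - 1).

Lemma cut_level_lift z : 1 <= sqn z -> cut_level z (cut_wr z) 0.
Proof.
move=> z1; rewrite /cut_level /cut_wr expr0n addr0 sqr_sqrtr ?subr_ge0 //.
by ring.
Qed.

Lemma sq_eq0 w0 w1 : w0 ^+ 2 + w1 ^+ 2 = 0 -> w0 = 0 /\ w1 = 0.
Proof.
move/eqP; rewrite paddr_eq0 ?sqr_ge0 // !sqrf_eq0.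
by move=> /andP[/eqP-> /eqP->].
Qed.

Lemma cut_classP z w0 w1 : cut_level z w0 w1 -> exists c s,
  [/\ c ^+ 2 + s ^+ 2 = 1, 1 <= sqn (crot c s z),
      c * w0 + s * w1 = cut_wr (crot c s z), - s * w0 + c * w1 = 0 &
      cut_class z w0 w1 = collapse (crot c s z)].
Proof.
move=> mo; rewrite /cut_class sqrtr_eq0.
have w_ge0 : 0 <= w0 ^+ 2 + w1 ^+ 2 by rewrite addr_ge0 // sqr_ge0.
have E : sqn z - 1 = w0 ^+ 2 + w1 ^+ 2 by move: mo; rewrite /cut_level; lra.
have z1 : 1 <= sqn z by rewrite -subr_ge0 E.
have [wle0|w_gt0] := leP (w0 ^+ 2 + w1 ^+ 2) 0.
  have w0E : w0 ^+ 2 + w1 ^+ 2 = 0 by apply/eqP; rewrite eq_le wle0.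
  have [w00 w10] := sq_eq0 w0E.
  exists 1, 0; rewrite crot_id /cut_wr E w0E sqrtr0 w00 w10.
  by split=> //; rewrite ?expr1n ?expr0n /=; ring.
have nv : cut_nz None z w0 w1 by rewrite /= gt_eqF.
have cs := ph_unit nv; have [i0 _ h0 h1] := cut_of_coord mo nv.
exists (phc None z w0 w1), (phs None z w0 w1); split=> //.
- by rewrite sqn_crot.
- by rewrite -h0 /= enorm2.
Qed.

Lemma cut_class_lift z : 1 <= sqn z -> cut_class z (cut_wr z) 0 = collapse z.
Proof.
move=> z1; rewrite /cut_class expr0n addr0 sqrtr_sqr ger0_norm ?sqrtr_ge0 //.
by case: eqP => // /eqP h; rewrite mul0r divff // crot_id.
Qed.

Lemma cut_class_act z w0 w1 c s : cut_level z w0 w1 -> c ^+ 2 + s ^+ 2 = 1 ->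
  cut_class (crot c s z) (c * w0 + s * w1) (- s * w0 + c * w1) =
  cut_class z w0 w1.
Proof.
move=> mo cs; rewrite /cut_class csqw //; case: eqP => [/eqP|/eqP h].
  rewrite sqrtr_eq0 => w_le0; apply: collapse_crot => //.
  move: mo; rewrite /cut_level.
  suff -> : w0 ^+ 2 + w1 ^+ 2 = 0 by rewrite subr0.
  by apply/eqP; rewrite eq_le w_le0 addr_ge0 // sqr_ge0.
have [] := ph_act None z w0 w1 cs; rewrite /phc /phs csqw // => -> ->.
by rewrite crotM; congr (collapse (crot _ _ _)); rewrite -[RHS]mulr1 -cs; ring.
Qed.

Definition act_invariant (T : Type) (F : 'M[R]_(n, 2) -> R -> R -> T) :=
  forall z w0 w1 c s, c ^+ 2 + s ^+ 2 = 1 ->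
  F (crot c s z) (c * w0 + s * w1) (- s * w0 + c * w1) = F z w0 w1.

Lemma cut_nz_invariant b : act_invariant (cut_nz b).
Proof. by move=> z w0 w1 c s cs; exact: cut_nz_act. Qed.

Lemma cut_coord_invariant b : act_invariant (cut_coord b).
Proof. by move=> z w0 w1 c s cs; exact: cut_coord_act. Qed.

Lemma invariantE T (F : 'M[R]_(n, 2) -> R -> R -> T) z z' : act_invariant F ->
  1 <= sqn z -> collapse z z' -> F z' (cut_wr z') 0 = F z (cut_wr z) 0.
Proof.
move=> iF z1 [->//|[/enorm_eq1 e1 [c [s [cs ->]]]]].
rewrite -(iF z _ _ c s cs); congr F; last by rewrite /cut_wr e1 subrr sqrtr0; ring.
by rewrite /cut_wr sqn_crot // e1 subrr sqrtr0; ring.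
Qed.

Lemma chartE a z : cut_chart a z = cut_coord a z (cut_wr z) 0 \/ a = None.
Proof.
case: a => [j|]; [left|by right]; rewrite /cut_chart /cut_coord /phc /phs.
rewrite enorm2 enorm_rowE -/(cut_wr z); apply: mxP2 => k; rewrite !mxE.
by case: eqP => _; split=> //=; ring.
Qed.

Lemma chart_coord a z : cut_nz a z (cut_wr z) 0 -> cut_chart a z = cut_coord a z (cut_wr z) 0.
Proof.
case: (chartE a z) => [//|->] /= h; rewrite /cut_coord /phc /phs.
rewrite expr0n addr0 sqrtr_sqr ger0_norm ?sqrtr_ge0 // mul0r divff ?crot_id //.
by apply: contraNneq h => ->; rewrite expr0n addr0.
Qed.

Lemma blowup_domE a : blowup_dom a =
  [set collapse z | z in [set z | 1 <= sqn z /\ cut_nz a z (cut_wr z) 0]].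
Proof.
case: a => [j|]; congr (_ @` _); apply/seteqP; split=> z /=.
- by rewrite enorm_ge1 row_neq0.
- by rewrite enorm_ge1 row_neq0.
- rewrite enorm_gt1 => z1; split; first exact: ltW.
  by rewrite expr0n addr0 /cut_wr sqr_sqrtr ?subr_ge0 ?ltW // gt_eqF // subr_gt0.
- rewrite enorm_gt1 => -[z1]; rewrite expr0n addr0 /cut_wr sqr_sqrtr ?subr_ge0 //.
  by move=> h; rewrite -subr_gt0 lt_def h subr_ge0.
Qed.

Lemma blowup_setE : blowup_set R n = [set collapse z | z in [set z | 1 <= sqn z]].
Proof.
rewrite /blowup_set; congr (_ @` _); apply/seteqP; split=> z /=.
  by rewrite /eball /= -enorm_ge1 leNgt => /negP.
by rewrite /eball /= -enorm_ge1 leNgt => /negP.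
Qed.

Lemma chart_collapse a z : 1 <= sqn z -> cut_nz a z (cut_wr z) 0 ->
  blowup_chart a (collapse z) = cut_coord a z (cut_wr z) 0.
Proof.
move=> z1 nv; rewrite /blowup_chart.
have zz' := get_collapse z.
have nv' := invariantE (@cut_nz_invariant a) z1 zz'.
by rewrite chart_coord ?nv' // (invariantE (@cut_coord_invariant a) z1 zz').
Qed.

Lemma par_collapse a u : 0 < cut_img a u -> exists2 z,
  1 <= sqn z & blowup_par a u = collapse z /\
  forall T (F : 'M[R]_(n, 2) -> R -> R -> T), act_invariant F ->
    F z (cut_wr z) 0 = F (cut_z a u) (cut_w0 a u) (cut_w1 a u).
Proof.
move=> iu; have [c [s [cs z1 w0E w1E cE]]] := cut_classP (cut_levelP iu).
exists (crot c s (cut_z a u)) => //; split=> // T F iF.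
by rewrite -[RHS](iF _ _ _ c s) // w0E w1E.
Qed.

Lemma cut_nz_cut a u : 0 < cut_img a u -> cut_nz a (cut_z a u) (cut_w0 a u) (cut_w1 a u).
Proof.
case: a => [j|] iu.
  by rewrite /cut_nz /csq cut_z0 cut_z1 expr0n addr0 sqr_sqrtr ?ltW // gt_eqF.
by rewrite /= expr0n addr0 enorm2 sqr_sqrtr ?ltW // gt_eqF.
Qed.

Lemma chart_image a (Q : 'M[R]_(n, 2) -> R -> R -> Prop) : act_invariant Q ->
  [set blowup_chart a p | p in blowup_dom a `&`
     [set collapse z | z in [set z | 1 <= sqn z /\ Q z (cut_wr z) 0]]] =
  [set u | 0 < cut_img a u /\ Q (cut_z a u) (cut_w0 a u) (cut_w1 a u)].
Proof.
move=> iQ; apply/seteqP; split=> [_ [p [+ [z [z1 Qz] zp]] <-]|u [iu Qu]].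
  rewrite blowup_domE => -[z' [z'1 nv] z'p].
  have : collapse z' z by rewrite z'p -zp; exact: collapse_refl.
  move=> /(invariantE iQ z'1) QE; rewrite QE in Qz.
  rewrite -z'p chart_collapse //.
  have [iu hz h0 h1] := cut_of_coord (cut_level_lift z'1) nv.
  by split=> //; rewrite hz h0 h1 iQ //; exact: ph_unit.
have [z z1 [pE inv]] := par_collapse iu.
have nvz : cut_nz a z (cut_wr z) 0.
  by rewrite (inv _ _ (@cut_nz_invariant a)) cut_nz_cut.
exists (collapse z).
  split; first by rewrite blowup_domE; exists z.
  by exists z => //; split=> //; rewrite (inv _ _ iQ).
by rewrite chart_collapse // (inv _ _ (@cut_coord_invariant a)) cut_coord_cut.
Qed.

Lemma chart_par a b u : 0 < cut_img a u ->
  cut_nz b (cut_z a u) (cut_w0 a u) (cut_w1 a u) ->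
  blowup_chart b (blowup_par a u) =
  cut_coord b (cut_z a u) (cut_w0 a u) (cut_w1 a u).
Proof.
move=> iu nv; have [z z1 [-> inv]] := par_collapse iu.
by rewrite chart_collapse ?(inv _ _ (@cut_nz_invariant b)) //
   (inv _ _ (@cut_coord_invariant b)).
Qed.

Lemma blowup_chartK a (p : set 'M[R]_(n, 2)) : blowup_dom a p -> blowup_par a (blowup_chart a p) = p.
Proof.
rewrite blowup_domE => -[z [z1 nv] <-]; rewrite chart_collapse // /blowup_par.
have mo := cut_level_lift z1; have [_ -> -> ->] := cut_of_coord mo nv.
by rewrite cut_class_act ?cut_class_lift //; exact: ph_unit.
Qed.

Lemma smooth_open_neq0 (A : set 'M[R]_(n, 2)) (f : 'M[R]_(n, 2) -> R) :
  open A -> smooth A f -> open [set u | A u /\ f u != 0].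
Proof.
move=> oA sf; rewrite openE => u [Au fu]; rewrite /interior.
have nA : \near u, A u by exact: open_nbhs_nbhs.
have nf : \near u, f u != 0.
  have /(_ [set r | r != 0]) := smooth_continuous sf Au; apply.
  by apply: open_nbhs_nbhs; split=> //; exact: open_neq.
by near=> v; split; near: v.
Unshelve. all: by end_near. Qed.

Lemma smooth_open_lt (A : set 'M[R]_(n, 2)) (f g : 'M[R]_(n, 2) -> R) :
  open A -> smooth A f -> smooth A g -> open [set u | A u /\ f u < g u].
Proof.
move=> oA sf sg; rewrite openE => u [Au fu]; rewrite /interior.
have nA : \near u, A u by exact: open_nbhs_nbhs.
have nf : \near u, f u < g u.
  have sd := smoothB oA sg sf.
  have h : \near u, 0 < g u - f u.
    have /(_ [set r | 0 < r]) := smooth_continuous sd Au; apply.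
    by apply: open_nbhs_nbhs; split; [exact: open_gt|rewrite /= subr_gt0].
  by apply: filterS h => v; rewrite subr_gt0.
by near=> v; split; near: v.
Unshelve. all: by end_near. Qed.

Lemma smooth_csq A (F : 'M[R]_(n, 2) -> 'M[R]_(n, 2)) j : open A ->
  smooth_mx A F -> smooth A (fun u => csq (F u) j).
Proof.
move=> oA sF; exact: smooth_ext (smoothD oA (smoothM oA (sF j 0) (sF j 0))
  (smoothM oA (sF j 1) (sF j 1))).
Qed.

Lemma smooth_sqn A (F : 'M[R]_(n, 2) -> 'M[R]_(n, 2)) : open A ->
  smooth_mx A F -> smooth A (fun u => sqn (F u)).
Proof. by move=> oA sF; apply: smooth_sum => // j; exact: smooth_csq. Qed.

Lemma smooth_id A : smooth_mx A (fun u : 'M[R]_(n, 2) => u).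
Proof. by move=> k l; exact: smooth_coord. Qed.

Lemma smooth_cut_img a : smooth [set: 'M[R]_(n, 2)] (cut_img a).
Proof.
have oT : open [set: 'M[R]_(n, 2)] by exact: openT.
have sn := smooth_sqn oT (@smooth_id setT).
case: a => [j|] /=; last exact: smoothB oT sn (smooth_cst _ _).
have sj := smooth_csq j oT (@smooth_id setT).
exact: smoothB oT (smoothD oT (smooth_cst _ 1) (smoothM oT (smooth_cst _ 2) sj)) sn.
Qed.

Definition cut_dom a : set 'M[R]_(n, 2) := [set u | 0 < cut_img a u].

Lemma open_cut_dom a : open (cut_dom a).
Proof.
have := smooth_open_lt openT (smooth_cst _ 0) (smooth_cut_img a).
by congr open; apply/seteqP; split=> u //= -[].
Qed.

Lemma smooth_sqrt_img a : smooth (cut_dom a) (fun u => Num.sqrt (cut_img a u)).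
Proof.
apply: smooth_sqrt => //; first exact: open_cut_dom.
by apply: smooth_sub (smooth_cut_img a).
Qed.

Lemma smooth_cut_z a : smooth_mx (cut_dom a) (cut_z a).
Proof.
case: a => [j|] k l; last exact: smooth_coord.
have oD := @open_cut_dom (Some j); have [->|kj] := eqVneq k j.
  move: l; apply: ord2P.
    by apply: smooth_ext (smooth_sqrt_img (Some j)) => // u _; rewrite cut_z0.
  by apply: smooth_ext (smooth_cst _ 0) => // u _; rewrite cut_z1.
by apply: smooth_ext (smooth_coord _ k l) => // u _; rewrite cut_zk.
Qed.

Lemma smooth_cut_w0 a : smooth (cut_dom a) (cut_w0 a).
Proof.
case: a => [j|]; first exact: smooth_coord.
apply: smooth_ext (smooth_sqrt_img None) => [|u _]; first exact: open_cut_dom.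
by rewrite /cut_w0 enorm2.
Qed.

Lemma smooth_cut_w1 a : smooth (cut_dom a) (cut_w1 a).
Proof. by case: a => [j|]; [exact: smooth_coord|exact: smooth_cst]. Qed.

Definition cut_overlap a b : set 'M[R]_(n, 2) :=
  [set u | 0 < cut_img a u /\ cut_nz b (cut_z a u) (cut_w0 a u) (cut_w1 a u)].

Lemma overlapE a b :
  [set blowup_chart a p | p in blowup_dom a `&` blowup_dom b] = cut_overlap a b.
Proof.
have iQ : act_invariant (fun z w0 w1 => is_true (cut_nz b z w0 w1)).
  by move=> z w0 w1 c s cs; rewrite cut_nz_act.
by rewrite (blowup_domE b) (chart_image a iQ).
Qed.

Definition cut_sq b z w0 w1 :=
  if b is Some j then csq z j else w0 ^+ 2 + w1 ^+ 2.

Lemma cut_nzE b z w0 w1 : cut_nz b z w0 w1 = (cut_sq b z w0 w1 != 0).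
Proof. by case: b. Qed.

Lemma smooth_cut_sq a b : smooth (cut_dom a)
  (fun u => cut_sq b (cut_z a u) (cut_w0 a u) (cut_w1 a u)).
Proof.
have oD := @open_cut_dom a; case: b => [j|]; first exact: smooth_csq oD (@smooth_cut_z a).
have [s0 s1] := (@smooth_cut_w0 a, @smooth_cut_w1 a).
exact: smooth_ext (smoothD oD (smoothM oD s0 s0) (smoothM oD s1 s1)).
Qed.

Lemma open_overlap a b : open (cut_overlap a b).
Proof.
have := smooth_open_neq0 (@open_cut_dom a) (smooth_cut_sq a b).
by congr open; apply/seteqP; split=> u /=; rewrite /cut_overlap /= cut_nzE.
Qed.

Lemma overlap_sub a b : cut_overlap a b `<=` cut_dom a.
Proof. by move=> u []. Qed.

Section Transition.
Variables a b : option 'I_n.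
Let A := cut_overlap a b.
Let oA : open A. Proof. exact: open_overlap. Qed.
Let z (u : 'M[R]_(n, 2)) := cut_z a u.
Let w0 (u : 'M[R]_(n, 2)) := cut_w0 a u.
Let w1 (u : 'M[R]_(n, 2)) := cut_w1 a u.
Let c u := phc b (z u) (w0 u) (w1 u).
Let s u := phs b (z u) (w0 u) (w1 u).
Let P k u := c u * z u k 0 - s u * z u k 1.
Let Q k u := s u * z u k 0 + c u * z u k 1.
Let W0 u := c u * w0 u + s u * w1 u.
Let W1 u : R := - s u * w0 u + c u * w1 u.

Let sz k l : smooth A (fun u => z u k l).
Proof. exact: smooth_sub (@overlap_sub a b) (smooth_cut_z a k l). Qed.
Let sw0 : smooth A w0.
Proof. exact: smooth_sub (@overlap_sub a b) (smooth_cut_w0 a). Qed.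
Let sw1 : smooth A w1.
Proof. exact: smooth_sub (@overlap_sub a b) (smooth_cut_w1 a). Qed.

Let sq_gt0 u : A u -> 0 < cut_sq b (z u) (w0 u) (w1 u).
Proof.
move=> [_]; rewrite cut_nzE lt_def => ->; case: b => [j|] /=; first exact: csq_ge0.
by rewrite addr_ge0 // sqr_ge0.
Qed.

Let sm : smooth A (fun u => (Num.sqrt (cut_sq b (z u) (w0 u) (w1 u)))^-1).
Proof.
apply: smoothV => //; first by move=> u Au; rewrite gt_eqF // sqrtr_gt0 sq_gt0.
by apply: smooth_sqrt => //; apply: smooth_sub (smooth_cut_sq a b); exact: overlap_sub.
Qed.

Let sc : smooth A c.
Proof.
move: (sm); rewrite /c; case: b => [j|] h.
  exact: smoothM oA (sz j 0) h.
exact: smoothM oA sw0 h.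
Qed.

Let ss : smooth A s.
Proof.
move: (sm); rewrite /s; case: b => [j|] h.
  exact: smoothN oA (smoothM oA (sz j 1) h).
exact: smoothM oA sw1 h.
Qed.

Let sP k : smooth A (P k).
Proof. exact: smoothB oA (smoothM oA sc (sz k 0)) (smoothM oA ss (sz k 1)). Qed.
Let sQ k : smooth A (Q k).
Proof. exact: smoothD oA (smoothM oA ss (sz k 0)) (smoothM oA sc (sz k 1)). Qed.
Let sW0 : smooth A W0.
Proof. exact: smoothD oA (smoothM oA sc sw0) (smoothM oA ss sw1). Qed.
Let sW1 : smooth A W1.
Proof. exact: smoothD oA (smoothM oA (smoothN oA ss) sw0) (smoothM oA sc sw1). Qed.

Let T : 'M[R]_(n, 2) -> 'M[R]_(n, 2) := blowup_chart b \o blowup_par a.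

Let TE u : A u -> T u = cut_coord b (z u) (w0 u) (w1 u).
Proof. by move=> [iu nu]; exact: chart_par. Qed.

Lemma smooth_transition : smooth_mx A T.
Proof.
have TE' k l : {in A, (fun u => cut_coord b (z u) (w0 u) (w1 u) k l) =1
    (fun u => T u k l)} by move=> u /[!inE] Au; rewrite TE.
move=> k l; apply: smooth_ext (TE' k l) _ => //.
rewrite /cut_coord; move: (sP) (sQ) (sW0) (sW1); rewrite /P /Q /W0 /W1 /c /s.
case: b => [j|] hP hQ hW0 hW1; move: l; apply: ord2P.
- have [kj|kj] := eqVneq k j.
    by apply: smooth_ext hW0 => // u _; rewrite mxE kj eqxx.
  by apply: smooth_ext (hP k) => // u _; rewrite mxE (negPf kj) crot0.
- have [kj|kj] := eqVneq k j.
    by apply: smooth_ext hW1 => // u _; rewrite mxE kj eqxx.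
  by apply: smooth_ext (hQ k) => // u _; rewrite mxE (negPf kj) crot1.
- by apply: smooth_ext (hP k) => // u _; rewrite crot0.
- by apply: smooth_ext (hQ k) => // u _; rewrite crot1.
Qed.

Let dM (f g : 'M[R]_(n, 2) -> R) u v : smooth A f -> smooth A g -> A u ->
  'D_v (fun y => f y * g y) u = f u * 'D_v g u + g u * 'D_v f u.
Proof.
move=> sf sg Au; rewrite -[LHS]/('D_v (f * g) u) deriveM //.
  exact: smooth_derivable sf Au.
exact: smooth_derivable sg Au.
Qed.

Let dD (f g : 'M[R]_(n, 2) -> R) u v : smooth A f -> smooth A g -> A u ->
  'D_v (fun y => f y + g y) u = 'D_v f u + 'D_v g u.
Proof.
move=> sf sg Au; rewrite -[LHS]/('D_v (f + g) u) deriveD //.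
  exact: smooth_derivable sf Au.
exact: smooth_derivable sg Au.
Qed.

Let dB (f g : 'M[R]_(n, 2) -> R) u v : smooth A f -> smooth A g -> A u ->
  'D_v (fun y => f y - g y) u = 'D_v f u - 'D_v g u.
Proof.
move=> sf sg Au; rewrite -[LHS]/('D_v (f - g) u) deriveB //.
  exact: smooth_derivable sf Au.
exact: smooth_derivable sg Au.
Qed.

Let dN (f : 'M[R]_(n, 2) -> R) u v : smooth A f -> A u ->
  'D_v (fun y => - f y) u = - 'D_v f u.
Proof.
move=> sf Au; rewrite -[LHS]/('D_v (- f) u) deriveN //.
exact: smooth_derivable sf Au.
Qed.

Let dE (f g : 'M[R]_(n, 2) -> R) u v : A u -> (forall y, A y -> f y = g y) ->
  'D_v f u = 'D_v g u.
Proof.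
move=> Au fg; apply: near_eq_derive; apply: (open_near_eq oA) => // y.
by rewrite inE; exact: fg.
Qed.

Let dP k u v : A u -> 'D_v (P k) u =
  c u * 'D_v (fun y => z y k 0) u + z u k 0 * 'D_v c u -
  (s u * 'D_v (fun y => z y k 1) u + z u k 1 * 'D_v s u).
Proof. by move=> Au; rewrite /P dB ?dM //; exact: smoothM. Qed.

Let dQ k u v : A u -> 'D_v (Q k) u =
  s u * 'D_v (fun y => z y k 0) u + z u k 0 * 'D_v s u +
  (c u * 'D_v (fun y => z y k 1) u + z u k 1 * 'D_v c u).
Proof. by move=> Au; rewrite /Q dD ?dM //; exact: smoothM. Qed.

Let dW0 u v : A u -> 'D_v W0 u =
  c u * 'D_v w0 u + w0 u * 'D_v c u + (s u * 'D_v w1 u + w1 u * 'D_v s u).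
Proof. by move=> Au; rewrite /W0 dD ?dM //; exact: smoothM. Qed.

Let dW1 u v : A u -> 'D_v W1 u =
  - s u * 'D_v w0 u - w0 u * 'D_v s u + (c u * 'D_v w1 u + w1 u * 'D_v c u).
Proof.
move=> Au; rewrite /W1 dD ?dM //; try exact: smoothM; try exact: smoothN.
  by rewrite dN // mulrN.
by apply: smoothM => //; exact: smoothN.
Qed.

Let cs1 u : A u -> c u ^+ 2 + s u ^+ 2 = 1.
Proof. by move=> [_ nu]; exact: ph_unit. Qed.

Let dcs u v : A u -> c u * 'D_v c u + s u * 'D_v s u = 0.
Proof.
move=> Au; have : 'D_v (fun y => c y * c y + s y * s y) u = 'D_v (cst (1 : R)) u.
  by apply: dE => // y Ay; rewrite -!expr2 cs1.
rewrite derive_cst dD ?dM //; try exact: smoothM.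
by lra.
Qed.

Let level u : A u -> sqn (z u) - (w0 u ^+ 2 + w1 u ^+ 2) = 1.
Proof. by move=> [iu _]; exact: cut_levelP. Qed.

Let dlevel u v : A u ->
  \sum_(k < n) (z u k 0 * 'D_v (fun y => z y k 0) u +
                z u k 1 * 'D_v (fun y => z y k 1) u) =
  w0 u * 'D_v w0 u + w1 u * 'D_v w1 u.
Proof.
move=> Au.
have : 'D_v (fun y => \sum_(k < n) (z y k 0 * z y k 0 + z y k 1 * z y k 1) -
    (w0 y * w0 y + w1 y * w1 y)) u = 'D_v (cst (1 : R)) u.
  by apply: dE => // y Ay; rewrite -(level Ay).
have sz2 k : smooth A (fun y => z y k 0 * z y k 0 + z y k 1 * z y k 1).
  by apply: smoothD => //; exact: smoothM.
have sw2 : smooth A (fun y => w0 y * w0 y + w1 y * w1 y).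
  by apply: smoothD => //; exact: smoothM.
rewrite derive_cst dB //; last exact: smooth_sum.
have -> : 'D_v (fun y => \sum_(k < n) (z y k 0 * z y k 0 + z y k 1 * z y k 1)) u =
    \sum_(k < n) 'D_v (fun y => z y k 0 * z y k 0 + z y k 1 * z y k 1) u.
  rewrite -derive_sum; last by move=> k; apply: smooth_derivable (sz2 k) Au.
  by congr (derive _ u v); apply/funext => y; rewrite fct_sumE.
rewrite (eq_bigr (fun k => 2 * (z u k 0 * 'D_v (fun y => z y k 0) u +
                z u k 1 * 'D_v (fun y => z y k 1) u))); last first.
  move=> k _; rewrite dD ?dM //; try exact: smoothM.
  by ring.
rewrite -mulr_sumr dD ?dM //; try exact: smoothM.
set S := \sum_(_ < _) _; lra.
Qed.

Let rot_form (C S C1 S1 C2 S2 x y x1 y1 x2 y2 : R) :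
  C ^+ 2 + S ^+ 2 = 1 -> C * C1 + S * S1 = 0 -> C * C2 + S * S2 = 0 ->
  (C * x1 + x * C1 - (S * y1 + y * S1)) * (S * x2 + x * S2 + (C * y2 + y * C2)) -
  (S * x1 + x * S1 + (C * y1 + y * C1)) * (C * x2 + x * C2 - (S * y2 + y * S2)) =
  (x1 * y2 - y1 * x2) + (C * S2 - S * C2) * (x * x1 + y * y1)
    - (C * S1 - S * C1) * (x * x2 + y * y2).
Proof.
move=> CS h1 h2.
have hC C' S' : C * C' + S * S' = 0 -> exists t, C' = - (S * t) /\ S' = C * t.
  move=> h; exists (C * S' - S * C'); split.
    rewrite -[LHS]mul1r -CS (_ : _ * C' = C * (C * C' + S * S') -
      S * (C * S' - S * C')); last by ring.
    by rewrite h; ring.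
  rewrite -[LHS]mul1r -CS (_ : _ * S' = S * (C * C' + S * S') +
    C * (C * S' - S * C')); last by ring.
  by rewrite h; ring.
have [t1 [-> ->]] := hC _ _ h1; have [t2 [-> ->]] := hC _ _ h2.
have E t : C * (C * t) - S * - (S * t) = t.
  by rewrite -[RHS]mul1r -CS; ring.
rewrite !E -[RHS]mul1r -CS; ring.
Qed.

Let rot_form_conj (C S C1 S1 C2 S2 x y x1 y1 x2 y2 : R) :
  C ^+ 2 + S ^+ 2 = 1 -> C * C1 + S * S1 = 0 -> C * C2 + S * S2 = 0 ->
  (C * x1 + x * C1 + (S * y1 + y * S1)) * (- S * x2 - x * S2 + (C * y2 + y * C2)) -
  (- S * x1 - x * S1 + (C * y1 + y * C1)) * (C * x2 + x * C2 + (S * y2 + y * S2)) =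
  (x1 * y2 - y1 * x2) - (C * S2 - S * C2) * (x * x1 + y * y1)
    + (C * S1 - S * C1) * (x * x2 + y * y2).
Proof.
move=> CS h1 h2.
have CS' : C ^+ 2 + (- S) ^+ 2 = 1 by rewrite sqrrN.
have h1' : C * C1 + - S * - S1 = 0 by rewrite mulrNN.
have h2' : C * C2 + - S * - S2 = 0 by rewrite mulrNN.
have H := rot_form x y x1 y1 x2 y2 CS' h1' h2'.
by apply: etrans (etrans _ H) _; ring.
Qed.

Let cancel_sum (X Y a1 b1 : R) : X + a1 - b1 + (Y - a1 + b1) = X + Y.
Proof. by ring. Qed.

Let TP k y : A y -> (if b is Some j then k != j else true) ->
  T y k 0 = P k y /\ T y k 1 = Q k y.
Proof.
move=> Ay; rewrite TE // /cut_coord /P /Q /c /s; case: b => [j|] kj.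
  by rewrite !mxE (negPf kj) /=.
by rewrite crot0 crot1.
Qed.

Let TW j y : A y -> b = Some j -> [/\ T y j 0 = W0 y, T y j 1 = W1 y & Q j y = 0].
Proof.
move=> Ay bj; rewrite TE // /cut_coord /Q /W0 /W1 /c /s bj !mxE eqxx /=.
by split=> //; rewrite /phc /phs; ring.
Qed.

Let W1_0 y : b = None -> W1 y = 0.
Proof. by move=> bN; rewrite /W1 /c /s bN /phc /phs; ring. Qed.

Let dTE k l u v : A u -> 'D_v T u k l = 'D_v (fun y => T y k l) u.
Proof.
move=> Au; rewrite derive_mx ?mxE //; apply/derivable_mxP => i j.
exact: smooth_derivable (smooth_transition i j) Au.
Qed.

Lemma transition_symplectic (u v w : 'M[R]_(n, 2)) : A u ->
  omega_st ('D_v T u) ('D_w T u) = omega_st v w.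
Proof.
move=> Au.
pose F (f g : 'M[R]_(n, 2) -> R) := 'D_v f u * 'D_w g u - 'D_v g u * 'D_w f u.
have FE f f' g g' : (forall y, A y -> f y = f' y) ->
    (forall y, A y -> g y = g' y) -> F f g = F f' g'.
  by move=> ff gg; rewrite /F (dE v Au ff) (dE w Au ff) (dE v Au gg) (dE w Au gg).
have F0 f g : (forall y, A y -> g y = 0) -> F f g = 0.
  move=> g0; rewrite (FE f f g (cst 0)) // /F !derive_cst; ring.
have -> : omega_st ('D_v T u) ('D_w T u) =
    \sum_(k < n) F (fun y => T y k 0) (fun y => T y k 1).
  apply: eq_bigr => k _.
  by congr (_ * _ - _ * _); exact: dTE.
have -> : \sum_(k < n) F (fun y => T y k 0) (fun y => T y k 1) =
    \sum_(k < n) F (P k) (Q k) + F W0 W1.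
  case eb : b => [j|]; last first.
    rewrite (F0 W0 W1) ?addr0; last by move=> y _; exact: W1_0.
    by apply: eq_bigr => k _; apply: FE => y Ay; have [] := @TP k y Ay; rewrite ?eb.
  rewrite (bigD1 j) //= [in RHS](bigD1 j) //= (F0 (P j) (Q j)) ?add0r; last first.
    by move=> y Ay; have [] := TW Ay eb.
  rewrite addrC; congr (_ + _).
    by apply: eq_bigr => k kj; apply: FE => y Ay; have [] := @TP k y Ay; rewrite ?eb.
  by apply: FE => y Ay; have [] := TW Ay eb.
have -> : \sum_(k < n) F (P k) (Q k) + F W0 W1 =
    \sum_(k < n) F (fun y => z y k 0) (fun y => z y k 1) + F w0 w1.
  have [h1 h2] := (dcs v Au, dcs w Au); have [l1 l2] := (dlevel v Au, dlevel w Au).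
  set C := c u in h1 h2; set S := s u in h1 h2.
  set t1 := C * 'D_v s u - S * 'D_v c u; set t2 := C * 'D_w s u - S * 'D_w c u.
  have FPQ k : F (P k) (Q k) = F (fun y => z y k 0) (fun y => z y k 1) +
      t2 * (z u k 0 * 'D_v (fun y => z y k 0) u +
            z u k 1 * 'D_v (fun y => z y k 1) u) -
      t1 * (z u k 0 * 'D_w (fun y => z y k 0) u +
            z u k 1 * 'D_w (fun y => z y k 1) u).
    apply: etrans (f_equal4 (fun p q r t : R => p * q - r * t)
      (dP k v Au) (dQ k w Au) (dQ k v Au) (dP k w Au)) _.
    exact: (rot_form _ _ _ _ _ _ (cs1 Au) h1 h2).
  rewrite (eq_bigr _ (fun k _ => FPQ k)) sumrB big_split /= -!mulr_sumr l1 l2.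
  have FW : F W0 W1 = F w0 w1 - t2 * (w0 u * 'D_v w0 u + w1 u * 'D_v w1 u) +
      t1 * (w0 u * 'D_w w0 u + w1 u * 'D_w w1 u).
    apply: etrans (f_equal4 (fun p q r t : R => p * q - r * t)
      (dW0 v Au) (dW1 w Au) (dW1 v Au) (dW0 w Au)) _.
    exact: (rot_form_conj _ _ _ _ _ _ (cs1 Au) h1 h2).
  by rewrite FW; exact: cancel_sum.
have dcoord k l v' : 'D_v' (fun y : 'M[R]_(n, 2) => y k l) u = v' k l.
  have /(congr1 (fun M : 'M[R]_(n, 2) => M k l)) := derive_id u v'.
  by rewrite derive_mx ?mxE //; exact: derivable_id.
have Fcoord k : F (fun y => y k 0) (fun y => y k 1) = v k 0 * w k 1 - v k 1 * w k 0.
  by rewrite /F !dcoord.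
rewrite /omega_st; case ea : a => [j|]; last first.
  rewrite (F0 w0 w1) ?addr0; last by move=> y _; rewrite /w1 ea.
  by apply: eq_bigr => k _; rewrite -Fcoord; apply: FE => y Ay; rewrite /z ea.
rewrite (bigD1 j) //= [in RHS](bigD1 j) //= (F0 _ (fun y => z y j 1)) ?add0r.
  rewrite addrC; congr (_ + _).
    apply: eq_bigr => k kj; rewrite -Fcoord.
    by apply: FE => y Ay; rewrite /z ea cut_zk.
  by rewrite -Fcoord; apply: FE => y Ay; rewrite /w0 /w1 ea.
by move=> y Ay; rewrite /z ea cut_z1.
Qed.

End Transition.

Lemma sqn_neq0 z : sqn z != 0 -> exists j, csq z j != 0.
Proof.
move=> h; apply: contrapT => no; move/eqP: h; apply.
by apply: big1 => j _; apply: contrapT => /eqP hj; apply: no; exists j.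
Qed.

Lemma blowup_cover : blowup_set R n = \bigcup_a blowup_dom a.
Proof.
rewrite blowup_setE; apply/seteqP; split=> p.
  move=> [z z1 <-]; have [j zj] : exists j, csq z j != 0.
    by apply: sqn_neq0; rewrite gt_eqF // (lt_le_trans ltr01).
  by exists (Some j) => //; rewrite blowup_domE; exists z.
by move=> [a _]; rewrite blowup_domE => -[z [z1 _] <-]; exists z.
Qed.

Lemma atlas_open_lt (F G : 'M[R]_(n, 2) -> R -> R -> R) :
  act_invariant F -> act_invariant G ->
  (forall a, smooth (cut_dom a) (fun u => F (cut_z a u) (cut_w0 a u) (cut_w1 a u))) ->
  (forall a, smooth (cut_dom a) (fun u => G (cut_z a u) (cut_w0 a u) (cut_w1 a u))) ->
  atlas_open (@blowup_dom R n) (@blowup_chart R n)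
    [set collapse z | z in [set z | 1 <= sqn z /\ F z (cut_wr z) 0 < G z (cut_wr z) 0]].
Proof.
move=> iF iG sF sG a.
have iQ : act_invariant (fun z w0 w1 => is_true (F z w0 w1 < G z w0 w1)).
  by move=> z w0 w1 c s cs; rewrite iF // iG.
rewrite (chart_image a iQ).
exact: (smooth_open_lt (@open_cut_dom a) (sF a) (sG a)).
Qed.

Definition separated (p q : set 'M[R]_(n, 2)) := exists A B,
  [/\ atlas_open (@blowup_dom R n) (@blowup_chart R n) A,
      atlas_open (@blowup_dom R n) (@blowup_chart R n) B,
      A p, B q & A `&` B = set0].

Lemma separated_sym p q : separated p q -> separated q p.
Proof. by move=> [A [B [oA oB Ap Bq AB]]]; exists B, A; rewrite setIC. Qed.

Lemma separated_lt (F : 'M[R]_(n, 2) -> R -> R -> R) z z' :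
  act_invariant F ->
  (forall a, smooth (cut_dom a) (fun u => F (cut_z a u) (cut_w0 a u) (cut_w1 a u))) ->
  1 <= sqn z -> 1 <= sqn z' ->
  F z (cut_wr z) 0 < F z' (cut_wr z') 0 -> separated (collapse z) (collapse z').
Proof.
move=> iF sF z1 z'1 lt; pose m := (F z (cut_wr z) 0 + F z' (cut_wr z') 0) / 2.
pose G (_ : 'M[R]_(n, 2)) (_ _ : R) := m.
have iG : act_invariant G by [].
have sG a : smooth (cut_dom a) (fun u => G (cut_z a u) (cut_w0 a u) (cut_w1 a u)).
  exact: smooth_cst.
have [zm mz] : F z (cut_wr z) 0 < m /\ m < F z' (cut_wr z') 0.
  by rewrite /m; split; move: lt; lra.
exists [set collapse z | z in [set z | 1 <= sqn z /\ F z (cut_wr z) 0 < m]],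
  [set collapse z | z in [set z | 1 <= sqn z /\ m < F z (cut_wr z) 0]].
split; first exact: (atlas_open_lt iF iG sF sG).
- exact: (atlas_open_lt iG iF sG sF).
- by exists z.
- by exists z'.
- apply/seteqP; split=> // p [[x [x1 xm] xp] [y [y1 my] yp]].
  have xy : collapse x y by rewrite xp -yp; exact: collapse_refl.
  have E := invariantE iF x1 xy.
  by move: my; rewrite E => /(lt_trans xm); rewrite ltxx.
Qed.

Definition inv_re k l z (_ _ : R) : R := z k 0 * z l 0 + z k 1 * z l 1.
Definition inv_im k l z (_ _ : R) : R := z k 1 * z l 0 - z k 0 * z l 1.
Definition inv_w0 k z w0 w1 : R := z k 0 * w0 - z k 1 * w1.
Definition inv_w1 k z w0 w1 : R := z k 1 * w0 + z k 0 * w1.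

Lemma inv_re_act k l : act_invariant (inv_re k l).
Proof.
by move=> z w0 w1 c s cs; rewrite /inv_re !crot0 !crot1 -[RHS]mul1r -cs; ring.
Qed.
Lemma inv_im_act k l : act_invariant (inv_im k l).
Proof.
by move=> z w0 w1 c s cs; rewrite /inv_im !crot0 !crot1 -[RHS]mul1r -cs; ring.
Qed.
Lemma inv_w0_act k : act_invariant (inv_w0 k).
Proof.
by move=> z w0 w1 c s cs; rewrite /inv_w0 !crot0 !crot1 -[RHS]mul1r -cs; ring.
Qed.
Lemma inv_w1_act k : act_invariant (inv_w1 k).
Proof.
by move=> z w0 w1 c s cs; rewrite /inv_w1 !crot0 !crot1 -[RHS]mul1r -cs; ring.
Qed.

Lemma inv_collapse z z' : 1 <= sqn z -> 1 <= sqn z' ->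
  (forall k l, inv_re k l z (cut_wr z) 0 = inv_re k l z' (cut_wr z') 0) ->
  (forall k l, inv_im k l z (cut_wr z) 0 = inv_im k l z' (cut_wr z') 0) ->
  (forall k, inv_w0 k z (cut_wr z) 0 = inv_w0 k z' (cut_wr z') 0) ->
  (forall k, inv_w1 k z (cut_wr z) 0 = inv_w1 k z' (cut_wr z') 0) ->
  collapse z = collapse z'.
Proof.
rewrite /inv_re /inv_im /inv_w0 /inv_w1 => z1 z'1 hre him h0 h1.
have hsq k : csq z k = csq z' k by have := hre k k; rewrite /csq !expr2.
have E : sqn z = sqn z' by apply: eq_bigr => k _.
have Ew : cut_wr z' = cut_wr z by rewrite /cut_wr E.
have [w_0|w_neq0] := eqVneq (cut_wr z) 0; last first.
  congr collapse; apply: mxP2 => k; have := h0 k; have := h1 k.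
  by rewrite Ew !mulr0 subr0 addr0 subr0 addr0 => /(mulIf w_neq0) -> /(mulIf w_neq0) ->.
have sq1 : sqn z = 1.
  apply/eqP; rewrite eq_le z1 andbT -subr_le0.
  by move/eqP: w_0; rewrite sqrtr_eq0.
have [k zk] : exists k, csq z k != 0 by apply: sqn_neq0; rewrite sq1 oner_neq0.
pose c := (z' k 0 * z k 0 + z' k 1 * z k 1) / csq z k.
pose s := (z' k 1 * z k 0 - z' k 0 * z k 1) / csq z k.
have zE : z' = crot c s z.
  apply: mxP2 => l; rewrite crot0 crot1; have := hre l k; have := him l k.
  set X := (X in X = _ -> _) => imE; set Y := (X in X = _ -> _) => reE.
  have -> : c * z l 0 - s * z l 1 = (z' k 0 * Y - z' k 1 * X) / csq z k.
    by rewrite /c /s /X /Y; ring.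
  have -> : s * z l 0 + c * z l 1 = (z' k 1 * Y + z' k 0 * X) / csq z k.
    by rewrite /c /s /X /Y; ring.
  rewrite imE reE; split; apply: (mulIf zk); rewrite divfK // hsq /csq; ring.
rewrite zE collapse_crot //.
have : csq z' k = csq z k by rewrite hsq.
rewrite /c /s !expr_div_n -mulrDl => hk.
have -> : (z' k 0 * z k 0 + z' k 1 * z k 1) ^+ 2 +
  (z' k 1 * z k 0 - z' k 0 * z k 1) ^+ 2 = csq z' k * csq z k by rewrite /csq; ring.
by rewrite hk -expr2 divff // expf_neq0.
Qed.

Lemma blowup_hausdorff p q : blowup_set R n p -> blowup_set R n q -> p <> q ->
  separated p q.
Proof.
rewrite blowup_setE => -[z z1 <-] [z' z'1 <-] pq; apply: contrapT => nsep.
have H (F : 'M[R]_(n, 2) -> R -> R -> R) : act_invariant F ->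
    (forall a, smooth (cut_dom a) (fun u => F (cut_z a u) (cut_w0 a u) (cut_w1 a u))) ->
    F z (cut_wr z) 0 = F z' (cut_wr z') 0.
  move=> iF sF.
  have [lt|lt|//] := ltgtP (F z (cut_wr z) 0) (F z' (cut_wr z') 0); exfalso; apply: nsep.
    exact: separated_lt iF sF z1 z'1 lt.
  by apply: separated_sym; exact: separated_lt iF sF z'1 z1 lt.
apply: pq; apply: inv_collapse => // k *; apply: H.
- exact: inv_re_act.
- move=> a; have [oD sz] := (@open_cut_dom a, @smooth_cut_z a).
  by apply: smoothD => //; exact: smoothM.
- exact: inv_im_act.
- move=> a; have [oD sz] := (@open_cut_dom a, @smooth_cut_z a).
  by apply: smoothB => //; exact: smoothM.
- exact: inv_w0_act.
- move=> a; have [oD sz] := (@open_cut_dom a, @smooth_cut_z a).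
  have [s0 s1] := (@smooth_cut_w0 a, @smooth_cut_w1 a).
  by apply: smoothB => //; exact: smoothM.
- exact: inv_w1_act.
- move=> a; have [oD sz] := (@open_cut_dom a, @smooth_cut_z a).
  have [s0 s1] := (@smooth_cut_w0 a, @smooth_cut_w1 a).
  by apply: smoothD => //; exact: smoothM.
Qed.

Lemma omega_st_linear (x : R) (u v w : 'M[R]_(n, 2)) :
  omega_st (x *: u + v) w = x * omega_st u w + omega_st v w.
Proof.
rewrite /omega_st mulr_sumr -big_split; apply: eq_bigr => k _.
by rewrite !mxE /=; ring.
Qed.

Lemma omega_st_antisym (v w : 'M[R]_(n, 2)) : omega_st v w = - omega_st w v.
Proof. by rewrite /omega_st -sumrN; apply: eq_bigr => k _; ring. Qed.

Lemma omega_st_nondegenerate (v : 'M[R]_(n, 2)) :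
  (forall w : 'M[R]_(n, 2), omega_st v w = 0) -> v = 0.
Proof.
move=> h; apply: mxP2 => k; rewrite mxE; split.
  have := h (delta_mx k 1); rewrite /omega_st (bigD1 k) //= big1 ?addr0.
    by rewrite !mxE !eqxx /= mulr1 mulr0 subr0.
  by move=> l lk; rewrite !mxE (negPf lk) /= !mulr0 subr0.
have := h (delta_mx k 0); rewrite /omega_st (bigD1 k) //= big1 ?addr0.
  by rewrite !mxE !eqxx /= mulr1 mulr0 sub0r => /eqP; rewrite oppr_eq0 => /eqP.
by move=> l lk; rewrite !mxE (negPf lk) /= !mulr0 subr0.
Qed.

End BlowupTheory.

Definition blowup (R : realType) (n : nat) : symplecticManifold R n.
Proof.
refine (@SymplecticManifold R n (set 'M[R]_(n, 2)) (blowup_set R n) (option 'I_n)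
  (@blowup_dom R n) (@blowup_chart R n) (@blowup_par R n)
  (fun _ _ => @omega_st R n) _ _ _ _ _ _ _ _ _ _ _ _).
- exact: blowup_cover.
- exists setT; first exact: countableP.
  by rewrite blowup_cover.
- exact: blowup_chartK.
- by move=> a b; rewrite overlapE; exact: open_overlap.
- by move=> a b; rewrite overlapE; exact: smooth_transition.
- exact: blowup_hausdorff.
- by move=> a p _; exact: omega_st_linear.
- by move=> a p _; exact: omega_st_antisym.
- by move=> a p _; exact: omega_st_nondegenerate.
- by move=> a v w; exact: smooth_cst.
- by move=> a p _ u v w; rewrite !derive_cst !addr0.
- move=> a b p ap bp v w; apply: transition_symplectic.
  by rewrite -overlapE; exists p.
Defined.

Arguments blowup R n : clear implicits.

(* The blowup of the ball B_(1+t), an open subset of the blowup of R^(2n). *)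
Definition blowup_ball_set (R : realType) (n : nat) (t : R) :
    set (set 'M[R]_(n, 2)) :=
  [set collapse z | z in eball n (1 + t) `\` eball n 1].

Arguments blowup_ball_set {R} n t.

Lemma blowup_ball_open (R : realType) (n : nat) (t : R) :
  @sm_open R n (blowup R n) (blowup_ball_set n t).
Proof.
split=> [_ [z [_ z1] <-]|]; first by exists z.
pose F (z : 'M[R]_(n, 2)) (_ _ : R) := Num.sqrt (sqn z).
pose G (_ : 'M[R]_(n, 2)) (_ _ : R) := 1 + t.
have iF : act_invariant F by move=> z w0 w1 c s cs; rewrite /F sqn_crot.
have iG : act_invariant G by [].
have sF a : smooth (cut_dom a) (fun u => F (cut_z a u) (cut_w0 a u) (cut_w1 a u)).
  have oD := @open_cut_dom R n a; apply: smooth_sqrt => //.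
    move=> u /cut_levelP; rewrite /cut_level => /eqP; rewrite subr_eq => /eqP ->.
    by rewrite ltr_pwDl // addr_ge0 // sqr_ge0.
  by apply: smooth_sqn => //; exact: smooth_cut_z.
have sG a : smooth (cut_dom a) (fun u => G (cut_z a u) (cut_w0 a u) (cut_w1 a u)).
  exact: smooth_cst.
have := atlas_open_lt iF iG sF sG; congr (atlas_open _ _ (_ @` _)).
apply/seteqP; split=> z /=.
  by move=> [z1 zt]; split=> //; rewrite /eball /= ltNge enorm_ge1 z1.
by move=> [zt /negP]; rewrite /eball /= -leNgt enorm_ge1 => z1; split.
Qed.

Definition blowup_ball (R : realType) (n : nat) (t : R) : symplecticManifold R n :=
  open_submanifold (blowup_ball_open n t).

Arguments blowup_ball {R} n t.

(* Main.v *)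
(** The inclusion of the shell shows that the capacity of [U_t] is at least
    [pi] for [t > tau]; it remains to exclude, for [t = tau], shells of
    radius close to 1 and larger. The blowup is the symplectic reduction of
    [C^n x C] at [|z|^2 - |w|^2 = 1] by the circle action of weights 1
    and -1, so everything is pulled back to [Q = {(w, z) : z <> 0}], where the
    gauge field [X] generates the action, [omh = d lamh] is the pullback of
    the symplectic form, and [iota] embeds the complement of the closed unit
    ball.

    An embedding [f] of the shell lifts to [u = f^-1] on an open part of
    [Q]. Integrating [d (rho o u)], for a radial cutoff [rho], in the
    direction of [Re w] gives a gauge invariant function [chi] on [Q] which
    is locally constant off the shell and equals [rho o u + c0] on it, with
    [c0 = 0] or [c0 = -1]. For cutoffs [psi = kappa o chi] the closed form
    [psi omh + d psi /\ u^* lambda] vanishes along [X] and for large [w],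
    hence has a primitive [beta] with [beta X = c + X G] for a constant [c]
    which its trace detects. Take two cutoffs such that at every point the
    first form [eta1] vanishes or the second form [eta2] is [omh], and let
    [gamma] be a primitive of [omh - eta2]: then [d (gamma /\ eta1)], integrated over
    quaternionic directions of a slice [n = 2], forces the trace of the
    first to be 0 or that of the second to be [- n vol B_1]. Both traces are
    volume differences because [u] preserves volume, and this bounds the
    volume enclosed by the shell, or excludes it when [c0 = 0]. *)
From HB Require Import structures.
Require Import Defs.
From mathcomp Require Import all_boot all_order all_algebra.
From mathcomp Require Import all_classical all_reals all_analysis.
From mathcomp Require Import ring lra zify.

Import Order.TTheory GRing.Theory Num.Theory.
Import numFieldNormedType.Exports.

Local Open Scope classical_set_scope.
Local Open Scope ring_scope.

Set Implicit Arguments.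
Unset Strict Implicit.
Unset Printing Implicit Defensive.

(** * Integration by lattice sums *)

(** The dichotomy is an intersection number. For n = 2 the second cohomology of the blowup is a line
    whose generator has nonzero square, because the exceptional sphere has self-intersection -1. So
    two closed forms, one of them with compact support, whose product vanishes pointwise cannot both
    have a nonzero class. The constant c of a primitive is the coordinate of a class on this line,
    and [lamh] has the coordinate 1/2 of the symplectic class. Thus the shell leaves the exceptional
    class entirely on one of its sides. For c0 = -1 the trace of a cutoff form is n times the
    enclosed volume minus the volume of the ball that fills the shell; so the enclosed region has
    either the volume of this ball or that volume minus the volume of B_1. The bound on tau says (1
    + tau)^(2n) - 1 < 1, so U_tau has less volume than B_1, which excludes the first case for radii
    near 1 or larger. In the second case a radius below 1 would enclose a negative volume, and a
    radius above 1 more than all of U_tau. *)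

Section Ultralimit.
Context {R : realType}.

(** An ultrafilter refining the neighbourhoods of infinity. Every bounded sequence converges along
    it, so that the limit is a total functional on bounded sequences which is still linear and
    monotone. *)
Definition ufilter : set_system nat :=
  sval (cid (ultraFilterLemma (F := \oo%classic) _)).

#[export] Instance ufilter_ultra : UltraFilter ufilter.
Proof. exact: (svalP (cid (ultraFilterLemma _))).1. Qed.

Lemma ufilter_eventually (P : set nat) : (\forall k \near \oo, P k) -> ufilter P.
Proof. exact: (svalP (cid (ultraFilterLemma _))).2. Qed.

Definition bounded_seq (u : nat -> R) := exists M : R, forall k, `|u k| <= M.

Definition ulim (u : nat -> R) : R := lim (u @ ufilter).

Lemma ulim_cvg u : bounded_seq u -> u @ ufilter --> ulim u.
Proof.
move=> [M uM]; have uI : ufilter (u @^-1` `[- M, M]%classic).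
  by apply: filterE => k; have := uM k; rewrite ler_norml /= in_itv.
have [x [_ ux]] := @segment_compact R (- M) M (u @ ufilter) _ uI.
apply/cvg_ex; exists x => A nA.
have [//|h] := in_ultra_setVsetC (u @^-1` A) ufilter_ultra.
by have [y [+ yA]] := ux (~` A) A h nA; move/(_ yA).
Qed.

Lemma ulim_unique u x : u @ ufilter --> x -> ulim u = x.
Proof. by move=> h; apply/cvg_lim. Qed.

Lemma ulim_cst x : ulim (fun=> x) = x.
Proof. by apply: ulim_unique; exact: cvg_cst. Qed.

Lemma bounded_seqD u v : bounded_seq u -> bounded_seq v ->
  bounded_seq (fun k => u k + v k).
Proof.
move=> [M uM] [N vN]; exists (M + N) => k.
by apply: le_trans (ler_normD _ _) _; exact: lerD.
Qed.

Lemma bounded_seqZ a u : bounded_seq u -> bounded_seq (fun k => a * u k).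
Proof.
by move=> [M uM]; exists (`|a| * M) => k; rewrite normrM ler_wpM2l.
Qed.

Lemma ulimD u v : bounded_seq u -> bounded_seq v ->
  ulim (fun k => u k + v k) = ulim u + ulim v.
Proof.
by move=> bu bv; apply: ulim_unique; apply: cvgD; exact: ulim_cvg.
Qed.

Lemma ulimZ a u : bounded_seq u -> ulim (fun k => a * u k) = a * ulim u.
Proof.
by move=> bu; apply: ulim_unique; apply: cvgM; [exact: cvg_cst|exact: ulim_cvg].
Qed.

Lemma ulim_le u v : bounded_seq u -> bounded_seq v ->
  (\forall k \near \oo, u k <= v k) -> ulim u <= ulim v.
Proof.
move=> bu bv uv; rewrite -subr_ge0 -[- ulim u]mulN1r -ulimZ // -ulimD //; last first.
  exact: bounded_seqZ.
have /ulim_cvg h : bounded_seq (fun k => v k + -1 * u k).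
  by apply: bounded_seqD => //; exact: bounded_seqZ.
apply: (limr_ge (F := ufilter)); first by apply/cvg_ex; eexists; exact: h.
apply: ufilter_eventually; apply: filterS uv => k /=.
by rewrite mulN1r subr_ge0.
Qed.

Lemma ulim_bound u M : (forall k, `|u k| <= M) -> `|ulim u| <= M.
Proof.
move=> uM; have bM a : bounded_seq (fun=> a) by exists `|a|.
have bu : bounded_seq u by exists M.
rewrite ler_norml; apply/andP; split; [rewrite -[leLHS]ulim_cst|rewrite -[leRHS]ulim_cst];
  by apply: ulim_le => //; near=> k; have := uM k; rewrite ler_norml => /andP[].
Unshelve. all: by end_near. Qed.

End Ultralimit.

Section MatrixNorm.
Context {R : realType} {m p : nat}.

Lemma mx_norm_leP (x : 'M[R]_(m, p)) r : 0 <= r ->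
  reflect (forall i j, `|x i j| <= r) (`|x| <= r).
Proof.
move=> r0; rewrite [`|x|]mx_normrE; apply: (iffP idP) => [h i j|h].
  by apply: le_trans h; exact: (le_bigmax_cond _ (fun ij => `|x ij.1 ij.2|) (j := (i, j))).
by apply: bigmax_le => // -[i j] _; exact: h.
Qed.

Lemma mx_coord_le (x : 'M[R]_(m, p)) i j : `|x i j| <= `|x|.
Proof. by move: i j; apply/mx_norm_leP. Qed.

Lemma mx_delta_norm (i : 'I_m) (j : 'I_p) : `|delta_mx i j : 'M[R]_(m, p)| = 1.
Proof.
apply/eqP; rewrite eq_le; apply/andP; split.
  apply/mx_norm_leP => // k l; rewrite mxE.
  by case: (_ && _); rewrite ?normr1 ?normr0.
by have := mx_coord_le (delta_mx i j) i j; rewrite mxE !eqxx normr1.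
Qed.

End MatrixNorm.

Section LatticeIntegral.
Context {R : realType} {m : nat}.
Local Notation E := 'M[R]_(m, 2).
Implicit Types (F G : E -> R).

(** The cube [-k, k] with mesh 1/k: each coordinate has k^2 steps on either side of 0, so that a
    single parameter refines the mesh and exhausts the space. *)
Definition grid_pt (k : nat) (c : {ffun 'I_m * 'I_2 -> 'I_(2 * k ^ 2).+1}) : E :=
  \matrix_(i, j) (((c (i, j))%:R - (k ^ 2)%:R) / k%:R).

Definition lattice_sum (k : nat) F : R :=
  k%:R^-1 ^+ (m * 2) * \sum_c F (@grid_pt k c).

(* An ultralimit, so that no measurability is needed to define it. *)
Definition lint F : R := ulim (fun k => lattice_sum k.+1 F).

Definition supp_in (r : R) F := forall x, r < `|x| -> F x = 0.
(** Exactly what makes the lattice sums of F a bounded sequence, on which [ulim] is additive.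
    Continuity is not included, so indicators of balls are allowed. *)
Definition adm F := (exists M : R, forall x, `|F x| <= M) /\ (exists r, supp_in r F).

Lemma lattice_sumD k F G :
  lattice_sum k (fun x => F x + G x) = lattice_sum k F + lattice_sum k G.
Proof. by rewrite /lattice_sum big_split mulrDr. Qed.

Lemma lattice_sumZ k a F : lattice_sum k (fun x => a * F x) = a * lattice_sum k F.
Proof. by rewrite /lattice_sum -mulr_sumr; ring. Qed.

Lemma lattice_sum_le k F G : (forall x, F x <= G x) ->
  lattice_sum k F <= lattice_sum k G.
Proof.
by move=> FG; rewrite ler_wpM2l ?exprn_ge0 ?invr_ge0 // ler_sum.
Qed.

(** Distributivity reduces the lattice sum of a product function to a count on one axis; used for
    cubes and for [bump]. *)
Lemma lattice_sum_prod k (f : R -> R) :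
  lattice_sum k (fun x => \prod_(ij : 'I_m * 'I_2) f (x ij.1 ij.2)) =
  (k%:R^-1 * \sum_(a < (2 * k ^ 2).+1) f ((a%:R - (k ^ 2)%:R) / k%:R)) ^+ (m * 2).
Proof.
rewrite exprMn /lattice_sum; congr (_ * _).
have -> : (m * 2)%N = #|{: 'I_m * 'I_2}| by rewrite card_prod !card_ord.
rewrite -prodr_const (bigA_distr_bigA (fun=> fun a : 'I__ => f ((a%:R - (k ^ 2)%:R) / k%:R))).
by apply: eq_bigr => c _; apply: eq_bigr => -[i j] _; rewrite mxE.
Qed.

Lemma count_interval (a b k : nat) :
  (\sum_(i < k) (a <= i < b) = minn k b - a)%N.
Proof.
elim: k => [|k IH]; first by rewrite big_ord0 min0n sub0n.
rewrite big_ord_recr IH /=; case: (leqP a k) => /=; case: (ltnP k b) => /=; lia.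
Qed.

Lemma count_ball (k : nat) (r : nat) : (0 < k)%N ->
  \sum_(a < (2 * k ^ 2).+1) (`|(a%:R - (k ^ 2)%:R) / k%:R| <= r%:R :> R)%:R
    <= ((2 * r + 1) * k)%:R :> R.
Proof.
move=> k0; rewrite -natr_sum ler_nat.
apply: (@leq_trans (\sum_(a < (2 * k ^ 2).+1) (k ^ 2 - r * k <= a < (k ^ 2 + r * k).+1))%N).
  apply: leq_sum => a _; case: leP => // h.
  have k0' : 0 < k%:R :> R by rewrite ltr0n.
  move: h; rewrite normrM normfV (ger0_norm (ltW k0')) ler_pdivrMr // -natrM.
  rewrite ler_norml lerBlDr lerBrDr => /andP[h1 h2].
  have {}h2 : (a <= r * k + k ^ 2)%N by rewrite -(ler_nat R) natrD.
  have {}h1 : (k ^ 2 <= a + r * k)%N by rewrite -(ler_nat R) natrD; move: h1; lra.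
  by rewrite lt0b; apply/andP; split; lia.
rewrite count_interval; nia.
Qed.

Lemma lattice_sum_bound (r : R) : exists2 C, 0 <= C &
  forall F (M : R), 0 <= M -> supp_in r F -> (forall x, `|F x| <= M) ->
  forall k, `|lattice_sum k.+1 F| <= M * C.
Proof.
have [N rN] : exists N : nat, r <= N%:R.
  have [r0|r0] := leP r 0; first by exists 0%N.
  by exists (Num.truncn r).+1; apply/ltW; have /andP[] := truncn_itv (ltW r0).
(* On each of the 2m axes at most (2N + 1) k nodes lie in [-N, N], each of weight 1/k. *)
exists ((2 * N + 1)%:R ^+ (m * 2)) => [|F M M0 sF FM k]; first exact: exprn_ge0.
pose f (t : R) : R := (`|t| <= N%:R)%R%:R.
have FP x : `|F x| <= M * \prod_(ij : 'I_m * 'I_2) f (x ij.1 ij.2).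
  have [xr|rx] := leP `|x| r.
    rewrite (eq_bigr (fun=> 1)) ?big1_eq ?mulr1 // => -[i j] _ /=.
    by rewrite /f (le_trans (mx_coord_le x i j)) // (le_trans xr).
  by rewrite sF // normr0 mulr_ge0 // prodr_ge0 // => ij _; rewrite /f ler0n.
have : `|lattice_sum k.+1 F| <=
    lattice_sum k.+1 (fun x => M * \prod_(ij : 'I_m * 'I_2) f (x ij.1 ij.2)).
  apply: (@le_trans _ _ (lattice_sum k.+1 (fun x => `|F x|))).
    rewrite /lattice_sum normrM ger0_norm ?exprn_ge0 ?invr_ge0 //.
    by rewrite ler_wpM2l ?exprn_ge0 ?invr_ge0 // ler_norm_sum.
  exact: lattice_sum_le.
move=> h; apply: (le_trans h); rewrite lattice_sumZ lattice_sum_prod.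
rewrite ler_wpM2l // lerXn2r ?nnegrE ?mulr_ge0 ?invr_ge0 // ?sumr_ge0 //.
rewrite mulrC ler_pdivrMr ?ltr0n // -natrM.
exact: (count_ball N (ltn0Sn k)).
Qed.

Lemma adm_bounded_seq F : adm F -> bounded_seq (fun k => lattice_sum k.+1 F).
Proof.
move=> [[M FM] [r sF]]; have [C C0 h] := lattice_sum_bound r.
exists (M * C); apply: h => //; exact: le_trans (normr_ge0 _) (FM 0).
Qed.

Lemma admD F G : adm F -> adm G -> adm (fun x => F x + G x).
Proof.
move=> [[M FM] [r sF]] [[N GN] [s sG]]; split.
  exists (M + N) => x; apply: le_trans (ler_normD _ _) _; exact: lerD.
exists (Num.max r s) => x; rewrite gt_max => /andP[rx sx].
by rewrite sF // sG // addr0.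
Qed.

Lemma admMl G F : (exists M : R, forall x, `|G x| <= M) -> adm F -> adm (fun x => G x * F x).
Proof.
move=> [N GN] [[M FM] [r sF]]; split.
  exists (N * M) => x; rewrite normrM; apply: ler_pM => //.
by exists r => x /sF ->; rewrite mulr0.
Qed.

Lemma admZ a F : adm F -> adm (fun x => a * F x).
Proof. by apply: (@admMl (fun=> a)); exists `|a|. Qed.

Lemma admN F : adm F -> adm (fun x => - F x).
Proof. by move=> /(admZ (-1)); under eq_fun do rewrite mulN1r. Qed.

Lemma admB F G : adm F -> adm G -> adm (fun x => F x - G x).
Proof. by move=> aF /admN; exact: admD. Qed.

Lemma adm0 : adm (fun=> 0).
Proof. by split; [exists 0 => x; rewrite normr0|exists 0]. Qed.

Lemma adm_sum (I : Type) (s : seq I) (P : pred I) (F : I -> E -> R) :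
  (forall i, adm (F i)) -> adm (fun x => \sum_(i <- s | P i) F i x).
Proof.
move=> aF; elim: s => [|i s IH].
  by under eq_fun do rewrite big_nil; exact: adm0.
under eq_fun do rewrite big_cons.
case: (P i) => //; exact: admD.
Qed.

Lemma lintD F G : adm F -> adm G -> lint (fun x => F x + G x) = lint F + lint G.
Proof.
move=> aF aG; rewrite /lint -ulimD; try exact: adm_bounded_seq.
by congr ulim; apply/funext => k; rewrite lattice_sumD.
Qed.

Lemma lintZ a F : adm F -> lint (fun x => a * F x) = a * lint F.
Proof.
move=> aF; rewrite /lint -ulimZ; last exact: adm_bounded_seq.
by congr ulim; apply/funext => k; rewrite lattice_sumZ.
Qed.

Lemma lintN F : adm F -> lint (fun x => - F x) = - lint F.
Proof.
by move=> aF; rewrite -mulN1r -lintZ //; congr lint; apply/funext => x; rewrite mulN1r.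
Qed.

Lemma lintB F G : adm F -> adm G -> lint (fun x => F x - G x) = lint F - lint G.
Proof. by move=> aF aG; rewrite lintD ?lintN //; exact: admN. Qed.

Lemma lint0 : lint (fun=> 0) = 0.
Proof.
rewrite /lint -[RHS](ulim_cst 0); congr ulim; apply/funext => k.
by rewrite /lattice_sum big1 ?mulr0.
Qed.

Lemma lint_sum (I : Type) (s : seq I) (P : pred I) (F : I -> E -> R) :
  (forall i, adm (F i)) ->
  lint (fun x => \sum_(i <- s | P i) F i x) = \sum_(i <- s | P i) lint (F i).
Proof.
move=> aF; elim: s => [|i s IH].
  by rewrite big_nil -[RHS]lint0; congr lint; apply/funext => x; rewrite big_nil.
rewrite big_cons -IH.
have -> : (fun x => \sum_(j <- i :: s | P j) F j x) =
    (fun x => (if P i then F i x + \sum_(j <- s | P j) F j x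
               else \sum_(j <- s | P j) F j x)).
  by apply/funext => x; rewrite big_cons.
by case: (P i) => //; rewrite lintD //; exact: adm_sum.
Qed.

Lemma lint_le F G : adm F -> adm G -> (forall x, F x <= G x) -> lint F <= lint G.
Proof.
move=> aF aG FG; apply: ulim_le; try exact: adm_bounded_seq.
by near=> k; exact: lattice_sum_le.
Unshelve. all: by end_near. Qed.

Lemma lint_ge0 F : adm F -> (forall x, 0 <= F x) -> 0 <= lint F.
Proof. by move=> aF F0; rewrite -lint0; apply: lint_le => //; exact: adm0. Qed.

Lemma lint_bound (r : R) : exists2 C, 0 < C &
  forall F (M : R), 0 <= M -> supp_in r F -> (forall x, `|F x| <= M) ->
  `|lint F| <= M * C.
Proof.
have [C C0 h] := lattice_sum_bound r; exists (C + 1) => [|F M M0 sF FM].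
  by rewrite ltr_wpDl.
apply: le_trans (_ : M * C <= _); last by rewrite ler_wpM2l // lerDl.
by apply: ulim_bound => k; exact: h.
Qed.

Lemma lint_norm_le F G : adm F -> adm G -> (forall x, `|F x| <= G x) ->
  `|lint F| <= lint G.
Proof.
move=> aF aG FG; rewrite ler_norml -lintN //; apply/andP; split.
  by apply: lint_le => //; [exact: admN|move=> x; have := FG x; rewrite ler_norml => /andP[]].
by apply: lint_le => // x; apply: le_trans (FG x); exact: ler_norm.
Qed.

(** Normalizes the functional from below; through it [ball_vol] is positive. *)
Lemma lint_unit_cube F : adm F -> (forall x, 0 <= F x) ->
  (forall x : E, (forall i j, 0 <= x i j <= 1) -> 1 <= F x) -> 1 <= lint F.
Proof.
move=> aF F0 F1; rewrite -(ulim_cst 1); apply: ulim_le.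
- by exists 1 => k; rewrite normr1.
- exact: adm_bounded_seq.
near=> k; pose f (t : R) : R := (0 <= t <= 1)%R%:R.
apply: (@le_trans _ _ (lattice_sum k.+1 (fun x => \prod_(ij : 'I_m * 'I_2) f (x ij.1 ij.2)))).
  rewrite lattice_sum_prod exprn_ege1 // mulrC ler_pdivlMr ?ltr0n // mul1r.
  set K := k.+1; rewrite -natr_sum ler_nat.
  apply: (@leq_trans (\sum_(a < (2 * K ^ 2).+1) (K ^ 2 <= a < K ^ 2 + K))%N).
    by rewrite count_interval; nia.
  apply: leq_sum => a _; case: andP => // -[h1 h2].
  rewrite lt0b divr_ge0 ?subr_ge0 ?ler_nat //= ler_pdivrMr ?ltr0n // mul1r lerBlDr.
  by rewrite -natrD ler_nat addnC ltnW.
apply: lattice_sum_le => x.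
have [h|h] := pselect (forall i j, 0 <= x i j <= 1).
  apply: le_trans (F1 _ h).
  rewrite (eq_bigr (fun=> 1)) ?big1_eq // => -[i j] _.
  by rewrite /f /= h.
have [[i j] xij] : exists ij : 'I_m * 'I_2, ~ (0 <= x ij.1 ij.2 <= 1).
  by apply: contrapT => no; apply: h => i j; apply: contrapT => h; apply: no; exists (i, j).
by rewrite (bigD1 (i, j)) //= /f; move/negP/negPf: xij => /= ->; rewrite mul0r.
Unshelve. all: by end_near. Qed.

Definition grid_shift k (a : 'I_(2 * k ^ 2).+1) (i : 'I_m) (j : 'I_2)
    (c : {ffun 'I_m * 'I_2 -> 'I_(2 * k ^ 2).+1}) :
    {ffun 'I_m * 'I_2 -> 'I_(2 * k ^ 2).+1} :=
  [ffun ij => if ij == (i, j) then c ij + a else c ij].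

Lemma grid_shift_bij k a i j : bijective (@grid_shift k a i j).
Proof.
exists (@grid_shift k (- a) i j) => c; apply/ffunP => ij; rewrite !ffunE;
  case: eqP => // _; first exact: addrK.
exact: subrK.
Qed.

(* The lattice has period [1/k] up to a wrap-around which happens outside of
   the support. *)
Lemma lattice_sum_shift k F r i j : (0 < k)%N -> 0 <= r -> r + 1 < k%:R -> supp_in r F ->
  lattice_sum k (fun x => F (x + k%:R^-1 *: delta_mx i j)) = lattice_sum k F.
Proof.
move=> k0 r0 rk sF; rewrite /lattice_sum; congr (_ * _).
have k0' : 0 < k%:R :> R by rewrite ltr0n.
have out (x : E) (a : 'I_m) (b : 'I_2) : r < `|x a b| -> F x = 0.
  by move=> h; apply: sF; apply: lt_le_trans h _; exact: mx_coord_le.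
rewrite [RHS](reindex (@grid_shift k (inord 1) i j)) /=; last exact: onW_bij (@grid_shift_bij k (inord 1) i j).
apply: eq_bigr => c _; set y := grid_pt (grid_shift (inord 1) i j c).
set z := grid_pt c + _.
have k2 : (0 < k ^ 2)%N by rewrite expn_gt0 k0.
have yz a b : (a, b) != (i, j) -> y a b = z a b.
  move=> ab; rewrite /y /z !mxE ffunE (negPf ab).
  by move: ab; rewrite xpair_eqE => /negPf ->; rewrite mulr0 addr0.
have [cmax|cmax] := ltnP (c (i, j)) (2 * k ^ 2).
  congr F; apply/matrixP => a b.
  have [|ab] := eqVneq (a, b) (i, j); last by rewrite yz.
  move=> [-> ->]; rewrite !mxE ffunE !eqxx mulr1.
  have -> : (c (i, j) + inord 1 : 'I_(2 * k ^ 2).+1) = (c (i, j)).+1 :> nat.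
    by rewrite /= inordK ?addn1 ?modn_small //; lia.
  by rewrite -[(c (i, j)).+1]addn1 (natrD R (c (i, j))); field; rewrite gt_eqF.
have cE : c (i, j) = (2 * k ^ 2)%N :> nat.
  by apply/eqP; rewrite eqn_leq cmax -ltnS ltn_ord.
rewrite (out z i j) ?(out y i j) //.
  have -> : y i j = - k%:R.
    rewrite /y mxE ffunE eqxx.
    have -> : (c (i, j) + inord 1 : 'I_(2 * k ^ 2).+1) = 0%N :> nat.
      by rewrite /= inordK ?cE ?addn1 ?modnn //; lia.
    by rewrite sub0r (natrX R k); field; rewrite gt_eqF.
  by rewrite normrN ger0_norm ?ltW //; lra.
have -> : z i j = k%:R + k%:R^-1.
  by rewrite /z !mxE !eqxx cE mulr1 (natrM R 2) (natrX R k); field; rewrite gt_eqF.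
have : 0 <= k%:R^-1 :> R by rewrite invr_ge0 ltW.
by move=> ki; rewrite ger0_norm; lra.
Qed.

End LatticeIntegral.

(** * Functions of class C^k *)

Section Calculus.
Context {R : realType}.

Lemma near0_ball (V : normedModType R) (P : set V) :
  (\forall h \near (0 : V), P h) <-> exists2 d : R, 0 < d & forall h, `|h| < d -> P h.
Proof.
split=> [/nbhs_ballP[d d0 dP]|[d d0 dP]].
  by exists d => // h hd; apply: dP; rewrite -ball_normE /= sub0r normrN.
by apply/nbhs_ballP; exists d => // h; rewrite -ball_normE /= sub0r normrN; exact: dP.
Qed.

Lemma derive_linear (V W : normedModType R) (f : V -> W) x (a : R) (u v : V) :
  differentiable f x -> 'D_(a *: u + v) f x = a *: 'D_u f x + 'D_v f x.
Proof. by move=> df; rewrite !deriveE // linearP. Qed.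

Lemma derive_expand (V W : normedModType R) (f : V -> W) x (e : R) :
  differentiable f x -> 0 < e ->
  \forall h \near (0 : V), `|f (x + h) - f x - 'D_h f x| <= e * `|h|.
Proof.
move=> df e0; have := diff_locally df => /eqaddoP /(_ e e0); apply: filterS => h.
rewrite deriveE // /= => H; rewrite (_ : _ - _ = (f \o shift x - (cst (f x) + 'd f x)) h) //.
by rewrite -[RHS]/(f (h + x) - (f x + 'd f x h)) opprD addrA (addrC x h).
Qed.

Lemma expand_differentiable (V W : normedModType R) (f : V -> W) (L : {linear V -> W}) x :
  continuous L ->
  (forall e : R, 0 < e -> \forall h \near (0 : V), `|f (x + h) - f x - L h| <= e * `|h|) ->
  differentiable f x /\ forall v, 'D_v f x = L v.
Proof.
move=> cL H.
have h : f \o shift x = cst (f x) + L +o_ 0 id.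
  apply/eqaddoE/eqaddoP => e e0; have := H e e0; apply: filterS => k.
  rewrite (_ : (f \o shift x - (cst (f x) + L)) k = f (x + k) - f x - L k) //.
  by rewrite -[LHS]/(f (k + x) - (f x + L k)) opprD addrA (addrC x k).
have dL := diff_unique cL h.
have df : differentiable f x.
  by apply/diff_locallyP; rewrite dL; split; [exact: cL|exact: h].
by split=> // v; rewrite deriveE // dL.
Qed.

Lemma derive_along_line (V : normedModType R) (f : V -> R) (x h : V) (t : R) : differentiable f (x + t *: h) ->
  is_derive t (1 : R) (fun s : R => f (x + s *: h)) ('D_h f (x + t *: h)).
Proof.
move=> df; apply: DeriveDef.
  apply/derivable1_diffP.
  have dl : differentiable ((cst x : R -> V) + (fun s : R => s *: h)) t.
    by apply: differentiableD; [exact: differentiable_cst|].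
  exact: (differentiable_comp dl df).
apply: (congr1 (fun F : R -> R => lim (F @ (0 : R)^'))); apply/funext => s /=.
by rewrite scalerDl [s *: (1 : R)]mulr1 addrCA.
Qed.

Lemma mvt_line (V : normedModType R) (f : V -> R) x h :
  (forall t, 0 <= t <= 1 -> differentiable f (x + t *: h)) ->
  exists2 t, 0 <= t <= 1 & f (x + h) - f x = 'D_h f (x + t *: h).
Proof.
move=> df.
have [||t t01 tE] := @MVT_segment R (fun s => f (x + s *: h))
    (fun s => 'D_h f (x + s *: h)) 0 1 ler01.
- move=> s /[!in_itv] /= /andP[s0 s1]; apply: derive_along_line; apply: df.
  by rewrite !ltW.
- apply: derivable_within_continuous => s /[!in_itv] /= s01.
  by have := derive_along_line (df s s01) => -[].
exists t; first by move: t01; rewrite in_itv.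
by move: tE; rewrite scale1r scale0r addr0 subr0 mulr1.
Qed.

Lemma const_on_segment (V : normedModType R) (f : V -> R) x h :
  (forall t, 0 <= t <= 1 -> differentiable f (x + t *: h)) ->
  (forall t, 0 <= t <= 1 -> 'D_h f (x + t *: h) = 0) -> f (x + h) = f x.
Proof.
move=> df d0; have [t t01 tE] := mvt_line df.
by apply/eqP; rewrite -subr_eq0 tE d0.
Qed.

Context {m p : nat}.
Local Notation E := 'M[R]_(m, p).

Lemma mx_delta_sum (v : E) : v = \sum_ij v ij.1 ij.2 *: delta_mx ij.1 ij.2.
Proof. by rewrite {1}[v]matrix_sum_delta pair_bigA. Qed.

(** Linearity as a proposition about a bare function, since the maps concerned, such as v |-> 'D_v f
    x, are linear only under a hypothesis on the point x. *)
Definition lin_fun (W : normedModType R) (L : E -> W) :=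
  forall a u v, L (a *: u + v) = a *: L u + L v.

Section LinFun.
Context {W : normedModType R} (L : E -> W) (lL : lin_fun L).

Let L_linear : linear L. Proof. by move=> a u v; rewrite lL. Qed.
Let LL : {linear E -> W} := HB.pack L (GRing.isLinear.Build R E W *:%R L L_linear).

Lemma lin_fun0 : L 0 = 0. Proof. exact: (raddf0 LL). Qed.
Lemma lin_funD u v : L (u + v) = L u + L v. Proof. exact: (raddfD LL). Qed.
Lemma lin_funN u : L (- u) = - L u. Proof. exact: (raddfN LL). Qed.
Lemma lin_funB u v : L (u - v) = L u - L v. Proof. exact: (raddfB LL). Qed.
Lemma lin_funZ a u : L (a *: u) = a *: L u. Proof. exact: (linearZ_LR LL). Qed.
Lemma lin_fun_sum (I : Type) (s : seq I) (P : pred I) (F : I -> E) :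
  L (\sum_(i <- s | P i) F i) = \sum_(i <- s | P i) L (F i).
Proof. exact: (raddf_sum LL). Qed.

Lemma lin_fun_coord v : L v = \sum_ij v ij.1 ij.2 *: L (delta_mx ij.1 ij.2).
Proof.
by rewrite {1}[v]mx_delta_sum lin_fun_sum; apply: eq_bigr => ij _; rewrite lin_funZ.
Qed.

Lemma lin_fun_bound : exists2 C : R, 0 < C & forall v, `|L v| <= C * `|v|.
Proof.
exists (1 + \sum_(ij : 'I_m * 'I_p) `|L (delta_mx ij.1 ij.2)|) => [|v].
  by rewrite ltr_wpDr // sumr_ge0.
rewrite lin_fun_coord; apply: le_trans (ler_norm_sum _ _ _) _.
rewrite mulrDl mul1r ler_wpDl // mulr_suml ler_sum // => ij _.
by rewrite normrZ mulrC ler_wpM2l // mx_coord_le.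
Qed.

Lemma lin_fun_continuous : continuous L.
Proof.
move=> x; apply/(@cvgrPdist_le _ _ _ (nbhs x) (nbhs_filter x)) => e e0.
have [C C0 LC] := lin_fun_bound.
apply/nbhs_ballP; exists (e / C) => [|y]; first by rewrite /= divr_gt0.
rewrite -ball_normE /= ltr_pdivlMr // mulrC => /ltW h.
by rewrite -lin_funB; apply: le_trans (LC _) _.
Qed.

(** The way in which new derivatives are identified: parameter integrals, local inverses and
    convolutions all produce a linear candidate together with an estimate of the remainder. *)
Lemma expand_diff (f : E -> W) x :
  (forall e : R, 0 < e -> \forall h \near (0 : E), `|f (x + h) - f x - L h| <= e * `|h|) ->
  differentiable f x /\ forall v, 'D_v f x = L v.
Proof.
exact: (@expand_differentiable _ _ f LL x lin_fun_continuous).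
Qed.

End LinFun.

Lemma derive_lin_fun (W : normedModType R) (f : E -> W) x :
  differentiable f x -> lin_fun (fun v => 'D_v f x).
Proof. by move=> df a u v; exact: derive_linear. Qed.

Lemma derive_coord (W : normedModType R) (f : E -> W) x v : differentiable f x ->
  'D_v f x = \sum_ij v ij.1 ij.2 *: 'D_(delta_mx ij.1 ij.2) f x.
Proof. by move=> /derive_lin_fun/lin_fun_coord. Qed.

Lemma lin_fun_diff (W : normedModType R) (L : E -> W) x : lin_fun L ->
  differentiable L x /\ forall v, 'D_v L x = L v.
Proof.
move=> lL; apply: expand_diff => // e e0; near=> h.
by rewrite lin_funD // [X in X - _]addrAC subrr add0r subrr normr0 mulr_ge0 // ltW.
Unshelve. all: by end_near. Qed.

End Calculus.

Section CkTools.
Context {R : realType}.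

Lemma Ck_le (V : normedModType R) k l (A : set V) (f : V -> R) :
  (l <= k)%N -> Ck k A f -> Ck l A f.
Proof.
move=> lk; rewrite -(subnK lk); elim: (k - l)%N => [//|j IH].
by rewrite addSn => /CkW.
Qed.

Lemma Ck_sub (V : normedModType R) k (A B : set V) (f : V -> R) :
  B `<=` A -> Ck k A f -> Ck k B f.
Proof.
move=> BA; elim: k f => [|k IH] f /=; first by move=> cf x /BA; exact: cf.
by move=> [df cf]; split=> [x /BA|v]; [exact: df|exact: IH].
Qed.

Lemma Ck_union (V : normedModType R) k (A B : set V) (f : V -> R) :
  Ck k A f -> Ck k B f -> Ck k (A `|` B) f.
Proof.
elim: k f => [|k IH] f /=; first by move=> fA fB x [/fA|/fB].
by move=> [dA cA] [dB cB]; split=> [x [/dA|/dB]|v] //; exact: IH.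
Qed.

(** [Ck k A f] only constrains f around each point of A, hence it glues over arbitrary families of
    sets. *)
Lemma Ck_bigcup (V : normedModType R) k (A : set V) (f : V -> R) :
  (forall x, A x -> exists2 B : set V, B x & Ck k B f) -> Ck k A f.
Proof.
move=> h; have : Ck k (\bigcup_(B in [set B : set V | Ck k B f]) B) f.
  elim: k f {h} => [|k IH] f /=; first by move=> x [B fB Bx]; exact: fB.
  split=> [x [B [dB _] Bx]|v]; first exact: dB.
  apply: Ck_sub (IH _) => x [B [_ cB] Bx]; exists B => //=; exact: cB.
by apply: Ck_sub => x /h[B Bx cB]; exists B.
Qed.

Lemma Ck_diff (V : normedModType R) k (A : set V) (f : V -> R) x :
  Ck k.+1 A f -> A x -> differentiable f x.
Proof. by case=> + _; apply. Qed.

Lemma Ck_continuous (V : normedModType R) k (A : set V) (f : V -> R) x :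
  Ck k A f -> A x -> {for x, continuous f}.
Proof. by move=> /(Ck_le (leq0n k)); apply. Qed.

Lemma Ck_derive (V : normedModType R) k (A : set V) (f : V -> R) v :
  Ck k.+1 A f -> Ck k A (fun x => 'D_v f x).
Proof. by case=> _; apply. Qed.

Lemma Ck_fsum (V : normedModType R) k (A : set V) (I : Type) (s : seq I) (P : pred I)
    (f : I -> V -> R) : open A -> (forall i, P i -> Ck k A (f i)) ->
  Ck k A (fun x => \sum_(i <- s | P i) f i x).
Proof.
move=> oA kf; elim: s => [|i s IH].
  by under eq_fun do rewrite big_nil; exact: Ck_cst.
under eq_fun do rewrite big_cons.
by case Pi: (P i) => //; apply: CkD => //; exact: kf.
Qed.

Section Algebra.
Context {V : normedModType R} (k : nat) (A : set V) (oA : open A).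
Implicit Types f g : V -> R.

Lemma Ck_add f g : Ck k A f -> Ck k A g -> Ck k A (fun x => f x + g x).
Proof. exact: CkD. Qed.
Lemma Ck_mul f g : Ck k A f -> Ck k A g -> Ck k A (fun x => f x * g x).
Proof. exact: CkM. Qed.
Lemma Ck_opp f : Ck k A f -> Ck k A (fun x => - f x).
Proof. exact: CkN. Qed.
Lemma Ck_minus f g : Ck k A f -> Ck k A g -> Ck k A (fun x => f x - g x).
Proof. by move=> cf cg; apply: Ck_add => //; exact: Ck_opp. Qed.
Lemma Ck_scale a f : Ck k A f -> Ck k A (fun x => a * f x).
Proof. by move=> cf; apply: Ck_mul => //; exact: Ck_cst. Qed.
Lemma Ck_sqr f : Ck k A f -> Ck k A (fun x => f x ^+ 2).
Proof. exact: (fun cf => Ck_mul cf cf). Qed.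

End Algebra.

Lemma norm_shift (V : normedModType R) (r : R) (x v : V) : r + `|v| < `|x| -> r < `|x + v|.
Proof.
move=> h; rewrite -(ltrD2r `|v|); apply: lt_le_trans h _.
by rewrite -{1}[x](addrK v); exact: ler_normB.
Qed.

(** A threshold that works locally becomes uniform on a compact set. It serves both for uniform
    remainders and, with other predicates P, for the closedness of the lifted shell and the
    shrinking of shells. *)
Lemma compact_uniform (V : normedModType R) (P : V -> R -> Prop) (K : set V) : compact K ->
  (forall x, K x -> exists2 d : R, 0 < d & forall y, `|y - x| < d ->
     forall r, 0 < r < d -> P y r) ->
  exists2 d : R, 0 < d & forall x, K x -> forall r, 0 < r < d -> P x r.
Proof.
move=> cK loc.
have : \forall r \near 0^'+, K `<=` (fun x => P x r).
  have /(_ _ (0 : R)^'+ (fun r x => P x r)) := (compact_near_coveringP K).1 cK; apply.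
  move=> x Kx; have [d d0 dP] := loc x Kx.
  exists ([set y | `|y - x| < d], [set r | 0 < r < d]) => /=.
    split.
      by apply/nbhs_ballP; exists d => // y; rewrite -ball_normE /= distrC.
    by near=> r; apply/andP; split; near: r; [exact: nbhs_right_gt|exact: nbhs_right_lt].
  by move=> [y r] /= [h1 h2]; exact: dP.
move=> /nbhs_ballP[d d0 dP]; exists d => // x Kx r /andP[r0 rd].
by apply: (dP r) => //=; rewrite -ball_normE /= sub0r normrN gtr0_norm.
Unshelve. all: by end_near. Qed.

Context {m p : nat}.
Local Notation E := 'M[R]_(m, p).
Implicit Types (A B K : set E) (f : E -> R).

Lemma Ck_lin_fun k A f : lin_fun f -> Ck k A f.
Proof.
move=> lf; case: k => [|k].
  by move=> x _; exact: lin_fun_continuous.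
split=> [x _|v]; first by have [] := lin_fun_diff x lf.
rewrite (_ : (fun x => _) = cst (f v)); first exact: Ck_cst.
by apply/funext => x; have [_ ->] := lin_fun_diff x lf.
Qed.

Lemma near_ball_open A (x : E) : open A -> A x ->
  exists2 d : R, 0 < d & forall y, `|y - x| < d -> A y.
Proof.
move=> oA Ax; have /nbhs_ballP[d d0 dA] : nbhs x A by exact: open_nbhs_nbhs.
by exists d => // y yx; apply: dA; rewrite -ball_normE /= distrC.
Qed.

Lemma cont_ball f (x : E) (e : R) : {for x, continuous f} -> 0 < e ->
  exists2 d : R, 0 < d & forall y, `|y - x| < d -> `|f y - f x| < e.
Proof.
move=> cf e0; have : \forall y \near x, `|f y - f x| < e.
  have /cvgrPdist_lt /(_ e e0) := cf; apply: filterS => y.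
  by rewrite distrC.
move=> /nbhs_ballP[d d0 dA].
by exists d => // y yx; apply: dA; rewrite -ball_normE /= distrC.
Qed.

(** Strict differentiability: base point and increment vary together. The mean value theorem along
    the segment reduces it to continuity of the partial derivatives at x0. *)
Lemma C1_strict A f (x0 : E) (e : R) : open A -> Ck 1 A f -> A x0 -> 0 < e ->
  exists2 d : R, 0 < d & forall x h, `|x - x0| < d -> `|h| < d ->
    A (x + h) /\ `|f (x + h) - f x - 'D_h f x| <= e * `|h|.
Proof.
move=> oA cf Ax0 e0; have [a a0 aA] := near_ball_open oA Ax0.
(* One more than the number of entries: each partial derivative may contribute e / N, and N is
   positive even for an empty matrix. *)
pose N : R := 1 + \sum_(ij : 'I_m * 'I_p) 1.
have N0 : 0 < N by rewrite /N ltr_wpDr // sumr_ge0.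
pose e' := e / N / 2.
have e'0 : 0 < e' by rewrite !divr_gt0.
have /choice[dd ddP] : forall ij : 'I_m * 'I_p, exists d : R, 0 < d /\
    forall y, `|y - x0| < d ->
    `|'D_(delta_mx ij.1 ij.2) f y - 'D_(delta_mx ij.1 ij.2) f x0| < e'.
  move=> ij; have [d d0 dP] := cont_ball (Ck_continuous (Ck_derive (delta_mx ij.1 ij.2) cf) Ax0) e'0.
  by exists d.
pose b := \big[Order.min/a]_(ij : 'I_m * 'I_p) dd ij.
have b0 : 0 < b by apply: lt_bigmin => // ij _; have [] := ddP ij.
have ba : b <= a by exact: bigmin_le_id.
have bdd ij : b <= dd ij by exact: bigmin_le_cond.
have b2 : 0 < b / 2 by rewrite divr_gt0.
exists (b / 2) => // x h xx0 hb.
have inb t : 0 <= t <= 1 -> `|x + t *: h - x0| < b.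
  move=> /andP[t0 t1]; rewrite addrAC; apply: le_lt_trans (ler_normD _ _) _.
  rewrite normrZ ger0_norm // [b in _ < b]splitr ltr_leD //.
  by apply: le_trans (ltW hb); rewrite ler_piMl.
have inA t : 0 <= t <= 1 -> A (x + t *: h).
  by move=> /inb h1; apply: aA; exact: lt_le_trans ba.
have df y : A y -> differentiable f y by exact: Ck_diff cf.
split; first by rewrite -[h]scale1r; apply: inA; rewrite ler01 lexx.
have [t t01 ->] := mvt_line (fun t t01 => df _ (inA t t01)).
have Ax : A x by have := inA 0; rewrite scale0r addr0 lexx ler01; exact.
rewrite (derive_coord h (df _ (inA t t01))) (derive_coord h (df _ Ax)) -sumrB.
apply: le_trans (ler_norm_sum _ _ _) _.
apply: (@le_trans _ _ (\sum_(ij : 'I_m * 'I_p) (1 * (e / N * `|h|)))).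
  apply: ler_sum => ij _; rewrite -scalerBr normrM mulrC mul1r.
  apply: ler_pM => //; last exact: mx_coord_le.
  have h1 := (ddP ij).2 _ (lt_le_trans (inb t t01) (bdd ij)).
  have h2 : `|x - x0| < dd ij.
    by have := inb 0; rewrite scale0r addr0 lexx ler01 => /(_ isT) /lt_le_trans; apply.
  have {}h2 := (ddP ij).2 _ h2.
  rewrite -(subrKA ('D_(delta_mx ij.1 ij.2) f x0)).
  apply: le_trans (ler_normD _ _) _; rewrite [leRHS]splitr lerD //; first exact: ltW.
  by rewrite distrC ltW.
rewrite -mulr_suml; set S := \sum_(_ : _) _.
have -> : e * `|h| = N * (e / N * `|h|) by field; rewrite gt_eqF.
rewrite ler_wpM2r ?mulr_ge0 ?invr_ge0 ?(ltW e0) ?(ltW N0) //.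
by rewrite /N lerDr.
Qed.

Lemma C1_uniform A K f (e : R) : open A -> Ck 1 A f -> compact K -> K `<=` A -> 0 < e ->
  exists2 d : R, 0 < d & forall x h, K x -> `|h| < d ->
    A (x + h) /\ `|f (x + h) - f x - 'D_h f x| <= e * `|h|.
Proof.
move=> oA cf cK KA e0.
have [|d d0 dP] := @compact_uniform _ (fun x r => forall h, `|h| < r ->
    A (x + h) /\ `|f (x + h) - f x - 'D_h f x| <= e * `|h|) K cK.
  move=> x Kx; have [d d0 dP] := C1_strict oA cf (KA _ Kx) e0.
  exists d => // y yx r /andP[_ rd] h hr; apply: dP => //; exact: lt_trans rd.
have d2 : 0 < d / 2 by rewrite divr_gt0.
exists (d / 2) => // x h Kx hd; apply: (dP x Kx (d / 2)) => //.
by rewrite d2 /= ltr_pdivrMr // ltr_pMr // ltr1n.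
Qed.

Lemma C0_uniform A K f (e : R) : open A -> Ck 0 A f -> compact K -> K `<=` A -> 0 < e ->
  exists2 d : R, 0 < d & forall x h, K x -> `|h| < d ->
    A (x + h) /\ `|f (x + h) - f x| <= e.
Proof.
move=> oA cf cK KA e0.
have [|d d0 dP] := @compact_uniform _ (fun x r => forall h, `|h| < r ->
    A (x + h) /\ `|f (x + h) - f x| <= e) K cK.
  move=> x Kx; have [a a0 aP] := near_ball_open oA (KA _ Kx).
  have e2 : 0 < e / 2 by rewrite divr_gt0.
  have [b b0 bP] := cont_ball (cf _ (KA _ Kx)) e2.
  pose c := Num.min a b; have c0 : 0 < c by rewrite lt_min a0.
  exists (c / 2); first by rewrite divr_gt0.
  move=> y yx r /andP[r0 rc] h hr.
  have yx' : `|y - x| < c by apply: lt_le_trans yx _; rewrite ler_pdivrMr // ler_pMr // ler1n.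
  have yhx : `|y + h - x| < c.
    rewrite addrAC; apply: le_lt_trans (ler_normD _ _) _.
    by rewrite [c]splitr ltrD //; exact: lt_trans rc.
  move: yx' yhx; rewrite !lt_min => /andP[_ h1] /andP[h2 h3]; split; first exact: aP.
  rewrite -(subrKA (f x)); apply: le_trans (ler_normD _ _) _.
  rewrite [e]splitr lerD //; first exact/ltW/bP.
  by rewrite distrC; exact/ltW/bP.
have d2 : 0 < d / 2 by rewrite divr_gt0.
exists (d / 2) => // x h Kx hd; apply: (dP x Kx (d / 2)) => //.
by rewrite d2 /= ltr_pdivrMr // ltr_pMr // ltr1n.
Qed.

Lemma C0_bounded K f : compact K -> Ck 0 K f -> exists2 M : R, 0 < M & forall x, K x -> `|f x| <= M.
Proof.
move=> cK cf; have cfK : {within K, continuous f}.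
  by apply: continuous_in_subspaceT => x /[!inE]; exact: cf.
have := continuous_compact cfK cK.
move=> /compact_bounded[M [Mr Mb]]; exists (`|M| + 1) => [|x Kx].
  by rewrite ltr_wpDl.
by apply: (Mb (`|M| + 1)); [rewrite (le_lt_trans (ler_norm M)) // ltrDl|exists x].
Qed.

Lemma compact_norm_ball (r : R) : 0 <= r -> compact [set x : E | `|x| <= r].
Proof.
move=> r0.
have lv : lin_fun (@vec_mx R m p) by move=> a u v; rewrite linearP.
have -> : [set x : E | `|x| <= r] =
    (@vec_mx R m p) @` [set v : 'rV[R]_(m * p) | forall i, `|v 0 i| <= r].
  apply/seteqP; split=> [x xr|_ [v vr <-]] /=.
    exists (mxvec x); last exact: mxvecK.
    move=> i /=; case/mxvec_indexP: i => i j; rewrite mxvecE.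
    by apply: le_trans xr; exact: mx_coord_le.
  by apply/mx_norm_leP => // i j; rewrite mxE; exact: vr.
apply: continuous_compact; first by apply: continuous_subspaceT; exact: lin_fun_continuous.
apply: (@rV_compact _ _ (fun=> [set t : R | `|t| <= r])) => _.
have -> : [set t : R | `|t| <= r] = `[- r, r]%classic.
  by apply/seteqP; split=> t /=; rewrite in_itv /= ler_norml.
exact: segment_compact.
Qed.

End CkTools.

Section CkComp.
Context {R : realType} {V : normedModType R} {m p : nat}.
Local Notation E := 'M[R]_(m, p).
Implicit Types (A : set V) (B : set E).

Lemma derive_mxE (g : V -> E) x v : (forall i j, differentiable (fun y => g y i j) x) ->
  'D_v g x = \matrix_(i, j) 'D_v (fun y => g y i j) x.
Proof.
by move=> dg; rewrite derive_mx //; apply/derivable_mxP => i j; exact: diff_derivable.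
Qed.

Lemma differentiable_mx (g : V -> E) x : (forall i j, differentiable (fun y => g y i j) x) ->
  differentiable g x.
Proof.
move=> dg; rewrite (_ : g = \sum_ij (fun y => g y ij.1 ij.2 *: delta_mx ij.1 ij.2)).
  apply: (big_ind (fun f : V -> E => differentiable f x)) => [|f h|ij _].
  - exact: differentiable_cst.
  - exact: differentiableD.
  - exact: differentiableZl.
by apply/funext => y; rewrite {1}[g y]mx_delta_sum fct_sumE.
Qed.

Lemma derive_compE (f : E -> R) (g : V -> E) x v : differentiable g x ->
  differentiable f (g x) -> 'D_v (fun y => f (g y)) x = 'D_('D_v g x) f (g x).
Proof.
move=> dg df; rewrite [LHS]deriveE; last exact: (differentiable_comp dg df).
by rewrite (diff_comp dg df) /= !deriveE.
Qed.

Lemma Ck_comp k A B (f : E -> R) (g : V -> E) : open A ->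
  (forall i j, Ck k A (fun y => g y i j)) -> Ck k B f -> (forall x, A x -> B (g x)) ->
  Ck k A (fun y => f (g y)).
Proof.
move=> oA; elim: k f => [|k IH] f cg cf AB.
  move=> x Ax; apply: (@continuous_comp _ _ _ g f); last exact/cf/AB.
  rewrite (_ : g = \sum_ij (fun y => g y ij.1 ij.2 *: delta_mx ij.1 ij.2)); last first.
    by apply/funext => y; rewrite {1}[g y]mx_delta_sum fct_sumE.
  apply: big_ind => [|f' h|ij _]; first exact: cst_continuous.
    by move=> h1 h2; apply: continuousD.
  by apply: continuousZl; exact: cg.
have dg x : A x -> forall i j, differentiable (fun y => g y i j) x.
  by move=> Ax i j; exact: Ck_diff (cg i j) Ax.
have dg' x : A x -> differentiable g x by move=> /dg; exact: differentiable_mx.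
have df x (Ax : A x) : differentiable f (g x) by exact: Ck_diff cf (AB x Ax).
split=> [x Ax|v]; first exact: (differentiable_comp (dg' x Ax) (df x Ax)).
apply: (@Ck_ext _ _ _ _ (fun x => \sum_ij
    ('D_v (fun y => g y ij.1 ij.2) x * 'D_(delta_mx ij.1 ij.2) f (g x)))) => //.
  move=> x /[!inE] Ax; rewrite derive_compE; [|exact: dg'|exact: df].
  rewrite (derive_coord _ (df x Ax)); apply: eq_bigr => ij _.
  by rewrite derive_mxE ?mxE //; exact: dg.
apply: Ck_fsum => // ij _; apply: CkM => //; first exact: Ck_derive (cg _ _).
apply: (IH (fun x => 'D_(delta_mx ij.1 ij.2) f x)) => //; last exact: Ck_derive.
by move=> i j; exact: CkW.
Qed.

End CkComp.

(** * Divergence and flows for the lattice integral *)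

Section LatticeCalculus.
Context {R : realType} {m : nat}.
Local Notation E := 'M[R]_(m, 2).
Implicit Types (F : E -> R) (L : E -> E).

Definition C0c F := Ck 0 setT F /\ exists r, supp_in r F.
Definition C1c F := Ck 1 setT F /\ exists r, supp_in r F.

Lemma C1c_C0c F : C1c F -> C0c F.
Proof. by move=> [/CkW ? ?]; split. Qed.

Lemma supp_in_le r s F : r <= s -> supp_in r F -> supp_in s F.
Proof. by move=> rs sF x sx; apply: sF; exact: le_lt_trans sx. Qed.

Lemma C0c_adm F : C0c F -> adm F.
Proof.
move=> [cF [r sF]]; split; last by exists r.
have [M M0 FM] := C0_bounded (compact_norm_ball (normr_ge0 r))
  (Ck_sub (@subsetT _ [set x : E | `|x| <= `|r|]) cF).
exists M => x; have [xr|rx] := leP `|x| `|r|; first exact: FM.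
by rewrite sF ?normr0 ?ltW //; apply: le_lt_trans rx; exact: ler_norm.
Qed.

Lemma C1c_adm F : C1c F -> adm F.
Proof. by move=> /C1c_C0c/C0c_adm. Qed.

Lemma supp_in_derive r F v : supp_in r F -> supp_in r (fun x => 'D_v F x).
Proof.
move=> sF x rx; rewrite -[RHS](derive_cst (0 : R) x v); apply: near_eq_derive.
apply: (@open_near_eq _ _ [set y : E | r < `|y|]) => //; last by move=> y /[!inE]; exact: sF.
have -> : [set y : E | r < `|y|] = (fun y : E => `|y|) @^-1` [set t : R | r < t] by [].
by apply: open_comp => [y _|]; [exact: norm_continuous|exact: open_gt].
Qed.

Lemma C1c_derive F v : C1c F -> C0c (fun x => 'D_v F x).
Proof.
move=> [cF [r sF]]; split; first exact: Ck_derive.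
by exists r; exact: supp_in_derive.
Qed.

Lemma C1c_diff F x : C1c F -> differentiable F x.
Proof. by move=> [cF _]; exact: Ck_diff cF _. Qed.

(** Beyond the ball of radius |r| + 1 a step shorter than 1 does not reach the support, so the
    compact estimate on that ball is an estimate everywhere. *)
Lemma C1c_uniform F (e : R) : C1c F -> 0 < e -> exists2 d : R, 0 < d &
  forall x h, `|h| < d -> `|F (x + h) - F x - 'D_h F x| <= e * `|h|.
Proof.
move=> [cF [r sF]] e0.
have [d d0 dP] := C1_uniform openT cF (compact_norm_ball (addr_ge0 (normr_ge0 r) ler01))
  (@subsetT _ _) e0.
exists (Num.min d 1) => [|x h]; first by rewrite lt_min d0 ltr01.
rewrite lt_min => /andP[hd h1].
have [xr|rx] := leP `|x| (`|r| + 1); first by have [] := dP x h xr hd.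
have r1 : r < `|x|.
  by apply: le_lt_trans rx; apply: le_trans (ler_norm _) _; rewrite lerDl.
have r2 : r < `|x + h|.
  apply: le_lt_trans (ler_norm r) _; rewrite -(ltrD2r 1).
  apply: lt_le_trans rx _; rewrite -[x in leLHS](addrK h).
  by apply: le_trans (ler_normB _ _) _; rewrite lerD2l ltW.
by rewrite !sF ?(supp_in_derive _ sF) // !subr0 normr0 mulr_ge0 // ltW.
Qed.

Lemma lint_eq0 F : adm F ->
  (forall e : R, 0 < e -> \forall k \near \oo, `|lattice_sum k.+1 F| <= e) -> lint F = 0.
Proof.
move=> aF h; apply: ulim_unique.
have hc : (fun k => lattice_sum k.+1 F) @ \oo --> (0 : R).
  apply/cvgrPdist_le => e e0; have := h e e0; apply: filterS => k.
  by rewrite sub0r normrN.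
by move=> A /hc; exact: ufilter_eventually.
Qed.

(** The difference quotient of step 1/k sums to zero because the lattice is invariant under this
    very step, and it approximates the derivative uniformly. *)
Lemma lint_derive_delta F i j : C1c F -> lint (fun x => 'D_(delta_mx i j) F x) = 0.
Proof.
move=> cF; set v := delta_mx i j; have aD := C0c_adm (C1c_derive v cF).
apply: lint_eq0 => // e e0; have [_ [r sF]] := cF.
pose r' := `|r| + 1; have [C C0 hC] := @lattice_sum_bound R m r'.
pose e' := e / (C + 1); have e'0 : 0 < e' by rewrite divr_gt0 // ltr_wpDl.
have [d d0 dP] := C1c_uniform cF e'0.
have [N NP] : exists N : nat, forall k, (N <= k)%N -> k.+1%:R^-1 < d /\ r' < k.+1%:R :> R.
  exists (maxn (Num.truncn d^-1) (Num.truncn r')) => k.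
  rewrite geq_max => /andP[k1 k2]; split.
    rewrite invf_plt ?posrE ?ltr0n //; apply: lt_le_trans (truncnS_gt _) _.
    by rewrite ler_nat ltnS.
  by apply: lt_le_trans (truncnS_gt _) _; rewrite ler_nat ltnS.
exists N => // k /= Nk; have [kd kr] := NP _ Nk.
have k0 : 0 < k.+1%:R^-1 :> R by rewrite invr_gt0 ltr0n.
(* Subtracting the difference quotient does not change the lattice sum, by [lattice_sum_shift]; what
   is left is the uniformly small remainder. *)
pose G x := 'D_v F x - k.+1%:R * (F (x + k.+1%:R^-1 *: v) - F x).
have -> : lattice_sum k.+1 (fun x => 'D_v F x) = lattice_sum k.+1 G.
  rewrite /G lattice_sumD (_ : (fun x => - _) = (fun x =>
    - k.+1%:R * (F (x + k.+1%:R^-1 *: v) + -1 * F x))); last first.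
    by apply/funext => x; ring.
  rewrite lattice_sumZ lattice_sumD lattice_sumZ.
  rewrite (@lattice_sum_shift _ _ _ _ `|r|) //; first by ring.
  by apply: supp_in_le sF; exact: ler_norm.
have nv : `|k.+1%:R^-1 *: v| = k.+1%:R^-1.
  by rewrite normrZ mx_delta_norm mulr1 gtr0_norm.
apply: le_trans (_ : e' * C <= e); last first.
  rewrite /e' mulrAC ler_pdivrMr ?ltr_wpDl // ler_wpM2l ?(ltW e0) //.
  by rewrite lerDl.
apply: hC; first exact: ltW.
  move=> x rx; rewrite /G.
  have r1 : r < `|x| by apply: le_lt_trans rx; apply: le_trans (ler_norm _) _; rewrite lerDl.
  have r2 : r < `|x + k.+1%:R^-1 *: v|.
    apply: le_lt_trans (ler_norm r) _; rewrite -(ltrD2r 1).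
    apply: lt_le_trans rx _; rewrite -[x in leLHS](addrK (k.+1%:R^-1 *: v)).
    apply: le_trans (ler_normB _ _) _; rewrite lerD2l nv.
    by rewrite invf_le1 ?ltr0n // ler1n.
  by rewrite (supp_in_derive _ sF) // !sF // subr0 mulr0 subr0.
move=> x; have := dP x (k.+1%:R^-1 *: v); rewrite nv => /(_ kd).
have lD := derive_lin_fun (C1c_diff x cF).
have -> : 'D_(k.+1%:R^-1 *: v) F x = k.+1%:R^-1 * 'D_v F x by exact: (lin_funZ lD).
move=> h.
have -> : G x = - k.+1%:R * (F (x + k.+1%:R^-1 *: v) - F x - k.+1%:R^-1 * 'D_v F x).
  by rewrite /G; field; rewrite addrC natr1 pnatr_eq0.
by rewrite normrM normrN normr_nat mulrC -ler_pdivlMr ?ltr0n.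
Qed.

Lemma lint_derive F v : C1c F -> lint (fun x => 'D_v F x) = 0.
Proof.
move=> cF; have -> : (fun x => 'D_v F x) =
    (fun x => \sum_ij v ij.1 ij.2 * 'D_(delta_mx ij.1 ij.2) F x).
  by apply/funext => x; rewrite (derive_coord v (C1c_diff x cF)).
rewrite lint_sum => [|ij]; last exact/admZ/C0c_adm/C1c_derive.
rewrite big1 // => ij _; rewrite lintZ; last exact/C0c_adm/C1c_derive.
by rewrite lint_derive_delta // mulr0.
Qed.

Lemma C1cM (g F : E -> R) : Ck 1 setT g -> C1c F -> C1c (fun x => g x * F x).
Proof.
move=> cg [cF [r sF]]; split; first by apply: CkM => //; exact: openT.
by exists r => x /sF ->; rewrite mulr0.
Qed.

Lemma C0cM (g F : E -> R) : Ck 0 setT g -> C0c F -> C0c (fun x => g x * F x).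
Proof.
move=> cg [cF [r sF]]; split; first by apply: CkM => //; exact: openT.
by exists r => x /sF ->; rewrite mulr0.
Qed.

Lemma C1cZ a F : C1c F -> C1c (fun x => a * F x).
Proof. by apply: (@C1cM (fun=> a)); exact: Ck_cst. Qed.

Definition ltrace L := \sum_ij L (delta_mx ij.1 ij.2) ij.1 ij.2.

Lemma lin_fun_entry L (i : 'I_m) (j : 'I_2) : lin_fun L -> lin_fun (fun x => L x i j).
Proof. by move=> lL a u v; rewrite lL !mxE. Qed.

(** The divergence theorem for a linear field, whose divergence is the constant [ltrace L].
    Rotations, transvections, dilations and the quaternionic fields are all integrated with it. *)
Lemma lint_lin_field F L : lin_fun L -> C1c F ->
  lint (fun x => 'D_(L x) F x) = - (ltrace L * lint F).
Proof.
move=> lL cF; have aF := C1c_adm cF.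
have cLF ij : C1c (fun x => L x ij.1 ij.2 * F x).
  by apply: C1cM => //; apply: Ck_lin_fun; exact: lin_fun_entry.
have aD ij : adm (fun x => 'D_(delta_mx ij.1 ij.2) (fun y => L y ij.1 ij.2 * F y) x).
  exact/C0c_adm/C1c_derive.
rewrite -mulNr -lintZ // -[RHS]add0r.
have E0 : lint (fun x => \sum_ij 'D_(delta_mx ij.1 ij.2) (fun y => L y ij.1 ij.2 * F y) x) = 0.
  by rewrite lint_sum // big1 // => ij _; exact: lint_derive.
rewrite -[X in X + _]E0 -lintD; [|exact: adm_sum|exact: admZ].
congr lint; apply/funext => x; rewrite (derive_coord (L x) (C1c_diff x cF)).
rewrite /ltrace mulNr mulr_suml -sumrB; apply: eq_bigr => ij _.
have [dL DL] := lin_fun_diff x (lin_fun_entry ij.1 ij.2 lL).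
rewrite -[(fun y => _ * _)]/((fun y => L y ij.1 ij.2) * F).
rewrite deriveM; [|exact: diff_derivable|exact/diff_derivable/C1c_diff].
rewrite DL -![_ *: _]/(_ * _).
by rewrite [F x * _]mulrC addrK.
Qed.

Lemma derive0_const (g : R -> R) :
  (forall s : R, 0 <= s <= 1 -> is_derive s (1 : R) g 0) -> g 1 = g 0.
Proof.
move=> dg; have [||s s01 sE] := @MVT_segment R g (fun=> 0) 0 1 ler01.
- by move=> s /[!in_itv] /= /andP[s0 s1]; apply: dg; rewrite !ltW.
- by apply: derivable_within_continuous => s /[!in_itv] /= /dg [].
by apply/eqP; rewrite -subr_eq0 sE mul0r.
Qed.

Lemma eps_is_derive (g : R -> R) (s a : R) :
  (forall e : R, 0 < e -> exists2 d : R, 0 < d & forall h, `|h| < d ->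
     `|g (s + h) - g s - h * a| <= e * `|h|) -> is_derive s (1 : R) g a.
Proof.
move=> H.
have C : (fun h : R => h^-1 *: ((g \o shift s) (h *: (1 : R)) - g s)) @ (0 : R)^' --> a.
  apply/cvgrPdist_le => e e0; have [d d0 dP] := H e e0.
  apply/nbhs_ballP; exists d => // h; rewrite -ball_normE /= sub0r normrN => hd h0.
  have -> : a - h^-1 *: (g (h *: (1 : R) + s) - g s) = - h^-1 * (g (s + h) - g s - h * a).
    by rewrite -[_ *: _]/(_ * _) [h *: 1]mulr1 [h + s]addrC; field.
  by rewrite normrM normrN normfV mulrC ler_pdivrMr ?normr_gt0 // dP.
by apply: DeriveDef; [apply/cvg_ex; exists a|exact/cvg_lim].
Qed.

Let lint_flow_aux F (Z : E -> E) (d0 r r' CZ : R) : C1c F -> 0 < d0 -> supp_in r F ->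
  (forall (s : R) x, - d0 < s < 1 + d0 -> r' < `|x| -> r < `|x + s *: Z x|) ->
  (forall x, `|x| <= r' -> `|Z x| <= CZ) ->
  (forall s : R, - d0 < s < 1 + d0 -> C0c (fun x => F (x + s *: Z x)) /\
     C0c (fun x => 'D_(Z x) F (x + s *: Z x))) ->
  forall s : R, 0 <= s <= 1 ->
  is_derive s (1 : R) (fun s => lint (fun x => F (x + s *: Z x)))
    (lint (fun x => 'D_(Z x) F (x + s *: Z x))).
Proof.
move=> cF d00 rF sF ZC adF s /andP[s0 s1]; apply: eps_is_derive => e e0.
have [C C0 hC] := @lint_bound R m r'.
pose CZ' := `|CZ| + 1; have CZ0 : 0 < CZ' by rewrite /CZ' ltr_wpDl.
pose e' := e / C / CZ'; have e'0 : 0 < e' by rewrite !divr_gt0.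
have [d dp dP] := C1c_uniform cF e'0.
exists (Num.min d0 (d / CZ')) => [|h]; first by rewrite lt_min d00 divr_gt0.
rewrite lt_min => /andP[hd0 hd].
have sh : - d0 < s + h < 1 + d0 by move: hd0; rewrite ltr_norml; lra.
have ss : - d0 < s < 1 + d0 by lra.
have [aF1 _] := adF _ sh; have [aF0 aD] := adF _ ss.
move/C0c_adm in aF1; move/C0c_adm in aF0; move/C0c_adm in aD.
rewrite -lintB // -lintZ // -lintB; [|exact: admB|exact: admZ].
have -> : e * `|h| = (e' * (CZ' * `|h|)) * C by rewrite /e'; field; rewrite !gt_eqF.
apply: hC; first exact: mulr_ge0 (ltW e'0) (mulr_ge0 (ltW CZ0) (normr_ge0 h)).
  move=> x xr; have h1 := sF _ x sh xr; have h2 := sF _ x ss xr.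
  by rewrite (supp_in_derive _ rF) // !rF // mulr0 !subr0.
move=> x; have [xr|rx] := leP `|x| r'; last first.
  have h1 := sF _ x sh rx; have h2 := sF _ x ss rx.
  rewrite (supp_in_derive _ rF) // !rF // mulr0 !subr0 normr0.
  exact: mulr_ge0 (ltW e'0) (mulr_ge0 (ltW CZ0) (normr_ge0 h)).
have Zx : `|h *: Z x| <= CZ' * `|h|.
  rewrite normrZ mulrC ler_wpM2r //; apply: le_trans (ZC x xr) _.
  by apply: le_trans (ler_norm _) _; rewrite lerDl.
have Zd : `|h *: Z x| < d.
  apply: le_lt_trans Zx _; rewrite mulrC -ltr_pdivlMr //.
have := dP (x + s *: Z x) (h *: Z x) Zd.
have -> : 'D_(h *: Z x) F (x + s *: Z x) = h * 'D_(Z x) F (x + s *: Z x).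
  exact: (lin_funZ (derive_lin_fun (C1c_diff (x + s *: Z x) cF))).
have -> : x + (s + h) *: Z x = x + s *: Z x + h *: Z x by rewrite scalerDl addrA.
move=> h1; apply: le_trans h1 _.
by rewrite ler_wpM2l // ltW.
Qed.

Lemma C1c_comp F (g : E -> E) : C1c F -> (forall i j, Ck 1 setT (fun x => g x i j)) ->
  (forall r, exists r', forall x, r' < `|x| -> r < `|g x|) -> C1c (fun x => F (g x)).
Proof.
move=> [cF [r sF]] cg pg; split; first exact: (Ck_comp openT cg cF).
by have [r' rr] := pg r; exists r' => x /rr; exact: sF.
Qed.

Lemma Ck_id_coord k i j : Ck k setT (fun x : E => x i j).
Proof. by apply: Ck_lin_fun => a u v; rewrite !mxE. Qed.

Lemma Ck_shear k (Z : E -> E) (s : R) i j : Ck k setT (fun x => Z x i j) ->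
  Ck k setT (fun x => (x + s *: Z x) i j).
Proof.
move=> cZ.
have -> : (fun x : E => (x + s *: Z x) i j) = (fun x => x i j + s * Z x i j).
  by apply/funext => x; rewrite !mxE.
by apply: (Ck_add openT); [exact: Ck_id_coord|exact: (Ck_scale openT)].
Qed.

Lemma Ck_derive_along k F (Z g : E -> E) : Ck k.+1 setT F ->
  (forall i j, Ck k setT (fun x => Z x i j)) -> (forall i j, Ck k setT (fun x => g x i j)) ->
  Ck k setT (fun x => 'D_(Z x) F (g x)).
Proof.
move=> cF cZ cg.
apply: (@Ck_ext _ _ _ _ (fun x => \sum_ij Z x ij.1 ij.2 * 'D_(delta_mx ij.1 ij.2) F (g x))).
- exact: openT.
- by move=> x _; rewrite (derive_coord (Z x)) //; exact: Ck_diff cF _.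
- apply: Ck_fsum => [|ij _]; first exact: openT.
  apply: CkM => //; first exact: openT.
  by apply: (Ck_comp openT cg (Ck_derive (delta_mx ij.1 ij.2) cF)).
Qed.

(** Differentiation under the integral along x |-> x + s Z x. The properness assumption, uniform in
    s on an interval slightly larger than [0, 1], keeps all supports in one ball and allows
    two-sided derivatives at 0 and 1. *)
Lemma lint_flow F (Z : E -> E) (d0 : R) : C1c F -> 0 < d0 ->
  (forall i j, Ck 1 setT (fun x => Z x i j)) ->
  (forall r, exists r', forall (s : R) x, - d0 < s < 1 + d0 ->
     r' < `|x| -> r < `|x + s *: Z x|) ->
  forall s : R, 0 <= s <= 1 ->
  is_derive s (1 : R) (fun s => lint (fun x => F (x + s *: Z x)))
    (lint (fun x => 'D_(Z x) F (x + s *: Z x))).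
Proof.
move=> cF d00 cZ pZ; have [cF1 [r rF]] := cF; have [r' rr] := pZ r.
have [CZ0 hCZ0] : exists C : R, forall x, `|x| <= r' -> `|Z x| <= C.
  have /choice[C hC] : forall ij : 'I_m * 'I_2, exists M : R, 0 < M /\ forall x : E,
      `|x| <= `|r'| -> `|Z x ij.1 ij.2| <= M.
    move=> ij; have [M M0 MP] := C0_bounded (compact_norm_ball (normr_ge0 r'))
      (Ck_sub (@subsetT _ _) (CkW (cZ ij.1 ij.2))).
    by exists M.
  exists (\sum_ij C ij) => x xr; apply/mx_norm_leP => [|i j].
    by apply: sumr_ge0 => ij _; apply/ltW; have [] := hC ij.
  rewrite (bigD1 (i, j)) //=; apply: ler_wpDr.
    by apply: sumr_ge0 => ij _; apply/ltW; have [] := hC ij.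
  by apply: (hC (i, j)).2; apply: le_trans xr _; exact: ler_norm.
apply: (lint_flow_aux cF d00 rF rr hCZ0) => s sd; split; split.
- by apply: (Ck_comp openT _ (CkW cF1)) => // i j; apply: Ck_shear; exact: CkW.
- by exists r' => x /(rr _ _ sd)/rF.
- apply: Ck_derive_along => // i j; first exact: CkW.
  by apply: Ck_shear; exact: CkW.
- by exists r' => x /(rr _ _ sd) h; rewrite (supp_in_derive _ rF).
Qed.

Lemma lint_translate F v : C1c F -> lint (fun x => F (x + v)) = lint F.
Proof.
move=> cF; have cv i j : Ck 1 setT (fun x : E => (fun=> v) x i j) by exact: Ck_cst.
have pv r : exists r', forall (s : R) (x : E), - 1 < s < 1 + 1 ->
    r' < `|x| -> r < `|x + s *: v|.
  exists (r + 2 * `|v|) => s x s12 rx; rewrite -(ltrD2r (2 * `|v|)).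
  apply: lt_le_trans rx _; rewrite -[x in leLHS](addrK (s *: v)).
  apply: le_trans (ler_normB _ _) _; rewrite lerD2l normrZ ler_wpM2r //.
  by rewrite ler_norml; lra.
have := lint_flow cF ltr01 cv pv; set g := (fun s : R => lint _) => dg.
have {dg} /derive0_const : forall s : R, 0 <= s <= 1 -> is_derive s (1 : R) g 0.
  move=> s /dg; congr is_derive.
  rewrite -[RHS](@lint_derive (fun x => F (x + s *: v)) v).
    congr lint; apply/funext => x.
    have dF := C1c_diff (x + s *: v) cF.
    rewrite (@derive_compE _ _ _ _ F (fun x => x + s *: v)) //.
      by rewrite deriveD // ?derive_id ?derive_cst ?addr0 //; exact: derivable_cst.
  apply: C1c_comp cF _ _ => [i j|r]; first exact: Ck_shear.
  by exists (r + `|s *: v|) => x; exact: norm_shift.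
by rewrite /g scale1r scale0r; under [X in _ = lint X -> _]eq_fun do rewrite addr0.
Qed.

End LatticeCalculus.

(** * Linear symplectic maps *)

Lemma scaleRE (R : realType) (a b : R) : a *: b = a * b.
Proof. by []. Qed.

Section Omega.
Context {R : realType} {n : nat}.
Local Notation E := 'M[R]_(n, 2).
Implicit Types (u v w x y : E).

Lemma omegaDl u v w : omega_st (u + v) w = omega_st u w + omega_st v w.
Proof. by have := omega_st_linear 1 u v w; rewrite scale1r mul1r. Qed.
Lemma omega0l w : omega_st (0 : E) w = 0.
Proof. by apply: big1 => j _; rewrite !mxE; ring. Qed.
Lemma omegaZl a u w : omega_st (a *: u) w = a * omega_st u w.
Proof. by have := omega_st_linear a u 0 w; rewrite omega0l !addr0. Qed.
Lemma omegaDr u v w : omega_st u (v + w) = omega_st u v + omega_st u w.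
Proof. by rewrite omega_st_antisym omegaDl opprD -!omega_st_antisym. Qed.
Lemma omegaZr a u w : omega_st u (a *: w) = a * omega_st u w.
Proof. by rewrite omega_st_antisym omegaZl -mulrN -omega_st_antisym. Qed.
Lemma omegaNl u w : omega_st (- u) w = - omega_st u w.
Proof. by rewrite -scaleN1r omegaZl mulN1r. Qed.
Lemma omegaNr u w : omega_st u (- w) = - omega_st u w.
Proof. by rewrite -scaleN1r omegaZr mulN1r. Qed.
Lemma omegaBr u v w : omega_st u (v - w) = omega_st u v - omega_st u w.
Proof. by rewrite omegaDr omegaNr. Qed.
Lemma omegaxx v : omega_st v v = 0.
Proof. by apply: big1 => j _; ring. Qed.

Lemma omega_lin_l w : lin_fun (fun v => omega_st v w).
Proof. by move=> a u v; rewrite omegaDl omegaZl. Qed.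
Lemma omega_lin_r w : lin_fun (fun v => omega_st w v).
Proof. by move=> a u v; rewrite omegaDr omegaZr. Qed.

Lemma omega_delta0 v k : omega_st v (delta_mx k 0) = - v k 1.
Proof.
rewrite /omega_st (bigD1 k) //= big1 ?addr0 => [|l lk].
  by rewrite !mxE !eqxx /= mulr0 mulr1 sub0r.
by rewrite !mxE (negPf lk) /= !mulr0 subr0.
Qed.
Lemma omega_delta1 v k : omega_st v (delta_mx k 1) = v k 0.
Proof.
rewrite /omega_st (bigD1 k) //= big1 ?addr0 => [|l lk].
  by rewrite !mxE !eqxx /= mulr0 mulr1 subr0.
by rewrite !mxE (negPf lk) /= !mulr0 subr0.
Qed.

Definition symp_lin (A : E -> E) :=
  lin_fun A /\ forall x y, omega_st (A x) (A y) = omega_st x y.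

Definition transvection a v x : E := x + (a * omega_st x v) *: v.

Lemma transvection_lin a v : lin_fun (transvection a v).
Proof.
move=> b x y; rewrite /transvection omegaDl omegaZl scalerDr scalerA.
by rewrite addrACA; congr (_ + _); rewrite -scalerDl; congr (_ *: _); ring.
Qed.

Lemma transvection_symp a v : symp_lin (transvection a v).
Proof.
split; first exact: transvection_lin.
move=> x y; rewrite /transvection !(omegaDl, omegaDr, omegaZl, omegaZr) omegaxx.
by rewrite (omega_st_antisym v y); ring.
Qed.

Lemma transvectionK a v : cancel (transvection a v) (transvection (- a) v).
Proof.
move=> x; rewrite /transvection omegaDl omegaZl omegaxx mulr0 addr0.
by rewrite mulNr scaleNr addrK.
Qed.

Lemma transvection_map u v : omega_st u v != 0 ->
  transvection (omega_st u v)^-1 (u - v) u = v.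
Proof.
move=> uv; rewrite /transvection omegaBr omegaxx sub0r mulrN mulVf // scaleN1r opprB.
by rewrite addrC subrK.
Qed.

Lemma transvection_fix a v x : omega_st x v = 0 -> transvection a v x = x.
Proof. by move=> h; rewrite /transvection h mulr0 scale0r addr0. Qed.

(** Words in transvections: invariance of the integral under linear symplectic maps is proved by
    induction on such a word, so that no determinant occurs. *)
Inductive transv_prod : (E -> E) -> Prop :=
| transv_id : transv_prod id
| transv_comp a v T : transv_prod T -> transv_prod (fun x => transvection a v (T x)).

Lemma transv_symp T : transv_prod T -> symp_lin T.
Proof.
elim=> [|a v {}T _ [lT sT]]; first by split.
have [l s] := transvection_symp a v.
by split=> [b x y|x y]; [rewrite lT l|rewrite s sT].
Qed.

Lemma transv_trans S T : transv_prod S -> transv_prod T -> transv_prod (fun x => S (T x)).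
Proof.
by elim=> [//|a v {}S _ IH] /IH; exact: transv_comp.
Qed.

Lemma transv_inv T : transv_prod T -> exists2 S, transv_prod S & cancel T S.
Proof.
elim=> [|a v {}T _ [S pS TS]]; first by exists id => //; exact: transv_id.
exists (fun x => S (transvection (- a) v x)).
  by apply: (@transv_trans S) => //; apply: (transv_comp (- a) v transv_id).
by move=> x; rewrite transvectionK TS.
Qed.

Local Notation e i := (delta_mx i 0 : E).
Local Notation f i := (delta_mx i 1 : E).

Lemma omega_ee i j : omega_st (e i) (e j) = 0.
Proof. by rewrite omega_delta0 mxE andbF oppr0. Qed.
Lemma omega_ff i j : omega_st (f i) (f j) = 0.
Proof. by rewrite omega_delta1 mxE andbF. Qed.
Lemma omega_ef i j : omega_st (e i) (f j) = (i == j)%:R.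
Proof. by rewrite omega_delta1 mxE eqxx andbT eq_sym. Qed.

Definition fixes_pairs k (B : E -> E) :=
  forall i : 'I_n, (i < k)%N -> B (e i) = e i /\ B (f i) = f i.

Definition perp_pairs k x := forall i : 'I_n, (i < k)%N ->
  omega_st (e i) x = 0 /\ omega_st (f i) x = 0.

Lemma perpD k x y : perp_pairs k x -> perp_pairs k y -> perp_pairs k (x + y).
Proof. move=> hx hy i ik; have [h1 h2] := hx i ik; have [h3 h4] := hy i ik.
by rewrite !omegaDr h1 h2 h3 h4 addr0. Qed.
Lemma perpZ k a x : perp_pairs k x -> perp_pairs k (a *: x).
Proof. by move=> hx i ik; have [h1 h2] := hx i ik; rewrite !omegaZr h1 h2 mulr0. Qed.
Lemma perpB k x y : perp_pairs k x -> perp_pairs k y -> perp_pairs k (x - y).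
Proof. by move=> hx hy; rewrite -scaleN1r; apply: perpD => //; exact: perpZ. Qed.

Lemma transvection_fixes k a v B : perp_pairs k v -> fixes_pairs k B ->
  fixes_pairs k (fun x => transvection a v (B x)).
Proof.
move=> pv fB i ik; have [-> ->] := fB i ik; have [h1 h2] := pv i ik.
by rewrite !transvection_fix.
Qed.

Lemma perp_image k B x : symp_lin B -> fixes_pairs k B -> perp_pairs k x -> perp_pairs k (B x).
Proof.
move=> [_ sB] fB px i ik; have [h1 h2] := fB i ik; have [h3 h4] := px i ik.
by split; [rewrite -h1 sB|rewrite -h2 sB].
Qed.

Lemma perp_basis (k : 'I_n) : perp_pairs k (e k) /\ perp_pairs k (f k).
Proof.
split=> i ik; have ik' : (i == k) = false by apply/negbTE; rewrite -val_eqE /= ltn_eqF.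
  by rewrite omega_ee omega_st_antisym omega_ef eq_sym ik' oppr0.
by rewrite omega_ff omega_ef ik'.
Qed.

Lemma symp_comp A B : symp_lin A -> symp_lin B -> symp_lin (fun x => A (B x)).
Proof. by move=> [lA sA] [lB sB]; split=> [a x y|x y]; [rewrite lB lA|rewrite sA sB]. Qed.

(** Gram-Schmidt for symplectic pairs. Two vectors with nonzero pairing are exchanged by one
    transvection ([transvection_map]), and otherwise an intermediate vector is inserted. All
    directions used are orthogonal to the pairs treated before, which therefore stay fixed. *)
Lemma transv_fix_pairs A k : (k <= n)%N -> symp_lin A ->
  exists2 T, transv_prod T & fixes_pairs k (fun x => T (A x)).
Proof.
move=> + sA; elim: k => [_|k IH kn]; first by exists id => //; exact: transv_id.
have [T pT fT] := IH (ltnW kn).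
pose i := Ordinal kn; pose B x := T (A x).
have sB : symp_lin B := symp_comp (transv_symp pT) sA.
have [pe pf] := perp_basis i.
have pu := perp_image sB fT pe; have pz := perp_image sB fT pf.
rewrite -/(B _) in pu pz; set u := B _ in pu; set z := B _ in pz.
have uz : omega_st u z = 1 by rewrite sB.2 omega_ef eqxx.
(* Each of the two pairings is affine in c and not identically zero, hence vanishes for at most one
   value; one of 0, 1, 2 avoids both zeros. *)
have [c [c1 c2]] : exists c, omega_st u (z + c *: f i) != 0 /\
    omega_st (z + c *: f i) (e i) != 0.
  have ef : omega_st (f i) (e i) = -1 by rewrite omega_st_antisym omega_ef eqxx.
  have H c : c != omega_st z (e i) -> 1 + c * omega_st u (f i) != 0 ->
      omega_st u (z + c *: f i) != 0 /\ omega_st (z + c *: f i) (e i) != 0.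
    move=> h1 h2; rewrite omegaDr omegaZr uz omegaDl omegaZl ef mulrN1 subr_eq0.
    by split=> //; rewrite eq_sym.
  have [b0|b0] := eqVneq (omega_st z (e i)) 0; last first.
    by exists 0; apply: H; [rewrite eq_sym|rewrite mul0r addr0 oner_neq0].
  have [a1|a1] := eqVneq (1 + omega_st u (f i)) 0; last first.
    by exists 1; apply: H; rewrite ?mul1r // b0 oner_neq0.
  exists 2; apply: H; first by rewrite b0 pnatr_eq0.
  have -> : 1 + 2 * omega_st u (f i) = -1 by move: a1; lra.
  by rewrite oppr_eq0 oner_neq0.
set w := z + c *: f i in c1 c2.
have pw : perp_pairs k w by apply: perpD => //; exact: perpZ.
pose S1 x := transvection (omega_st w (e i))^-1 (w - e i)
  (transvection (omega_st u w)^-1 (u - w) x).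
have pS1 : transv_prod S1 by apply/transv_comp/transv_comp/transv_id.
have S1u : S1 u = e i by rewrite /S1 !transvection_map.
have fS1 : fixes_pairs k (fun x => S1 (B x)).
  by do 2!(apply: transvection_fixes; first exact: perpB).
pose B1 x := S1 (B x).
have sB1 : symp_lin B1 := symp_comp (transv_symp pS1) sB.
have pw1 := perp_image sB1 fS1 pf; set w1 := B1 (f i) in pw1.
have ew1 : omega_st (e i) w1 = 1 by rewrite -S1u -[S1 u]/(B1 (e i)) sB1.2 omega_ef eqxx.
have eff : omega_st (e i) (f i) = 1 by rewrite omega_ef eqxx.
have [S2 [pS2 S2w S2e fS2]] : exists S2, [/\ transv_prod S2, S2 w1 = f i, S2 (e i) = e i &
    fixes_pairs k (fun x => S2 (B1 x))].
  have [w0|w0] := eqVneq (omega_st w1 (f i)) 0; last first.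
    exists (transvection (omega_st w1 (f i))^-1 (w1 - f i)); split.
    - exact/(transv_comp _ _ transv_id).
    - exact: transvection_map.
    - by rewrite transvection_fix // omegaBr ew1 eff subrr.
    - by apply: transvection_fixes => //; exact: perpB.
  (* Detour from w1 to f i: this vector pairs nontrivially with both of them, and both directions
     used are orthogonal to e i, which must not move. *)
  pose w2 := w1 + e i.
  have h1 : omega_st w1 w2 != 0.
    by rewrite /w2 omegaDr omegaxx add0r omega_st_antisym ew1 oppr_eq0 oner_neq0.
  have h2 : omega_st w2 (f i) != 0 by rewrite /w2 omegaDl w0 eff add0r oner_neq0.
  have pw2 : perp_pairs k w2 by exact: perpD.
  exists (fun x => transvection (omega_st w2 (f i))^-1 (w2 - f i)
    (transvection (omega_st w1 w2)^-1 (w1 - w2) x)); split.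
  - exact/transv_comp/transv_comp/transv_id.
  - by rewrite !transvection_map.
  - rewrite (@transvection_fix _ (w1 - w2)); last first.
      by rewrite /w2 opprD addrA subrr sub0r omegaNr omegaxx oppr0.
    by rewrite transvection_fix // /w2 omegaBr omegaDr ew1 omegaxx eff addr0 subrr.
  - by do 2!(apply: transvection_fixes; first exact: perpB).
exists (fun x => S2 (S1 (T x))).
  by apply: transv_trans => //; exact: transv_trans.
move=> j; rewrite ltnS leq_eqVlt => /orP[jk|jk]; last exact: fS2.
have -> : j = i by apply: val_inj; exact/eqP.
by rewrite -[T (A (e i))]/u S1u S2e -[S1 _]/w1 S2w.
Qed.

(** Undoing A on all n pairs exhibits A as the inverse of a word. This reduces the symplectic group
    to shears with explicit flows. *)
Lemma symp_transv A : symp_lin A -> exists2 T, transv_prod T & A =1 T.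
Proof.
move=> sA; have [T pT fT] := transv_fix_pairs (leqnn n) sA.
have [S pS TS] := transv_inv pT; exists S => // x.
have lTA := (symp_comp (transv_symp pT) sA).1.
suff TA : T (A x) = x by rewrite -{2}TA TS.
rewrite (lin_fun_coord lTA) [RHS]mx_delta_sum; apply: eq_bigr => -[i j] _ /=.
have [h1 h2] := fT i (ltn_ord i); congr (_ *: _).
by move: j; apply: ord2P.
Qed.

(** The transvections with parameter s a are the flow x + s Z x with Z of trace a omega(v, v) = 0,
    and Z is unchanged by the flow; so the derivative of the integral in s is that of
    [lint_lin_field] with zero trace. *)
Lemma lint_transvection F a v : C1c F -> lint (fun x => F (transvection a v x)) = lint F.
Proof.
move=> cF; pose Z x : E := (a * omega_st x v) *: v.
have lZ : lin_fun Z.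
  by move=> b x y; rewrite /Z omegaDl omegaZl scalerA -scalerDl; congr (_ *: _); ring.
have cZ i j : Ck 1 setT (fun x => Z x i j) by apply: Ck_lin_fun; exact: lin_fun_entry.
have TE s x : x + s *: Z x = transvection (s * a) v x.
  by rewrite /transvection /Z scalerA mulrA.
have [C C0 hC] := lin_fun_bound (omega_lin_l v).
have pZ r : exists r', forall (s : R) x, - 1 < s < 1 + 1 -> r' < `|x| -> r < `|x + s *: Z x|.
  exists (`|r| * (1 + 2 * (`|a| * C * `|v|))) => s x s1 rx.
  rewrite ltNge; apply/negP => xr; move: rx; rewrite ltNge => /negP; apply.
  have yE := TE s x; set y := x + s *: Z x in xr yE.
  have -> : x = transvection (- (s * a)) v y by rewrite yE transvectionK.
  have {}xr : `|y| <= `|r| by apply: le_trans xr _; exact: ler_norm.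
  rewrite mulrDr mulr1; apply: le_trans (ler_normD _ _) _; rewrite lerD //.
  rewrite normrZ !normrM normrN normrM.
  have s2 : `|s| <= 2 by rewrite ler_norml; lra.
  have h := hC y; rewrite /= in h.
  have -> : `|s| * `|a| * `|omega_st y v| * `|v| = (`|s| * `|omega_st y v|) * (`|a| * `|v|) by ring.
  have -> : `|r| * (2 * (`|a| * C * `|v|)) = (2 * (C * `|r|)) * (`|a| * `|v|) by ring.
  rewrite ler_wpM2r ?mulr_ge0 //; apply: ler_pM => //.
  by apply: le_trans h _; rewrite ler_pM2l.
have := lint_flow cF ltr01 cZ pZ; set g := (fun s : R => lint _) => dg.
have {dg} /derive0_const : forall s : R, 0 <= s <= 1 -> is_derive s (1 : R) g 0.
  move=> s s01; have := dg s s01; congr is_derive.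
  have lT := transvection_lin (s * a) v.
  have cFs : C1c (fun x => F (transvection (s * a) v x)).
    apply: C1c_comp cF _ _ => [i j|r]; first by apply: Ck_lin_fun; exact: lin_fun_entry.
    have [r' hr] := pZ r; exists r' => x; rewrite -TE; apply: hr; lra.
  have := lint_lin_field lZ cFs.
  have -> : ltrace Z = 0.
    rewrite /ltrace (eq_bigr (fun ij => a * (v ij.1 ij.2 *: omega_st (delta_mx ij.1 ij.2) v))).
      by rewrite -mulr_sumr -(lin_fun_coord (omega_lin_l v)) omegaxx mulr0.
    by move=> ij _; rewrite /Z mxE scaleRE; ring.
  rewrite mul0r oppr0 => <-; congr lint; apply/funext => x; rewrite TE.
  have [dT DT] := lin_fun_diff x lT.
  rewrite (derive_compE _ dT (C1c_diff _ cF)) DT.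
  by rewrite (@transvection_fix _ _ (Z x)) // /Z omegaZl omegaxx mulr0.
rewrite /g => h; transitivity (lint (fun x => F (x + 0 *: Z x))).
  by rewrite -h; congr lint; apply/funext => x; rewrite TE mul1r.
by congr lint; apply/funext => x; rewrite scale0r addr0.
Qed.

Lemma transv_proper T r : transv_prod T -> exists r', forall x, r' < `|x| -> r < `|T x|.
Proof.
move=> pT; have [S pS TS] := transv_inv pT.
have [C C0 hC] := lin_fun_bound (transv_symp pS).1.
exists (C * `|r|) => x rx; rewrite ltNge; apply/negP => xr.
move: rx; rewrite ltNge => /negP; apply; rewrite -[x]TS.
apply: le_trans (hC _) _; rewrite ler_pM2l //; apply: le_trans xr _; exact: ler_norm.
Qed.

Lemma lint_symp F A : symp_lin A -> C1c F -> lint (fun x => F (A x)) = lint F.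
Proof.
move=> /symp_transv[T pT AT] cF.
have -> : (fun x => F (A x)) = (fun x => F (T x)) by apply/funext => x; rewrite AT.
elim: pT F cF {A AT} => [//|a v {}T pT IH] F cF.
rewrite -[RHS](lint_transvection a v cF); apply: (IH (fun x => F (transvection a v x))).
have pt := transv_comp a v transv_id.
apply: C1c_comp cF _ _ => [i j|r]; first by apply: Ck_lin_fun; apply: lin_fun_entry; exact: transvection_lin.
exact: (transv_proper r pt).
Qed.

(** The factor is interpolated linearly from 1 to c. The trace 2n (c - 1) of the field cancels the
    logarithmic derivative of the power, so that the product is constant. *)
Lemma lint_scale F (c : R) : 0 < c -> C1c F ->
  c ^+ (n * 2) * lint (fun x => F (c *: x)) = lint F.
Proof.
move=> c0 cF; pose Z x : E := (c - 1) *: x.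
have lZ : lin_fun Z by move=> b x y; rewrite /Z scalerDr !scalerA mulrC.
have cZ i j : Ck 1 setT (fun x => Z x i j) by apply: Ck_lin_fun; exact: lin_fun_entry.
pose cs s := 1 + s * (c - 1).
have TE s x : x + s *: Z x = cs s *: x.
  by rewrite /Z /cs scalerA scalerDl scale1r.
pose q := Num.min 1 c / 2; have m0 : 0 < Num.min 1 c by rewrite lt_min ltr01.
have q0 : 0 < q by rewrite divr_gt0.
(* A margin around [0, 1] on which the interpolated factor 1 + s (c - 1) stays above q, half of
   min(1, c). *)
pose d0 := q / (`|c - 1| + 1); have N0 : 0 < `|c - 1| + 1 by rewrite ltr_wpDl.
have d00 : 0 < d0 by rewrite divr_gt0.
have dq : d0 * `|c - 1| <= q.
  by rewrite /d0 mulrAC ler_pdivrMr // ler_wpM2l ?(ltW q0) // lerDl.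
have csq s : - d0 < s < 1 + d0 -> q <= cs s.
  move=> s01; have m2 : Num.min 1 c = 2 * q by rewrite /q; field.
  have m1 : Num.min 1 c <= 1 by rewrite ge_min lexx.
  have mc : Num.min 1 c <= c by rewrite ge_min lexx orbT.
  move: dq; rewrite /cs; have [c1|c1] := leP 0 (c - 1).
    by rewrite ger0_norm //; nra.
  by rewrite ltr0_norm //; nra.
have pZ r : exists r', forall (s : R) x, - d0 < s < 1 + d0 -> r' < `|x| -> r < `|x + s *: Z x|.
  exists (`|r| / q) => s x s1; rewrite ltr_pdivrMr // TE normrZ => h.
  apply: le_lt_trans (ler_norm r) _; apply: lt_le_trans h _; rewrite mulrC.
  by rewrite ler_wpM2r //; apply: le_trans (csq s s1) _; exact: ler_norm.
have := lint_flow cF d00 cZ pZ; set g := (fun s : R => lint _) => dg.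
have {dg} /derive0_const : forall s : R, 0 <= s <= 1 ->
    is_derive s (1 : R) (fun s => cs s ^+ (n * 2) * g s) 0.
  move=> s s01; have ss : - d0 < s < 1 + d0 by lra.
  have cs0 : 0 < cs s := lt_le_trans q0 (csq s ss).
  have dg1 := dg s s01.
  have cFs : C1c (fun x => F (cs s *: x)).
    apply: C1c_comp cF _ _ => [i j|r].
      by apply: Ck_lin_fun => a u v; rewrite !mxE !scaleRE; ring.
    by have [r' hr] := pZ r; exists r' => x; rewrite -TE; exact: hr.
  have HE : lint (fun x => 'D_(Z x) F (x + s *: Z x)) = - ((n * 2)%:R * (c - 1) / cs s * g s).
    have lid : lin_fun (fun x : E => (c - 1) / cs s *: x).
      by move=> b x y; rewrite scalerDr !scalerA mulrC.
    have := lint_lin_field lid cFs.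
    have -> : ltrace (fun x : E => (c - 1) / cs s *: x) = (n * 2)%:R * (c - 1) / cs s.
      rewrite /ltrace (eq_bigr (fun=> (c - 1) / cs s)) => [|ij _]; last first.
        by rewrite !mxE !eqxx mulr1.
      by rewrite sumr_const -[RHS]mulrA mulr_natl; congr (_ *+ _); rewrite card_prod !card_ord.
    have -> : g s = lint (fun x => F (cs s *: x)).
      by rewrite /g; congr lint; apply/funext => x; rewrite TE.
    move=> <-; congr lint; apply/funext => x; rewrite TE.
    have lc : lin_fun (fun x : E => cs s *: x) by move=> b y z; rewrite scalerDr !scalerA mulrC.
    have [dT DT] := lin_fun_diff x lc.
    rewrite (derive_compE _ dT (C1c_diff _ cF)) DT /Z scalerA.
    by congr ('D_(_ *: x) F _); field; rewrite gt_eqF.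
  rewrite HE in dg1.
  have dc : is_derive s (1 : R) cs (c - 1).
    apply: eps_is_derive => e e0; exists 1 => // h _.
    have -> : cs (s + h) - cs s - h * (c - 1) = 0 by rewrite /cs; ring.
    by rewrite normr0 mulr_ge0 // ltW.
  have -> : (fun s => cs s ^+ (n * 2) * g s) = cs ^+ (n * 2) * g.
    by apply/funext => t; rewrite !fctE.
  apply: is_derive_eq; rewrite !fctE.
  case: (n * 2)%N => [|N]; first by rewrite !scaleRE !mulr0n !mul0r oppr0 mulr0; ring.
  by rewrite !scaleRE /= exprS; field; rewrite gt_eqF.
rewrite /g => h; transitivity (cs 1 ^+ (n * 2) * lint (fun x => F (x + 1 *: Z x))).
  by rewrite /cs mul1r addrC subrK; congr (_ * _); congr lint; apply/funext => x; rewrite TE /cs mul1r addrC subrK.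
rewrite h /cs mul0r addr0 expr1n mul1r.
by congr lint; apply/funext => x; rewrite scale0r addr0.
Qed.

End Omega.

(** * Parameter integrals and differential forms *)

Section UnitIntegral.
Context {R : realType}.
Implicit Types (f g : R -> R).

Definition riemann_sum (k : nat) f : R := k%:R^-1 * \sum_(i < k) f (i%:R / k%:R).

Definition int01 f : R := ulim (fun k => riemann_sum k.+1 f).

Definition bounded01 f := exists M : R, forall s, 0 <= s <= 1 -> `|f s| <= M.

Lemma node01 (k : nat) (i : 'I_k.+1) : 0 <= (i%:R / k.+1%:R : R) <= 1.
Proof.
rewrite divr_ge0 //= ler_pdivrMr ?ltr0n // mul1r ler_nat.
exact/ltnW/ltn_ord.
Qed.

Lemma riemann_sum_bound f (M : R) k : (forall s, 0 <= s <= 1 -> `|f s| <= M) ->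
  `|riemann_sum k.+1 f| <= M.
Proof.
move=> fM; rewrite /riemann_sum normrM ger0_norm ?invr_ge0 //.
rewrite mulrC ler_pdivrMr ?ltr0n //; apply: le_trans (ler_norm_sum _ _ _) _.
rewrite -[k.+1 in leRHS]card_ord -sum1_card natr_sum mulr_sumr ler_sum // => i _.
by rewrite mulr1; exact/fM/node01.
Qed.

Lemma bounded01_seq f : bounded01 f -> bounded_seq (fun k => riemann_sum k.+1 f).
Proof. by move=> [M fM]; exists M => k; exact: riemann_sum_bound. Qed.

Lemma riemann_sumD k f g : riemann_sum k (fun s => f s + g s) = riemann_sum k f + riemann_sum k g.
Proof. by rewrite /riemann_sum big_split mulrDr. Qed.

Lemma riemann_sumZ k a f : riemann_sum k (fun s => a * f s) = a * riemann_sum k f.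
Proof. by rewrite /riemann_sum -mulr_sumr; ring. Qed.

Lemma int01D f g : bounded01 f -> bounded01 g -> int01 (fun s => f s + g s) = int01 f + int01 g.
Proof.
move=> bf bg; rewrite /int01 -ulimD; try exact: bounded01_seq.
by congr ulim; apply/funext => k; rewrite riemann_sumD.
Qed.

Lemma int01Z a f : bounded01 f -> int01 (fun s => a * f s) = a * int01 f.
Proof.
move=> bf; rewrite /int01 -ulimZ; last exact: bounded01_seq.
by congr ulim; apply/funext => k; rewrite riemann_sumZ.
Qed.

Lemma int01_bound f (M : R) : (forall s, 0 <= s <= 1 -> `|f s| <= M) -> `|int01 f| <= M.
Proof. by move=> fM; apply: ulim_bound => k; exact: riemann_sum_bound. Qed.

Lemma eq_int01 f g : (forall s, 0 <= s <= 1 -> f s = g s) -> int01 f = int01 g.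
Proof.
move=> fg; congr ulim; apply/funext => k; rewrite /riemann_sum.
by congr (_ * _); apply: eq_bigr => i _; exact/fg/node01.
Qed.

Lemma int01_cst a : int01 (fun=> a) = a.
Proof.
rewrite /int01 -[RHS](ulim_cst a); congr ulim; apply/funext => k.
by rewrite /riemann_sum sumr_const card_ord -[X in _ * X]mulr_natl mulKf // pnatr_eq0.
Qed.

Lemma bounded01D f g : bounded01 f -> bounded01 g -> bounded01 (fun s => f s + g s).
Proof.
move=> [M fM] [N gN]; exists (M + N) => s s01; apply: le_trans (ler_normD _ _) _.
by rewrite lerD ?fM ?gN.
Qed.

Lemma bounded01M f g : bounded01 f -> bounded01 g -> bounded01 (fun s => f s * g s).
Proof.
move=> [M fM] [N gN]; exists (M * N) => s s01; rewrite normrM.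
by apply: ler_pM; rewrite ?fM ?gN.
Qed.

Lemma bounded01_cst a : bounded01 (fun=> a).
Proof. by exists `|a|. Qed.

Lemma bounded01N f : bounded01 f -> bounded01 (fun s => - f s).
Proof. by move=> [M fM]; exists M => s s01; rewrite normrN fM. Qed.

Lemma bounded01B f g : bounded01 f -> bounded01 g -> bounded01 (fun s => f s - g s).
Proof. by move=> bf /bounded01N; exact: bounded01D. Qed.

Lemma int01B f g : bounded01 f -> bounded01 g -> int01 (fun s => f s - g s) = int01 f - int01 g.
Proof.
move=> bf bg; rewrite -[- int01 g]mulN1r -int01Z // -int01D //.
  by apply: eq_int01 => s _; rewrite mulN1r.
by apply: bounded01M => //; exact: bounded01_cst.
Qed.

Lemma bounded01_sum (I : Type) (r : seq I) (P : pred I) (F : I -> R -> R) :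
  (forall i, bounded01 (F i)) -> bounded01 (fun s => \sum_(i <- r | P i) F i s).
Proof.
move=> bF; elim: r => [|i r IH].
  by under eq_fun do rewrite big_nil; exact: bounded01_cst.
under eq_fun do rewrite big_cons.
by case: (P i) => //; exact: bounded01D.
Qed.

Lemma int01_sum (I : Type) (r : seq I) (P : pred I) (F : I -> R -> R) :
  (forall i, bounded01 (F i)) ->
  int01 (fun s => \sum_(i <- r | P i) F i s) = \sum_(i <- r | P i) int01 (F i).
Proof.
move=> bF; elim: r => [|i r IH].
  rewrite big_nil -[RHS](int01_cst 0); apply: eq_int01 => s _.
  by rewrite big_nil.
rewrite big_cons -IH.
rewrite (@eq_int01 _ (fun s => if P i then F i s + \sum_(j <- r | P j) F j s
               else \sum_(j <- r | P j) F j s)); last by move=> s _; rewrite big_cons.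
by case: (P i) => //; rewrite int01D //; exact: bounded01_sum.
Qed.

Lemma int01_ftc f g : bounded01 g ->
  (forall e : R, 0 < e -> exists2 d : R, 0 < d & forall s h, 0 <= s <= 1 -> `|h| < d ->
     `|f (s + h) - f s - h * g s| <= e * `|h|) ->
  int01 g = f 1 - f 0.
Proof.
move=> bg H; apply/eqP; rewrite -subr_eq0; apply/eqP.
have -> : int01 g - (f 1 - f 0) = int01 (fun s => g s + - (f 1 - f 0)).
  by rewrite int01D ?int01_cst //; exact: bounded01_cst.
apply: ulim_unique.
have hc : (fun k => riemann_sum k.+1 (fun s => g s + - (f 1 - f 0))) @ \oo --> (0 : R).
  apply/cvgrPdist_le => e e0; have [d d0 dP] := H e e0.
  exists (Num.truncn d^-1) => // k /= dk.
  have kd : k.+1%:R^-1 < d.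
    rewrite invf_plt ?posrE ?ltr0n //; apply: lt_le_trans (truncnS_gt _) _.
    by rewrite ler_nat ltnS.
  have k0 : 0 < k.+1%:R :> R by rewrite ltr0n.
  have rc (a : R) : riemann_sum k.+1 (fun=> a) = a.
    by rewrite /riemann_sum sumr_const card_ord -[X in _ * X]mulr_natl mulKf ?gt_eqF.
  rewrite riemann_sumD rc.
  have -> : f 1 - f 0 = \sum_(i < k.+1) (f (i%:R / k.+1%:R + k.+1%:R^-1) - f (i%:R / k.+1%:R)).
    transitivity (\sum_(0 <= i < k.+1) (f (i.+1%:R / k.+1%:R) - f (i%:R / k.+1%:R))).
      by rewrite telescope_sumr // divff ?gt_eqF // mul0r.
    rewrite big_mkord; apply: eq_bigr => i _; congr (f _ - _).
    by rewrite -natr1 mulrDl mul1r.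
  rewrite /riemann_sum mulr_sumr -sumrB sub0r normrN.
  apply: le_trans (ler_norm_sum _ _ _) _.
  apply: (@le_trans _ _ (\sum_(i < k.+1) e * k.+1%:R^-1)); last first.
    by rewrite sumr_const card_ord -[leLHS]mulr_natr -mulrA mulVf ?gt_eqF // mulr1.
  apply: ler_sum => i _; rewrite distrC.
  have := dP (i%:R / k.+1%:R) k.+1%:R^-1 (node01 i).
  have kn : `|k.+1%:R^-1| = k.+1%:R^-1 :> R by rewrite ger0_norm ?invr_ge0.
  by rewrite kn => /(_ kd).
by move=> A /hc; exact: ufilter_eventually.
Qed.

Context {m p m' p' : nat}.
Local Notation E := 'M[R]_(m, p).
Local Notation E' := 'M[R]_(m', p').

(** Common frame for the two families of paths that are integrated along: the orbits of a circle
    action and the translations in the direction of Re w. *)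
Record affine_family (Phi : R -> E -> E') (L : R -> E -> E') (C : R) : Prop := {
  af_lin : forall s, lin_fun (L s) ;
  af_add : forall s x h, Phi s (x + h) = Phi s x + L s h ;
  af_bound : forall s h, 0 <= s <= 1 -> `|L s h| <= C * `|h| ;
  af_cont : forall x, continuous (Phi^~ x) }.

Section Family.
Variables (Phi : R -> E -> E') (L : R -> E -> E') (C : R).
Hypothesis aff : affine_family Phi L C.
Variables (A : set E) (B : set E').
Hypothesis oA : open A.
Hypothesis oB : open B.
Hypothesis AB : forall s x, 0 <= s <= 1 -> A x -> B (Phi s x).

Let orbit x := [set Phi s x | s in `[0, 1]%classic].

Let orbit_compact x : compact (orbit x).
Proof.
apply: continuous_compact; last exact: segment_compact.
by apply: continuous_subspaceT; exact: (af_cont aff).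
Qed.

Let orbitP s x : 0 <= s <= 1 -> orbit x (Phi s x).
Proof. by move=> s01; exists s => //=; rewrite in_itv. Qed.

Let orbit_sub x : A x -> orbit x `<=` B.
Proof. by move=> Ax y /= [s + <-]; rewrite /= in_itv => s01; exact: AB. Qed.

Lemma bounded01_family F x : Ck 0 B F -> A x -> bounded01 (fun s => F (Phi s x)).
Proof.
move=> cF Ax; have [M M0 MP] := C0_bounded (@orbit_compact x) (Ck_sub (orbit_sub Ax) cF).
by exists M => s s01; exact/MP/orbitP.
Qed.

Let L_bound s h : 0 <= s <= 1 -> `|L s h| <= (`|C| + 1) * `|h|.
Proof.
move=> s01; apply: le_trans (af_bound aff h s01) _; rewrite ler_wpM2r //.
by apply: le_trans (ler_norm _) _; rewrite lerDl.
Qed.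

Lemma C0_int01 F (wt : R -> R) : Ck 0 B F -> bounded01 wt ->
  Ck 0 A (fun x => int01 (fun s => wt s * F (Phi s x))).
Proof.
move=> cF bw x Ax; have [W hW] := bw.
have W0 : 0 < `|W| + 1 by rewrite ltr_wpDl.
apply/(@cvgrPdist_le _ _ _ (nbhs x) (nbhs_filter x)) => e e0.
have e'0 : 0 < e / (`|W| + 1) by rewrite divr_gt0.
have [d d0 dP] := C0_uniform oB cF (@orbit_compact x) (orbit_sub Ax) e'0.
have [a a0 aA] := near_ball_open oA Ax.
apply/nbhs_ballP; exists (Num.min a (d / (`|C| + 1))) => [|y].
  by rewrite /= lt_min a0 divr_gt0.
rewrite -ball_normE /= distrC lt_min => /andP[ya yd]; have Ay := aA y ya.
rewrite distrC -mulN1r -int01Z; last by apply: bounded01M => //; exact: bounded01_family.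
rewrite -int01D; [|by apply: bounded01M => //; exact: bounded01_family|]; last first.
  by apply: bounded01M; [exact: bounded01_cst|apply: bounded01M => //; exact: bounded01_family].
apply: int01_bound => s s01; rewrite mulN1r -mulrBr normrM.
have yE : y = x + (y - x) by rewrite addrC subrK.
have Ld : `|L s (y - x)| < d.
  by apply: le_lt_trans (L_bound _ s01) _; rewrite mulrC -ltr_pdivlMr.
have [_] := dP _ _ (orbitP x s01) Ld; rewrite -(af_add aff) -yE => h.
have -> : e = (`|W| + 1) * (e / (`|W| + 1)) by field; rewrite gt_eqF.
apply: ler_pM => //; apply: le_trans (hW _ s01) _.
by apply: le_trans (ler_norm _) _; rewrite lerDl.
Qed.

Lemma derive_int01 F (wt : R -> R) x : Ck 1 B F -> bounded01 wt -> A x ->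
  differentiable (fun x => int01 (fun s => wt s * F (Phi s x))) x /\
  forall v, 'D_v (fun x => int01 (fun s => wt s * F (Phi s x))) x =
            int01 (fun s => wt s * 'D_(L s v) F (Phi s x)).
Proof.
move=> cF bw Ax; have [W hW] := bw.
have W0 : 0 < `|W| + 1 by rewrite ltr_wpDl.
have dF s : 0 <= s <= 1 -> differentiable F (Phi s x) by move=> s01; apply: Ck_diff cF _; exact: AB.
have bD v : bounded01 (fun s => wt s * 'D_(L s v) F (Phi s x)).
  apply: bounded01M => //.
  have [M MP] : bounded01 (fun s => \sum_ij L s v ij.1 ij.2 * 'D_(delta_mx ij.1 ij.2) F (Phi s x)).
    apply: bounded01_sum => ij; apply: bounded01M.
      exists ((`|C| + 1) * `|v|) => s s01; apply: le_trans (L_bound _ s01).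
      exact: mx_coord_le.
    by apply: (@bounded01_family (fun y => 'D_(delta_mx ij.1 ij.2) F y)) => //; exact: Ck_derive.
  by exists M => s s01; rewrite derive_coord; [exact: MP|exact: dF].
have bF y : A y -> bounded01 (fun s => wt s * F (Phi s y)).
  by move=> Ay; apply: bounded01M => //; apply: bounded01_family => //; exact: CkW.
apply: expand_diff.
  move=> a u v /=; rewrite scaleRE -int01Z // -int01D //; last first.
    by apply: bounded01M => //; exact: bounded01_cst.
  apply: eq_int01 => s s01; rewrite (af_lin aff) derive_linear ?scaleRE; last exact: dF.
  by ring.
move=> e e0; have e'0 : 0 < e / (`|W| + 1) / (`|C| + 1) by rewrite !divr_gt0.
have [d d0 dP] := C1_uniform oB cF (@orbit_compact x) (orbit_sub Ax) e'0.
have [a a0 aA] := near_ball_open oA Ax.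
apply/near0_ball; exists (Num.min a (d / (`|C| + 1))) => [|h].
  by rewrite lt_min a0 divr_gt0.
rewrite lt_min => /andP[ha hd].
have Axh : A (x + h) by apply: aA; rewrite addrAC subrr add0r.
rewrite -!int01B //; try exact: bF; try exact: bD; last first.
  by apply: bounded01B; exact: bF.
apply: int01_bound => s s01.
have Ld : `|L s h| < d.
  by apply: le_lt_trans (L_bound _ s01) _; rewrite mulrC -ltr_pdivlMr.
have [_] := dP _ _ (orbitP x s01) Ld; rewrite -(af_add aff) => H.
have -> : wt s * F (Phi s (x + h)) - wt s * F (Phi s x) - wt s * 'D_(L s h) F (Phi s x) =
  wt s * (F (Phi s (x + h)) - F (Phi s x) - 'D_(L s h) F (Phi s x)) by ring.
rewrite normrM.
have -> : e * `|h| = (`|W| + 1) * (e / (`|W| + 1) / (`|C| + 1) * ((`|C| + 1) * `|h|)).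
  by field; rewrite !gt_eqF.
apply: ler_pM => //.
  apply: le_trans (hW _ s01) _.
  by apply: le_trans (ler_norm _) _; rewrite lerDl.
by apply: le_trans H _; rewrite ler_pM2l //; exact: L_bound.
Qed.

(** The weight is part of the statement because each differentiation brings out an entry of L s v,
    which the induction absorbs into it. *)
Lemma Ck_int01 k F (wt : R -> R) : Ck k B F -> bounded01 wt ->
  Ck k A (fun x => int01 (fun s => wt s * F (Phi s x))).
Proof.
elim: k F wt => [|k IH] F wt cF bw; first exact: C0_int01.
have cF1 : Ck 1 B F by apply: Ck_le cF.
have D x : A x -> _ := fun Ax => derive_int01 cF1 bw Ax.
split=> [x Ax|v]; first by have [] := D x Ax.
apply: (@Ck_ext _ _ _ _ (fun x => \sum_ij
    int01 (fun s => wt s * L s v ij.1 ij.2 * 'D_(delta_mx ij.1 ij.2) F (Phi s x)))) => //.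
  move=> x /[!inE] Ax; have [_ ->] := D x Ax.
  rewrite -int01_sum => [|ij]; last first.
    apply: bounded01M; last first.
      by apply: (@bounded01_family (fun y => 'D_(delta_mx ij.1 ij.2) F y)) => //; apply: Ck_derive.
    apply: bounded01M => //; exists ((`|C| + 1) * `|v|) => s s01.
    by apply: le_trans (L_bound _ s01); exact: mx_coord_le.
  apply: eq_int01 => s s01; rewrite [in RHS]derive_coord.
    by rewrite mulr_sumr; apply: eq_bigr => ij _; rewrite scaleRE mulrA.
  by apply: Ck_diff cF1 _; exact: AB.
apply: Ck_fsum => // ij _; apply: (IH (fun y => 'D_(delta_mx ij.1 ij.2) F y)).
  exact: Ck_derive.
apply: bounded01M => //; exists ((`|C| + 1) * `|v|) => s s01.
by apply: le_trans (L_bound _ s01); exact: mx_coord_le.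
Qed.

End Family.

End UnitIntegral.

Section ScalarFTC.
Context {R : realType}.

Lemma int01_ftc_cont (g g' : R -> R) : (forall s, is_derive s (1 : R) g (g' s)) ->
  continuous g' -> int01 g' = g 1 - g 0.
Proof.
move=> dg cg.
have dgf (x : R) : differentiable g x by apply/derivable1_diffP; have [] := dg x.
have dgE (x h : R) : 'D_h g x = h * g' x.
  have -> : h = h *: 1 + 0 :> R by rewrite addr0 scaleRE mulr1.
  rewrite derive_linear // derive0 addr0 scaleRE; congr (_ * _); last first.
    by have [_ ->] := dg x.
  by rewrite addr0 scaleRE mulr1.
apply: int01_ftc.
  have [M [Mr MP]] : bounded_set (g' @` `[0, 1]%classic).
    apply: compact_bounded; apply: continuous_compact; last exact: segment_compact.
    exact: continuous_subspaceT.
  exists (`|M| + 1) => s s01; apply: (MP (`|M| + 1)).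
    by rewrite (le_lt_trans (ler_norm M)) // ltrDl.
  by exists s => //=; rewrite in_itv.
move=> e e0.
have [|d d0 dP] := @compact_uniform R R (fun s r => forall h, `|h| < r ->
    `|g (s + h) - g s - h * g' s| <= e * `|h|) `[0, 1]%classic (@segment_compact R 0 1).
  move=> s0 _; have e2 : 0 < e / 2 by rewrite divr_gt0.
  have : \forall y \near s0, `|g' s0 - g' y| < e / 2.
    by have /cvgrPdist_lt := cg s0; apply.
  move=> /nbhs_ballP[d d0 dP]; exists (d / 2); first by rewrite divr_gt0.
  move=> y yx r /andP[_ rd] h hr.
  have [t /andP[t0 t1] ->] := mvt_line (fun t (_ : 0 <= t <= 1) => dgf (y + t *: h)).
  rewrite dgE -mulrBr normrM mulrC ler_wpM2r //.
  have h1 : `|g' s0 - g' (y + t *: h)| < e / 2.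
    apply: dP; rewrite -ball_normE /= distrC addrAC [d]splitr.
    apply: le_lt_trans (ler_normD _ _) _; rewrite ltrD //.
    rewrite scaleRE normrM; apply: le_lt_trans (_ : `|h| < _); last exact: lt_trans rd.
    by rewrite ler_piMl // ger0_norm.
  have h2 : `|g' s0 - g' y| < e / 2.
    apply: dP; rewrite -ball_normE /= distrC; apply: lt_trans yx _.
    by rewrite ltr_pdivrMr // ltr_pMr // ltr1n.
  rewrite -(subrKA (g' s0)); apply: le_trans (ler_normD _ _) _.
  by rewrite [e]splitr lerD //; apply/ltW; rewrite // distrC.
exists (d / 2); first by rewrite divr_gt0.
move=> s h s01 hd; apply: (dP s _ (d / 2)) => //=.
by rewrite divr_gt0 //= ltr_pdivrMr // ltr_pMr // ltr1n.
Qed.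

End ScalarFTC.

(** * Symmetry of second derivatives *)

Section Schwarz.
Context {R : realType} {m p : nat}.
Local Notation E := 'M[R]_(m, p).

(** The mean value theorem twice: in the direction u for the increment of f by t v, then in the
    direction v for the derivative along u. *)
Let second_difference (A : set E) (f : E -> R) x (u v : E) (e : R) : open A -> Ck 2 A f -> A x ->
  0 < e -> exists2 d : R, 0 < d & forall t : R, 0 < t < d ->
  `|f (x + t *: u + t *: v) - f (x + t *: u) - f (x + t *: v) + f x
    - t ^+ 2 * 'D_v (fun y => 'D_u f y) x| <= e * t ^+ 2.
Proof.
move=> oA cf Ax e0; have [a a0 aA] := near_ball_open oA Ax.
have cD : Ck 0 A (fun y => 'D_v (fun z => 'D_u f z) y) := Ck_derive v (Ck_derive u cf).
have [b b0 bP] := cont_ball (cD _ Ax) e0.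
have N0 : 0 < `|u| + `|v| + 1 by rewrite ltr_wpDl // addr_ge0.
exists (Num.min a b / (`|u| + `|v| + 1)); first by rewrite divr_gt0 // lt_min a0.
move=> t /andP[t0]; rewrite ltr_pdivlMr // => tN.
have near_x (r s : R) : 0 <= r <= 1 -> 0 <= s <= 1 ->
    `|x + r *: (t *: u) + s *: (t *: v) - x| < Num.min a b.
  move=> /andP[r0 r1] /andP[s0 s1]; apply: le_lt_trans tN.
  rewrite addrAC [x + _]addrC addrK; apply: le_trans (ler_normD _ _) _.
  rewrite !normrZ (gtr0_norm t0) !ger0_norm // mulrDr mulr1 mulrDr.
  apply: ler_wpDr; first exact: ltW.
  by rewrite lerD // ler_piMl // mulr_ge0 // ltW.
have inA r s : 0 <= r <= 1 -> 0 <= s <= 1 -> A (x + r *: (t *: u) + s *: (t *: v)).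
  by move=> h1 h2; apply: aA; have := near_x r s h1 h2; rewrite lt_min => /andP[].
have z01 : 0 <= (0 : R) <= 1 by rewrite lexx ler01.
have o01 : 0 <= (1 : R) <= 1 by rewrite lexx ler01.
have inA0 r : 0 <= r <= 1 -> A (x + r *: (t *: u)).
  by move=> h1; have := inA r 0 h1 z01; rewrite scale0r addr0.
have inA1 r : 0 <= r <= 1 -> A (x + r *: (t *: u) + t *: v).
  by move=> h1; have := inA r 1 h1 o01; rewrite scale1r.
have df y : A y -> differentiable f y by apply: Ck_diff cf.
pose phi y := f (y + t *: v) - f y.
have dsh y : differentiable (fun y : E => y + t *: v) y.
  have := @differentiableD _ _ _ (id : E -> E) (cst (t *: v)) y; exact.
have dshE y h : 'D_h (fun y : E => y + t *: v) y = h.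
  rewrite -[fun y => _]/((id : E -> E) + cst (t *: v)) deriveD //.
  by rewrite derive_id derive_cst addr0.
have dphi r : 0 <= r <= 1 -> differentiable phi (x + r *: (t *: u)) /\
    forall h, 'D_h phi (x + r *: (t *: u)) =
    'D_h f (x + r *: (t *: u) + t *: v) - 'D_h f (x + r *: (t *: u)).
  move=> h1; set y := x + _.
  have d1 : differentiable (fun y => f (y + t *: v)) y.
    exact: (differentiable_comp (dsh y) (df _ (inA1 r h1))).
  have d2 := df _ (inA0 r h1).
  split; first exact: differentiableB.
  move=> h; rewrite -[phi]/((fun y => f (y + t *: v)) - f).
  rewrite deriveB; [|exact: diff_derivable|exact: diff_derivable].
  by rewrite (derive_compE _ (dsh y) (df _ (inA1 r h1))) dshE.
have [r r01 rE] := mvt_line (fun r h => (dphi r h).1).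
have -> : f (x + t *: u + t *: v) - f (x + t *: u) - f (x + t *: v) + f x =
    phi (x + t *: u) - phi x by rewrite /phi; ring.
rewrite rE (dphi r r01).2.
have dDu y : A y -> differentiable (fun y => 'D_u f y) y by apply: Ck_diff; exact: Ck_derive u cf.
have DZ y : A y -> 'D_(t *: u) f y = t * 'D_u f y.
  by move=> Ay; rewrite (lin_funZ (derive_lin_fun (df y Ay))).
rewrite DZ ?DZ; [|exact: inA0|exact: inA1].
have [s s01 sE] := mvt_line (fun s h => dDu _ (inA r s r01 h)).
rewrite -mulrBr sE.
have -> : 'D_(t *: v) (fun y => 'D_u f y) (x + r *: (t *: u) + s *: (t *: v)) =
    t * 'D_v (fun y => 'D_u f y) (x + r *: (t *: u) + s *: (t *: v)).
  by rewrite (lin_funZ (derive_lin_fun (dDu _ (inA r s r01 s01)))).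
rewrite mulrA -expr2 -mulrBr normrM ger0_norm ?sqr_ge0 // mulrC ler_wpM2r ?sqr_ge0 //.
apply/ltW/bP; have := near_x r s r01 s01.
by rewrite lt_min => /andP[].
Qed.

(** The second difference is symmetric in u and v, and divided by t^2 it tends to either mixed
    derivative. *)
Lemma derive_swap (A : set E) (f : E -> R) x (u v : E) : open A -> Ck 2 A f -> A x ->
  'D_u (fun y => 'D_v f y) x = 'D_v (fun y => 'D_u f y) x.
Proof.
move=> oA cf Ax; apply/eqP; rewrite -subr_eq0 -normr_le0; apply/ler_addgt0Pr => e e0.
have e2 : 0 < e / 2 by rewrite divr_gt0.
have [a a0 aP] := second_difference u v oA cf Ax e2.
have [b b0 bP] := second_difference v u oA cf Ax e2.
pose t := Num.min a b / 2; have m0 : 0 < Num.min a b by rewrite lt_min a0.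
have t0 : 0 < t by rewrite divr_gt0.
have tm : t < Num.min a b by rewrite ltr_pdivrMr // ltr_pMr // ltr1n.
have [ta tb] : t < a /\ t < b by move: tm; rewrite lt_min => /andP[].
have h1 := aP t; rewrite t0 ta in h1; have {}h1 := h1 isT.
have h2 := bP t; rewrite t0 tb in h2; have {}h2 := h2 isT.
have key (P Q X c : R) : `|X - Q| <= c -> `|X - P| <= c -> `|P - Q| <= c + c.
  move=> hQ hP; rewrite (_ : P - Q = X - Q - (X - P)); last by ring.
  by apply: le_trans (ler_normB _ _) _; exact: lerD.
rewrite add0r -(ler_pM2l (exprn_gt0 2 t0)) -{1}(ger0_norm (sqr_ge0 t)) -normrM mulrBr.
have -> : t ^+ 2 * e = e / 2 * t ^+ 2 + e / 2 * t ^+ 2 by field.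
apply: key h1 _; apply: le_trans h2; rewrite le_eqVlt; apply/orP; left; apply/eqP.
congr `|_ - _|; rewrite [x + t *: v + _]addrAC; congr (_ + _).
exact: addrAC.
Qed.

End Schwarz.

Lemma derive_fsum (R : realType) (V : normedModType R) (I : Type) (s : seq I) (P : pred I)
    (F : I -> V -> R) x v : (forall i, P i -> differentiable (F i) x) ->
  differentiable (fun y => \sum_(i <- s | P i) F i y) x /\
  'D_v (fun y => \sum_(i <- s | P i) F i y) x = \sum_(i <- s | P i) 'D_v (F i) x.
Proof.
move=> dF; elim: s => [|i s [IH1 IH2]].
  under eq_fun do rewrite big_nil; rewrite big_nil derive_cst.
  by split=> //; exact: differentiable_cst.
under eq_fun do rewrite big_cons; rewrite big_cons.
case Pi: (P i) => //; have dFi := dF i Pi; split; first exact: differentiableD.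
rewrite -[fun y => _]/(F i + (fun y => \sum_(j <- s | P j) F j y)) deriveD ?IH2 //.
  exact: diff_derivable.
exact: diff_derivable.
Qed.

Section Forms.
Context {R : realType} {m p : nat}.
Local Notation E := 'M[R]_(m, p).
Implicit Types (A : set E) (b : E -> E -> R).

Definition form1 k A b := (forall q, A q -> lin_fun (b q)) /\ forall v, Ck k A (b^~ v).

(** The exterior derivative on constant vector fields, for which Cartan's formula has no bracket
    term. *)
Definition dform b q (u v : E) : R := 'D_u (b^~ v) q - 'D_v (b^~ u) q.

Lemma form1_sub k A B b : B `<=` A -> form1 k A b -> form1 k B b.
Proof. by move=> BA [lb cb]; split=> [q /BA|v]; [exact: lb|exact: Ck_sub (cb v)]. Qed.

Lemma form1_le k l A b : (l <= k)%N -> form1 k A b -> form1 l A b.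
Proof. by move=> lk [lb cb]; split=> // v; exact: Ck_le (cb v). Qed.

Lemma form1_field k A b (L : E -> E) : open A -> form1 k A b ->
  (forall i j, Ck k A (fun q => L q i j)) -> Ck k A (fun q => b q (L q)).
Proof.
move=> oA [lb cb] cL.
apply: (@Ck_ext _ _ _ _ (fun q => \sum_ij L q ij.1 ij.2 * b q (delta_mx ij.1 ij.2))) => //.
  by move=> q /[!inE] Aq; rewrite [RHS](lin_fun_coord (lb q Aq)).
by apply: Ck_fsum => // ij _; exact: Ck_mul.
Qed.

Lemma derive_form_lin A b (L : E -> E) q v : open A -> form1 1 A b -> lin_fun L -> A q ->
  'D_v (fun q => b q (L q)) q = 'D_v (b^~ (L q)) q + b q (L v).
Proof.
move=> oA [lb cb] lL Aq.
have db w : differentiable (b^~ w) q by exact: Ck_diff (cb w) Aq.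
have HL (ij : 'I_m * 'I_p) : lin_fun (fun q => L q ij.1 ij.2).
  by move=> a x y; rewrite lL !mxE.
have E1 (F : 'I_m * 'I_p -> E -> R) : (forall ij, differentiable (F ij) q) ->
    'D_v (fun q => \sum_ij F ij q) q = \sum_ij 'D_v (F ij) q.
  by move=> dF; have [_ ->] := derive_fsum (index_enum _) (P := xpredT) v (fun ij _ => dF ij).
transitivity ('D_v (fun q => \sum_ij (L q ij.1 ij.2 * b q (delta_mx ij.1 ij.2))) q).
  apply: near_eq_derive; apply: (open_near_eq oA) => // y /[!inE] Ay.
  by rewrite (lin_fun_coord (lb y Ay)).
rewrite E1 => [|ij]; last by apply: differentiableM => //; have [] := lin_fun_diff q (HL ij).
rewrite (lin_fun_coord (lb q Aq) (L v)).
have -> : 'D_v (b^~ (L q)) q = \sum_ij L q ij.1 ij.2 * 'D_v (b^~ (delta_mx ij.1 ij.2)) q.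
  transitivity ('D_v (fun y => \sum_ij (L q ij.1 ij.2 * b y (delta_mx ij.1 ij.2))) q).
    apply: near_eq_derive; apply: (open_near_eq oA) => // y /[!inE] Ay.
    by rewrite (lin_fun_coord (lb y Ay)).
  rewrite E1 => [|ij]; last by apply: differentiableM => //; exact: differentiable_cst.
  apply: eq_bigr => ij _; rewrite -[fun y => _]/(L q ij.1 ij.2 \*: (b^~ (delta_mx ij.1 ij.2))).
  by rewrite deriveZ //; exact: diff_derivable.
rewrite -big_split; apply: eq_bigr => ij _ /=.
have [dL DL] := lin_fun_diff q (HL ij).
rewrite -[fun y => _]/((fun y => L y ij.1 ij.2) * (b^~ (delta_mx ij.1 ij.2))).
rewrite deriveM; [|exact: diff_derivable|exact: diff_derivable].
by rewrite DL !scaleRE; congr (_ + _); rewrite mulrC.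
Qed.

End Forms.

(** * Circle actions *)

Lemma Ck_derive_field (R : realType) (m p k : nat) (A : set 'M[R]_(m, p)) (F : 'M[R]_(m, p) -> R)
    (Z : 'M[R]_(m, p) -> 'M[R]_(m, p)) : open A -> Ck k.+1 A F ->
  (forall i j, Ck k A (fun x => Z x i j)) -> Ck k A (fun x => 'D_(Z x) F x).
Proof.
move=> oA cF cZ.
apply: (@Ck_ext _ _ _ _ (fun x => \sum_ij Z x ij.1 ij.2 * 'D_(delta_mx ij.1 ij.2) F x)) => //.
  by move=> x /[!inE] Ax; rewrite [RHS]derive_coord //; exact: Ck_diff cF Ax.
by apply: Ck_fsum => // ij _; apply: Ck_mul => //; exact: Ck_derive cF.
Qed.

Section Rotation.
Context {R : realType} {m : nat} (eps : 'I_m -> R).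
Local Notation Q := 'M[R]_(m, 2).
Implicit Types (q v : Q) (A : set Q) (P : Q -> R).

(** Each row, a complex coordinate, turns with its own weight eps i; for integer weights the time 1
    is a full period. [rot_gen] is the velocity up to the factor 2 pi. *)
Definition rot_by (s : R) q : Q := \matrix_(i, j)
  (if j == 0 then cos (2 * pi * eps i * s) * q i 0 - sin (2 * pi * eps i * s) * q i 1
   else sin (2 * pi * eps i * s) * q i 0 + cos (2 * pi * eps i * s) * q i 1).

Definition rot_gen q : Q := \matrix_(i, j)
  (if j == 0 then - (eps i * q i 1) else eps i * q i 0).

Lemma rot_by_lin s : lin_fun (rot_by s).
Proof.
by move=> a u v; apply: mxP2 => k; rewrite !mxE /=; split; ring.
Qed.

Lemma rot_gen_lin : lin_fun rot_gen.
Proof.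
by move=> a u v; apply: mxP2 => k; rewrite !mxE /=; split; ring.
Qed.

Lemma rot_gen_by s q : rot_gen (rot_by s q) = rot_by s (rot_gen q).
Proof. by apply: mxP2 => k; rewrite !mxE /=; split; ring. Qed.

Lemma ltrace_rot_gen : ltrace rot_gen = 0.
Proof.
rewrite /ltrace big1 // => -[i j] _ /=; rewrite !mxE !eqxx /=.
by move: j; apply: ord2P; rewrite /= !mulr0 ?oppr0.
Qed.

Lemma rot_by0 q : rot_by 0 q = q.
Proof. by apply: mxP2 => k; rewrite !mxE /= mulr0 cos0 sin0; split; ring. Qed.

Lemma is_derive_cosM (a s : R) : is_derive s (1 : R) (fun s => cos (a * s)) (- a * sin (a * s)).
Proof.
have h : is_derive s (1 : R) (fun s => a * s) a.
  apply: eps_is_derive => e e0; exists 1 => // h _.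
  have -> : a * (s + h) - a * s - h * a = 0 by ring.
  by rewrite normr0 mulr_ge0 // ltW.
have := @is_derive1_comp R cos (fun s => a * s) s _ _ (is_derive_cos (a * s)) h.
by rewrite mulrC mulrN -mulNr.
Qed.

Lemma is_derive_sinM (a s : R) : is_derive s (1 : R) (fun s => sin (a * s)) (a * cos (a * s)).
Proof.
have h : is_derive s (1 : R) (fun s => a * s) a.
  apply: eps_is_derive => e e0; exists 1 => // h _.
  have -> : a * (s + h) - a * s - h * a = 0 by ring.
  by rewrite normr0 mulr_ge0 // ltW.
have := @is_derive1_comp R sin (fun s => a * s) s _ _ (is_derive_sin (a * s)) h.
by rewrite mulrC.
Qed.

Lemma derive_rot_entry q i j s :
  is_derive s (1 : R) (fun s => rot_by s q i j) (2 * pi * rot_gen (rot_by s q) i j).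
Proof.
have dc := is_derive_cosM (2 * pi * eps i) s; have ds := is_derive_sinM (2 * pi * eps i) s.
move: j; apply: ord2P.
  have -> : (fun s => rot_by s q i 0) = (q i 0 \*: (fun s => cos (2 * pi * eps i * s))) -
      (q i 1 \*: (fun s => sin (2 * pi * eps i * s))).
    by apply/funext => t; rewrite mxE /= -[RHS]/(q i 0 * _ - q i 1 * _); ring.
  by apply: is_derive_eq; rewrite !scaleRE !mxE /=; ring.
have -> : (fun s => rot_by s q i 1) = (q i 0 \*: (fun s => sin (2 * pi * eps i * s))) +
    (q i 1 \*: (fun s => cos (2 * pi * eps i * s))).
  by apply/funext => t; rewrite mxE /= -[RHS]/(q i 0 * _ + q i 1 * _); ring.
by apply: is_derive_eq; rewrite !scaleRE !mxE /=; ring.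
Qed.

Lemma derive_rot q s : differentiable (fun s => rot_by s q) s /\
  'D_1 (fun s => rot_by s q) s = (2 * pi) *: rot_gen (rot_by s q).
Proof.
have d i j : differentiable (fun s => rot_by s q i j) s.
  by apply/derivable1_diffP; have [] := derive_rot_entry q i j s.
split; first exact: differentiable_mx.
rewrite derive_mxE //; apply/matrixP => i j; rewrite [LHS]mxE [RHS]mxE.
by have [_ ->] := derive_rot_entry q i j s.
Qed.

Lemma is_derive_along_rot P q s : differentiable P (rot_by s q) ->
  is_derive s (1 : R) (fun s => P (rot_by s q)) (2 * pi * 'D_(rot_gen (rot_by s q)) P (rot_by s q)).
Proof.
move=> dP; have [d D] := derive_rot q s; apply: DeriveDef.
  by apply/derivable1_diffP; exact: (differentiable_comp d dP).
by rewrite (derive_compE (1 : R) d dP) D (lin_funZ (derive_lin_fun dP)) scaleRE.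
Qed.

Lemma rot_continuous q : continuous (fun s => rot_by s q).
Proof. by move=> s; apply: differentiable_continuous; have [] := derive_rot q s. Qed.

Lemma rot_affine : affine_family rot_by rot_by 2.
Proof.
split.
- exact: rot_by_lin.
- by move=> s x h; rewrite (lin_funD (rot_by_lin s)).
- move=> s h _; apply/mx_norm_leP => [|i j]; first by rewrite mulr_ge0.
  have hc t (x : R) : `|cos t * x| <= `|x|.
    by rewrite normrM ler_piMl // ler_norml cos_geN1 cos_le1.
  have hs t (x : R) : `|sin t * x| <= `|x|.
    by rewrite normrM ler_piMl // ler_norml sin_geN1 sin_le1.
  have -> : 2 * `|h| = `|h| + `|h| by ring.
  rewrite mxE; case: ifP => _.
    by apply: le_trans (ler_normB _ _) _; apply: lerD;
      [apply: le_trans (hc _ _) _|apply: le_trans (hs _ _) _]; exact: mx_coord_le.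
  by apply: le_trans (ler_normD _ _) _; apply: lerD;
    [apply: le_trans (hs _ _) _|apply: le_trans (hc _ _) _]; exact: mx_coord_le.
- exact: rot_continuous.
Qed.

(** The factor 1 is the weight of [Ck_int01]. The potential [rot_pot], with weight s, is the
    function whose derivative along the orbit is P minus its average. *)
Definition rot_avg P q := int01 (fun s => 1 * P (rot_by s q)).
Definition rot_pot P q := 2 * pi * int01 (fun s => s * P (rot_by s q)).

Section Average.
Variable A : set Q.
Hypothesis oA : open A.
Hypothesis rA : forall s q, A q -> A (rot_by s q).
Hypothesis per : forall i, cos (2 * pi * eps i) = 1 /\ sin (2 * pi * eps i) = 0.

Let rA' s q : 0 <= s <= 1 -> A q -> A (rot_by s q). Proof. by move=> _; exact: rA. Qed.

Let id_bounded : bounded01 (fun s : R => s).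
Proof. by exists 1 => s /andP[s0 s1]; rewrite ger0_norm. Qed.

Let id_cont : continuous (fun s : R => s). Proof. by move=> s; exact: cvg_id. Qed.

Lemma rot_by1 q : rot_by 1 q = q.
Proof. by apply: mxP2 => k; have [h1 h2] := per k; rewrite !mxE /= mulr1 h1 h2; split; ring. Qed.

Lemma Ck_rot_avg k P : Ck k A P -> Ck k A (rot_avg P).
Proof. by move=> cP; apply: (Ck_int01 rot_affine oA oA rA' cP); exact: bounded01_cst. Qed.

Lemma Ck_rot_pot k P : Ck k A P -> Ck k A (rot_pot P).
Proof.
move=> cP; apply: Ck_scale => //.
exact: (Ck_int01 rot_affine oA oA rA' cP id_bounded).
Qed.

Let cont_path P q : Ck 0 A P -> A q -> continuous (fun s => P (rot_by s q)).
Proof.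
move=> cP Aq s; apply: (@continuous_comp _ _ _ (fun s => rot_by s q) P).
  exact: rot_continuous.
by apply: cP; exact: rA.
Qed.

Let bounded_path P q : Ck 0 A P -> A q -> bounded01 (fun s => P (rot_by s q)).
Proof. by move=> cP Aq; exact: (bounded01_family rot_affine rA' cP Aq). Qed.

Let cGen P : Ck 1 A P -> Ck 0 A (fun q => 'D_(rot_gen q) P q).
Proof.
move=> cP; apply: Ck_derive_field => // i j.
by apply: Ck_lin_fun => a u v; rewrite rot_gen_lin !mxE.
Qed.

(* Integration by parts of [s * d/ds P (rot_by s q)] over a full period. *)
Lemma rot_avg_decomp P q : Ck 1 A P -> A q ->
  P q = rot_avg P q + 'D_(rot_gen q) (rot_pot P) q.
Proof.
move=> cP Aq; have dP s : differentiable P (rot_by s q) by apply: Ck_diff cP _; exact: rA.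
pose h s := P (rot_by s q).
pose h' s := 2 * pi * 'D_(rot_gen (rot_by s q)) P (rot_by s q).
have dh s : is_derive s (1 : R) h (h' s) by exact: is_derive_along_rot.
have ch : continuous h by apply: cont_path => //; exact: CkW.
have ch' : continuous h'.
  move=> s; apply: cvgM; first exact: cvg_cst.
  exact: (cont_path (cGen cP) Aq).
have dg s : is_derive s (1 : R) (fun s => s * h s) (h s + s * h' s).
  have := is_deriveM (is_derive_id s (1 : R)) (dh s).
  rewrite -[X in is_derive _ _ X]/(fun s => s * h s) => H.
  by apply: is_derive_eq; rewrite !scaleRE mulr1 addrC.
have cg : continuous (fun s => h s + s * h' s).
  by move=> s; apply: cvgD; [exact: ch|apply: cvgM; [exact: id_cont|exact: ch']].
have := int01_ftc_cont dg cg.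
have h1E : h 1 = P q by rewrite /h rot_by1.
rewrite mul0r subr0 mul1r h1E => <-.
have bh : bounded01 h by apply: bounded_path => //; exact: CkW.
have bh' : bounded01 h'.
  by apply: bounded01M; [exact: bounded01_cst|exact: bounded_path (cGen cP) Aq].
rewrite int01D //; last exact: bounded01M.
congr (_ + _); first by apply: eq_int01 => s _; rewrite mul1r.
have [dG DG] := derive_int01 rot_affine oA oA rA' cP id_bounded Aq.
have -> : 'D_(rot_gen q) (rot_pot P) q =
    'D_(rot_gen q) ((2 * pi) \*: (fun y => int01 (fun s => s * P (rot_by s y)))) q by [].
rewrite deriveZ; last exact: diff_derivable.
rewrite DG scaleRE -int01Z; last first.
  apply: bounded01M => //.
  have [M MP] := bounded_path (cGen cP) Aq; exists M => s s01.
  by have := MP s s01; rewrite rot_gen_by.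
by apply: eq_int01 => s _; rewrite /h' rot_gen_by; ring.
Qed.

(** Since the generator is in the kernel of db, the derivative of b(generator) in the direction v,
    transported along the orbit, is up to 2 pi the derivative in s of b at [rot_by s q] on
    [rot_by s v]. This function is periodic, so its derivative has integral zero. *)
Lemma rot_avg_const b q v : form1 1 A b ->
  (forall q, A q -> forall u, dform b q (rot_gen q) u = 0) -> A q ->
  'D_v (rot_avg (fun q => b q (rot_gen q))) q = 0.
Proof.
move=> fb hb Aq; have [lb cb] := fb.
have lg := rot_gen_lin.
have cP : Ck 1 A (fun q => b q (rot_gen q)).
  apply: form1_field => // i j.
  by apply: Ck_lin_fun => a u w; rewrite lg !mxE.
have [_ ->] := derive_int01 rot_affine oA oA rA' cP (bounded01_cst 1) Aq.
have E1 s : 1 * 'D_(rot_by s v) (fun q => b q (rot_gen q)) (rot_by s q) =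
    'D_(rot_gen (rot_by s q)) (b^~ (rot_by s v)) (rot_by s q) + b (rot_by s q) (rot_gen (rot_by s v)).
  rewrite mul1r (derive_form_lin _ oA fb lg (rA s Aq)); congr (_ + _).
  by have := hb _ (rA s Aq) (rot_by s v); rewrite /dform; lra.
pose g s := b (rot_by s q) (rot_by s v).
pose g' s := 2 * pi * ('D_(rot_gen (rot_by s q)) (b^~ (rot_by s v)) (rot_by s q) +
  b (rot_by s q) (rot_gen (rot_by s v))).
have pi2 : 2 * pi != 0 :> R by rewrite mulf_neq0 // gt_eqF // pi_gt0.
have gE s : g s = \sum_ij rot_by s v ij.1 ij.2 * b (rot_by s q) (delta_mx ij.1 ij.2).
  by rewrite /g (lin_fun_coord (lb _ (rA s Aq))).
have dterm s (ij : 'I_m * 'I_2) : is_derive s (1 : R)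
    (fun s => rot_by s v ij.1 ij.2 * b (rot_by s q) (delta_mx ij.1 ij.2))
    (rot_by s v ij.1 ij.2 * (2 * pi * 'D_(rot_gen (rot_by s q)) (b^~ (delta_mx ij.1 ij.2)) (rot_by s q)) +
     b (rot_by s q) (delta_mx ij.1 ij.2) * (2 * pi * rot_gen (rot_by s v) ij.1 ij.2)).
  have h1 := derive_rot_entry v ij.1 ij.2 s.
  have h2 := is_derive_along_rot (Ck_diff (cb (delta_mx ij.1 ij.2)) (rA s Aq)).
  have := is_deriveM h1 h2.
  by rewrite -[X in is_derive _ _ X]/(fun s => rot_by s v ij.1 ij.2 * b (rot_by s q) (delta_mx ij.1 ij.2)).
have g'E s : g' s = \sum_ij
    (rot_by s v ij.1 ij.2 * (2 * pi * 'D_(rot_gen (rot_by s q)) (b^~ (delta_mx ij.1 ij.2)) (rot_by s q)) +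
     b (rot_by s q) (delta_mx ij.1 ij.2) * (2 * pi * rot_gen (rot_by s v) ij.1 ij.2)).
  rewrite /g' (lin_fun_coord (lb _ (rA s Aq))) big_split /= mulrDr !mulr_sumr; congr (_ + _); last first.
    by apply: eq_bigr => ij _; rewrite scaleRE; ring.
  have -> : 'D_(rot_gen (rot_by s q)) (b^~ (rot_by s v)) (rot_by s q) =
      \sum_ij rot_by s v ij.1 ij.2 * 'D_(rot_gen (rot_by s q)) (b^~ (delta_mx ij.1 ij.2)) (rot_by s q).
    transitivity ('D_(rot_gen (rot_by s q))
        (fun y => \sum_ij rot_by s v ij.1 ij.2 * b y (delta_mx ij.1 ij.2)) (rot_by s q)).
      apply: near_eq_derive; apply: (open_near_eq oA); last exact: rA.
      by move=> y /[!inE] Ay; rewrite (lin_fun_coord (lb y Ay)).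
    have dd (ij : 'I_m * 'I_2) : differentiable (b^~ (delta_mx ij.1 ij.2)) (rot_by s q).
      exact: Ck_diff (cb _) (rA s Aq).
    have [_ ->] := @derive_fsum _ _ _ (index_enum _) xpredT
      (fun ij y => rot_by s v ij.1 ij.2 * b y (delta_mx ij.1 ij.2)) (rot_by s q)
      (rot_gen (rot_by s q)) (fun ij _ => differentiableM (differentiable_cst _ _) (dd ij)).
    apply: eq_bigr => ij _.
    rewrite -[fun y => _]/(rot_by s v ij.1 ij.2 \*: (b^~ (delta_mx ij.1 ij.2))).
    by rewrite deriveZ //; exact: diff_derivable.
  by rewrite mulr_sumr; apply: eq_bigr => ij _; ring.
have dg s : is_derive s (1 : R) g (g' s).
  rewrite g'E (_ : g = fun s => \sum_ij rot_by s v ij.1 ij.2 * b (rot_by s q) (delta_mx ij.1 ij.2)).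
    have [D1 D2] := @derive_fsum _ R _ (index_enum _) xpredT
      (fun ij s => rot_by s v ij.1 ij.2 * b (rot_by s q) (delta_mx ij.1 ij.2)) s 1
      (fun ij _ => (derivable1_diffP _ _).1 (@ex_derive _ _ _ _ _ _ _ (dterm s ij))).
    apply: DeriveDef; first exact/derivable1_diffP.
    by rewrite D2; apply: eq_bigr => ij _; have [_ ->] := dterm s ij.
  by apply/funext => t; exact: gE.
have cg' : continuous g'.
  rewrite (funext g'E).
  have cc ij : continuous (fun s => rot_by s v ij.1 ij.2 *
      (2 * pi * 'D_(rot_gen (rot_by s q)) (b^~ (delta_mx ij.1 ij.2)) (rot_by s q)) +
     b (rot_by s q) (delta_mx ij.1 ij.2) * (2 * pi * rot_gen (rot_by s v) ij.1 ij.2)).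
    have ce (w : Q) i j : continuous (fun s => rot_by s w i j).
      move=> s; apply: differentiable_continuous; apply/derivable1_diffP.
      by have [] := derive_rot_entry w i j s.
    move=> s; apply: cvgD; apply: cvgM.
    - exact: ce.
    - apply: cvgM; first exact: cvg_cst.
      exact: (cont_path (cGen (cb (delta_mx ij.1 ij.2))) Aq).
    - exact: (cont_path (CkW (cb (delta_mx ij.1 ij.2))) Aq).
    - apply: cvgM; first exact: cvg_cst.
      have eg : (fun x => rot_gen (rot_by x v) ij.1 ij.2) = (fun x => rot_by x (rot_gen v) ij.1 ij.2).
        by apply/funext => x; rewrite rot_gen_by.
      by rewrite eg rot_gen_by; exact: ce.
  elim: (index_enum _) => [|ij r IH].
    by under eq_fun do rewrite big_nil; exact: cst_continuous.
  by under eq_fun do rewrite big_cons; move=> s; apply: cvgD; [exact: cc|exact: IH].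
have := int01_ftc_cont dg cg'.
rewrite {1 2}/g !rot_by1 !rot_by0 subrr => H.
transitivity ((2 * pi)^-1 * int01 g'); last by rewrite H mulr0.
rewrite -int01Z; last first.
  have [M [Mr MP]] : bounded_set (g' @` `[0, 1]%classic).
    apply: compact_bounded; apply: continuous_compact; last exact: segment_compact.
    exact: continuous_subspaceT.
  exists (`|M| + 1) => s s01; apply: (MP (`|M| + 1)).
    by rewrite (le_lt_trans (ler_norm M)) // ltrDl.
  by exists s => //=; rewrite in_itv.
by apply: eq_int01 => s _; rewrite E1 /g' mulKf.
Qed.

End Average.

End Rotation.

(** * Radial integrals *)

Section ScalarCk.
Context {R : realType}.

Lemma is_derive_diff (f : R -> R) (x a : R) : is_derive x (1 : R) f a ->
  differentiable f x /\ forall h, 'D_h f x = h * a.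
Proof.
move=> [df D]; have df' : differentiable f x by apply/derivable1_diffP.
split=> // h; have -> : h = h *: (1 : R) + 0 by rewrite addr0 scaleRE mulr1.
by rewrite derive_linear // derive0 addr0 D addr0 !scaleRE mulr1.
Qed.

Lemma Ck_is_derive k (f f' : R -> R) : (forall x, is_derive x (1 : R) f (f' x)) ->
  Ck k setT f' -> Ck k.+1 setT f.
Proof.
move=> df cf'; split=> [x _|v]; first by have [] := is_derive_diff (df x).
rewrite (_ : (fun x => 'D_v f x) = fun x => v * f' x); first exact: (Ck_scale openT).
by apply/funext => x; have [_ ->] := is_derive_diff (df x).
Qed.

Lemma Ck_comp1 (V : normedModType R) k (A : set V) (g : V -> R) (phi : R -> R) : open A ->
  Ck k A g -> Ck k setT phi -> Ck k A (fun x => phi (g x)).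
Proof.
move=> oA; elim: k phi => [|k IH] phi cg cp.
  by move=> x Ax; apply: (@continuous_comp _ _ _ g phi); [exact: cg|exact: cp].
have dg x : A x -> differentiable g x by move=> Ax; exact: Ck_diff cg Ax.
have dp y : differentiable phi y by exact: Ck_diff cp _.
split=> [x Ax|v]; first exact: (differentiable_comp (dg x Ax) (dp _)).
apply: (@Ck_ext _ _ _ _ (fun x => 'D_v g x * 'D_1 phi (g x))) => //.
  move=> x /[!inE] Ax; rewrite [RHS]deriveE; last exact: (differentiable_comp (dg x Ax) (dp _)).
  rewrite (diff_comp (dg x Ax) (dp _)) /= -(deriveE _ (dg x Ax)) -(deriveE _ (dp (g x))).
  have H (a : R) : 'D_a phi (g x) = a * 'D_1 phi (g x).
    have -> : a = a *: (1 : R) + 0 by rewrite addr0 scaleRE mulr1.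
    by rewrite derive_linear // derive0 !addr0 !scaleRE mulr1.
  exact: esym (H _).
apply: Ck_mul => //; first exact: Ck_derive cg.
by apply: (IH (fun y => 'D_1 phi y)); [exact: CkW|exact: Ck_derive cp].
Qed.

Lemma derive_comp1 (V : normedModType R) (g : V -> R) (phi : R -> R) x v a :
  differentiable g x -> is_derive (g x) (1 : R) phi a ->
  'D_v (fun x => phi (g x)) x = a * 'D_v g x.
Proof.
move=> dg dp; have [dp' DP] := is_derive_diff dp.
rewrite [LHS]deriveE; last exact: (differentiable_comp dg dp').
by rewrite (diff_comp dg dp') /= -(deriveE _ dg) -(deriveE _ dp') DP mulrC.
Qed.

Definition pos (x : R) : R := Num.max x 0.

Lemma pos_ge0 x : 0 <= pos x. Proof. by rewrite /pos le_max lexx orbT. Qed.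
Lemma pos_id x : 0 <= x -> pos x = x. Proof. by move=> h; rewrite /pos max_l. Qed.
Lemma pos_0 x : x <= 0 -> pos x = 0. Proof. by move=> h; rewrite /pos max_r. Qed.

Lemma is_derive_exp (k : nat) (x : R) : is_derive x (1 : R) (fun y => y ^+ k.+1) (k.+1%:R * x ^+ k).
Proof.
have H := @is_deriveX R R id k.+1 x 1 1 (is_derive_id x (1 : R)).
have -> : (fun y : R => y ^+ k.+1) = id ^+ k.+1 by apply/funext => y; rewrite fctE.
by apply: is_derive_eq; rewrite scaleRE mulr1.
Qed.

Lemma is_derive_pos_exp (k : nat) (x : R) :
  is_derive x (1 : R) (fun y => pos y ^+ k.+2) (k.+2%:R * pos x ^+ k.+1).
Proof.
have [x0|x0|->] := ltgtP x 0.
- have -> : k.+2%:R * pos x ^+ k.+1 = 0 by rewrite pos_0 ?ltW // expr0n mulr0.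
  apply: (near_eq_is_derive (f := fun=> 0)) => //.
  have : \forall y \near x, y < 0 by apply: open_nbhs_nbhs; split => //; exact: open_lt.
  by apply: filterS => y y0; rewrite pos_0 ?ltW // expr0n.
- rewrite pos_id ?ltW //; have := is_derive_exp k.+1 x.
  apply: near_eq_is_derive => //.
  have : \forall y \near x, 0 < y by apply: open_nbhs_nbhs; split => //; exact: open_gt.
  by apply: filterS => y y0; rewrite pos_id ?ltW.
- have p00 : pos 0 = 0 by exact: pos_id.
  rewrite p00 expr0n mulr0; apply: eps_is_derive => e e0.
  exists (Num.min 1 e) => [|h]; first by rewrite lt_min ltr01.
  rewrite lt_min => /andP[h1 he].
  rewrite add0r p00 expr0n mulr0 !subr0 normrX ger0_norm ?pos_ge0 //.
  have ph : pos h <= `|h|.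
    by have [h0|h0] := leP 0 h; [rewrite pos_id // ger0_norm|rewrite pos_0 // ltW].
  have p0 := pos_ge0 h.
  apply: (@le_trans _ _ (pos h ^+ 2)).
    by rewrite -addn2 exprD ler_piMl ?sqr_ge0 // exprn_ile1 // (le_trans ph) // ltW.
  rewrite expr2; apply: ler_pM => //.
  by apply: le_trans ph _; exact: ltW.
Qed.

Lemma Ck_pos : Ck 0 setT pos.
Proof.
move=> x _; apply: (@continuous_max _ _ id (fun=> 0) x); first exact: cvg_id.
exact: cvg_cst.
Qed.

(* The two cubes make this step from 0 to 1 of class C^2. *)
Definition st (x : R) : R := 1 - pos (1 - pos x ^+ 3) ^+ 3.
Definition st' (x : R) : R := 9 * (pos (1 - pos x ^+ 3) ^+ 2 * pos x ^+ 2).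

Lemma st0 x : x <= 0 -> st x = 0.
Proof. by move=> h; rewrite /st (pos_0 h) expr0n subr0 pos_id // expr1n subrr. Qed.

Lemma pos3_ge1 x : 1 <= x -> pos (1 - pos x ^+ 3) = 0.
Proof.
by move=> x1; rewrite [pos x]pos_id ?(le_trans ler01) // pos_0 // subr_le0 exprn_ege1.
Qed.

Lemma st1 x : 1 <= x -> st x = 1.
Proof. by move=> x1; rewrite /st pos3_ge1 // expr0n subr0. Qed.

Lemma st_ge0 x : 0 <= st x.
Proof.
rewrite /st subr_ge0 exprn_ile1 ?pos_ge0 // /pos ge_max ler01 andbT.
by rewrite gerBl exprn_ge0 ?pos_ge0.
Qed.

Lemma st_le1 x : st x <= 1.
Proof. by rewrite /st gerBl exprn_ge0 ?pos_ge0. Qed.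

Lemma st'_ge0 x : 0 <= st' x.
Proof. by rewrite /st' mulr_ge0 // mulr_ge0 // sqr_ge0. Qed.

Lemma st'_0 x : x <= 0 -> st' x = 0.
Proof. by move=> h; rewrite /st' (pos_0 h) [0 ^+ 2]expr0n /= !mulr0. Qed.

Lemma st'_1 x : 1 <= x -> st' x = 0.
Proof. by move=> h; rewrite /st' pos3_ge1 // expr0n mul0r mulr0. Qed.

Lemma is_derive_1sub (f : R -> R) (x a : R) : is_derive x (1 : R) f a ->
  is_derive x (1 : R) (fun y => 1 - f y) (- a).
Proof.
move=> df; have := is_deriveB (is_derive_cst (1 : R) x (1 : R)) df.
by rewrite sub0r.
Qed.

Lemma is_derive_st x : is_derive x (1 : R) st (st' x).
Proof.
have h1 := is_derive_1sub (is_derive_pos_exp 1 x).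
have h2 := @is_derive1_comp R (fun y => pos y ^+ 3) (fun y => 1 - pos y ^+ 3) x _ _
  (is_derive_pos_exp 1 _) h1.
have := is_derive_1sub h2; congr is_derive.
by rewrite /st'; ring.
Qed.

Lemma Ck_pos2 : Ck 1 setT (fun x => pos x ^+ 2).
Proof.
apply: Ck_is_derive => [x|]; first exact: is_derive_pos_exp.
by apply: (Ck_scale openT); under eq_fun do rewrite expr1; exact: Ck_pos.
Qed.

Lemma Ck_pos3 : Ck 2 setT (fun x => pos x ^+ 3).
Proof.
apply: Ck_is_derive => [x|]; first exact: is_derive_pos_exp.
by apply: (Ck_scale openT); exact: Ck_pos2.
Qed.

Lemma Ck_st' : Ck 1 setT st'.
Proof.
apply: (Ck_scale openT); apply: (Ck_mul openT) Ck_pos2.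
apply: (Ck_comp1 openT _ Ck_pos2).
by apply: (Ck_minus openT); [exact: Ck_cst|exact: CkW Ck_pos3].
Qed.

Lemma Ck_st : Ck 2 setT st.
Proof. by apply: Ck_is_derive Ck_st' => x; exact: is_derive_st. Qed.

Lemma st'_mid : 0 < st' (2^-1).
Proof.
have p : pos (2^-1 : R) = 2^-1 by rewrite pos_id.
rewrite /st' p pos_id; last by rewrite subr_ge0 exprn_ile1 // invf_le1 ?ler1n.
have h : (2^-1 : R) < 1 by rewrite invf_lt1 ?ltr1n.
by rewrite mulr_gt0 // mulr_gt0 // exprn_gt0 // subr_gt0 exprn_ilt1.
Qed.

End ScalarCk.

Section Dot.
Context {R : realType} {m : nat}.
Local Notation E := 'M[R]_(m, 2).
Implicit Types (z u v : E).

Definition dot u v : R := \sum_(j < m) (u j 0 * v j 0 + u j 1 * v j 1).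
Definition Jmx z : E := crot 0 1 z.

Lemma Jmx0 z k : Jmx z k 0 = - z k 1. Proof. by rewrite crot0; ring. Qed.
Lemma Jmx1 z k : Jmx z k 1 = z k 0. Proof. by rewrite crot1; ring. Qed.
Lemma Jmx_lin : lin_fun Jmx.
Proof. by move=> a u v; apply: mxP2 => k; rewrite !mxE /=; split; ring. Qed.

Lemma dot_lin u : lin_fun (dot u).
Proof.
move=> a v w; rewrite scaleRE /dot mulr_sumr -big_split; apply: eq_bigr => k _.
by rewrite !mxE /=; ring.
Qed.
Lemma dotC u v : dot u v = dot v u.
Proof. by apply: eq_bigr => k _; ring. Qed.
Lemma dotJ z : dot z (Jmx z) = 0.
Proof. by apply: big1 => k _; rewrite Jmx0 Jmx1; ring. Qed.
Lemma dotzz z : dot z z = sqn z.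
Proof. by apply: eq_bigr => k _; rewrite /csq !expr2. Qed.
Lemma omega_dot u v : omega_st u v = dot (Jmx u) v.
Proof. by apply: eq_bigr => k _; rewrite Jmx0 Jmx1; ring. Qed.
Lemma ltrace_J : ltrace Jmx = 0.
Proof.
by rewrite /ltrace big1 // => -[i j] _; rewrite !mxE /=; move: j; apply: ord2P;
  rewrite /= ?eqxx /= ?andbF; ring.
Qed.

Lemma csq_le_sqn z j : csq z j <= sqn z.
Proof. by rewrite (sqn_split z j) lerDl sumr_ge0 // => k _; exact: csq_ge0. Qed.

Lemma norm_sqn z : `|z| ^+ 2 <= sqn z.
Proof.
rewrite -[sqn z]sqr_sqrtr ?sqn_ge0 // lerXn2r ?nnegrE ?sqrtr_ge0 //.
apply/mx_norm_leP => [|i j]; first exact: sqrtr_ge0.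
rewrite -sqrtr_sqr ler_sqrt ?sqn_ge0 //; apply: le_trans (csq_le_sqn z i).
by move: j; apply: ord2P; rewrite /csq ?lerDl ?lerDr sqr_ge0.
Qed.

Lemma sqnZ a z : sqn (a *: z) = a ^+ 2 * sqn z.
Proof. by rewrite /sqn mulr_sumr; apply: eq_bigr => k _; rewrite /csq !mxE; ring. Qed.

Lemma sqn_gt0 z : z != 0 -> 0 < sqn z.
Proof.
move=> z0; rewrite lt_def sqn_ge0 andbT; apply: contra z0 => /eqP h.
rewrite -normr_eq0 -sqrf_eq0 eq_le sqr_ge0 andbT -h; exact: norm_sqn.
Qed.

Lemma Ck_sqn (V : normedModType R) k (A : set V) (F : V -> E) : open A ->
  (forall i j, Ck k A (fun q => F q i j)) -> Ck k A (fun q => sqn (F q)).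
Proof.
move=> oA cF; apply: Ck_fsum => // j _.
by apply: Ck_add => //; exact: Ck_sqr.
Qed.

Lemma derive_sqn z v : differentiable (@sqn R m) z /\ 'D_v (@sqn R m) z = 2 * dot z v.
Proof.
have lc j l : lin_fun (fun z : E => z j l) by move=> a x y; rewrite !mxE.
have D j : differentiable (fun z : E => csq z j) z /\
    'D_v (fun z : E => csq z j) z = 2 * (z j 0 * v j 0 + z j 1 * v j 1).
  have [d0 D0] := lin_fun_diff z (lc j 0); have [d1 D1] := lin_fun_diff z (lc j 1).
  have -> : (fun z : E => csq z j) = (fun z : E => z j 0) * (fun z : E => z j 0) +
      (fun z : E => z j 1) * (fun z : E => z j 1).
    by apply/funext => y; rewrite /csq !expr2.
  split; first by apply: differentiableD; apply: differentiableM.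
  rewrite deriveD ?deriveM ?D0 ?D1 ?scaleRE; try (by apply: diff_derivable); try (by apply/diff_derivable/differentiableM).
  by ring.
have [d1 D1] := @derive_fsum _ _ _ (index_enum _) xpredT (fun j (z : E) => csq z j) z v
  (fun j _ => (D j).1).
split=> //; rewrite D1 /dot mulr_sumr; apply: eq_bigr => j _; exact: (D j).2.
Qed.

Lemma derive_radial (phi : R -> R) z v a : is_derive (sqn z) (1 : R) phi a ->
  'D_v (fun z => phi (sqn z)) z = a * (2 * dot z v).
Proof.
move=> dp; have [d D] := derive_sqn z v.
by rewrite (derive_comp1 v d dp) D.
Qed.

Lemma Ck_radial k (phi : R -> R) : Ck k setT phi -> Ck k setT (fun z : E => phi (sqn z)).
Proof.
move=> cp; apply: (Ck_comp1 openT _ cp); apply: (Ck_sqn openT) => i j.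
exact: Ck_id_coord.
Qed.

Lemma supp_radial (phi : R -> R) (s : R) : (forall t, s <= t -> phi t = 0) ->
  supp_in (`|s| + 1) (fun z : E => phi (sqn z)).
Proof.
move=> h z sz; apply: h; apply: le_trans (norm_sqn z).
apply: le_trans (ler_norm s) _; have : 0 <= `|s| by [].
set a := `|s| in sz *; move=> a0; nra.
Qed.

End Dot.

Section RadialVolume.
Context {R : realType} {n : nat}.
Local Notation E := 'M[R]_(n, 2).

Definition ball_ind (s : R) (z : E) : R := ((sqn z <= s)%R)%:R.
(** Its value is never computed: all volumes are compared as multiples of it, and only its
    positivity enters. *)
Definition ball_vol : R := lint (ball_ind 1).

Lemma ball_ind_adm s : adm (ball_ind s).
Proof.
split; first by exists 1 => z; rewrite /ball_ind; case: (sqn z <= s)%R; rewrite ?normr1 ?normr0.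
exists (`|s| + 1) => z h; rewrite /ball_ind leNgt.
have -> : s < sqn z; last by [].
apply: lt_le_trans (norm_sqn z); apply: le_lt_trans (ler_norm s) _; have : 0 <= `|s| by [].
set a := `|s| in h *; move=> a0; nra.
Qed.

Lemma C1c_radial (phi : R -> R) (s : R) : Ck 1 setT phi -> (forall t, s <= t -> phi t = 0) ->
  C1c (fun z : E => phi (sqn z)).
Proof.
by move=> cp h; split; [exact: Ck_radial|exists (`|s| + 1); exact: supp_radial].
Qed.

Lemma lint_radial_scale (phi : R -> R) (s b : R) : Ck 1 setT phi -> (forall t, b <= t -> phi t = 0) ->
  0 < s -> lint (fun z : E => phi (sqn z)) = s ^+ n * lint (fun z : E => phi (s * sqn z)).
Proof.
move=> cp h s0; rewrite -(@lint_scale _ _ _ (Num.sqrt s)) ?sqrtr_gt0 //; last exact: C1c_radial cp h.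
rewrite mulnC exprM sqr_sqrtr ?ltW //; congr (_ * _).
by congr lint; apply/funext => z; rewrite sqnZ sqr_sqrtr // ltW.
Qed.

Lemma C1c_radial_scale (phi : R -> R) (s b : R) : Ck 1 setT phi -> (forall t, b <= t -> phi t = 0) ->
  0 < s -> C1c (fun z : E => phi (s * sqn z)).
Proof.
move=> cp h s0; apply: (@C1c_radial (fun t => phi (s * t)) (b / s)) => [|t].
  apply: (Ck_comp1 openT _ cp); apply: (Ck_scale openT).
  by apply: (Ck_is_derive (f' := fun=> 1)) => //; exact: Ck_cst.
by rewrite ler_pdivrMr // mulrC; exact: h.
Qed.

Lemma lint_radial_ge (phi : R -> R) (s b : R) : Ck 1 setT phi -> (forall t, b <= t -> phi t = 0) ->
  (forall t, 0 <= phi t) -> 0 < s -> (forall t, t <= s -> 1 <= phi t) ->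
  s ^+ n * ball_vol <= lint (fun z : E => phi (sqn z)).
Proof.
move=> cp h p0 s0 p1; rewrite (lint_radial_scale cp h s0); apply: ler_wpM2l; first by apply/exprn_ge0/ltW.
apply: lint_le => [||z]; first exact: ball_ind_adm.
  exact: C1c_adm (C1c_radial_scale cp h s0).
rewrite /ball_ind; case: (leP (sqn z) 1) => // z1; apply: p1.
by rewrite -[leRHS]mulr1 ler_pM2l.
Qed.

Lemma lint_radial_le (phi : R -> R) (s b : R) : Ck 1 setT phi -> (forall t, b <= t -> phi t = 0) ->
  (forall t, phi t <= 1) -> 0 < s -> (forall t, s < t -> phi t <= 0) ->
  lint (fun z : E => phi (sqn z)) <= s ^+ n * ball_vol.
Proof.
move=> cp h p0 s0 p1; rewrite (lint_radial_scale cp h s0); apply: ler_wpM2l; first by apply/exprn_ge0/ltW.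
apply: lint_le => [||z]; [exact: C1c_adm (C1c_radial_scale cp h s0)|exact: ball_ind_adm|].
rewrite /ball_ind; case: (leP (sqn z) 1) => // z1; apply: p1.
by rewrite -[ltLHS]mulr1 ltr_pM2l.
Qed.

Definition plateau (a b t : R) : R := 1 - st ((t - a) / (b - a)).

Lemma is_derive_plateau a b t :
  is_derive t (1 : R) (plateau a b) (- (st' ((t - a) / (b - a)) / (b - a))).
Proof.
have h : is_derive t (1 : R) (fun t => (t - a) / (b - a)) (b - a)^-1.
  apply: eps_is_derive => e e0; exists 1 => // h _.
  have -> : (t + h - a) / (b - a) - (t - a) / (b - a) - h * (b - a)^-1 = 0 by ring.
  by rewrite normr0 mulr_ge0 // ltW.
have := is_derive_1sub (@is_derive1_comp R st (fun t => (t - a) / (b - a)) t _ _ (is_derive_st _) h).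
exact.
Qed.

Lemma Ck_affine k (a b : R) : Ck k setT (fun t : R => (t - a) / (b - a)).
Proof.
case: k => [|k].
  move=> x _; apply: cvgM; last exact: cvg_cst.
  by apply: cvgB; [exact: cvg_id|exact: cvg_cst].
apply: (Ck_is_derive (f' := fun=> (b - a)^-1)); last exact: Ck_cst.
move=> t; apply: eps_is_derive => e e0; exists 1 => // h _.
have -> : (t + h - a) / (b - a) - (t - a) / (b - a) - h * (b - a)^-1 = 0 by ring.
by rewrite normr0 mulr_ge0 // ltW.
Qed.

Lemma Ck_plateau a b : Ck 2 setT (plateau a b).
Proof.
apply: (Ck_minus openT); first exact: Ck_cst.
by apply: (Ck_comp1 openT _ Ck_st); exact: Ck_affine.
Qed.

Lemma plateau1 a b t : a < b -> t <= a -> plateau a b t = 1.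
Proof.
by move=> ab ta; rewrite /plateau st0 ?subr0 // pmulr_lle0 ?invr_gt0 ?subr_gt0 // subr_le0.
Qed.
Lemma plateau0 a b t : a < b -> b <= t -> plateau a b t = 0.
Proof.
move=> ab ta; rewrite /plateau st1 ?subrr // ler_pdivlMr ?subr_gt0 // mul1r.
by rewrite lerD2r.
Qed.
Lemma plateau_ge0 a b t : 0 <= plateau a b t.
Proof. by rewrite /plateau subr_ge0 st_le1. Qed.
Lemma plateau_le1 a b t : plateau a b t <= 1.
Proof. by rewrite /plateau gerBl st_ge0. Qed.

(** Here a and b are squared radii, whence the exponent n instead of 2n. *)
Lemma plateau_vol a b : 0 < a -> a < b ->
  a ^+ n * ball_vol <= lint (fun z : E => plateau a b (sqn z)) <= b ^+ n * ball_vol.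
Proof.
move=> a0 ab; have c := CkW (Ck_plateau a b).
have h t : b <= t -> plateau a b t = 0 by exact: plateau0.
rewrite (lint_radial_ge c h) // ?(lint_radial_le c h) //=; [..|move=> t ta].
- exact: plateau_le1.
- exact: lt_trans ab.
- by move=> t bt; rewrite h // ltW.
- exact: plateau_ge0.
- by rewrite plateau1.
Qed.

Lemma ball_vol_gt0 : 0 < ball_vol.
Proof.
(* On the unit cube |x|^2 <= 2n < s, so that the plateau is 1 there. *)
pose s : R := n.*2%:R + 1; have s0 : 0 < s by rewrite ltr_wpDl.
have s1 : s < s + 1 by rewrite ltrDl.
have /andP[_ h] := plateau_vol s0 s1.
have s2 : 0 < (s + 1) ^+ n by rewrite exprn_gt0 // ltr_wpDl // ltW.
rewrite -(pmulr_rgt0 _ s2); apply: lt_le_trans h.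
apply: lt_le_trans ltr01 _; apply: lint_unit_cube => [|x|x x1].
- by apply: C1c_adm; apply: C1c_radial (CkW (Ck_plateau s (s + 1))) _ => t; exact: plateau0.
- exact: plateau_ge0.
rewrite plateau1 //; apply: (@le_trans _ _ (\sum_(j < n) 2)).
  apply: ler_sum => j _; rewrite /csq -[2]/(1 + 1); apply: lerD; rewrite expr_le1 //;
    by have /andP[] := x1 j 0; have /andP[] := x1 j 1.
by rewrite sumr_const card_ord -mulrnA mul2n /s lerDl.
Qed.

End RadialVolume.

(** * Geometry of the reduction *)

Lemma open_Ck_lt (R : realType) (V : normedModType R) k (f g : V -> R) :
  Ck k setT f -> Ck k setT g -> open [set x | f x < g x].
Proof.
move=> cf cg; have cd : Ck 0 setT (fun x => g x - f x).
  by apply: (Ck_minus openT); [exact: Ck_le cg|exact: Ck_le cf].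
have -> : [set x | f x < g x] = (fun x => g x - f x) @^-1` [set t | 0 < t].
  by apply/seteqP; split=> x /=; rewrite subr_gt0.
by apply: open_comp => [x _|]; [exact: cd|exact: open_gt].
Qed.

Lemma closed_Ck_le (R : realType) (V : normedModType R) k (f g : V -> R) :
  Ck k setT f -> Ck k setT g -> closed [set x | f x <= g x].
Proof.
move=> cf cg; have -> : [set x | f x <= g x] = ~` [set x | g x < f x].
  by apply/seteqP; split=> x /=; rewrite leNgt => /negP.
exact/open_closedC/open_Ck_lt/cf.
Qed.

(** Closes the estimates made with a cutoff of width x: the error is a continuous function of x and
    is evaluated at x = 0. *)
Lemma le_at_right0 (R : realType) (c d : R) (err : R -> R) : {for 0, continuous err} ->
  0 < d -> (forall x, 0 < x < d -> c <= err x) -> c <= err 0.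
Proof.
move=> ce d0 h; apply/ler_addgt0Pr => e e0.
have /nbhs_ballP[r /= r0 rP] : \forall x \near 0, `|err 0 - err x| < e.
  by have /cvgrPdist_lt := ce; apply.
pose x := Num.min r d / 2; have m0 : 0 < Num.min r d by rewrite lt_min r0.
have x0 : 0 < x by rewrite divr_gt0.
have xm : x < Num.min r d by rewrite ltr_pdivrMr // ltr_pMr // ltr1n.
move: xm; rewrite lt_min => /andP[xr xd].
apply: (le_trans (h x _)); first by rewrite x0.
have : `|err 0 - err x| < e by apply: rP; rewrite /ball /= sub0r normrN gtr0_norm.
by rewrite ltr_norml => /andP[h1 h2]; lra.
Qed.

Section ProductSpace.
Context {R : realType} {n : nat}.
Local Notation Q := 'M[R]_(1 + n, 2).
Local Notation E := 'M[R]_(n, 2).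
Implicit Types (q : Q) (z u v : E).

Lemma usubmx_lin : lin_fun (usubmx : Q -> 'M[R]_(1, 2)).
Proof. by move=> a u v; apply/matrixP => i j; rewrite !mxE. Qed.
Lemma dsubmx_lin : lin_fun (dsubmx : Q -> E).
Proof. by move=> a u v; apply/matrixP => i j; rewrite !mxE. Qed.

Definition in_y z : Q := col_mx 0 z.
Definition in_w (w : 'M[R]_(1, 2)) : Q := col_mx w 0.
Definition Uw : Q := in_w (delta_mx 0 0).
Definition Vw : Q := in_w (delta_mx 0 1).

Lemma in_y_lin : lin_fun in_y.
Proof. by move=> a u v; rewrite /in_y scale_col_mx add_col_mx scaler0 add0r. Qed.
Lemma in_w_lin : lin_fun in_w.
Proof. by move=> a u v; rewrite /in_w scale_col_mx add_col_mx scaler0 add0r. Qed.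

Lemma w_split (w : 'M[R]_(1, 2)) : w = w 0 0 *: delta_mx 0 0 + w 0 1 *: delta_mx 0 1.
Proof. by apply: mxP2 => k; rewrite (ord1 k) !mxE !eqxx /= !mulr1 !mulr0 addr0 add0r. Qed.

Lemma q_split q : q = in_w (usubmx q) + in_y (dsubmx q).
Proof. by rewrite -{1}[q]vsubmxK /in_w /in_y add_col_mx addr0 add0r. Qed.

Definition epsX (i : 'I_(1 + n)) : R := if fintype.split i is inl _ then -1 else 1.
(** Turns z alone. The difference of the generators of [epsZ] and [epsX] is the rotation of w, which
    links the values of a one-form on gauge orbits with its winding around w = 0. *)
Definition epsZ (i : 'I_(1 + n)) : R := if fintype.split i is inl _ then 0 else 1.

Lemma splitl_ k : fintype.split (lshift n k : 'I_(1 + n)) = inl k.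
Proof. exact: (unsplitK (inl k)). Qed.
Lemma splitr_ k : fintype.split (rshift 1 k : 'I_(1 + n)) = inr k.
Proof. exact: (unsplitK (inr k)). Qed.

Lemma rot_genX q : rot_gen epsX q = in_y (Jmx (dsubmx q)) - in_w (Jmx (usubmx q)).
Proof.
rewrite /in_y /in_w opp_col_mx add_col_mx oppr0 addr0 add0r.
apply: mxP2 => k; case: (split_ordP k) => i ->; rewrite ?col_mxEu ?col_mxEd !mxE /epsX ?splitl_ ?splitr_ /=.
  by split; ring.
by split; ring.
Qed.

Lemma rot_genZ q : rot_gen epsZ q = in_y (Jmx (dsubmx q)).
Proof.
apply: mxP2 => k; case: (split_ordP k) => i ->; rewrite ?col_mxEu ?col_mxEd !mxE /epsZ ?splitl_ ?splitr_ /=.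
  by split; ring.
by split; ring.
Qed.

Lemma perX i : cos (2 * pi * epsX i) = 1 /\ sin (2 * pi * epsX i) = 0.
Proof.
have h : cos (2 * pi * 1 : R) = 1 /\ sin (2 * pi * 1 : R) = 0.
  by rewrite mulr1 mulr_natl cos2pi sin2pi.
rewrite /epsX; case: (fintype.split i) => _ //.
by rewrite mulrN cosN sinN h.1 h.2 oppr0.
Qed.

Lemma perZ i : cos (2 * pi * epsZ i) = 1 /\ sin (2 * pi * epsZ i) = 0.
Proof.
rewrite /epsZ; case: (fintype.split i) => _; first by rewrite mulr0 cos0 sin0.
by rewrite mulr1 mulr_natl cos2pi sin2pi.
Qed.

Lemma csq_rot_by (eps : 'I_(1 + n) -> R) s q k : csq (rot_by eps s q) k = csq q k.
Proof.
rewrite /csq !mxE /=; set c := cos _; set s' := sin _.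
by have := cos2Dsin2 (2 * pi * eps k * s); rewrite -/c -/s' => cs; rewrite -[RHS]mul1r -cs; ring.
Qed.

Definition sqw q := sqn (usubmx q).
Definition sqy q := sqn (dsubmx q).

Lemma sqw_rot eps s q : sqw (rot_by eps s q) = sqw q.
Proof.
by apply: eq_bigr => k _; have := csq_rot_by eps s q (lshift n k); rewrite /csq !mxE /= => ->.
Qed.
Lemma sqy_rot eps s q : sqy (rot_by eps s q) = sqy q.
Proof.
by apply: eq_bigr => k _; have := csq_rot_by eps s q (rshift 1 k); rewrite /csq !mxE /= => ->.
Qed.

Lemma Ck_entry k A i j (L : Q -> 'M[R]_(i, j)) a b : lin_fun L -> Ck k A (fun q => L q a b).
Proof. by move=> lL; apply: Ck_lin_fun => c u v; rewrite lL !mxE. Qed.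

Lemma Ck_sqw k : Ck k setT sqw.
Proof. by apply: (Ck_sqn openT) => i j; apply: Ck_entry; exact: usubmx_lin. Qed.
Lemma Ck_sqy k : Ck k setT sqy.
Proof. by apply: (Ck_sqn openT) => i j; apply: Ck_entry; exact: dsubmx_lin. Qed.

(** An open set of a vector space instead of the level set |z|^2 - |w|^2 = 1: stretching z is one
    more direction along which everything is invariant, and derivatives can be taken on constant
    vectors. *)
Definition Qdom : set Q := [set q | 0 < sqy q].
Definition wre q : R := usubmx q 0 0.

Lemma open_Qdom : open Qdom.
Proof. exact: open_Ck_lt (Ck_cst 0 setT 0) (Ck_sqy 0). Qed.

Lemma wre_lin : lin_fun wre.
Proof. by move=> a u v; rewrite /wre usubmx_lin !mxE. Qed.

Lemma open_wre a : open [set q | a < wre q].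
Proof. exact: (open_Ck_lt (f := fun=> a) (Ck_cst 0 setT a) (Ck_lin_fun 0 setT wre_lin)). Qed.

Lemma open_sqw a : open [set q | sqw q < a].
Proof. exact: open_Ck_lt (Ck_sqw 0) (Ck_cst 0 setT a). Qed.

Lemma compact_Q (r e a : R) : 0 <= r -> compact [set q : Q | [/\ `|q| <= r, e <= sqy q & sqw q <= a]].
Proof.
move=> r0; have -> : [set q : Q | [/\ `|q| <= r, e <= sqy q & sqw q <= a]] =
    [set q : Q | `|q| <= r] `&` ([set q | e <= sqy q] `&` [set q | sqw q <= a]).
  by apply/seteqP; split=> q /= => [[]|[? []]].
apply: compact_closedI; first exact: compact_norm_ball.
apply: closedI; first exact: closed_Ck_le (Ck_cst 0 setT e) (Ck_sqy 0).
exact: closed_Ck_le (Ck_sqw 0) (Ck_cst 0 setT a).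
Qed.

Lemma norm_col (w : 'M[R]_(1, 2)) z (r : R) : 0 <= r -> `|w| <= r -> `|z| <= r -> `|col_mx w z| <= r.
Proof.
move=> r0 hw hz; apply/mx_norm_leP => // k j; case: (split_ordP k) => i ->.
  by rewrite col_mxEu (le_trans (mx_coord_le _ _ _)).
by rewrite col_mxEd (le_trans (mx_coord_le _ _ _)).
Qed.

(** Section of the quotient over |z| > 1: the representative on the level set with w real and
    positive. Its differential [diota] has a pole at |z| = 1, where w = 0. *)
Definition iota z : Q := col_mx (cut_wr z *: delta_mx 0 0) z.
Definition diota z v : Q := (dot z v / cut_wr z) *: Uw + in_y v.

Lemma iota_y z : dsubmx (iota z) = z. Proof. exact: col_mxKd. Qed.
Lemma iota_w z : usubmx (iota z) = cut_wr z *: delta_mx 0 0. Proof. exact: col_mxKu. Qed.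
Lemma iota_wre z : wre (iota z) = cut_wr z.
Proof. by rewrite /wre iota_w !mxE !eqxx mulr1. Qed.
Lemma iota_sqy z : sqy (iota z) = sqn z. Proof. by rewrite /sqy iota_y. Qed.
Lemma iota_sqw z : 1 <= sqn z -> sqw (iota z) = sqn z - 1.
Proof.
move=> z1; rewrite /sqw iota_w /sqn big_ord1 /csq !mxE !eqxx /= mulr1 mulr0 expr0n addr0.
by rewrite sqr_sqrtr // subr_ge0.
Qed.

Lemma cut_wr_gt0 z : 1 < sqn z -> 0 < cut_wr z.
Proof. by move=> z1; rewrite sqrtr_gt0 subr_gt0. Qed.

Lemma rot_genX_iota z : rot_gen epsX (iota z) = in_y (Jmx z) - cut_wr z *: Vw.
Proof.
rewrite rot_genX iota_y iota_w; congr (_ - _).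
rewrite (lin_funZ Jmx_lin) (lin_funZ in_w_lin); congr (_ *: in_w _).
by apply: mxP2 => k; rewrite (ord1 k) !mxE !eqxx /=; split; ring.
Qed.

Lemma diota_lin z : lin_fun (diota z).
Proof.
move=> a u v; rewrite /diota dot_lin in_y_lin scaleRE mulrDl scalerDl scalerDr addrACA.
by congr (_ + _ + _); rewrite scalerA mulrA.
Qed.

Lemma cut_wr_derive z v : 1 < sqn z ->
  differentiable (@cut_wr R n) z /\ 'D_v (@cut_wr R n) z = dot z v / cut_wr z.
Proof.
move=> z1; have s0 : 0 < sqn z - 1 by rewrite subr_gt0.
have dp : is_derive (sqn z) (1 : R) (fun t => Num.sqrt (t - 1)) (2 * cut_wr z)^-1.
  have h : is_derive (sqn z) (1 : R) (fun t : R => t - 1) 1.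
    have := is_deriveB (is_derive_id (sqn z) (1 : R)) (is_derive_cst (1 : R) (sqn z) (1 : R)).
    by rewrite subr0.
  have := @is_derive1_comp R Num.sqrt (fun t => t - 1) (sqn z) _ _ (is_derive1_sqrt s0) h.
  by rewrite mulr1.
split; last by rewrite (derive_radial v dp) invfM; field; rewrite gt_eqF // cut_wr_gt0.
have [d _] := derive_sqn z v.
exact: (differentiable_comp d (is_derive_diff dp).1).
Qed.

Lemma open_out a : open [set z : E | a < sqn z].
Proof.
apply: (open_Ck_lt (Ck_cst 0 setT a)); apply: (Ck_sqn openT) => i j; exact: Ck_id_coord.
Qed.
Lemma open_in a : open [set z : E | sqn z < a].
Proof.
apply: (open_Ck_lt _ (Ck_cst 0 setT a)); apply: (Ck_sqn openT) => i j; exact: Ck_id_coord.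
Qed.

Let Mout : set E := [set z | 1 < sqn z].
Let oM : open Mout. Proof. exact: open_out. Qed.

Lemma Ck_cut_wr k : Ck k Mout (@cut_wr R n).
Proof.
apply: Ck_sqrt; [exact: open_out|by move=> z; rewrite subr_gt0|].
apply: (Ck_minus oM); last exact: Ck_cst.
by apply: (Ck_sqn oM) => i j; apply: Ck_sub (Ck_id_coord _ _ _).
Qed.

Lemma Ck_iota k i j : Ck k Mout (fun z => iota z i j).
Proof.
case: (split_ordP i) => a ->.
  under eq_fun do rewrite col_mxEu mxE.
  by apply: (Ck_mul oM); [exact: Ck_cut_wr|exact: Ck_cst].
under eq_fun do rewrite col_mxEd.
by apply: Ck_sub (Ck_id_coord _ _ _).
Qed.

Lemma iota_derive z v : 1 < sqn z -> differentiable iota z /\ 'D_v iota z = diota z v.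
Proof.
move=> z1; have d i j : differentiable (fun y => iota y i j) z by exact: Ck_diff (Ck_iota 1 i j) z1.
split; first exact: differentiable_mx.
rewrite derive_mxE //; apply/matrixP => i j; rewrite mxE.
case: (split_ordP i) => a ->.
  under eq_fun do rewrite col_mxEu mxE mulrC.
  have [dw Dw] := cut_wr_derive v z1.
  rewrite -[fun y => _]/(((delta_mx 0 0 : 'M[R]_(1, 2)) a j) \*: (@cut_wr R n)).
  rewrite deriveZ; last exact: diff_derivable.
  have -> : diota z v (lshift n a) j = dot z v / cut_wr z * (delta_mx 0 0 : 'M[R]_(1, 2)) a j.
    by rewrite /diota /Uw /in_w /in_y scale_col_mx add_col_mx col_mxEu addr0 mxE.
  by rewrite [RHS]mulrC -Dw.
under eq_fun do rewrite col_mxEd.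
have lc : lin_fun (fun y : E => y a j) by move=> c x y; rewrite !mxE.
have [_ ->] := lin_fun_diff z lc.
by rewrite /diota /Uw /in_w /in_y scale_col_mx add_col_mx col_mxEd scaler0 add0r.
Qed.

Lemma derive_iota (F : Q -> R) z v : differentiable F (iota z) -> 1 < sqn z ->
  'D_v (fun z => F (iota z)) z = 'D_(diota z v) F (iota z).
Proof.
by move=> dF z1; have [d D] := iota_derive v z1; rewrite (derive_compE v d dF) D.
Qed.

Lemma Ck_comp_iota k (F : Q -> R) (A : set Q) (B : set E) : open B -> B `<=` Mout ->
  (forall z, B z -> A (iota z)) -> Ck k A F -> Ck k B (fun z => F (iota z)).
Proof.
move=> oB BM BA cF; apply: (Ck_comp oB _ cF BA) => i j.
exact: Ck_sub (Ck_iota k i j).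
Qed.

End ProductSpace.

Lemma derive_near0 (R : realType) (V : normedModType R) (A : set V) (f : V -> R) x v :
  open A -> A x -> (forall y, A y -> f y = 0) -> 'D_v f x = 0.
Proof.
move=> oA Ax f0; rewrite -(derive_cst (V := V) (0 : R) x v); apply: near_eq_derive.
by apply: (open_near_eq oA) => // y /[!inE] Ay; rewrite f0.
Qed.

Section FormAlgebra.
Context {R : realType} {m : nat}.
Local Notation E := 'M[R]_(m, 2).
Implicit Types (A : set E) (b : E -> E -> R).

Lemma dformC b q u v : dform b q u v = - dform b q v u.
Proof. by rewrite /dform opprB. Qed.

Lemma dform_lin k A b q u : form1 k.+1 A b -> open A -> A q -> lin_fun (dform b q u).
Proof.
move=> [lb cb] oA Aq a v w; rewrite /dform scaleRE.
have dv x : differentiable (b^~ x) q by exact: Ck_diff (cb x) Aq.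
have -> : 'D_u (b^~ (a *: v + w)) q = a * 'D_u (b^~ v) q + 'D_u (b^~ w) q.
  transitivity ('D_u (a \*: (b^~ v) + (b^~ w)) q).
    apply: near_eq_derive; apply: (open_near_eq oA) => // y /[!inE] Ay.
    by rewrite lb.
  rewrite deriveD; [|by apply: derivableZ; exact: diff_derivable|exact: diff_derivable].
  by rewrite deriveZ //; exact: diff_derivable.
rewrite (derive_lin_fun (dv u)) scaleRE; ring.
Qed.

Lemma dform_near0 A b q u v : open A -> A q -> (forall q, A q -> forall v, b q v = 0) ->
  dform b q u v = 0.
Proof.
move=> oA Aq b0; have h w x : 'D_w (b^~ x) q = 0 by apply: (derive_near0 w oA Aq) => y Ay; exact: b0.
by rewrite /dform !h subrr.
Qed.

Lemma dform_Ck k A b u v : open A -> form1 k.+1 A b -> Ck k A (fun q => dform b q u v).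
Proof. by move=> oA [_ cb]; apply: Ck_minus => //; exact: Ck_derive (cb _). Qed.

Lemma J_sum (z : E) : Jmx z = \sum_(k < m) (z k 0 *: delta_mx k 1 - z k 1 *: delta_mx k 0).
Proof.
apply/matrixP => i j; rewrite summxE (bigD1 i) //= big1 => [|k ki].
  rewrite addr0 !mxE eqxx /=; move: j; apply: ord2P => /=; ring.
by rewrite !mxE eq_sym (negPf ki) /= !mulr0 subr0.
Qed.

Lemma dot_e0 (z : E) k : dot z (delta_mx k 0) = z k 0.
Proof.
rewrite /dot (bigD1 k) //= big1 => [|i ik]; first by rewrite !mxE eqxx /=; ring.
by rewrite !mxE (negPf ik) /= !mulr0 addr0.
Qed.
Lemma dot_e1 (z : E) k : dot z (delta_mx k 1) = z k 1.
Proof.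
rewrite /dot (bigD1 k) //= big1 => [|i ik]; first by rewrite !mxE eqxx /=; ring.
by rewrite !mxE (negPf ik) /= !mulr0 addr0.
Qed.

End FormAlgebra.

(** * Stokes on the complement of the unit ball *)

Section TraceOnLevel.
Context {R : realType} {n : nat}.
Local Notation Q := 'M[R]_(1 + n, 2).
Local Notation E := 'M[R]_(n, 2).
Implicit Types (q : Q) (z : E) (eta : Q -> Q -> Q -> R).

(** For a two-form with X in its kernel this is the symplectic trace of the pullback by [iota] (see
    [ytrace_iota]), that is, the density of its product with the (n-1)-st divided power of omega.
    Written on constant vectors it stays bounded up to |z| = 1, although [diota] does not. *)
Definition ytrace eta q : R :=
  \sum_(k < n) eta q (in_y (delta_mx k 0)) (in_y (delta_mx k 1)) + eta q Uw Vw.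

(** Extension by zero over the closed unit ball. The result jumps at the sphere, so it is only used
    as an admissible function and compared with smooth cutoffs. *)
Definition on_out (F : E -> R) z : R := if 1 < sqn z then F z else 0.

Lemma iota_far (l : R) z : 0 <= l -> 1 + l < `|z| -> 1 < sqn z /\ l < cut_wr z.
Proof.
move=> l0 hz; have h : 1 + l ^+ 2 < sqn z.
  apply: lt_le_trans (norm_sqn z); apply: (@le_lt_trans _ _ ((1 + l) ^+ 2)); first by nra.
  by rewrite ltrXn2r ?nnegrE // addr_ge0.
split; first by apply: le_lt_trans h; rewrite lerDl sqr_ge0.
rewrite -(ger0_norm l0) -sqrtr_sqr ltr_sqrt ?ltrBrDl //.
by have := sqr_ge0 l; lra.
Qed.

Lemma norm_iota (r : R) z : 0 <= r -> `|z| <= r -> cut_wr z <= r -> `|iota z : Q| <= r.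
Proof.
move=> r0 hz hw; apply: norm_col => //; rewrite normrZ mx_delta_norm mulr1.
by rewrite ger0_norm // sqrtr_ge0.
Qed.

Lemma norm_le_sqn (r : R) z : 0 <= r -> sqn z <= r ^+ 2 -> `|z| <= r.
Proof.
by move=> r0 h; rewrite -(@ler_pXn2r _ 2) ?nnegrE //; apply: le_trans (norm_sqn z) h.
Qed.

Variables (alpha : Q -> Q -> R) (l r c : R) (G : Q -> R).
Hypothesis fa : form1 1 Qdom alpha.
Hypothesis l0 : 0 <= l.
Hypothesis va : forall q, Qdom q -> l < wre q -> forall v : Q, alpha q v = 0.
Hypothesis iX : forall q, Qdom q -> 0 < wre q -> forall v, dform alpha q (rot_gen epsX q) v = 0.
Hypothesis r0 : 0 < r.
Hypothesis cG : Ck 1 (Qdom `&` [set q | sqw q < r]) G.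
Hypothesis aX : forall q, Qdom q -> sqw q < r ->
  alpha q (rot_gen epsX q) = c + 'D_(rot_gen epsX q) G q.

Let Mout : set E := [set z | 1 < sqn z].
Let oM : open Mout. Proof. exact: open_out. Qed.
Let oQ : open (Qdom : set Q). Proof. exact: open_Qdom. Qed.
Let la q : Qdom q -> lin_fun (alpha q). Proof. exact: fa.1. Qed.
Let QM z : 1 < sqn z -> Qdom (iota z : Q).
Proof. by move=> z1; rewrite /Qdom /= iota_sqy; exact: lt_trans z1. Qed.
Let da q (v : Q) : Qdom q -> differentiable (alpha^~ v) q.
Proof. by move=> Dq; exact: Ck_diff (fa.2 v) Dq. Qed.
Let lform q (u : Q) : Qdom q -> lin_fun (dform alpha q u). Proof. exact: dform_lin fa oQ. Qed.

Let pull z (v : E) := alpha (iota z) (diota z v).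

Let pullE z (v : E) : 1 < sqn z ->
  pull z v = dot v z * (cut_wr z)^-1 * alpha (iota z) Uw + alpha (iota z) (in_y v).
Proof.
by move=> z1; rewrite /pull /diota (la (QM z1)) scaleRE (dotC z).
Qed.

Let pull_lin z : 1 < sqn z -> lin_fun (pull z).
Proof. by move=> z1 a u v; rewrite /pull diota_lin (la (QM z1)). Qed.

Let Ck_alpha_iota v : Ck 1 Mout (fun z => alpha (iota z) v).
Proof. exact: (Ck_comp_iota oM (fun _ h => h) QM (fa.2 v)). Qed.

Let Ck_wV : Ck 1 Mout (fun z : E => (cut_wr z)^-1).
Proof. by apply: CkV => // [z z1|]; [rewrite gt_eqF // cut_wr_gt0|exact: Ck_cut_wr]. Qed.

Let Ck_pull (v : E) : Ck 1 Mout (pull^~ v).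
Proof.
apply: (Ck_ext oM _ (f := fun z => dot v z * (cut_wr z)^-1 * alpha (iota z) Uw + alpha (iota z) (in_y v))).
  by move=> z /[!inE] z1; exact: esym (pullE v z1).
apply: (Ck_add oM) (Ck_alpha_iota _); apply: (Ck_mul oM) (Ck_alpha_iota _).
exact: (Ck_mul oM (Ck_lin_fun _ _ (dot_lin v)) Ck_wV).
Qed.

Let derive_wV z (u : E) : 1 < sqn z -> differentiable (fun z : E => (cut_wr z)^-1) z /\
  'D_u (fun z : E => (cut_wr z)^-1) z = - (dot z u / cut_wr z ^+ 3).
Proof.
move=> z1; have w0 : cut_wr z != 0 by rewrite gt_eqF // cut_wr_gt0.
split; first exact: Ck_diff Ck_wV z1.
have [d D] := cut_wr_derive u z1.
rewrite (deriveV w0) ?scaleRE; last exact: diff_derivable.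
by rewrite D; field.
Qed.

Let derive_pull z (u v : E) : 1 < sqn z -> 'D_u (pull^~ v) z =
  (dot v u / cut_wr z - dot z v * (dot z u / cut_wr z ^+ 3)) * alpha (iota z) Uw +
  dot z v / cut_wr z * 'D_(diota z u) (alpha^~ Uw) (iota z) +
  'D_(diota z u) (alpha^~ (in_y v)) (iota z).
Proof.
move=> z1; have Dq := QM z1.
have -> : 'D_u (pull^~ v) z = 'D_u ((fun z => dot v z) * (fun z : E => (cut_wr z)^-1) *
    (fun z => alpha (iota z) Uw) + (fun z => alpha (iota z) (in_y v))) z.
  by apply: near_eq_derive; apply: (open_near_eq oM) => // y /[!inE] y1; rewrite pullE.
have d1 : differentiable (fun z => dot v z) z by have [] := lin_fun_diff z (dot_lin v).
have D1 : 'D_u (fun z => dot v z) z = dot v u by have [_ ->] := lin_fun_diff z (dot_lin v).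
have [d2 D2] := derive_wV u z1.
have d3 w : differentiable (fun z => alpha (iota z) w) z by exact: Ck_diff (Ck_alpha_iota w) z1.
have D3 w : 'D_u (fun z => alpha (iota z) w) z = 'D_(diota z u) (alpha^~ w) (iota z).
  by rewrite (derive_iota u (da w Dq) z1).
have d12 := differentiableM d1 d2.
have d123 := differentiableM d12 (d3 Uw).
rewrite deriveD; [|exact: diff_derivable|exact: diff_derivable].
rewrite deriveM; [|exact: diff_derivable|exact: diff_derivable].
rewrite deriveM; [|exact: diff_derivable|exact: diff_derivable].
rewrite !scaleRE !D3 D1 D2 (dotC v z); congr (_ + _).
rewrite -[(_ * _) z]/(dot v z * (cut_wr z)^-1) (dotC v z).
ring.
Qed.

Let dpull_alg (w s p q al e b b' c1 c1' c2 c2' : R) :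
  (s / w - q * (p / w ^+ 3)) * al + q / w * (p / w * e + b) + (p / w * c1 + c2) -
  ((s / w - p * (q / w ^+ 3)) * al + p / w * (q / w * e + b') + (q / w * c1' + c2')) =
  c2 - c2' + q / w * (b - c1') + p / w * (c1 - b').
Proof. ring. Qed.

(** The terms with the value of alpha on Uw carry the second derivative of [cut_wr]; they are
    symmetric in u and v and cancel. *)
Let dpull z (u v : E) : 1 < sqn z -> 'D_u (pull^~ v) z - 'D_v (pull^~ u) z =
  dform alpha (iota z) (in_y u) (in_y v) + dot z v / cut_wr z * dform alpha (iota z) (in_y u) Uw +
  dot z u / cut_wr z * dform alpha (iota z) Uw (in_y v).
Proof.
move=> z1; have Dq := QM z1; rewrite (derive_pull u v z1) (derive_pull v u z1).
have H w x : 'D_(diota z w) (alpha^~ x) (iota z) =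
    dot z w / cut_wr z * 'D_Uw (alpha^~ x) (iota z) + 'D_(in_y w) (alpha^~ x) (iota z).
  by rewrite /diota (derive_lin_fun (da x Dq)) scaleRE.
by rewrite !H /dform (dotC v u); exact: dpull_alg.
Qed.

Let dpull_trace_alg (w x y s t : R) : y / w * - s + x / w * t = w^-1 * (x * t - y * s).
Proof. ring. Qed.

(** Summed over k, the mixed terms give the form on (Uw, J z). As J z is X plus [cut_wr z] times Vw
    and X is in the kernel, this is the (Uw, Vw) part of the trace, with the pole cancelled. *)
Let dpull_trace z : 1 < sqn z ->
  \sum_(k < n) ('D_(delta_mx k 0) (pull^~ (delta_mx k 1)) z - 'D_(delta_mx k 1) (pull^~ (delta_mx k 0)) z) =
  ytrace (dform alpha) (iota z).
Proof.
move=> z1; have Dq := QM z1; have w0 : cut_wr z != 0 by rewrite gt_eqF // cut_wr_gt0.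
rewrite /ytrace; under eq_bigr do rewrite dpull // dot_e0 dot_e1 -addrA.
rewrite big_split /=; congr (_ + _).
transitivity ((cut_wr z)^-1 * dform alpha (iota z) Uw (in_y (Jmx z))).
  rewrite J_sum (lin_fun_sum in_y_lin) (lin_fun_sum (lform _ Dq)) mulr_sumr; apply: eq_bigr => k _.
  rewrite (lin_funB in_y_lin) !(lin_funZ in_y_lin) (lin_funB (lform _ Dq)) !(lin_funZ (lform _ Dq)).
  by rewrite !scaleRE (dformC _ _ (in_y _) Uw); exact: dpull_trace_alg.
have -> : in_y (Jmx z) = rot_gen epsX (iota z) + cut_wr z *: Vw by rewrite rot_genX_iota subrK.
rewrite (lin_funD (lform _ Dq)) (lin_funZ (lform _ Dq)) scaleRE.
rewrite (dformC _ _ Uw (rot_gen _ _)) iX ?iota_wre ?cut_wr_gt0 //.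
by rewrite oppr0 add0r mulKf.
Qed.

Let Ck_ytrace : Ck 0 Qdom (ytrace (dform alpha)).
Proof.
apply: (Ck_add oQ); last exact: (dform_Ck _ _ oQ fa).
by apply: (Ck_fsum _ oQ) => k _; exact: (dform_Ck _ _ oQ fa).
Qed.

Let dform_far q u v : Qdom q -> l < wre q -> dform alpha q u v = 0.
Proof.
move=> Dq lq; apply: (@dform_near0 _ _ (Qdom `&` [set q | l < wre q])) => //.
  by apply: openI => //; exact: open_wre.
by move=> y [Dy ly] w; exact: va.
Qed.

Let ytrace_far z : 1 < sqn z -> l < cut_wr z -> ytrace (dform alpha) (iota z) = 0.
Proof.
move=> z1 lz; have H u v : dform alpha (iota z) u v = 0.
  by apply: dform_far; [exact: QM|rewrite iota_wre].
by rewrite /ytrace H addr0 big1.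
Qed.

Let ytrace_bound : exists2 B : R, 0 < B & forall z, 1 < sqn z -> `|ytrace (dform alpha) (iota z)| <= B.
Proof.
have K := @compact_Q R n (1 + l) 1 (l ^+ 2) (addr_ge0 ler01 l0).
have [|B B0 BP] := C0_bounded K (f := ytrace (dform alpha)).
  by apply: Ck_sub Ck_ytrace => q [_ h _]; apply: lt_le_trans h.
exists B => // z z1; have [lz|zl] := ltP l (cut_wr z).
  by rewrite ytrace_far // normr0 ltW.
apply: BP; split.
- apply: norm_iota; first by rewrite addr_ge0.
    by rewrite leNgt; apply/negP => /(iota_far l0) [_]; rewrite ltNge zl.
  by apply: le_trans zl _; rewrite lerDr.
- by rewrite iota_sqy ltW.
- have z1' : 0 <= sqn z - 1 by rewrite subr_ge0 ltW.
  rewrite /= (iota_sqw (ltW z1)) -[sqn z - 1]sqr_sqrtr //.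
  by apply: lerXn2r => //; rewrite nnegrE // sqrtr_ge0.
Qed.

Lemma on_out_ytrace_adm : adm (on_out (fun z => ytrace (dform alpha) (iota z))).
Proof.
have [B B0 BP] := ytrace_bound; split.
  exists B => z; rewrite /on_out; case: ifP => [/BP//|_]; by rewrite normr0 ltW.
exists (1 + l) => z /(iota_far l0) [z1 zl]; rewrite /on_out z1; exact: ytrace_far.
Qed.

(** * The boundary layer 1 + d < |z|^2 < 1 + 2d *)

Section Cutoff.
Variable d : R.
Hypothesis d0 : 0 < d.
Hypothesis dr : 4 * d < r.
Let a : R := 1 + d.
Let b : R := 1 + 2 * d.
Let ab : a < b. Proof. by have := d0; rewrite /a /b; have := dr; have := d0; lra. Qed.
Let a1 : 1 < a. Proof. by rewrite /a ltrDl. Qed.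
Let pl (t : R) := plateau a b t.
Let kap (t : R) := 1 - pl t.
Let kap' (t : R) := st' ((t - a) / (b - a)) / (b - a).

Let d_kap t : is_derive t (1 : R) kap (kap' t).
Proof. by have := is_derive_1sub (is_derive_plateau a b t); rewrite opprK. Qed.

Let kap_lo t : t <= a -> kap t = 0. Proof. by move=> h; rewrite /kap /pl (plateau1 ab h) subrr. Qed.
Let kap'_lo t : t <= a -> kap' t = 0.
Proof.
move=> h; rewrite /kap' st'_0 ?mul0r // pmulr_lle0 ?subr_le0 //.
by rewrite invr_gt0 subr_gt0; exact: ab.
Qed.
Let kap'_hi t : b <= t -> kap' t = 0.
Proof.
move=> h; rewrite /kap' st'_1 ?mul0r // ler_pdivlMr ?mul1r ?lerD2r //.
by rewrite subr_gt0; exact: ab.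
Qed.
Let kap'_ge0 t : 0 <= kap' t. Proof. by rewrite /kap' divr_ge0 ?st'_ge0 // subr_ge0; exact/ltW/ab. Qed.
Let kap01 t : 0 <= kap t <= 1.
Proof. by rewrite /kap /pl subr_ge0 plateau_le1 gerBl plateau_ge0. Qed.

Let Ck_kap' : Ck 1 setT kap'.
Proof.
have h : Ck 1 setT (fun t => (b - a)^-1 * st' ((t - a) / (b - a))).
  by apply: (Ck_scale openT); apply: (Ck_comp1 openT _ Ck_st'); exact: Ck_affine.
by apply: Ck_ext h => [|t _]; [exact: openT|rewrite /kap' mulrC].
Qed.
Let Ck_kap : Ck 1 setT kap.
Proof. by apply: (Ck_minus openT); [exact: Ck_cst|exact: CkW (Ck_plateau a b)]. Qed.

Let inner : set E := [set z | sqn z < a].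
Let oI : open inner. Proof. exact: open_in. Qed.
Let MI : Mout `|` inner = setT.
Proof.
apply/seteqP; split=> // z _; have [h|h] := ltP 1 (sqn z); first by left.
by right; exact: le_lt_trans a1.
Qed.

Let bform (v : E) z := kap (sqn z) * pull z v.

Let bform_in z (v : E) : sqn z < a -> bform v z = 0.
Proof. by move=> h; rewrite /bform kap_lo ?mul0r // ltW. Qed.

Let C1c_bform (v : E) : C1c (bform v).
Proof.
split; last first.
  exists (1 + l) => z /(iota_far l0)[z1 zl].
  by rewrite /bform /pull va ?mulr0 ?iota_wre //; exact: QM.
rewrite -MI; apply: Ck_union.
  by apply: (Ck_mul oM) (Ck_pull v); apply: Ck_sub (Ck_radial Ck_kap).
apply: (Ck_ext oI _ (f := cst 0)); last exact: Ck_cst.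
by move=> z /[!inE] h; rewrite bform_in.
Qed.

Let derive_bform z (u v : E) : 1 < sqn z -> 'D_u (bform v) z =
  kap (sqn z) * 'D_u (pull^~ v) z + kap' (sqn z) * (2 * dot z u) * pull z v.
Proof.
move=> z1; rewrite /bform -[fun z => _]/((fun z : E => kap (sqn z)) * (pull^~ v)).
have dk : differentiable (fun z : E => kap (sqn z)) z.
  exact: (Ck_diff (Ck_radial Ck_kap) (I : setT z)).
have dP := Ck_diff (Ck_pull v) z1.
rewrite deriveM; [|exact: diff_derivable|exact: diff_derivable].
by rewrite (derive_radial u (d_kap (sqn z))); congr (_ + _); exact: mulrC.
Qed.

(** The left-hand side is a sum of derivatives of compactly supported functions, hence has integral
    zero. On the right, the second term is the boundary contribution: alpha on the Hopf direction J
    z, weighted by the layer. *)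
Let bform_trace z :
  \sum_(k < n) ('D_(delta_mx k 0) (bform (delta_mx k 1)) z - 'D_(delta_mx k 1) (bform (delta_mx k 0)) z) =
  kap (sqn z) * ytrace (dform alpha) (iota z) + 2 * (kap' (sqn z) * alpha (iota z) (in_y (Jmx z))).
Proof.
have [z1|z1] := ltP 1 (sqn z); last first.
  have za : sqn z < a by exact: le_lt_trans a1.
  rewrite kap_lo ?kap'_lo ?mul0r ?mulr0 ?addr0 1?ltW // big1 // => k _.
  have H u v : 'D_u (bform v) z = 0 by apply: (derive_near0 u oI) => // y; exact: bform_in.
  by rewrite !H subrr.
have -> : alpha (iota z) (in_y (Jmx z)) = pull z (Jmx z).
  by rewrite pullE // dotC dotJ mul0r mul0r add0r.
rewrite -dpull_trace // J_sum (lin_fun_sum (pull_lin z1)) !mulr_sumr -big_split.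
apply: eq_bigr => k _; rewrite /= (lin_funB (pull_lin z1)) !(lin_funZ (pull_lin z1)) !derive_bform //.
by rewrite dot_e0 dot_e1 !scaleRE; ring.
Qed.

Let kapF z := kap (sqn z) * ytrace (dform alpha) (iota z).
Let kapJ z := kap' (sqn z) * alpha (iota z) (in_y (Jmx z)).
Let kapS z := kap' (sqn z).

Let kapF_adm : adm kapF.
Proof.
have -> : kapF = fun z => kap (sqn z) * on_out (fun z => ytrace (dform alpha) (iota z)) z.
  apply/funext => z; rewrite /kapF /on_out; case: ltP => // z1.
  by rewrite kap_lo ?mul0r ?mulr0 //; apply: le_trans z1 (ltW a1).
apply: admMl on_out_ytrace_adm; exists 1 => z.
by have /andP[h1 h2] := kap01 (sqn z); rewrite ger0_norm.
Qed.

Let C1c_kapS : C1c kapS.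
Proof. exact: C1c_radial Ck_kap' kap'_hi. Qed.

Let Mr : set E := [set z | 1 < sqn z /\ sqn z < 1 + r].
Let oMr : open Mr. Proof. by apply: openI; [exact: open_out|exact: open_in]. Qed.
Let MrQ z : Mr z -> (Qdom `&` [set q | sqw q < r]) (iota z : Q).
Proof.
by move=> [z1 zr]; split; [exact: QM|rewrite /= iota_sqw 1?ltW // ltrBlDl].
Qed.

Let kapS_supp z : kapS z != 0 -> a < sqn z < b.
Proof.
apply: contraNT; rewrite /kapS negb_and -!leNgt => /orP[h|h].
  by rewrite kap'_lo.
by rewrite kap'_hi.
Qed.

Let kapS_Mr z : kapS z != 0 -> Mr z.
Proof.
move=> /kapS_supp/andP[h1 h2]; split; first exact: lt_trans a1 h1.
by apply: lt_trans h2 _; rewrite /b; have := dr; have := d0; lra.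
Qed.

Let kapG z := kapS z * G (iota z).

Let Ck_Gi : Ck 1 Mr (fun z => G (iota z)).
Proof. by apply: Ck_comp_iota cG => // z []. Qed.

Let outer : set E := [set z | b < sqn z].
Let oO : open outer. Proof. exact: open_out. Qed.

Let C1c_kapG : C1c kapG.
Proof.
split; last first.
  have [_ [s hs]] := C1c_kapS; exists s => z /hs; rewrite /kapG => ->; exact: mul0r.
have -> : setT = Mr `|` (inner `|` outer).
  apply/seteqP; split=> // z _; have [h|h] := ltP (sqn z) a; first by right; left.
  have [h'|h'] := ltP b (sqn z); first by right; right.
  by left; split; [exact: lt_le_trans a1 h|apply: le_lt_trans h' _; rewrite /b; have := dr; have := d0; lra].
apply: Ck_union.
  by apply: (Ck_mul oMr) Ck_Gi; apply: Ck_sub C1c_kapS.1.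
apply: (Ck_ext _ (f := cst 0)); [exact: openU| |exact: Ck_cst].
move=> z /[!inE] h; rewrite /kapG /kapS /=.
by case: h => h; [rewrite kap'_lo ?mul0r // ltW|rewrite kap'_hi ?mul0r // ltW].
Qed.

Let lint_kapG : lint (fun z => 'D_(Jmx z) kapG z) = 0.
Proof. by rewrite (lint_lin_field Jmx_lin C1c_kapG) ltrace_J mul0r oppr0. Qed.

(** The discrepancy between J z and X in the layer; it enters only multiplied by [cut_wr z], which
    is at most sqrt(2d) there. *)
Let err_J z := alpha (iota z) Vw - 'D_Vw G (iota z).

Let derive_kapG z : 'D_(Jmx z) kapG z =
  kapS z * ('D_(rot_gen epsX (iota z)) G (iota z) + cut_wr z * 'D_Vw G (iota z)).
Proof.
have [z1|z1] := ltP (sqn z) a.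
  rewrite [kapS z]kap'_lo ?mul0r 1?ltW //.
  by apply: (derive_near0 _ oI) => // y ya; rewrite /kapG /kapS kap'_lo ?mul0r // ltW.
have [z2|z2] := ltP b (sqn z).
  rewrite [kapS z]kap'_hi ?mul0r 1?ltW //.
  by apply: (derive_near0 _ oO) => // y ya; rewrite /kapG /kapS kap'_hi ?mul0r // ltW.
have zM : Mr z.
  by split; [exact: lt_le_trans a1 z1|apply: le_lt_trans z2 _; rewrite /b; have := dr; have := d0; lra].
have dGi := Ck_diff Ck_Gi zM; have dS := C1c_diff z C1c_kapS.
rewrite -[kapG]/(kapS * (fun z => G (iota z))).
rewrite deriveM; [|exact: diff_derivable|exact: diff_derivable].
have dk1 : differentiable kap' (sqn z) := Ck_diff Ck_kap' (I : setT (sqn z)).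
have dk := DeriveDef (diff_derivable (v := (1 : R)) dk1) erefl.
rewrite [X in _ + _ *: X](derive_radial (Jmx z) dk) dotJ !mulr0 scaler0 addr0.
have dG : differentiable G (iota z) by exact: Ck_diff cG (MrQ zM).
rewrite (derive_iota _ dG zM.1); congr (_ * _).
rewrite /diota dotJ mul0r scale0r add0r.
have -> : in_y (Jmx z) = rot_gen epsX (iota z) + cut_wr z *: Vw by rewrite rot_genX_iota subrK.
by rewrite (lin_funD (derive_lin_fun dG)) (lin_funZ (derive_lin_fun dG)) scaleRE.
Qed.

Let kapJ_alg (e x s w al g : R) : s * (e + x + w * al) = e * s + s * (x + w * g) + s * (w * (al - g)).
Proof. ring. Qed.

(** J z is X plus a small multiple of Vw; on X the gauge hypothesis gives c plus the derivative of
    G, which is up to the same small multiple the derivative of [kapG] along J z, of integral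
    zero. *)
Let kapJE z : kapJ z = c * kapS z + 'D_(Jmx z) kapG z + kapS z * (cut_wr z * err_J z).
Proof.
rewrite derive_kapG /kapJ; have [/kapS_Mr zM|/negP] := boolP (kapS z != 0); last first.
  by move=> /negP/negPn/eqP k0; rewrite -/(kapS z) k0 !mul0r mulr0 !addr0.
have [Dq wq] := MrQ zM.
have -> : in_y (Jmx z) = rot_gen epsX (iota z) + cut_wr z *: Vw by rewrite rot_genX_iota subrK.
rewrite (lin_funD (la Dq)) (lin_funZ (la Dq)) scaleRE (aX Dq wq); exact: kapJ_alg.
Qed.

Let v1 : R := @ball_vol R n.
Let v1_gt0 : 0 < v1. Proof. exact: ball_vol_gt0. Qed.

(** The divergence theorem for the field z turns the integral of |z|^2 kap' into n times that of the
    plateau, and in the layer |z|^2 differs from 1 by at most 2d. *)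
Let kapS_vol : n%:R * v1 * (1 - 2 * d) <= lint kapS <= n%:R * v1 * b ^+ n.
Proof.
have cpl := C1c_radial (n := n) (CkW (Ck_plateau a b)) (fun t h => plateau0 ab h).
have csk : C1c (fun z : E => sqn z * kapS z).
  by apply: (C1cM _ C1c_kapS); apply: (Ck_sqn openT) => i j; exact: Ck_id_coord.
have h1 : lint (fun z : E => sqn z * kapS z) = n%:R * lint (fun z : E => pl (sqn z)).
  have lid : lin_fun (id : E -> E) by [].
  have tid : ltrace (id : E -> E) = 2 * n%:R.
    rewrite /ltrace (eq_bigr (fun=> 1)) => [|i _]; last by rewrite mxE !eqxx.
    by rewrite sumr_const card_prod !card_ord natrM mulrC.
  have := lint_lin_field lid cpl; rewrite tid.
  have -> : (fun z : E => 'D_z (fun z => plateau a b (sqn z)) z) = fun z => (- 2) * (sqn z * kapS z).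
    apply/funext => z; rewrite (derive_radial _ (is_derive_plateau a b (sqn z))) dotzz /kapS /kap'; ring.
  rewrite lintZ; last exact: C1c_adm.
  rewrite /pl; lra.
have /andP[w1 w2] := @plateau_vol R n _ _ (lt_trans ltr01 a1) ab.
have an : 1 <= a ^+ n by rewrite exprn_ege1 // ltW // a1.
have n0 : 0 <= n%:R :> R by [].
have L1 : lint (fun z : E => (1 - 2 * d) * (sqn z * kapS z)) <= lint kapS.
  apply: lint_le => [||z]; [by apply: admZ; exact: C1c_adm|exact: C1c_adm|].
  have [/kapS_supp/andP[h2 h3]|/negPn/eqP ->] := boolP (kapS z != 0); last by rewrite !mulr0.
  rewrite mulrA ler_piMl ?kap'_ge0 //; have := d0; move: h2 h3; rewrite /a /b => h2 h3 h4; nra.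
have L2 : lint kapS <= lint (fun z : E => sqn z * kapS z).
  apply: lint_le => [||z]; [exact: C1c_adm|exact: C1c_adm|].
  have [/kapS_supp/andP[h2 h3]|/negPn/eqP ->] := boolP (kapS z != 0); last by rewrite !mulr0.
  by rewrite ler_peMl ?kap'_ge0 // ltW // (lt_trans a1).
rewrite lintZ in L1; last exact: C1c_adm.
rewrite h1 in L1 L2; apply/andP; split.
  have [h|h] := leP 0 (1 - 2 * d).
    apply: le_trans L1; rewrite mulrC; apply: ler_wpM2l => //; apply: ler_wpM2l => //.
    by apply: le_trans w1; rewrite ler_peMl // ltW // v1_gt0.
  apply: (@le_trans _ _ 0); first by rewrite nmulr_lle0 // mulr_ge0 // ltW // v1_gt0.
  by apply: lint_ge0 => [|z]; [exact: C1c_adm|exact: kap'_ge0].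
by apply: le_trans L2 _; rewrite -mulrA [v1 * _]mulrC; exact: ler_wpM2l.
Qed.

Let kapF_lint : lint kapF + 2 * lint kapJ = 0.
Proof.
have aJ : adm kapJ.
  have H k : adm (fun z => 'D_(delta_mx k 0) (bform (delta_mx k 1)) z - 'D_(delta_mx k 1) (bform (delta_mx k 0)) z).
    by apply: admB; apply: C0c_adm; apply: C1c_derive; exact: C1c_bform.
  have := admZ 2^-1 (admB (adm_sum (index_enum _) xpredT H) kapF_adm).
  congr adm; apply/funext => z; rewrite bform_trace /kapF -/(kapJ z); by field.
rewrite -(lintZ _ aJ) -(lintD kapF_adm (admZ _ aJ)).
have -> : (fun z => kapF z + 2 * kapJ z) =
    fun z => \sum_(k < n) ('D_(delta_mx k 0) (bform (delta_mx k 1)) z - 'D_(delta_mx k 1) (bform (delta_mx k 0)) z).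
  by apply/funext => z; rewrite bform_trace.
have aD u (v : E) : adm (fun z => 'D_u (bform v) z).
  by apply: C0c_adm; apply: C1c_derive; exact: C1c_bform.
rewrite lint_sum => [|k]; last exact: admB.
by apply: big1 => k _; rewrite lintB // !lint_derive ?subrr //; exact: C1c_bform.
Qed.

Let kapJ_lint (B : R) : 0 <= B -> (forall z, 1 < sqn z -> sqn z < b -> `|err_J z| <= B) ->
  `|lint kapJ - c * lint kapS| <= Num.sqrt (2 * d) * B * lint kapS.
Proof.
move=> B0 hB; have aS := C1c_adm C1c_kapS.
have aG : adm (fun z => 'D_(Jmx z) kapG z).
  apply: C0c_adm; split; last by have [_ [s hs]] := C1c_kapG; exists s => z; exact: supp_in_derive.
  by apply: Ck_derive_field => //; [exact: openT|exact: C1c_kapG.1|move=> i j; apply: Ck_lin_fun => x y w; rewrite Jmx_lin !mxE].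
have bE z : `|kapS z * (cut_wr z * err_J z)| <= Num.sqrt (2 * d) * B * kapS z.
  have [k0|/negPn/eqP ->] := boolP (kapS z != 0); last by rewrite mul0r mulr0 normr0.
  have /andP[h1 h2] := kapS_supp k0.
  rewrite normrM mulrC (ger0_norm (kap'_ge0 _)); apply: ler_wpM2r; first exact: kap'_ge0.
  rewrite normrM; apply: ler_pM => //; last by apply: hB => //; exact: lt_trans a1 h1.
  rewrite ger0_norm ?sqrtr_ge0 // ler_wsqrtr //.
  by move: h2; rewrite /b; have := d0; lra.
have aE : adm (fun z => kapS z * (cut_wr z * err_J z)).
  have [[M hM] [s hs]] := aS; split.
    exists (Num.sqrt (2 * d) * B * M) => z; apply: le_trans (bE z) _.
    rewrite ler_wpM2l ?mulr_ge0 ?sqrtr_ge0 //.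
    by apply: le_trans (ler_norm _) (hM z).
  by exists s => z /hs ->; rewrite mul0r.
have -> : kapJ = fun z => c * kapS z + 'D_(Jmx z) kapG z + kapS z * (cut_wr z * err_J z).
  by apply/funext => z; exact: kapJE.
rewrite lintD // ?lintD // ?lint_kapG ?addr0 ?lintZ //; last by apply: admD => //; exact: admZ.
  rewrite addrAC subrr add0r -lintZ //; apply: lint_norm_le => //; exact: admZ.
exact: admZ.
Qed.

Lemma trace_cutoff (B B' : R) : 0 <= B -> 0 <= B' -> d < 1 ->
  (forall z, 1 < sqn z -> `|ytrace (dform alpha) (iota z)| <= B) ->
  (forall z, 1 < sqn z -> sqn z < b -> `|err_J z| <= B') ->
  `|lint (on_out (fun z => ytrace (dform alpha) (iota z))) - (- (2 * n%:R * c * v1))| <=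
  B * (v1 * ((1 + 3 * d) ^+ n - (1 - d) ^+ n)) +
  2 * (`|c| * (n%:R * v1 * (b ^+ n - (1 - 2 * d))) + Num.sqrt (2 * d) * B' * (n%:R * v1 * b ^+ n)).
Proof.
move=> B0 B'0 d1 hB hB'; have aT := on_out_ytrace_adm.
set T := on_out _; have bb : b < 1 + 3 * d by rewrite /b; have := d0; lra.
have b0 : 0 < b by rewrite /b; have := d0; lra.
have dd : 0 < 1 - d by rewrite subr_gt0.
have dd1 : 1 - d < 1 by have := d0; lra.
pose p1 (z : E) := plateau b (1 + 3 * d) (sqn z); pose p2 (z : E) := plateau (1 - d) 1 (sqn z).
have cp1 : C1c p1 := C1c_radial (CkW (Ck_plateau b (1 + 3 * d))) (fun t h => plateau0 bb h).
have cp2 : C1c p2 := C1c_radial (CkW (Ck_plateau (1 - d) 1)) (fun t h => plateau0 dd1 h).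
have /andP[_ w1] := @plateau_vol R n _ _ b0 bb; have /andP[w2 _] := @plateau_vol R n _ _ dd dd1.
have E1 : `|lint T - lint kapF| <= B * (v1 * ((1 + 3 * d) ^+ n - (1 - d) ^+ n)).
  rewrite -lintB; [|exact: aT|exact: kapF_adm].
  apply: (@le_trans _ _ (lint (fun z => B * (p1 z - p2 z)))); last first.
    rewrite lintZ; last by apply: admB; exact: C1c_adm.
    rewrite lintB; try exact: C1c_adm.
    by apply: ler_wpM2l => //; rewrite mulrBr lerB // mulrC.
  apply: lint_norm_le => [||z].
  - by apply: admB; [exact: aT|exact: kapF_adm].
  - by apply: admZ; apply: admB; exact: C1c_adm.
  have p1_01 := conj (plateau_ge0 b (1 + 3 * d) (sqn z)) (plateau_le1 b (1 + 3 * d) (sqn z)).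
  have p2_01 := conj (plateau_ge0 (1 - d) 1 (sqn z)) (plateau_le1 (1 - d) 1 (sqn z)).
  rewrite /T /on_out; case: ltP => z1; last first.
    rewrite /kapF kap_lo ?mul0r ?subrr ?normr0; last by apply: le_trans z1 (ltW a1).
    rewrite mulr_ge0 // subr_ge0 /p1 plateau1 //; first exact: p2_01.2.
    by apply: le_trans z1 _; rewrite /b lerDl mulr_ge0 // ltW // d0.
  rewrite /p2 (plateau0 dd1 (ltW z1)) subr0.
  have H : `|ytrace (dform alpha) (iota z) - kapF z| =
      `|1 - kap (sqn z)| * `|ytrace (dform alpha) (iota z)|.
    by rewrite -normrM [in RHS]mulrBl mul1r.
  rewrite H mulrC; apply: ler_pM => //; first exact: hB.
  have /andP[k0 k1] := kap01 (sqn z).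
  rewrite ger0_norm ?subr_ge0 //; have [zb|bz] := leP (sqn z) b.
    by rewrite /p1 plateau1 // gerBl.
  rewrite /kap /pl plateau0 ?subr0 ?subrr; [exact: p1_01.1|exact: ab|exact: ltW].
have /andP[s1 s2] := kapS_vol.
have E2 := kapJ_lint B'0 hB'.
have E3 : `|c * lint kapS - c * (n%:R * v1)| <= `|c| * (n%:R * v1 * (b ^+ n - (1 - 2 * d))).
  rewrite -mulrBr normrM; apply: ler_wpM2l => //.
  have n0 : 0 <= n%:R * v1 by rewrite mulr_ge0 // ltW // v1_gt0.
  have b1 : 1 <= b ^+ n by rewrite exprn_ege1 // ltW // (lt_trans a1).
  have h3 : n%:R * v1 <= n%:R * v1 * b ^+ n by rewrite ler_peMr.
  have h4 : n%:R * v1 * (1 - 2 * d) <= n%:R * v1.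
    by rewrite ler_piMr // gerBl mulr_ge0 // ltW // d0.
  rewrite ler_norml mulrBr; apply/andP; split; lra.
have E4 : Num.sqrt (2 * d) * B' * lint kapS <= Num.sqrt (2 * d) * B' * (n%:R * v1 * b ^+ n).
  by rewrite ler_wpM2l ?mulr_ge0 ?sqrtr_ge0.
have E5 : lint T - - (2 * n%:R * c * v1) = (lint T - lint kapF) -
    2 * ((lint kapJ - c * lint kapS) + (c * lint kapS - c * (n%:R * v1))).
  by have := kapF_lint; lra.
rewrite E5; apply: le_trans (ler_normB _ _) _; apply: lerD => //.
rewrite normrM ger0_norm // ler_pM2l // addrC; apply: le_trans (ler_normD _ _) _.
apply: lerD => //; exact: le_trans E4.
Qed.

End Cutoff.

(** The sphere |z| = 1 is the only boundary, because alpha vanishes for large Re w. There alpha is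
    integrated over Hopf circles, on which alpha(X) has mean c; the factor 2n times the ball volume
    is the mass of the layer in the limit d -> 0. *)
Lemma trace_level : lint (on_out (fun z => ytrace (dform alpha) (iota z))) =
  - (2 * n%:R * c * @ball_vol R n).
Proof.
have [B B0 hB] := ytrace_bound.
have r2 : 0 < r / 2 by rewrite divr_gt0.
have K := @compact_Q R n (1 + r) 1 (r / 2) (addr_ge0 ler01 (ltW r0)).
have [|B' B'0 hB'] := C0_bounded K (f := fun q => alpha q Vw - 'D_Vw G q).
  have oQr : open (Qdom `&` [set q : Q | sqw q < r]) by apply: openI => //; exact: open_sqw.
  apply: (@Ck_sub _ _ _ (Qdom `&` [set q : Q | sqw q < r])) => [q [_ h1 h2]|].
    by split; [exact: lt_le_trans h1|apply: le_lt_trans h2 _; rewrite ltr_pdivrMr // ltr_pMr // ltr1n].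
  apply: (Ck_minus oQr); last exact: Ck_derive cG.
  by apply: Ck_sub (CkW (fa.2 Vw)) => q [].
set X := LHS; set Y := RHS.
(* The bound of [trace_cutoff] as a function of the width d: continuous and zero at d = 0. *)
pose err (d : R) := B * (@ball_vol R n * ((1 + 3 * d) ^+ n - (1 - d) ^+ n)) +
  2 * (`|c| * (n%:R * @ball_vol R n * ((1 + 2 * d) ^+ n - (1 - 2 * d))) +
     Num.sqrt (2 * d) * B' * (n%:R * @ball_vol R n * (1 + 2 * d) ^+ n)).
have cE : {for 0, continuous err}.
  have cx (x : R) : {for 0, continuous (fun d : R => x * d)}.
    by apply: cvgM; [exact: cvg_cst|exact: cvg_id].
  have cs : {for 0, continuous (fun d : R => Num.sqrt (2 * d))}.
    apply: (@continuous_comp R R R (fun d => 2 * d) Num.sqrt 0); first exact: cx.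
    exact: sqrt_continuous.
  have cp (x : R) k : {for 0, continuous (fun d : R => (1 + x * d) ^+ k)}.
    apply: (@continuous_comp _ _ _ (fun d => 1 + x * d) (fun y => y ^+ k)).
      by apply: cvgD; [exact: cvg_cst|exact: cx].
    exact: exprn_continuous.
  apply: cvgD.
    apply: cvgM; first exact: cvg_cst.
    apply: cvgM; first exact: cvg_cst.
    apply: cvgB; first exact: cp.
    have := cp (- 1) n.
    by rewrite (_ : (fun d : R => (1 + -1 * d) ^+ n) = fun d => (1 - d) ^+ n) //; apply/funext => d; rewrite mulN1r.
  apply: cvgM; first exact: cvg_cst.
  apply: cvgD.
    apply: cvgM; first exact: cvg_cst.
    apply: cvgM; first exact: cvg_cst.
    apply: cvgB; first exact: cp.
    by apply: cvgB; [exact: cvg_cst|exact: cx].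
  apply: cvgM; last by apply: cvgM; [exact: cvg_cst|exact: cp].
  apply: cvgM; last exact: cvg_cst.
  exact: cs.
have d0 : 0 < Num.min 1 (r / 4) by rewrite lt_min ltr01 divr_gt0.
have := @le_at_right0 R `|X - Y| _ err cE d0.
have -> : err 0 = 0 by rewrite /err !mulr0 sqrtr0 !mul0r !addr0 !subr0 !expr1n !subrr ?mulr0 ?mul0r ?mulr0 ?addr0 ?mulr0.
move=> H; apply/eqP; rewrite -subr_eq0 -normr_le0; apply: H => d /andP[d1].
rewrite lt_min => /andP[d2 d3]; apply: trace_cutoff => //; [|exact: ltW|exact: ltW|].
  by rewrite mulrC -ltr_pdivlMr.
move=> z z1 zb; apply: hB'.
have z2 : sqn z - 1 < r / 2.
  by move: d3; rewrite ltr_pdivlMr // => d3; rewrite ltrBlDr; apply: lt_trans zb _; lra.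
split.
- have h : sqn z <= (1 + r) ^+ 2 by have := r0; nra.
  apply: norm_iota; [by rewrite addr_ge0 // ltW|apply: norm_le_sqn => //; by rewrite addr_ge0 // ltW|].
  have hr : 0 <= 1 + r by rewrite addr_ge0 // ltW.
  rewrite -(ger0_norm hr) -sqrtr_sqr; apply: ler_wsqrtr.
  by apply: le_trans h; rewrite gerBl.
- by rewrite iota_sqy ltW.
- by rewrite /= iota_sqw 1?ltW.
Qed.

End TraceOnLevel.

(** * Primitives *)

Section Constancy.
Context {R : realType} {n : nat}.
Local Notation Q := 'M[R]_(1 + n, 2).
Local Notation E := 'M[R]_(n, 2).
Implicit Types (q : Q) (y : E).

Lemma sqnD (u v : 'M[R]_(n, 2)) : sqn (u + v) = sqn u + 2 * dot u v + sqn v.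
Proof.
rewrite /sqn /dot mulr_sumr -!big_split; apply: eq_bigr => k _ /=.
by rewrite /csq !mxE; ring.
Qed.

Lemma sqn_J (y : E) : sqn (Jmx y) = sqn y.
Proof. by rewrite sqn_crot // expr0n expr1n add0r. Qed.

Lemma dotZl a (u v : E) : dot (a *: u) v = a * dot u v.
Proof. by rewrite dotC (lin_funZ (dot_lin v)) scaleRE dotC. Qed.
Lemma dotZr a (u v : E) : dot u (a *: v) = a * dot u v.
Proof. by rewrite (lin_funZ (dot_lin u)). Qed.

Lemma sqn_segment_gt0 (u v : E) (t : R) : 0 <= t <= 1 -> 0 < sqn u -> 0 < sqn v -> 0 <= dot u v ->
  0 < sqn (u + t *: (v - u)).
Proof.
move=> /andP[t0 t1] u0 v0 uv.
have -> : u + t *: (v - u) = (1 - t) *: u + t *: v.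
  by rewrite scalerBr scalerBl scale1r [t *: v - _]addrC addrA.
rewrite sqnD !sqnZ dotZl dotZr.
have [->|tn0] := eqVneq t 0; first by rewrite subr0 expr1n mul1r mul0r !mulr0 expr0n mul0r !addr0.
have t10 : 0 <= 1 - t by rewrite subr_ge0.
rewrite ltr_wpDl //; last by rewrite mulr_gt0 // exprn_gt0 // lt_def tn0.
by rewrite addr_ge0 ?mulr_ge0 ?sqr_ge0 // ltW.
Qed.

Lemma sqw_segment (r t : R) q (w : 'M[R]_(1, 2)) : 0 <= t <= 1 -> sqw q < r -> sqn w < r ->
  sqw (q + t *: in_w (w - usubmx q)) < r.
Proof.
move=> /andP[t0 t1] qr wr; rewrite /sqw (lin_funD usubmx_lin) (lin_funZ usubmx_lin) col_mxKu.
move: qr wr; rewrite /sqw /sqn !big_ord1 /csq.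
have e j : (usubmx q + t *: (w - usubmx q)) 0 j = usubmx q 0 j + t * (w 0 j - usubmx q 0 j).
  by rewrite !mxE.
rewrite !e.
set a := usubmx q 0 0; set b := usubmx q 0 1; set c := w 0 0; set d := w 0 1 => h1 h2.
have -> : (a + t * (c - a)) ^+ 2 + (b + t * (d - b)) ^+ 2 =
  (1 - t) * (a ^+ 2 + b ^+ 2) + t * (c ^+ 2 + d ^+ 2) - t * (1 - t) * ((a - c) ^+ 2 + (b - d) ^+ 2) by ring.
have h3 : 0 <= t * (1 - t) * ((a - c) ^+ 2 + (b - d) ^+ 2).
  by rewrite mulr_ge0 ?mulr_ge0 ?subr_ge0 ?addr_ge0 ?sqr_ge0.
move: h1 h2; set A := a ^+ 2 + b ^+ 2; set B := c ^+ 2 + d ^+ 2 => h1 h2.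
have hM : Num.max A B < r by rewrite gt_max h1.
have hA : (1 - t) * A <= (1 - t) * Num.max A B by rewrite ler_wpM2l ?subr_ge0 // le_max lexx.
have hB : t * B <= t * Num.max A B by rewrite ler_wpM2l // le_max lexx orbT.
lra.
Qed.

(** The tube is convex in w. In z a segment avoids 0 as soon as its ends have nonnegative scalar
    product. *)
Lemma const_on_tube (r : R) (F : Q -> R) q q' :
  (forall q, Qdom q -> sqw q < r -> differentiable F q) ->
  (forall q v, Qdom q -> sqw q < r -> 'D_v F q = 0) ->
  Qdom q -> sqw q < r -> Qdom q' -> sqw q' < r -> F q = F q'.
Proof.
move=> dF DF Dq qr Dq' qr'.
have seg_y q1 y : Qdom q1 -> sqw q1 < r -> 0 < sqn y -> 0 <= dot (dsubmx q1) y ->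
    F (in_w (usubmx q1) + in_y y) = F q1.
  move=> D1 r1 y0 dy; have -> : in_w (usubmx q1) + in_y y = q1 + in_y (y - dsubmx q1).
    by rewrite {2}[q1]q_split -addrA -(lin_funD in_y_lin) addrCA subrr addr0.
  have D t : 0 <= t <= 1 -> Qdom (q1 + t *: in_y (y - dsubmx q1)) /\ sqw (q1 + t *: in_y (y - dsubmx q1)) < r.
    move=> t01; split.
      rewrite /Qdom /= /sqy (lin_funD dsubmx_lin) (lin_funZ dsubmx_lin) col_mxKd.
      exact: sqn_segment_gt0.
    by rewrite /sqw (lin_funD usubmx_lin) (lin_funZ usubmx_lin) col_mxKu scaler0 addr0.
  by apply: const_on_segment => t /D[h1 h2]; [exact: dF|exact: DF].
pose y := dsubmx q; pose y' := dsubmx q'.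
have Fw : F q = F (in_w (usubmx q') + in_y y).
  have -> : in_w (usubmx q') + in_y y = q + in_w (usubmx q' - usubmx q).
    rewrite (lin_funB in_w_lin) addrCA; congr (_ + _).
    by apply/eqP; rewrite eq_sym subr_eq addrC -q_split.
  apply/esym/const_on_segment => t t01; [apply: dF|apply: DF]; try exact: sqw_segment.
    by rewrite /Qdom /= /sqy (lin_funD dsubmx_lin) (lin_funZ dsubmx_lin) col_mxKd scaler0 addr0.
  by rewrite /Qdom /= /sqy (lin_funD dsubmx_lin) (lin_funZ dsubmx_lin) col_mxKd scaler0 addr0.
pose q1 (z : E) : Q := in_w (usubmx q') + in_y z.
have q1w z : usubmx (q1 z) = usubmx q'.
  by rewrite (lin_funD usubmx_lin) /in_w /in_y !col_mxKu addr0.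
have q1y z : dsubmx (q1 z) = z.
  by rewrite (lin_funD dsubmx_lin) /in_w /in_y !col_mxKd add0r.
have step (z z' : E) : 0 < sqn z -> 0 < sqn z' -> 0 <= dot z z' -> F (q1 z') = F (q1 z).
  move=> z0 z'0 zz; rewrite -[in RHS](@seg_y (q1 z) z') ?q1w //.
  - by rewrite /Qdom /= /sqy q1y.
  - by rewrite /sqw q1w.
  - by rewrite q1y.
have -> : F q' = F (q1 y') by rewrite /q1 -q_split.
rewrite Fw -/(q1 y); have [h|h] := leP 0 (dot y y'); first by rewrite (step y y').
(* Otherwise the path goes through J y or - J y, which is orthogonal to y and on the side of y'. *)
pose s : R := if 0 <= dot (Jmx y) y' then 1 else -1.
have s2 : s ^+ 2 = 1 by rewrite /s; case: ifP; rewrite ?sqrrN expr1n.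
have J0 : 0 < sqn (s *: Jmx y) by rewrite sqnZ s2 mul1r sqn_J.
rewrite -(step y (s *: Jmx y)) // ?dotZr ?dotJ ?mulr0 // (step (s *: Jmx y) y') // dotZl /s.
by case: (leP 0 (dot (Jmx y) y')); rewrite ?mul1r // mulN1r oppr_ge0 => /ltW.
Qed.

End Constancy.

(** * Primitives by integration along Re w *)

Section Primitive.
Context {R : realType} {n : nat}.
Local Notation Q := 'M[R]_(1 + n, 2).
Implicit Types (q v : Q) (F : Q -> R) (eta : Q -> Q -> Q -> R).

Definition shiftU (L s : R) q : Q := q + (L * s) *: Uw.

Lemma shiftU_y L s q : dsubmx (shiftU L s q) = dsubmx q.
Proof. by rewrite /shiftU (lin_funD dsubmx_lin) (lin_funZ dsubmx_lin) col_mxKd scaler0 addr0. Qed.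

Lemma shiftU_dom L s q : Qdom q -> Qdom (shiftU L s q).
Proof. by rewrite /Qdom /= /sqy shiftU_y. Qed.

Lemma shiftU_wre L s q : wre (shiftU L s q) = wre q + L * s.
Proof. by rewrite /wre (lin_funD usubmx_lin) (lin_funZ usubmx_lin) col_mxKu !mxE !eqxx mulr1. Qed.

Definition wim q : R := usubmx q 0 1.

Lemma shiftU_wim L s q : wim (shiftU L s q) = wim q.
Proof. by rewrite /wim (lin_funD usubmx_lin) (lin_funZ usubmx_lin) col_mxKu !mxE mulr0 addr0. Qed.

Lemma sqwE q : sqw q = wre q ^+ 2 + wim q ^+ 2.
Proof. by rewrite /sqw /sqn big_ord1. Qed.

Lemma shiftU_affine L : affine_family (shiftU L) (fun _ => id) 1.
Proof.
split=> [s a u v //|s x h|s h _|x s].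
- by rewrite /shiftU addrAC.
- by rewrite mul1r.
apply: cvgD; first exact: cvg_cst.
apply: cvgZr_tmp; apply: cvgM; [exact: cvg_cst|exact: cvg_id].
Qed.

Let oQ : open (Qdom : set Q). Proof. exact: open_Qdom. Qed.
Let domS L s q : 0 <= s <= 1 -> Qdom q -> Qdom (shiftU L s q). Proof. by move=> _; exact: shiftU_dom. Qed.

(* Minus the integral of F from q in the direction of Re w; F vanishes at the
   other end. *)
Definition prim L F q : R := - L * int01 (fun s => 1 * F (shiftU L s q)).

Lemma Ck_prim k L F : Ck k Qdom F -> Ck k Qdom (prim L F).
Proof.
move=> cF; apply: (Ck_scale oQ).
exact: (Ck_int01 (shiftU_affine L) oQ oQ (domS L) cF (bounded01_cst 1)).
Qed.

Lemma derive_prim L F q v : Ck 1 Qdom F -> Qdom q -> 'D_v (prim L F) q = prim L (fun x => 'D_v F x) q.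
Proof.
move=> cF Dq.
have [d D] := derive_int01 (shiftU_affine L) oQ oQ (domS L) cF (bounded01_cst 1) Dq.
rewrite -[prim L F]/(- L \*: (fun x => int01 (fun s => 1 * F (shiftU L s x)))).
by rewrite deriveZ ?D //; exact: diff_derivable.
Qed.

Let bS L F q : Ck 0 Qdom F -> Qdom q -> bounded01 (fun s => F (shiftU L s q)).
Proof. by move=> cF Dq; exact: (bounded01_family (shiftU_affine L) (domS L) cF Dq). Qed.

Lemma prim_lin L a F G q : Ck 0 Qdom F -> Ck 0 Qdom G -> Qdom q ->
  prim L (fun x => a * F x + G x) q = a * prim L F q + prim L G q.
Proof.
move=> cF cG Dq; rewrite /prim.
under [in LHS]eq_fun do rewrite mul1r; under [X in a * (_ * int01 X)]eq_fun do rewrite mul1r.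
under [X in _ + _ * int01 X]eq_fun do rewrite mul1r.
rewrite int01D ?int01Z; [ring|exact: bS| |exact: bS].
by apply: bounded01M; [exact: bounded01_cst|exact: bS].
Qed.

Lemma eq_prim L F G q : (forall s, 0 <= s <= 1 -> F (shiftU L s q) = G (shiftU L s q)) ->
  prim L F q = prim L G q.
Proof. by move=> FG; rewrite /prim; congr (_ * _); apply: eq_int01 => s s01; rewrite FG. Qed.

Lemma prim_eq0 L F q : (forall s, 0 <= s <= 1 -> F (shiftU L s q) = 0) -> prim L F q = 0.
Proof.
move=> F0; rewrite /prim (eq_int01 (g := fun=> 0)) ?int01_cst ?mulr0 // => s s01.
by rewrite F0 ?mulr0.
Qed.

Lemma prim_deriveU L F q : Ck 1 Qdom F -> Qdom q ->
  prim L (fun x => 'D_Uw F x) q = F q - F (shiftU L 1 q).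
Proof.
move=> cF Dq.
pose h s := F (shiftU L s q).
have dh s : is_derive s (1 : R) h (L * 'D_Uw F (shiftU L s q)).
  have dF : differentiable F (q + s *: (L *: Uw)).
    apply: Ck_diff cF _; have := shiftU_dom L s Dq; by rewrite /shiftU scalerA mulrC.
  have := derive_along_line dF.
  have -> : (fun s0 : R => F (q + s0 *: (L *: Uw))) = h.
    by apply/funext => x; rewrite /h /shiftU scalerA mulrC.
  rewrite (lin_funZ (derive_lin_fun dF)) scaleRE.
  by have -> : q + s *: (L *: Uw) = shiftU L s q by rewrite /shiftU scalerA mulrC.
have ch : continuous (fun s => L * 'D_Uw F (shiftU L s q)).
  move=> s; apply: cvgM; first exact: cvg_cst.
  apply: (@continuous_comp _ _ _ (fun s => shiftU L s q) (fun x => 'D_Uw F x)).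
    exact: (af_cont (shiftU_affine L)).
  by apply: (Ck_derive Uw cF); exact: shiftU_dom.
have := int01_ftc_cont dh ch; rewrite int01Z; last by apply: (@bS L (fun x => 'D_Uw F x) q) => //; exact: Ck_derive.
have -> : h 0 = F q by rewrite /h /shiftU mulr0 scale0r addr0.
move=> H; rewrite /prim; under eq_fun do rewrite mul1r.
by rewrite mulNr H opprB.
Qed.

Definition form2 k A eta := [/\ forall u, form1 k A (fun q => eta q u),
  forall q u v, A q -> eta q u v = - eta q v u &
  forall q u v w, A q -> 'D_u (fun q => eta q v w) q + 'D_v (fun q => eta q w u) q +
     'D_w (fun q => eta q u v) q = 0].

(** The homotopy operator of the Poincare lemma for the translations along Uw. *)
Definition prim_form L eta q v : R := prim L (fun q => eta q Uw v) q.

Variables (eta : Q -> Q -> Q -> R) (l : R).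
Hypothesis f2 : form2 1 Qdom eta.
Hypothesis l0 : 0 < l.
Hypothesis eta0 : forall q u v, Qdom q -> l ^+ 2 < sqw q -> eta q u v = 0.
Hypothesis iX : forall q v, Qdom q -> eta q (rot_gen epsX q) v = 0.
Hypothesis n_gt0 : (0 < n)%N.

Let L : R := 6 * l.
Let beta := prim_form L eta.

Let ceta u v : Ck 1 Qdom (fun q => eta q u v). Proof. by have [h _ _] := f2; exact: (h u).2. Qed.

Lemma prim_form1 : form1 1 Qdom beta.
Proof.
have [h1 _ _] := f2; split=> [q Dq a u v|v]; last exact: Ck_prim.
rewrite /beta /prim_form scaleRE -prim_lin //; try exact: CkW.
by apply: eq_prim => s s01; rewrite (h1 _).1 //; exact: shiftU_dom.
Qed.

Lemma prim_form_U q : Qdom q -> beta q Uw = 0.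
Proof.
move=> Dq; apply: prim_eq0 => s _; have [_ h _] := f2.
have := h _ Uw Uw (shiftU_dom L s Dq); set x := eta _ _ _ => H.
by apply/eqP; rewrite -[_ == 0](mulrn_eq0 x 2) mulr2n {1}H addNr.
Qed.

(** Closedness rewrites the antisymmetrized derivative under the integral as the derivative of eta u
    v along Uw; only the starting point contributes. *)
Lemma dprim_form q u v : Qdom q -> - (5 * l) < wre q -> dform beta q u v = eta q u v.
Proof.
move=> Dq wq; have [_ h2 h3] := f2.
have cD x w : Ck 0 Qdom (fun y => 'D_x (fun z => eta z Uw w) y) by exact: Ck_derive (ceta Uw w).
rewrite /dform /beta /prim_form !derive_prim //.
have -> : prim L (fun x => 'D_u (fun q0 => eta q0 Uw v) x) q - prim L (fun x => 'D_v (fun q0 => eta q0 Uw u) x) q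
   = prim L (fun x => 'D_Uw (fun q0 => eta q0 u v) x) q.
  rewrite [LHS]addrC -mulN1r -prim_lin //; apply: eq_prim => s _.
  have Ds := shiftU_dom L s Dq; have := h3 _ Uw u v Ds.
  have -> : 'D_u (fun q0 => eta q0 v Uw) (shiftU L s q) = - 'D_u (fun q0 => eta q0 Uw v) (shiftU L s q).
    rewrite -deriveN; last exact: diff_derivable (Ck_diff (ceta Uw v) Ds).
    by apply: near_eq_derive; apply: (open_near_eq oQ) => // y /[!inE] Dy; rewrite h2.
  by lra.
rewrite prim_deriveU // (eta0 u v (shiftU_dom L 1 Dq)) ?subr0 //.
rewrite sqwE shiftU_wre mulr1; have := sqr_ge0 (wim (shiftU L 1 q)); move: wq; rewrite /L => wq.
have h : l < wre q + 6 * l by lra.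
by have := l0; nra.
Qed.

Lemma prim_form_re q v : Qdom q -> l < wre q -> beta q v = 0.
Proof.
move=> Dq lq; apply: prim_eq0 => s /andP[s0 s1]; apply: eta0; first exact: shiftU_dom.
rewrite sqwE shiftU_wre; have := sqr_ge0 (wim (shiftU L s q)).
have h : 0 <= L * s by rewrite mulr_ge0 // /L mulr_ge0 // ltW.
by have := l0; nra.
Qed.

Lemma prim_form_im q v : Qdom q -> l < `|wim q| -> beta q v = 0.
Proof.
move=> Dq lq; apply: prim_eq0 => s _; apply: eta0; first exact: shiftU_dom.
rewrite sqwE shiftU_wim -[wim q ^+ 2]real_normK ?num_real //.
by have := sqr_ge0 (wre (shiftU L s q)); have := l0; nra.
Qed.

Let tube : set Q := Qdom `&` [set q | sqw q < (5 * l) ^+ 2].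
Let o_tube : open tube. Proof. by apply: openI; [exact: open_Qdom|exact: open_sqw]. Qed.

Lemma tube_wre q : sqw q < (5 * l) ^+ 2 -> - (5 * l) < wre q.
Proof.
rewrite sqwE => h; rewrite ltNge; apply/negP => h'.
by have := sqr_ge0 (wim q); have := l0; nra.
Qed.

Lemma prim_gauge : exists c : R, exists2 G : Q -> R, Ck 1 tube G &
  forall q, Qdom q -> sqw q < (5 * l) ^+ 2 ->
    beta q (rot_gen epsX q) = c + 'D_(rot_gen epsX q) G q.
Proof.
have rA s q : tube q -> tube (rot_by epsX s q).
  by move=> [h1 h2]; split; rewrite /Qdom /= ?sqy_rot ?sqw_rot.
have fb : form1 1 tube beta by apply: form1_sub prim_form1 => q [].
have hb q : tube q -> forall u, dform beta q (rot_gen epsX q) u = 0.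
  by move=> [Dq h] u; rewrite dprim_form ?iX //; exact: tube_wre.
pose P q := beta q (rot_gen epsX q).
have cP : Ck 1 tube P.
  apply: form1_field => // i j; apply: Ck_lin_fun => a u w; by rewrite rot_gen_lin !mxE.
pose q0 : Q := in_y (const_mx 1).
have q0t : tube q0.
  split.
    rewrite /Qdom /= /sqy col_mxKd; apply: sqn_gt0; apply/eqP => /matrixP/(_ (Ordinal n_gt0) 0).
    by rewrite !mxE => /eqP; rewrite oner_eq0.
  rewrite /= /sqw col_mxKu /sqn big_ord1 /csq !mxE expr0n addr0 exprn_gt0 // mulr_gt0 //.
exists (rot_avg epsX P q0), (rot_pot epsX P); first exact: (Ck_rot_pot o_tube rA).
move=> q Dq qr; have tq : tube q by [].
have -> : rot_avg epsX P q0 = rot_avg epsX P q; last exact: (rot_avg_decomp o_tube rA perX cP tq).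
apply: (const_on_tube _ _ q0t.1 q0t.2 Dq qr) => x.
  by move=> Dx xr; exact: Ck_diff (Ck_rot_avg o_tube rA cP) (conj Dx xr).
by move=> v Dx xr; exact: (rot_avg_const o_tube rA perX v fb hb (conj Dx xr)).
Qed.

Lemma trace_prim c (G : Q -> R) : Ck 1 tube G ->
  (forall q, Qdom q -> sqw q < (5 * l) ^+ 2 -> beta q (rot_gen epsX q) = c + 'D_(rot_gen epsX q) G q) ->
  lint (on_out (fun z => ytrace eta (iota z))) = - (2 * n%:R * c * @ball_vol R n).
Proof.
move=> cG aX; have r0 : 0 < (5 * l) ^+ 2 by rewrite exprn_gt0 // mulr_gt0.
have wpos q : 0 <= wre q -> - (5 * l) < wre q by have := l0; lra.
have vb q : Qdom q -> l < wre q -> forall v, beta q v = 0 by move=> Dq lq v; exact: prim_form_re.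
have ib q : Qdom q -> 0 < wre q -> forall v, dform beta q (rot_gen epsX q) v = 0.
  by move=> Dq wq v; rewrite dprim_form ?iX //; apply: wpos; exact: ltW.
rewrite -(trace_level prim_form1 (ltW l0) vb ib r0 cG aX).
congr lint; apply/funext => z; rewrite /on_out; case: ifP => // z1.
have Dz : Qdom (iota z : Q) by rewrite /Qdom /= iota_sqy (lt_trans ltr01).
have wz : - (5 * l) < wre (iota z : Q) by apply: wpos; rewrite iota_wre sqrtr_ge0.
by rewrite /ytrace dprim_form //; congr (_ + _); apply: eq_bigr => k _; rewrite dprim_form.
Qed.

(* moving q in the direction of Im w leads to a place where beta vanishes *)
Lemma prim_avg0 q : Qdom q -> l ^+ 2 < sqw q -> - (5 * l) < wre q ->
  rot_avg epsZ (fun q => beta q (rot_gen epsZ q)) q = 0.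
Proof.
pose A : set Q := Qdom `&` ([set q | l ^+ 2 < sqw q] `&` [set q | - (5 * l) < wre q]).
have oA : open A.
  apply: openI => //; apply: openI; last exact: open_wre.
  exact: open_Ck_lt (Ck_cst 0 setT (l ^+ 2)) (Ck_sqw 0).
have rZ s x : usubmx (rot_by epsZ s x) = usubmx x.
  apply: mxP2 => k; rewrite !mxE /= /epsZ splitl_ !mulr0 mul0r cos0 sin0; split; ring.
have rA s x : A x -> A (rot_by epsZ s x).
  by move=> [h1 [h2 h3]]; split; [rewrite /Qdom /= sqy_rot|split; rewrite /= ?sqw_rot // /wre rZ].
have fb : form1 1 A beta by apply: form1_sub prim_form1 => x [].
have hb x : A x -> forall u, dform beta x (rot_gen epsZ x) u = 0.
  by move=> [Dx [h1 h2]] u; rewrite dprim_form // eta0.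
move=> Dq lq wq; pose P x := beta x (rot_gen epsZ x).
have cP : Ck 1 A P.
  apply: form1_field => // i j; apply: Ck_lin_fun => a u w; by rewrite rot_gen_lin !mxE.
pose s : R := if 0 <= wim q then 1 else - 1.
pose h := ((l + 1) * s) *: (Vw : Q).
have hE t : [/\ sqy (q + t *: h) = sqy q, wre (q + t *: h) = wre q & wim (q + t *: h) = wim q + t * ((l + 1) * s)].
  rewrite /sqy /wre /wim (lin_funD usubmx_lin) (lin_funD dsubmx_lin) !(lin_funZ usubmx_lin) !(lin_funZ dsubmx_lin).
  rewrite /Vw /in_w col_mxKu col_mxKd !scaler0 addr0 !mxE /= !mulr0 !mulr1 addr0; split=> //.
have hA t : 0 <= t <= 1 -> A (q + t *: h).
  move=> /andP[t0 t1]; have [e1 e2 e3] := hE t; split; first by rewrite /Qdom /= e1.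
  split; last by rewrite /= e2.
  apply: lt_le_trans lq _; rewrite !sqwE e2 e3 lerD2l /s; have := l0.
  by case: (leP 0 (wim q)) => h0 l0'; have : 0 <= t * (l + 1) by [rewrite mulr_ge0 // ltW // addr_gt0]; nra.
have dA x : A x -> differentiable (rot_avg epsZ P) x.
  by move=> Ax; exact: Ck_diff (Ck_rot_avg oA rA cP) Ax.
rewrite -[LHS](@const_on_segment _ _ (rot_avg epsZ P) q h); first last.
- by move=> t /hA At; exact: (rot_avg_const oA rA perZ h fb hb At).
- by move=> t /hA; exact: dA.
rewrite /rot_avg (eq_int01 (g := fun=> 0)) ?int01_cst // => t _.
rewrite mul1r /P prim_form_im //.
  rewrite /Qdom /= sqy_rot; have [e1 _ _] := hE 1; move: e1; rewrite scale1r => ->; exact: Dq.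
rewrite /wim rZ -/(wim (q + h)); have [_ _ e3] := hE 1; move: e3; rewrite scale1r mul1r => ->.
rewrite /s; have := l0; case: (leP 0 (wim q)) => h0 l0'.
  by rewrite ger0_norm ?mulr1; [lra|rewrite addr_ge0 // addr_ge0 // ltW].
by rewrite ler0_norm ?mulrN1; lra.
Qed.

End Primitive.

(** * Quaternionic directions *)

Section Parts.
Context {R : realType} {m : nat}.
Local Notation E := 'M[R]_(m, 2).
Implicit Types (A B : set E) (W F : E -> R) (Z : E -> E).

Lemma Ck_cut k A B W F : open A -> open B -> A `|` B = setT -> Ck k setT W ->
  (forall x, B x -> W x = 0) -> Ck k A F -> Ck k setT (fun x => W x * F x).
Proof.
move=> oA oB AB cW W0 cF; rewrite -AB; apply: Ck_union.
  by apply: (Ck_mul oA) cF; exact: Ck_sub cW.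
apply: (Ck_ext oB (f := cst 0)); last exact: Ck_cst.
by move=> x /[!inE] Bx; rewrite W0 ?mul0r.
Qed.

Lemma C1c_cut A B W F : open A -> open B -> A `|` B = setT -> C1c W ->
  (forall x, B x -> W x = 0) -> Ck 1 A F -> C1c (fun x => W x * F x).
Proof.
move=> oA oB AB [cW [r hr]] W0 cF; split; first exact: (Ck_cut oA oB AB cW W0 cF).
by exists r => x /hr ->; rewrite mul0r.
Qed.

Lemma C0c_cut A B W F : open A -> open B -> A `|` B = setT -> C0c W ->
  (forall x, B x -> W x = 0) -> Ck 0 A F -> C0c (fun x => W x * F x).
Proof.
move=> oA oB AB [cW [r hr]] W0 cF; split; first exact: (Ck_cut oA oB AB cW W0 cF).
by exists r => x /hr ->; rewrite mul0r.
Qed.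

Lemma derive_cut A B W F x v : open A -> open B -> A `|` B = setT -> C1c W ->
  (forall x, B x -> W x = 0) -> Ck 1 A F ->
  'D_v (fun x => W x * F x) x = W x * 'D_v F x + 'D_v W x * F x.
Proof.
move=> oA oB AB cW W0 cF.
have [Ax|Bx] : A x \/ B x by have : (A `|` B) x by rewrite AB.
  have dF := Ck_diff cF Ax; have dW := C1c_diff x cW.
  rewrite -[fun x => _]/(W * F) deriveM; [|exact: diff_derivable|exact: diff_derivable].
  by congr (_ + _); exact: mulrC.
rewrite (W0 _ Bx) mul0r (derive_near0 v oB Bx) => [|y By]; last by rewrite W0 ?mul0r.
by rewrite (derive_near0 v oB Bx W0) mul0r addr0.
Qed.

Lemma lint_parts A B W F Z : open A -> open B -> A `|` B = setT -> C1c W ->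
  (forall x, B x -> W x = 0) -> Ck 1 A F ->
  (forall H, C1c H -> lint (fun x => 'D_(Z x) H x) = 0) ->
  (forall x, A x -> 'D_(Z x) W x * F x = 0) -> lint (fun x => W x * 'D_(Z x) F x) = 0.
Proof.
move=> oA oB AB cW W0 cF hZ ZW.
rewrite -(hZ _ (C1c_cut oA oB AB cW W0 cF)); congr lint; apply/funext => x.
rewrite (derive_cut x (Z x) oA oB AB cW W0 cF).
have [Ax|Bx] : A x \/ B x by have : (A `|` B) x by rewrite AB.
  by rewrite ZW ?addr0.
by rewrite (derive_near0 _ oB Bx W0) mul0r addr0.
Qed.

Lemma lint_gt0 F (x0 : E) : C0c F -> (forall x, 0 <= F x) -> 0 < F x0 -> 0 < lint F.
Proof.
move=> cF F0 Fx0; have e0 : 0 < F x0 / 2 by rewrite divr_gt0.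
have [d d0 dP] := cont_ball (cF.1 x0 I) e0.
have d2 : 0 < d ^+ 2 by rewrite exprn_gt0.
have a0 : 0 < d ^+ 2 / 2 by rewrite divr_gt0.
have ab : d ^+ 2 / 2 < d ^+ 2 by rewrite ltr_pdivrMr // ltr_pMr // ltr1n.
pose p (x : E) := plateau (d ^+ 2 / 2) (d ^+ 2) (sqn x).
have cp : C1c p := C1c_radial (CkW (Ck_plateau _ _)) (fun t h => plateau0 ab h).
have /andP[vp _] := @plateau_vol R m _ _ a0 ab.
have p0 : 0 < lint p by apply: lt_le_trans vp; rewrite mulr_gt0 ?exprn_gt0 // ball_vol_gt0.
have cps : C1c (fun x => p (x - x0)).
  apply: (C1c_comp (g := fun x => x - x0) cp) => [i j|r].
    under eq_fun do rewrite !mxE.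
    by apply: (Ck_minus openT); [exact: Ck_id_coord|exact: Ck_cst].
  by exists (r + `|x0|) => x hx; apply: norm_shift; rewrite normrN.
have : F x0 / 2 * lint p <= lint F.
  rewrite -(lint_translate (- x0) cp) -lintZ; last exact: C1c_adm.
  apply: lint_le => [||x]; [by apply: admZ; exact: C1c_adm|exact: C0c_adm|].
  have [h|h] := ltP (sqn (x - x0)) (d ^+ 2); last by rewrite /p plateau0 ?mulr0.
  apply: (@le_trans _ _ (F x0 / 2)).
    by rewrite ler_piMr ?plateau_le1 // ltW.
  have /dP : `|x - x0| < d.
    by rewrite -(@ltr_pXn2r _ 2) ?nnegrE // 1?ltW //; apply: le_lt_trans (norm_sqn _) h.
  by rewrite ltr_norml => /andP[h1 _]; lra.
by apply: lt_le_trans; rewrite mulr_gt0.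
Qed.

(** Functions that agree along a single line have the same derivative in its direction; this freezes
    the fields Y1 and Y2, which depend on z only, when differentiating in w. *)
Lemma derive_line_eq (f g : E -> R) x v : (forall t : R, f (t *: v + x) = g (t *: v + x)) ->
  'D_v f x = 'D_v g x.
Proof.
move=> fg; have fgx : f x = g x by have := fg 0; rewrite scale0r add0r.
rewrite /derive; set F := (fun h : R => _); set G := (fun h : R => _ *: (g _ - _)).
by have -> : F = G by apply/funext => t; rewrite /F /G /= fg fgx.
Qed.

End Parts.

Section Dichotomy.
Context {R : realType}.
Local Notation Q := 'M[R]_(1 + 2, 2).
Implicit Types (q u v : Q).

(** Multiplication by the quaternion j: (y_1, y_2) goes to (- conj y_2, conj y_1). It anticommutes
    with [Jmx], so [quat y] and [Jmx (quat y)] complete the Hopf direction to a frame of the sphere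
    through y, with linear and divergence-free fields. *)
Definition quat (y : 'M[R]_(2, 2)) : 'M[R]_(2, 2) := \matrix_(i, j)
  (if i == 0 then if j == 0 then - y 1 0 else y 1 1
   else if j == 0 then y 0 0 else - y 0 1).

Lemma quat_lin : lin_fun quat.
Proof. by move=> a u v; apply: mxP2; apply: ord2P; rewrite !mxE /=; split; ring. Qed.

Lemma quat2 y : quat (quat y) = - y.
Proof. by apply: mxP2; apply: ord2P; rewrite !mxE /= ?opprK. Qed.

Lemma quatJ y : quat (Jmx y) = - Jmx (quat y).
Proof. by apply: mxP2; apply: ord2P; rewrite !mxE /=; split; ring. Qed.

Lemma sum2 (F : 'I_2 -> R) : \sum_(j < 2) F j = F 0 + F 1.
Proof. by rewrite big_ord_recl big_ord1; congr (_ + F _); exact: val_inj. Qed.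

Lemma dot_quat y : dot y (quat y) = 0.
Proof. by rewrite /dot sum2 !mxE /=; ring. Qed.

Lemma dot_Jquat y : dot y (Jmx (quat y)) = 0.
Proof. by rewrite /dot sum2 !(Jmx0, Jmx1) !mxE /=; ring. Qed.

Definition Y1 q : Q := in_y (quat (dsubmx q)).
Definition Y2 q : Q := in_y (Jmx (quat (dsubmx q))).

Lemma Y1_lin : lin_fun Y1.
Proof. by move=> a u v; rewrite /Y1 dsubmx_lin quat_lin in_y_lin. Qed.
Lemma Y2_lin : lin_fun Y2.
Proof. by move=> a u v; rewrite /Y2 dsubmx_lin quat_lin Jmx_lin in_y_lin. Qed.

Lemma dsub_in_y (n : nat) (y : 'M[R]_(n, 2)) : dsubmx (in_y y) = y. Proof. exact: col_mxKd. Qed.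

Lemma JJ (n : nat) (y : 'M[R]_(n, 2)) : Jmx (Jmx y) = - y.
Proof. by apply: mxP2 => k; rewrite !(Jmx0, Jmx1) !mxE. Qed.

Lemma Y21 q : Y2 (Y1 q) = - in_y (Jmx (dsubmx q)).
Proof. by rewrite /Y2 /Y1 dsub_in_y quat2 (lin_funN Jmx_lin) (lin_funN in_y_lin). Qed.
Lemma Y12 q : Y1 (Y2 q) = in_y (Jmx (dsubmx q)).
Proof. by rewrite /Y2 /Y1 dsub_in_y quatJ quat2 (lin_funN Jmx_lin) opprK. Qed.

Lemma ltrace_in_y (n : nat) (L : 'M[R]_(n, 2) -> 'M[R]_(n, 2)) :
  ltrace (fun q : 'M[R]_(1 + n, 2) => in_y (L (dsubmx q))) = ltrace L.
Proof.
rewrite /ltrace -(pair_bigA _ (fun i j => in_y (L (dsubmx (delta_mx i j : 'M[R]_(1 + n, 2)))) i j)).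
rewrite -(pair_bigA _ (fun i j => L (delta_mx i j) i j)) /=.
rewrite big_split_ord /= big1 ?add0r => [|i _]; last first.
  by apply: big1 => j _; rewrite col_mxEu mxE.
apply: eq_bigr => i _; apply: eq_bigr => j _; rewrite col_mxEd.
congr (L _ i j); apply/matrixP => a b; rewrite !mxE.
by rewrite (inj_eq (@rshift_inj _ _)).
Qed.

Lemma ltrace_Y1 : ltrace Y1 = 0.
Proof.
rewrite [LHS](ltrace_in_y quat) /ltrace big1 // => -[i j] _.
by move: j i; apply: ord2P; apply: ord2P; rewrite !mxE /= ?oppr0.
Qed.
Lemma ltrace_Y2 : ltrace Y2 = 0.
Proof.
rewrite [LHS](ltrace_in_y (fun y => Jmx (quat y))) /ltrace big1 // => -[i j] _.
by move: j i; apply: ord2P; apply: ord2P; rewrite !mxE /=; ring.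
Qed.

End Dichotomy.

(** * The product of two classes on the slice n = 2 *)

Section GaugeDichotomy.
Context {R : realType}.
Local Notation Q := 'M[R]_(1 + 2, 2).
Implicit Types (q u v : Q).
Local Notation X := (rot_gen (@epsX R 2)).
Local Notation Z := (rot_gen (@epsZ R 2)).

Variables (b gam : Q -> Q -> R) (eta : Q -> Q -> Q -> R) (l c a : R) (G G2 : Q -> R).
Let tube : set Q := Qdom `&` [set q | sqw q < (5 * l) ^+ 2].
Let o_tube : open tube. Proof. by apply: openI; [exact: open_Qdom|exact: open_sqw]. Qed.
Let oQ : open (Qdom : set Q). Proof. exact: open_Qdom. Qed.
Hypothesis l0 : 0 < l.
Hypothesis fb : form1 1 Qdom b.
Hypothesis f2 : form2 1 Qdom eta.
Hypothesis lin_eta : forall q u, Qdom q -> lin_fun (eta q u).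
Hypothesis db : forall q u v, Qdom q -> - (5 * l) < wre q -> dform b q u v = eta q u v.
Hypothesis eta0 : forall q u v, Qdom q -> l ^+ 2 < sqw q -> eta q u v = 0.
Hypothesis bU : forall q, Qdom q -> b q Uw = 0.
Hypothesis avgZ : forall q, Qdom q -> l ^+ 2 < sqw q -> - (5 * l) < wre q ->
  rot_avg epsZ (fun q => b q (Z q)) q = 0.
Hypothesis iX : forall q v, Qdom q -> eta q (X q) v = 0.
Hypothesis cG : Ck 1 tube G.
Hypothesis bX : forall q, tube q -> b q (X q) = c + 'D_(X q) G q.
Hypothesis fgam : form1 1 Qdom gam.
Hypothesis cG2 : Ck 1 tube G2.
Hypothesis gX : forall q, tube q -> gam q (X q) = a + 'D_(X q) G2 q.
Hypothesis dich : forall q, tube q ->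
  (forall u v, eta q u v = 0) \/ (forall u v, dform gam q u v = 0).

(** The cutoff in |w|^2 takes place between l1 and l2, that is, outside the support of eta and
    inside the tube where primitives and potentials are available. *)
Let l1 : R := 2 * l ^+ 2.
Let l2 : R := 3 * l ^+ 2.
Let ll : 0 < l ^+ 2. Proof. by rewrite exprn_gt0. Qed.
Let l12 : l1 < l2. Proof. by rewrite /l1 /l2; have := ll; lra. Qed.
Let l25 : l2 < (5 * l) ^+ 2. Proof. by rewrite /l2 exprMn; have := ll; lra. Qed.
Let l1l : l ^+ 2 < l1. Proof. by rewrite /l1; have := ll; lra. Qed.

(** A bump in |z|^2 supported in [1, 3], which keeps the integrals away from z = 0. *)
Let kap (t : R) := plateau 2 3 t - plateau 1 2 t.
Let mm (t : R) := plateau l1 l2 t.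
Let mm' (t : R) := - (st' ((t - l1) / (l2 - l1)) / (l2 - l1)).

Let kap_lo t : t <= 1 -> kap t = 0.
Proof. by move=> h; rewrite /kap !plateau1 ?subrr // ?ltr_nat // ?ler_nat; lra. Qed.
Let kap_hi t : 3 <= t -> kap t = 0.
Proof. by move=> h; rewrite /kap !plateau0 ?subrr //; lra. Qed.
Let kap_ge0 t : 0 <= kap t.
Proof.
rewrite /kap subr_ge0; have [h|h] := leP t 2.
  by rewrite [leRHS]plateau1 ?plateau_le1 //; lra.
by rewrite [leLHS]plateau0 ?plateau_ge0 //; lra.
Qed.
Let Ck_kap : Ck 2 setT kap. Proof. by apply: (Ck_minus openT); exact: Ck_plateau. Qed.

Let mm_hi t : l2 <= t -> mm t = 0. Proof. exact: plateau0. Qed.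
Let mm'_lo t : t <= l1 -> mm' t = 0.
Proof.
move=> h; rewrite /mm' st'_0 ?mul0r ?oppr0 // pmulr_lle0 ?subr_le0 //.
by rewrite invr_gt0 subr_gt0; exact: l12.
Qed.
Let mm'_hi t : l2 <= t -> mm' t = 0.
Proof.
move=> h; rewrite /mm' st'_1 ?mul0r ?oppr0 // ler_pdivlMr ?mul1r ?lerD2r //.
by rewrite subr_gt0; exact: l12.
Qed.
Let Ck_mm' : Ck 1 setT mm'.
Proof.
apply: (Ck_opp openT).
have h : Ck 1 setT (fun t => (l2 - l1)^-1 * st' ((t - l1) / (l2 - l1))).
  by apply: (Ck_scale openT); apply: (Ck_comp1 openT _ Ck_st'); exact: Ck_affine.
by apply: Ck_ext h => [|t _]; [exact: openT|rewrite mulrC].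
Qed.

Let W q : R := kap (sqy q) * mm (sqw q).
(** Radial derivative of W in w: along a w-direction v the derivative of W is K times the scalar
    product of w and v. It lives where l1 <= |w|^2 <= l2. *)
Let K q : R := 2 * kap (sqy q) * mm' (sqw q).

Let supp_yw (F : Q -> R) : (forall q, 3 <= sqy q -> F q = 0) -> (forall q, l2 <= sqw q -> F q = 0) ->
  exists r, supp_in r F.
Proof.
move=> h1 h2; exists (3 + l2) => q hq.
have hr : 0 <= 3 + l2 by rewrite /l2; have := ll; lra.
have [/h1 //|h3] := leP 3 (sqy q); have [/h2 //|h4] := leP l2 (sqw q).
have : `|q| <= 3 + l2; last by rewrite leNgt hq.
rewrite -[q]vsubmxK; apply: norm_col => //; apply: norm_le_sqn => //.
  rewrite -/(sqw q) (le_trans (ltW h4)) //; have := ll; rewrite /l2 => h; nra.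
rewrite -/(sqy q) (le_trans (ltW h3)) //; have := ll; rewrite /l2 => h; nra.
Qed.

Let C1c_W : C1c W.
Proof.
split.
  apply: (Ck_mul openT); apply: (Ck_comp1 openT).
  - exact: Ck_sqy.
  - exact: CkW Ck_kap.
  - exact: Ck_sqw.
  - exact: CkW (Ck_plateau l1 l2).
apply: supp_yw => q h; first by rewrite /W (kap_hi h) mul0r.
by rewrite /W (mm_hi h) mulr0.
Qed.

Let C1c_K : C1c K.
Proof.
split.
  apply: (Ck_mul openT); [apply: (Ck_scale openT)|]; apply: (Ck_comp1 openT).
  - exact: Ck_sqy.
  - exact: CkW Ck_kap.
  - exact: Ck_sqw.
  - exact: Ck_mm'.
apply: supp_yw => q h; first by rewrite /K (kap_hi h) mulr0 mul0r.
by rewrite /K (mm'_hi h) mulr0.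
Qed.

Let BW : set Q := [set q | sqy q < 1] `|` [set q | l2 < sqw q].
Let oBW : open BW.
Proof.
apply: openU; first exact: open_Ck_lt (Ck_sqy 0) (Ck_cst 0 setT 1).
exact: open_Ck_lt (Ck_cst 0 setT l2) (Ck_sqw 0).
Qed.
Let ABW : tube `|` BW = setT.
Proof.
apply/seteqP; split=> // q _; have [h|h] := ltP (sqy q) 1; first by right; left.
have [h'|h'] := ltP l2 (sqw q); first by right; right.
left; split; first exact: lt_le_trans h.
exact: le_lt_trans h' l25.
Qed.
Let W_B q : BW q -> W q = 0.
Proof.
by case=> [/ltW h|/ltW h]; rewrite /W; [rewrite (kap_lo h) mul0r|rewrite (mm_hi h) mulr0].
Qed.
Let K_B q : BW q -> K q = 0.
Proof.
by case=> [/ltW h|/ltW h]; rewrite /K; [rewrite (kap_lo h) mulr0 mul0r|rewrite (mm'_hi h) mulr0].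
Qed.

Let BK : set Q := [set q | sqy q < 1] `|` ([set q | l2 < sqw q] `|` [set q | sqw q < l1]).
Let oBK : open BK.
Proof.
apply: openU; first exact: open_Ck_lt (Ck_sqy 0) (Ck_cst 0 setT 1).
apply: openU; last exact: open_sqw.
exact: open_Ck_lt (Ck_cst 0 setT l2) (Ck_sqw 0).
Qed.
Let K_BK q : BK q -> K q = 0.
Proof.
case=> [/ltW h|[/ltW h|/ltW h]]; rewrite /K; first by rewrite (kap_lo h) mulr0 mul0r.
  by rewrite (mm'_hi h) mulr0.
by rewrite (mm'_lo h) mulr0.
Qed.
Let ann : set Q := Qdom `&` ([set q | l ^+ 2 < sqw q] `&` [set q | - (5 * l) < wre q]).
Let o_ann : open ann.
Proof.
apply: openI => //; apply: openI; last exact: open_wre.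
exact: open_Ck_lt (Ck_cst 0 setT (l ^+ 2)) (Ck_sqw 0).
Qed.
Let tube_wre q : tube q -> - (5 * l) < wre q.
Proof.
move=> [_]; rewrite /= sqwE => h; rewrite ltNge; apply/negP => h'.
by have := sqr_ge0 (wim q); have := l0; nra.
Qed.
Let ABK : ann `|` BK = setT.
Proof.
apply/seteqP; split=> // q _; have [h|h] := ltP (sqy q) 1; first by right; left.
have [h'|h'] := ltP l2 (sqw q); first by right; right; left.
have [h2|h2] := ltP (sqw q) l1; first by right; right; right.
left; split; first exact: lt_le_trans h.
split; first exact: lt_le_trans l1l h2.
by apply: tube_wre; split; [exact: lt_le_trans h|exact: le_lt_trans h' l25].
Qed.

Let dsqy q v : differentiable (@sqy R 2) q /\ 'D_v (@sqy R 2) q = 2 * dot (dsubmx q) (dsubmx v).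
Proof.
have [d D] := lin_fun_diff q (@dsubmx_lin R 2).
have [d' D'] := derive_sqn (dsubmx q) (dsubmx v).
split; first exact: (differentiable_comp d d').
by rewrite (derive_compE v d d') D D'.
Qed.
Let dsqw q v : differentiable (@sqw R 2) q /\ 'D_v (@sqw R 2) q = 2 * dot (usubmx q) (usubmx v).
Proof.
have [d D] := lin_fun_diff q (@usubmx_lin R 2).
have [d' D'] := derive_sqn (usubmx q) (usubmx v).
split; first exact: (differentiable_comp d d').
by rewrite (derive_compE v d d') D D'.
Qed.

Let derive_yw (f g : R -> R) q v : Ck 1 setT f -> Ck 1 setT g ->
  'D_v (fun q => f (sqy q) * g (sqw q)) q =
  f (sqy q) * (('D_1 g (sqw q)) * (2 * dot (usubmx q) (usubmx v))) +
  g (sqw q) * (('D_1 f (sqy q)) * (2 * dot (dsubmx q) (dsubmx v))).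
Proof.
move=> cf cg; have [d1 D1] := dsqy q v; have [d2 D2] := dsqw q v.
have df : differentiable f (sqy q) := Ck_diff cf (I : setT (sqy q)).
have dg : differentiable g (sqw q) := Ck_diff cg (I : setT (sqw q)).
have i1 := DeriveDef (diff_derivable (v := (1 : R)) df) erefl.
have i2 := DeriveDef (diff_derivable (v := (1 : R)) dg) erefl.
have e1 := derive_comp1 v d1 i1; have e2 := derive_comp1 v d2 i2.
have c1 : differentiable (fun q : Q => f (sqy q)) q by exact: differentiable_comp d1 df.
have c2 : differentiable (fun q : Q => g (sqw q)) q by exact: differentiable_comp d2 dg.
rewrite -[fun q => _]/((fun q : Q => f (sqy q)) * (fun q : Q => g (sqw q))).
rewrite deriveM; [|exact: diff_derivable|exact: diff_derivable].
by rewrite e1 e2 D1 D2.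
Qed.

Let perp q v := dot (dsubmx q) (dsubmx v) = 0 /\ dot (usubmx q) (usubmx v) = 0.

Let DW_perp q v : perp q v -> 'D_v W q = 0.
Proof.
move=> [h1 h2]; rewrite (derive_yw q v (CkW Ck_kap) (CkW (Ck_plateau l1 l2))) h1 h2.
by rewrite !mulr0 addr0.
Qed.
Let DK_perp q v : perp q v -> 'D_v K q = 0.
Proof.
move=> [h1 h2]; have -> : K = 2 \*: (fun q => kap (sqy q) * mm' (sqw q)).
  by apply/funext => x; rewrite /K -mulrA.
have cc : C1c (fun q => kap (sqy q) * mm' (sqw q)).
  have := C1cZ 2^-1 C1c_K; congr C1c; apply/funext => x.
  by rewrite /K; field.
rewrite deriveZ; last by apply: diff_derivable; exact: C1c_diff cc.
by rewrite (derive_yw q v (CkW Ck_kap) Ck_mm') h1 h2 !mulr0 addr0 scaler0.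
Qed.

Let perp_X q : perp q (X q).
Proof.
rewrite /perp rot_genX; split.
  by rewrite (lin_funB dsubmx_lin) /in_y /in_w !col_mxKd subr0 dotJ.
by rewrite (lin_funB usubmx_lin) /in_y /in_w !col_mxKu sub0r (lin_funN (dot_lin _)) dotJ oppr0.
Qed.
Let perp_Z q : perp q (Z q).
Proof.
rewrite /perp rot_genZ /in_y !col_mxKd !col_mxKu dotJ; split=> //.
exact: (lin_fun0 (dot_lin _)).
Qed.
Let perp_Y1 q : perp q (Y1 q).
Proof.
rewrite /perp /Y1 /in_y !col_mxKd !col_mxKu dot_quat; split=> //.
exact: (lin_fun0 (dot_lin _)).
Qed.
Let perp_Y2 q : perp q (Y2 q).
Proof.
rewrite /perp /Y2 /in_y !col_mxKd !col_mxKu dot_Jquat; split=> //.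
exact: (lin_fun0 (dot_lin _)).
Qed.

Let DW_U q (w : 'M[R]_(1, 2)) : 'D_(in_w w) W q = K q * dot (usubmx q) w.
Proof.
rewrite (derive_yw q _ (CkW Ck_kap) (CkW (Ck_plateau l1 l2))).
rewrite /in_w col_mxKu col_mxKd (lin_fun0 (dot_lin _)) !mulr0 addr0.
have -> : 'D_1 (plateau l1 l2) (sqw q) = mm' (sqw q) by have [_ ->] := is_derive_plateau l1 l2 (sqw q).
by rewrite /K; ring.
Qed.

Let lint_lin0 (L : Q -> Q) : lin_fun L -> ltrace L = 0 ->
  forall H, C1c H -> lint (fun x => 'D_(L x) H x) = 0.
Proof. by move=> lL tL H cH; rewrite (lint_lin_field lL cH) tL mul0r oppr0. Qed.

Let fb_tube : form1 1 tube b. Proof. by apply: form1_sub fb => q []. Qed.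
Let fg_tube : form1 1 tube gam. Proof. by apply: form1_sub fgam => q []. Qed.
Let ceta u v : Ck 1 tube (fun q => eta q u v).
Proof. by have [h _ _] := f2; apply: Ck_sub ((h u).2 v) => q []. Qed.
Let cb v : Ck 1 tube (b^~ v). Proof. exact: fb_tube.2. Qed.

Let g1 q : R := eta q Uw Vw.
Let cg1 : Ck 1 tube g1. Proof. exact: ceta. Qed.

Let b_in_w q : Qdom q -> b q (in_w (Jmx (usubmx q))) = wre q * b q Vw.
Proof.
move=> Dq; have -> : Jmx (usubmx q) = (- wim q) *: delta_mx 0 0 + wre q *: delta_mx 0 1.
  by rewrite {1}[Jmx _]w_split Jmx0 Jmx1.
by rewrite (in_w_lin (- wim q)) (lin_funZ in_w_lin) (fb.1 _ Dq) (lin_funZ (fb.1 _ Dq)) -/Uw -/Vw bU // !scaleRE mulr0 add0r.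
Qed.

(** Where |w| > l the average of b(Z) over rotations of z vanishes, so b(Z) is a pure derivative
    along Z and disappears under the integral. *)
Let potZ := rot_pot epsZ (fun q => b q (Z q)).
Let annZ s q : ann q -> ann (rot_by epsZ s q).
Proof.
have rZ : usubmx (rot_by epsZ s q) = usubmx q.
  apply: mxP2 => k; rewrite !mxE /= /epsZ splitl_ !mulr0 mul0r cos0 sin0; split; ring.
by move=> [h1 [h2 h3]]; split; [rewrite /Qdom /= sqy_rot|split; rewrite /= ?sqw_rot // /wre rZ].
Qed.
Let cPZ : Ck 1 ann (fun q => b q (Z q)).
Proof.
apply: form1_field => //; first by apply: form1_sub fb => q [].
by move=> i j; apply: Ck_lin_fun => x u w; rewrite rot_gen_lin !mxE.
Qed.
Let c_potZ : Ck 1 ann potZ. Proof. exact: (Ck_rot_pot o_ann annZ cPZ). Qed.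
Let bZ q : ann q -> b q (Z q) = 'D_(Z q) potZ q.
Proof.
move=> aq; rewrite (rot_avg_decomp o_ann annZ perZ cPZ aq).
by have [h1 [h2 h3]] := aq; rewrite avgZ // add0r.
Qed.

Let Wb v := fun q => W q * b q v.
Let C1c_Wb v : C1c (Wb v). Proof. exact: (C1c_cut o_tube oBW ABW C1c_W W_B (cb v)). Qed.

Let Wg1_adm : adm (fun q => W q * g1 q).
Proof. exact: C1c_adm (C1c_cut o_tube oBW ABW C1c_W W_B cg1). Qed.

Let Ck_lin_entry k (A : set Q) (L : Q -> Q) i j : lin_fun L -> Ck k A (fun q => L q i j).
Proof. by move=> lL; apply: Ck_lin_fun => x u w; rewrite lL !mxE. Qed.

Let adm_cut_D (A B : set Q) (V F : Q -> R) (L : Q -> Q) : open A -> open B -> A `|` B = setT ->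
  C1c V -> (forall x, B x -> V x = 0) -> Ck 1 A F -> lin_fun L ->
  adm (fun q => V q * 'D_(L q) F q).
Proof.
move=> oA oB AB cV VB cF lL; apply: C0c_adm; apply: (C0c_cut oA oB AB (C1c_C0c cV) VB).
by apply: Ck_derive_field => // i j; exact: Ck_lin_entry.
Qed.

(** Stokes in the w-plane: the mass of eta(Uw, Vw) is the winding of b around a circle |w| > l. The
    rotation of w is Z - X; b(Z) integrates to zero and b(X) to c. *)
Let lint_Wg1 : lint (fun q => W q * g1 q) = c * lint K.
Proof.
have lX : lin_fun X by exact: rot_gen_lin.
have lZ : lin_fun Z by exact: rot_gen_lin.
have aKZ := adm_cut_D o_ann oBK ABK C1c_K K_BK c_potZ lZ.
have aKX := adm_cut_D o_tube oBW ABW C1c_K K_B cG lX.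
have zKZ : lint (fun q => K q * 'D_(Z q) potZ q) = 0.
  apply: (lint_parts o_ann oBK ABK C1c_K K_BK c_potZ); first exact: lint_lin0 (ltrace_rot_gen _).
  by move=> q _; rewrite (DK_perp (perp_Z q)) mul0r.
have zKX : lint (fun q => K q * 'D_(X q) G q) = 0.
  apply: (lint_parts o_tube oBW ABW C1c_K K_B cG); first exact: lint_lin0 (ltrace_rot_gen _).
  by move=> q _; rewrite (DK_perp (perp_X q)) mul0r.
have aK := C1c_adm C1c_K.
(* As b vanishes on Uw, one boundary term is left, K wre b(Vw), which is K times b on the rotation
   of w. *)
have key q : 'D_Uw (Wb Vw) q - 'D_Vw (Wb Uw) q =
    W q * g1 q + (K q * 'D_(Z q) potZ q - (c * K q + K q * 'D_(X q) G q)).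
  rewrite (derive_cut q Uw o_tube oBW ABW C1c_W W_B (cb Vw)).
  rewrite (derive_cut q Vw o_tube oBW ABW C1c_W W_B (cb Uw)).
  have [tq|Bq] : tube q \/ BW q by have : (tube `|` BW) q by rewrite ABW.
    have [Dq _] := tq; have H := db Uw Vw Dq (tube_wre tq).
    have -> : W q * g1 q = W q * 'D_Uw (b^~ Vw) q - W q * 'D_Vw (b^~ Uw) q by rewrite /g1 -H /dform mulrBr.
    rewrite /Uw /Vw !DW_U -/Uw -/Vw bU // mulr0.
    have -> : dot (usubmx q) (delta_mx 0 0) = wre q by rewrite dot_e0.
    have E : K q * (wre q * b q Vw) = K q * 'D_(Z q) potZ q - (c * K q + K q * 'D_(X q) G q).
      have [/eqP k0|kn0] := boolP (K q == 0); first by rewrite k0 !mul0r mulr0 addr0 subr0.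
      have aq : ann q.
        have [//|Bq] : ann q \/ BK q by have : (ann `|` BK) q by rewrite ABK.
        by rewrite K_BK ?eqxx in kn0.
      rewrite -bZ // -b_in_w // [c * _]mulrC -mulrDr -bX // -mulrBr; congr (_ * _).
      rewrite -(lin_funB (fb.1 _ Dq)); congr (b q _).
      by rewrite rot_genZ rot_genX opprB addrC subrK.
    rewrite -E; ring.
  have w0 := W_B Bq; have k0 := K_B Bq; have dw v := derive_near0 v oBW Bq W_B.
  by rewrite w0 k0 !dw !(mul0r, mulr0, addr0, subr0).
have aD u v : adm (fun q => 'D_u (Wb v) q) by apply: C0c_adm; apply: C1c_derive; exact: C1c_Wb.
have : lint (fun q => 'D_Uw (Wb Vw) q - 'D_Vw (Wb Uw) q) = 0.
  by rewrite lintB // !lint_derive ?subrr //; exact: C1c_Wb.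
have -> : (fun q => 'D_Uw (Wb Vw) q - 'D_Vw (Wb Uw) q) =
    fun q => W q * g1 q + (K q * 'D_(Z q) potZ q - (c * K q + K q * 'D_(X q) G q)).
  by apply/funext => q; exact: key.
have a2 : adm (fun q => c * K q + K q * 'D_(X q) G q) by apply: admD => //; exact: admZ.
rewrite lintD; [|exact: Wg1_adm|exact: admB].
rewrite lintB // lintD ?lintZ //; last exact: admZ.
by rewrite zKZ zKX addr0 sub0r => /subr0_eq.
Qed.

Let lint_K : lint K < 0.
Proof.
have aK := C1c_adm C1c_K.
rewrite -oppr_gt0 -lintN //.
(* A point where both factors are nonzero: |z|^2 = 2 is the top of the bump and |w|^2 is the middle
   of the cutoff. *)
pose q0 : Q := col_mx (Num.sqrt ((l1 + l2) / 2) *: delta_mx 0 0) (Num.sqrt 2 *: delta_mx 0 0).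
have cd : C0c (fun q => - K q).
  by have := C1c_C0c (C1cZ (- 1) C1c_K); congr C0c; apply/funext => q; rewrite mulN1r.
have ge q : 0 <= - K q.
  rewrite /K -mulrN mulr_ge0 ?mulr_ge0 ?kap_ge0 // /mm' opprK divr_ge0 ?st'_ge0 //.
  by rewrite subr_ge0; exact/ltW/l12.
have sd (m : nat) (x : R) : 0 <= x -> sqn (Num.sqrt x *: delta_mx 0 0 : 'M[R]_(m.+1, 2)) = x.
  move=> x0; rewrite sqnZ sqr_sqrtr // /sqn (bigD1 0) //= big1 => [|i i0].
    by rewrite /csq !mxE !eqxx /= expr1n expr0n !addr0 mulr1.
  by rewrite /csq !mxE (negPf i0) /= expr0n addr0.
apply: (@lint_gt0 R 3 _ q0 cd ge).
have e1 : sqw q0 = (l1 + l2) / 2.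
  by rewrite /sqw col_mxKu sd // divr_ge0 // /l1 /l2; have := ll; lra.
have e2 : sqy q0 = 2 by rewrite /sqy col_mxKd sd.
rewrite /K e1 e2 /kap /mm' plateau1 ?plateau0 ?subr0 ?mulr1 //; [|lra..].
have -> : ((l1 + l2) / 2 - l1) / (l2 - l1) = 2^-1.
  by field; rewrite subr_eq0 gt_eqF // l12.
rewrite mulrN opprK mulr_gt0 // divr_gt0 ?st'_mid // subr_gt0; exact: l12.
Qed.

Let g q v := gam q v.
Let th q u v w : R := gam q u * eta q v w + gam q v * eta q w u + gam q w * eta q u v.

Let anti q u v : Qdom q -> eta q u v = - eta q v u.
Proof. by move=> Dq; have [_ h _] := f2; exact: h. Qed.
Let etaxx q u : Qdom q -> eta q u u = 0.
Proof. by move=> Dq; have := anti u u Dq; lra. Qed.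

Let feta u : form1 1 tube (fun q => eta q u).
Proof. by have [h _ _] := f2; apply: form1_sub (h u) => q []. Qed.

Let fetaL (L : Q -> Q) : lin_fun L -> form1 1 tube (fun q => eta q (L q)).
Proof.
move=> lL; split=> [q [Dq _]|v]; first exact: lin_eta.
apply: (Ck_ext o_tube _ (f := fun q => - eta q v (L q))).
  by move=> q /[!inE] -[Dq _]; rewrite [RHS]anti.
by apply: (Ck_opp o_tube); apply: (form1_field o_tube (feta v)) => i j; exact: Ck_lin_entry.
Qed.

Let cgl (L : Q -> Q) : lin_fun L -> Ck 1 tube (fun q => gam q (L q)).
Proof. by move=> lL; apply: (form1_field o_tube fg_tube) => i j; exact: Ck_lin_entry. Qed.
Let cel u (L : Q -> Q) : lin_fun L -> Ck 1 tube (fun q => eta q u (L q)).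
Proof. by move=> lL; apply: (form1_field o_tube (feta u)) => i j; exact: Ck_lin_entry. Qed.

Let cgc v : Ck 1 tube (fun q => gam q v). Proof. exact: fg_tube.2. Qed.

(** The three-form gam /\ eta on (L q, Uw, Vw), while [TV w] is the same form on (Y1 q, Y2 q, w):
    together the evaluations on triples of the four fields. *)
Let TY (L : Q -> Q) q := gam q (L q) * g1 q + gam q Uw * eta q Vw (L q) - gam q Vw * eta q Uw (L q).
Let TV w q := th q (Y1 q) (Y2 q) w.

Let cTY (L : Q -> Q) : lin_fun L -> Ck 1 tube (TY L).
Proof.
move=> lL; apply: (Ck_minus o_tube); first apply: (Ck_add o_tube).
- by apply: (Ck_mul o_tube); [exact: cgl|exact: cg1].
- by apply: (Ck_mul o_tube); [exact: cgc|exact: cel].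
- by apply: (Ck_mul o_tube); [exact: cgc|exact: cel].
Qed.

Let cTV w : Ck 1 tube (TV w).
Proof.
apply: (Ck_add o_tube); first apply: (Ck_add o_tube).
- apply: (Ck_mul o_tube); [exact: cgl Y1_lin|exact: (fetaL Y2_lin).2].
- by apply: (Ck_mul o_tube); [exact: cgl Y2_lin|exact: cel Y1_lin].
- apply: (Ck_mul o_tube); first exact: cgc.
  by apply: (form1_field o_tube (fetaL Y1_lin)) => i j; exact: Ck_lin_entry Y2_lin.
Qed.

Let derive_prod (f1 f2' : Q -> R) q v : differentiable f1 q -> differentiable f2' q ->
  'D_v (fun q => f1 q * f2' q) q = f1 q * 'D_v f2' q + 'D_v f1 q * f2' q.
Proof.
move=> d1 d2; rewrite -[fun q => _]/(f1 * f2') deriveM; [|exact: diff_derivable|exact: diff_derivable].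
by congr (_ + _); exact: mulrC.
Qed.

Let dd (F : Q -> R) q : tube q -> Ck 1 tube F -> differentiable F q.
Proof. by move=> tq cF; exact: Ck_diff cF tq. Qed.

Let derive_TY (L : Q -> Q) q v : lin_fun L -> tube q -> 'D_v (TY L) q =
  (gam q (L q) * 'D_v g1 q + ('D_v (gam^~ (L q)) q + gam q (L v)) * g1 q) +
  (gam q Uw * ('D_v (fun q' => eta q' Vw (L q)) q + eta q Vw (L v)) + 'D_v (gam^~ Uw) q * eta q Vw (L q)) -
  (gam q Vw * ('D_v (fun q' => eta q' Uw (L q)) q + eta q Uw (L v)) + 'D_v (gam^~ Vw) q * eta q Uw (L q)).
Proof.
move=> lL tq.
have d1 : differentiable (fun q => gam q (L q)) q := dd tq (cgl lL).
have d2 u : differentiable (fun q => eta q u (L q)) q := dd tq (cel u lL).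
have d3 u : differentiable (fun q => gam q u) q := dd tq (cgc u).
have d4 : differentiable g1 q by exact: (dd tq cg1).
pose p1 := fun q => gam q (L q) * g1 q; pose p2 := fun q => gam q Uw * eta q Vw (L q).
pose p3 := fun q => gam q Vw * eta q Uw (L q).
have e1 : differentiable p1 q := differentiableM d1 d4.
have e2 : differentiable p2 q := differentiableM (d3 Uw) (d2 Vw).
have e3 : differentiable p3 q := differentiableM (d3 Vw) (d2 Uw).
rewrite -[TY L]/(p1 + p2 - p3).
rewrite deriveB; [|by apply: diff_derivable; exact: differentiableD|exact: diff_derivable].
rewrite deriveD; [|exact: diff_derivable|exact: diff_derivable].
rewrite /p1 /p2 /p3 !derive_prod //.
rewrite (derive_form_lin v o_tube fg_tube lL tq).
by rewrite (derive_form_lin v o_tube (feta Vw) lL tq) (derive_form_lin v o_tube (feta Uw) lL tq).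
Qed.

Let derive_TV w x q : tube q -> dsubmx x = 0 -> 'D_x (TV w) q =
  (gam q (Y1 q) * 'D_x (fun q' => eta q' (Y2 q) w) q + 'D_x (gam^~ (Y1 q)) q * eta q (Y2 q) w) +
  (gam q (Y2 q) * 'D_x (fun q' => eta q' w (Y1 q)) q + 'D_x (gam^~ (Y2 q)) q * eta q w (Y1 q)) +
  (gam q w * 'D_x (fun q' => eta q' (Y1 q) (Y2 q)) q + 'D_x (gam^~ w) q * eta q (Y1 q) (Y2 q)).
Proof.
move=> tq x0; pose y1 := Y1 q; pose y2 := Y2 q.
have e2 u v : differentiable (fun q => eta q u v) q := dd tq ((feta u).2 v).
have d3 u : differentiable (fun q => gam q u) q := dd tq (cgc u).
pose p1 := fun q => gam q y1 * eta q y2 w; pose p2 := fun q => gam q y2 * eta q w y1.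
pose p3 := fun q => gam q w * eta q y1 y2.
have i1 : differentiable p1 q := differentiableM (d3 y1) (e2 y2 w).
have i2 : differentiable p2 q := differentiableM (d3 y2) (e2 w y1).
have i3 : differentiable p3 q := differentiableM (d3 w) (e2 y1 y2).
rewrite (@derive_line_eq _ _ _ (p1 + p2 + p3)) => [|t]; last first.
  have yt : dsubmx (t *: x + q) = dsubmx q by rewrite dsubmx_lin x0 scaler0 add0r.
  by rewrite /TV /th /Y1 /Y2 yt.
rewrite deriveD; [|by apply: diff_derivable; exact: differentiableD|exact: diff_derivable].
rewrite deriveD; [|exact: diff_derivable|exact: diff_derivable].
by rewrite /p1 /p2 /p3 !derive_prod.
Qed.

Let sum6r0 (x1 x2 x3 x4 x5 x6 : R) : x1 * 0 - x2 * 0 + x3 * 0 + x4 * 0 - x5 * 0 + x6 * 0 = 0.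
Proof. ring. Qed.

Let sum6l0 (x1 x2 x3 x4 x5 x6 : R) : 0 * x1 - 0 * x2 + 0 * x3 + 0 * x4 - 0 * x5 + 0 * x6 = 0.
Proof. ring. Qed.

(* The Cartan formula for d(gam /\ eta)(Y1, Y2, U, V), whose only bracket term
   comes from [Y1, Y2] = - 2 J. *)
Let cartan q : tube q ->
  'D_(Y1 q) (TY Y2) q - 'D_(Y2 q) (TY Y1) q + 'D_Uw (TV Vw) q - 'D_Vw (TV Uw) q =
  - 2 * (gam q (X q) * g1 q).
Proof.
move=> tq; have [Dq _] := tq; have [_ _ cl] := f2.
have yw (w : 'M[R]_(1, 2)) : dsubmx (in_w w : Q) = 0 by exact: col_mxKd.
rewrite !derive_TY ?derive_TV //; try exact: Y1_lin; try exact: Y2_lin; try exact: yw.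
rewrite Y21 Y12 (lin_funN (fgam.1 _ Dq)) !(lin_funN (lin_eta _ Dq)).
set j := in_y (Jmx (dsubmx q)).
have jE : j = X q + (wre q *: Vw - wim q *: Uw).
  have -> : wre q *: Vw - wim q *: Uw = in_w (Jmx (usubmx q)) :> Q.
    have -> : Jmx (usubmx q) = (- wim q) *: delta_mx 0 0 + wre q *: delta_mx 0 1.
      by rewrite {1}[Jmx _]w_split Jmx0 Jmx1.
    by rewrite (in_w_lin (- wim q)) (lin_funZ in_w_lin) scaleNr addrC.
  by rewrite rot_genX subrK.
have gj : gam q j = gam q (X q) + (wre q * gam q Vw - wim q * gam q Uw).
  by rewrite jE (lin_funD (fgam.1 _ Dq)) (lin_funB (fgam.1 _ Dq)) !(lin_funZ (fgam.1 _ Dq)).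
have ej u : eta q u j = wre q * eta q u Vw - wim q * eta q u Uw.
  rewrite jE (lin_funD (lin_eta u Dq)) (lin_funB (lin_eta u Dq)) !(lin_funZ (lin_eta u Dq)).
  by rewrite (anti u (X q) Dq) iX // oppr0 add0r.
rewrite gj !ej !etaxx //.
have eVU : eta q Vw Uw = - g1 q by exact: anti.
rewrite eVU -/(g1 q).
set y1 := Y1 q; set y2 := Y2 q.
have da u v w : 'D_w (fun q' => eta q' u v) q = - 'D_w (fun q' => eta q' v u) q.
  rewrite -deriveN; last exact: diff_derivable (dd tq ((feta v).2 u)).
  by apply: near_eq_derive; apply: (open_near_eq o_tube) => // y /[!inE] -[Dy _]; exact: anti.
have c1 := cl q y2 Uw Vw Dq; have c2 := cl q y1 Uw Vw Dq.
have c3 := cl q y1 y2 Vw Dq; have c4 := cl q y1 y2 Uw Dq.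
(* The four-form d gam /\ eta on the four fields; it vanishes since one of its factors does. *)
have zz : dform gam q y1 y2 * g1 q - dform gam q y1 Uw * eta q y2 Vw + dform gam q y1 Vw * eta q y2 Uw
   + dform gam q y2 Uw * eta q y1 Vw - dform gam q y2 Vw * eta q y1 Uw + dform gam q Uw Vw * eta q y1 y2 = 0.
  have [h|h] := dich tq; first by rewrite /g1 !h; exact: sum6r0.
  by rewrite !h; exact: sum6l0.
have [e21 e22] := (anti Vw y2 Dq, anti Vw y1 Dq); have [e23 e24] := (anti Uw y2 Dq, anti Uw y1 Dq).
rewrite e21 e22 e23 e24 (da Vw y2 y1) (da Uw y2 y1) (da Vw y1 y2) (da Uw y1 y2) (da Vw y1 Uw) (da Uw y1 Vw).
rewrite (da Vw y2 Uw) in c1; rewrite (da Vw y1 Uw) in c2.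
rewrite (da Vw y1 y2) in c3; rewrite (da Uw y1 y2) in c4.
move: c1 c2 c3 c4 zz; rewrite /dform -/g1.
(* From here on all values and derivatives are independent numbers: the four closedness relations of
   eta eliminate some of them, and the claim is [zz] up to [ring]. *)
generalize (gam q y1) (gam q y2) (gam q Uw) (gam q Vw) (gam q (X q)) (g1 q) => gy1 gy2 gU gV gx e.
generalize (eta q y1 y2) (eta q y1 Uw) (eta q y1 Vw) (eta q y2 Uw) (eta q y2 Vw) => e12 e1U e1V e2U e2V.
generalize ('D_y1 g1 q) ('D_y2 g1 q) ('D_y1 (fun q' => eta q' y2 Vw) q) ('D_y1 (fun q' => eta q' y2 Uw) q).
generalize ('D_y2 (fun q' => eta q' y1 Vw) q) ('D_y2 (fun q' => eta q' y1 Uw) q).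
generalize ('D_Uw (fun q' => eta q' y2 Vw) q) ('D_Uw (fun q' => eta q' y1 Vw) q) ('D_Uw (fun q' => eta q' y1 y2) q).
generalize ('D_Vw (fun q' => eta q' y2 Uw) q) ('D_Vw (fun q' => eta q' y1 Uw) q) ('D_Vw (fun q' => eta q' y1 y2) q).
generalize ('D_y1 (gam^~ y2) q) ('D_y1 (gam^~ Uw) q) ('D_y1 (gam^~ Vw) q).
generalize ('D_y2 (gam^~ y1) q) ('D_y2 (gam^~ Uw) q) ('D_y2 (gam^~ Vw) q).
generalize ('D_Uw (gam^~ y1) q) ('D_Uw (gam^~ y2) q) ('D_Uw (gam^~ Vw) q).
generalize ('D_Vw (gam^~ y1) q) ('D_Vw (gam^~ y2) q) ('D_Vw (gam^~ Uw) q).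
generalize (wre q) (wim q).
move=> w0 w1 v1 v2 vU u1 u2 uV d21 d2U d2V d12 d1U d1V pV2 pV1 pV12 pU2 pU1 pU12 p21V p21U p1 p2 p12V p12U.
move=> c1 c2 c3 c4 zz.
have {}c1 : pV2 = pU2 - p2 by lra.
have {}c2 : pV1 = pU1 - p1 by lra.
have {}c3 : pV12 = p21V - p12V by lra.
have {}c4 : pU12 = p21U - p12U by lra.
rewrite c1 c2 c3 c4; apply/eqP; rewrite -subr_eq0; apply/eqP; apply: etrans zz; ring.
Qed.

(** Y1 and Y2 are divergence free and preserve |z| and |w|, hence W. The derivatives of W in w live
    where |w|^2 >= l1, and eta vanishes there. So all four derivatives of the Cartan formula
    integrate to zero. *)
Let lint_gX : lint (fun q => W q * (gam q (X q) * g1 q)) = 0.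
Proof.
have yw (w : 'M[R]_(1, 2)) : dsubmx (in_w w : Q) = 0 by exact: col_mxKd.
have aY L L' : lin_fun L -> lin_fun L' -> adm (fun q => W q * 'D_(L' q) (TY L) q).
  by move=> lL lL'; exact: (adm_cut_D o_tube oBW ABW C1c_W W_B (cTY lL) lL').
have aV w v : adm (fun q => W q * 'D_v (TV w) q).
  apply: C0c_adm; apply: (C0c_cut o_tube oBW ABW (C1c_C0c C1c_W) W_B).
  by apply: Ck_derive; exact: cTV.
have zY L L' : lin_fun L -> lin_fun L' -> ltrace L' = 0 -> (forall q, perp q (L' q)) ->
    lint (fun q => W q * 'D_(L' q) (TY L) q) = 0.
  move=> lL lL' tL pL; apply: (lint_parts o_tube oBW ABW C1c_W W_B (cTY lL)); first exact: lint_lin0.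
  by move=> q _; rewrite DW_perp ?mul0r.
have zV w (x : 'M[R]_(1, 2)) : lint (fun q => W q * 'D_(in_w x) (TV w) q) = 0.
  apply: (lint_parts (Z := fun=> in_w x) o_tube oBW ABW C1c_W W_B (cTV w)); first by move=> H; exact: lint_derive.
  move=> q [Dq _]; rewrite DW_U; have [h|h] := leP (sqw q) l1.
    by rewrite /K (mm'_lo h) mulr0 mul0r mul0r.
  have e0 u v : eta q u v = 0 by apply: eta0 => //; exact: lt_trans l1l h.
  by rewrite /TV /th !e0 !mulr0 !addr0 mulr0.
have a1 := aY _ _ Y2_lin Y1_lin; have a2 := aY _ _ Y1_lin Y2_lin.
have z1 := zY _ _ Y2_lin Y1_lin ltrace_Y1 perp_Y1; have z2 := zY _ _ Y1_lin Y2_lin ltrace_Y2 perp_Y2.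
have : lint (fun q => W q * 'D_(Y1 q) (TY Y2) q - W q * 'D_(Y2 q) (TY Y1) q +
    (W q * 'D_Uw (TV Vw) q - W q * 'D_Vw (TV Uw) q)) = 0.
  rewrite lintD; [|exact: admB|by apply: admB; exact: aV].
  by rewrite lintB // lintB; [rewrite z1 z2 !zV; ring|exact: aV|exact: aV].
have aX : adm (fun q => W q * (gam q (X q) * g1 q)).
  apply: C1c_adm; apply: (C1c_cut o_tube oBW ABW C1c_W W_B).
  by apply: (Ck_mul o_tube) cg1; apply: cgl; exact: rot_gen_lin.
have -> : (fun q => W q * 'D_(Y1 q) (TY Y2) q - W q * 'D_(Y2 q) (TY Y1) q +
    (W q * 'D_Uw (TV Vw) q - W q * 'D_Vw (TV Uw) q)) = fun q => - 2 * (W q * (gam q (X q) * g1 q)).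
  apply/funext => q.
  have [tq|Bq] : tube q \/ BW q by have : (tube `|` BW) q by rewrite ABW.
    by rewrite [RHS]mulrCA -cartan //; ring.
  by rewrite W_B // !mul0r subrr addr0 mulr0.
rewrite lintZ // => /eqP; rewrite mulf_eq0 => /orP[|/eqP //].
by rewrite oppr_eq0 pnatr_eq0.
Qed.

(* the gauge field rotates (Uw, Vw) and contracts eta to zero, so that it
   preserves eta Uw Vw *)
Let Xg1 q : tube q -> 'D_(X q) g1 q = 0.
Proof.
move=> tq; have [Dq _] := tq; have [_ _ cl] := f2.
have := cl q (X q) Uw Vw Dq.
have Z0 x v : 'D_v (fun q' => eta q' x (X q')) q = 0.
  apply: (derive_near0 v oQ Dq) => y Dy; by rewrite anti // iX // oppr0.
have lX : lin_fun X by exact: rot_gen_lin.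
have hU := Z0 Vw Uw; have hV := Z0 Uw Vw.
rewrite (derive_form_lin _ o_tube (feta Vw) lX tq) in hU.
rewrite (derive_form_lin _ o_tube (feta Uw) lX tq) in hV.
have XU : X Uw = - Vw.
  rewrite rot_genX /Uw /in_w col_mxKd col_mxKu (lin_fun0 Jmx_lin) (lin_fun0 in_y_lin) sub0r -/(in_w _).
  by congr (- in_w _); apply: mxP2 => k; rewrite (ord1 k) Jmx0 Jmx1 !mxE /= ?oppr0.
have XV : X Vw = Uw.
  rewrite rot_genX /Vw /in_w col_mxKd col_mxKu (lin_fun0 Jmx_lin) (lin_fun0 in_y_lin) sub0r -/(in_w _).
  rewrite -(lin_funN in_w_lin).
  by congr (in_w _); apply: mxP2 => k; rewrite (ord1 k) !mxE /=; split; ring.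
rewrite XU (lin_funN (lin_eta _ Dq)) etaxx // oppr0 addr0 in hU.
rewrite XV etaxx // addr0 in hV.
rewrite hU addr0.
have -> : 'D_Vw (fun q' => eta q' (X q) Uw) q = 0; last by rewrite addr0.
rewrite -[RHS]oppr0 -hV -deriveN; last exact: diff_derivable (dd tq ((feta Uw).2 (X q))).
by apply: near_eq_derive; apply: (open_near_eq o_tube) => // y /[!inE] -[Dy _]; exact: anti.
Qed.

(** As X preserves both W and eta(Uw, Vw), only the constant a of gam(X) survives in [lint_gX]; what
    remains is a c times the integral of K, which is negative. *)
Lemma gauge_dichotomy : a = 0 \/ c = 0.
Proof.
have lX : lin_fun X by exact: rot_gen_lin.
have cGg : Ck 1 tube (fun q => G2 q * g1 q) by exact: (Ck_mul o_tube).
have z : lint (fun q => W q * 'D_(X q) (fun q => G2 q * g1 q) q) = 0.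
  apply: (lint_parts o_tube oBW ABW C1c_W W_B cGg); first exact: lint_lin0 (ltrace_rot_gen _).
  by move=> q _; rewrite (DW_perp (perp_X q)) mul0r.
have aG : adm (fun q => W q * 'D_(X q) (fun q => G2 q * g1 q) q).
  exact: (adm_cut_D o_tube oBW ABW C1c_W W_B cGg lX).
have := lint_gX.
have -> : (fun q => W q * (gam q (X q) * g1 q)) =
   fun q => a * (W q * g1 q) + W q * 'D_(X q) (fun q => G2 q * g1 q) q.
  apply/funext => q.
  have [tq|Bq] : tube q \/ BW q by have : (tube `|` BW) q by rewrite ABW.
    rewrite derive_prod; [|exact: dd|exact: dd].
    by rewrite Xg1 // gX //; ring.
  by rewrite W_B // !mul0r mulr0 addr0.
rewrite lintD //; last exact: admZ.
rewrite z addr0 lintZ // lint_Wg1 mulrA => /eqP.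
rewrite mulf_eq0 (lt_eqF lint_K) orbF mulf_eq0 => /orP[/eqP|/eqP]; by [left|right].
Qed.

End GaugeDichotomy.

(** * The reduced symplectic form *)

Section ExteriorCalculus.
Context {R : realType} {m : nat}.
Local Notation E := 'M[R]_(m, 2).
Implicit Types (A : set E) (b : E -> E -> R).

Lemma derive_sub (V : normedModType R) (f g : V -> R) x v : differentiable f x -> differentiable g x ->
  'D_v (fun x => f x - g x) x = 'D_v f x - 'D_v g x.
Proof.
move=> df dg; rewrite -[fun x => _]/(f - g) deriveB //; exact: diff_derivable.
Qed.

Lemma derive_mul (V : normedModType R) (f g : V -> R) x v : differentiable f x -> differentiable g x ->
  'D_v (fun x => f x * g x) x = f x * 'D_v g x + 'D_v f x * g x.
Proof.
move=> df dg; rewrite -[fun x => _]/(f * g) deriveM; [|exact: diff_derivable|exact: diff_derivable].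
by congr (_ + _); exact: mulrC.
Qed.

Lemma derive_add (V : normedModType R) (f g : V -> R) x v : differentiable f x -> differentiable g x ->
  'D_v (fun x => f x + g x) x = 'D_v f x + 'D_v g x.
Proof.
move=> df dg; rewrite -[fun x => _]/(f + g) deriveD //; exact: diff_derivable.
Qed.

Lemma eq_derive (V : normedModType R) (A : set V) (f g : V -> R) x v : open A -> A x ->
  (forall y, A y -> f y = g y) -> 'D_v f x = 'D_v g x.
Proof.
move=> oA Ax fg; apply: near_eq_derive; apply: (open_near_eq oA) => // y /[!inE]; exact: fg.
Qed.

Definition form2m k A (eta : E -> E -> E -> R) := [/\ forall u, form1 k A (fun q => eta q u),
  forall q u v, A q -> eta q u v = - eta q v u &
  forall q u v w, A q -> 'D_u (fun q => eta q v w) q + 'D_v (fun q => eta q w u) q +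
     'D_w (fun q => eta q u v) q = 0].

Let cyclic_cancel (a b c a' b' c' : R) : a = a' -> b = b' -> c = c' ->
  a - b + (c - a') + (b' - c') = 0.
Proof. by move=> -> -> ->; ring. Qed.

Lemma dform_form2m k A b : open A -> form1 k.+2 A b -> form2m k.+1 A (dform b).
Proof.
move=> oA fb; have [lb cb] := fb; have fb1 : form1 1 A b by exact: form1_le fb.
split=> [u|q u v _|q u v w Aq].
- split=> [q Aq|v]; first exact: (@dform_lin R m 0 A b q u fb1 oA Aq).
  exact: (dform_Ck _ _ oA fb).
- exact: dformC.
have c2 x : Ck 2 A (b^~ x) by exact: Ck_le (cb x).
have dd x y : differentiable (fun q => 'D_x (b^~ y) q) q by exact: Ck_diff (Ck_derive x (c2 y)) Aq.
rewrite /dform !derive_sub //.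
have e1 := derive_swap u v oA (c2 w) Aq; have e2 := derive_swap u w oA (c2 v) Aq.
have e3 := derive_swap v w oA (c2 u) Aq.
exact: (cyclic_cancel e1 e2 e3).
Qed.

Context {n : nat}.
Local Notation F := 'M[R]_(n, 2).
Implicit Types (u : E -> F) (c : E -> F).

(** Pullback by u of a one-form on E encoded by the vector c. With c = psi u / 2 it is the cut
    radial primitive of omega, with c = G(u) v the form that carries the derivative of G along v. *)
Definition pform u c q a : R := omega_st (c q) ('D_a u q).

Lemma derive_omega (f g : E -> F) q a : (forall i j, differentiable (fun q => f q i j) q) ->
  (forall i j, differentiable (fun q => g q i j) q) ->
  'D_a (fun q => omega_st (f q) (g q)) q = omega_st ('D_a f q) (g q) + omega_st (f q) ('D_a g q).
Proof.
move=> df dg; rewrite (derive_mxE _ df) (derive_mxE _ dg) /omega_st.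
have d1 (j : 'I_n) : differentiable (fun q => f q j 0 * g q j 1 - f q j 1 * g q j 0) q.
  by apply: differentiableB; apply: differentiableM.
have [_ ->] := @derive_fsum _ _ _ (index_enum _) xpredT
  (fun (j : 'I_n) q => f q j 0 * g q j 1 - f q j 1 * g q j 0) q a (fun j _ => d1 j).
rewrite -big_split; apply: eq_bigr => j _ /=.
rewrite derive_sub; [|exact: differentiableM|exact: differentiableM].
by rewrite !derive_mul // !mxE; ring.
Qed.

Let add_cancel (a b c : R) : a + c - (b + c) = a - b.
Proof. by ring. Qed.

Section PForm.
Variables (A : set E) (u c : E -> F).
Hypothesis oA : open A.
Hypothesis cu : forall i j, Ck 4 A (fun q => u q i j).

Let du q : A q -> forall i j, differentiable (fun q => u q i j) q.
Proof. by move=> Aq i j; exact: Ck_diff (cu i j) Aq. Qed.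

Let DuE q a i j : A q -> ('D_a u q) i j = 'D_a (fun q => u q i j) q.
Proof. by move=> Aq; rewrite (derive_mxE _ (du Aq)) mxE. Qed.

Lemma Ck_Du k a i j : (k <= 3)%N -> Ck k A (fun q => ('D_a u q) i j).
Proof.
move=> k3; apply: (Ck_ext oA (f := fun q => 'D_a (fun q => u q i j) q)).
  by move=> q /[!inE] Aq; rewrite DuE.
by apply: Ck_derive; exact: Ck_le (cu i j).
Qed.

Lemma Du_lin q : A q -> lin_fun (fun a => 'D_a u q).
Proof. by move=> Aq; apply: derive_lin_fun; exact: (differentiable_mx (du Aq)). Qed.

Lemma Ck_omega k (f g : E -> F) : (forall i j, Ck k A (fun q => f q i j)) ->
  (forall i j, Ck k A (fun q => g q i j)) -> Ck k A (fun q => omega_st (f q) (g q)).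
Proof.
move=> cf cg; apply: (Ck_fsum _ oA) => j _; apply: (Ck_minus oA); exact: (Ck_mul oA).
Qed.

Lemma pform_form1 k : (k <= 3)%N -> (forall i j, Ck k A (fun q => c q i j)) ->
  form1 k A (pform u c).
Proof.
move=> k3 cc; split=> [q Aq|v].
  by move=> a x y; rewrite /pform (Du_lin Aq) omegaDr omegaZr scaleRE.
by apply: Ck_omega => // i j; exact: Ck_Du.
Qed.

(* the second derivatives of u cancel by Schwarz *)
Lemma dform_pform q a a' : A q -> (forall i j, Ck 1 A (fun q => c q i j)) ->
  dform (pform u c) q a a' = omega_st ('D_a c q) ('D_a' u q) - omega_st ('D_a' c q) ('D_a u q).
Proof.
move=> Aq cc; have dc i j : differentiable (fun q => c q i j) q by exact: Ck_diff (cc i j) Aq.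
have dDu x i j : differentiable (fun q => ('D_x u q) i j) q.
  by apply: Ck_diff (Ck_Du x i j _) Aq; exact: (isT : (1 <= 3)%N).
have H x y : 'D_x (fun q => pform u c q y) q =
    omega_st ('D_x c q) ('D_y u q) + omega_st (c q) ('D_x (fun q => 'D_y u q) q).
  exact: (derive_omega x dc (dDu y)).
apply: etrans (f_equal2 (fun x y : R => x - y) (H a a') (H a' a)) _.
suff -> : 'D_a (fun q => 'D_a' u q) q = 'D_a' (fun q => 'D_a u q) q.
  exact: add_cancel.
have H' x y : 'D_x (fun q => 'D_y u q) q = \matrix_(i, j) 'D_x (fun q => 'D_y (fun q => u q i j) q) q.
  apply: etrans (derive_mxE x (dDu y)) _; apply/matrixP => i j; rewrite [LHS]mxE [RHS]mxE.
  by apply: (eq_derive _ oA Aq) => z Az; exact: DuE.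
apply: etrans (H' a a') (etrans _ (esym (H' a' a))); apply/matrixP => i j; rewrite [LHS]mxE [RHS]mxE.
by apply: (derive_swap a a' oA _ Aq); exact: Ck_le (cu i j).
Qed.

End PForm.

(** The symplectic trace of the product of two linear forms does not depend on the symplectic basis;
    here the basis is the image of the standard one under L. *)
Lemma omega_trace (L : F -> F) (p r : F) : symp_lin L ->
  \sum_(k < n) (omega_st p (L (delta_mx k 0)) * omega_st r (L (delta_mx k 1)) -
    omega_st p (L (delta_mx k 1)) * omega_st r (L (delta_mx k 0))) = omega_st p r.
Proof.
move=> sL; have [T tT LT] := symp_transv sL.
have [S tS TS] := transv_inv tT; have [S' _ SS'] := transv_inv tS.
have LS x : L (S x) = x.
  by rewrite LT -[T (S x)]SS' TS SS'.
have -> : omega_st p r = omega_st (S p) (S r) by rewrite -[RHS]sL.2 !LS.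
rewrite [RHS]/omega_st; apply: eq_bigr => k _.
have H x y : omega_st x (L y) = omega_st (S x) y by rewrite -{1}(LS x) sL.2.
by rewrite !H !omega_delta0 !omega_delta1; ring.
Qed.

End ExteriorCalculus.

Section ReducedForm.
Context {R : realType} {n : nat}.
Local Notation Q := 'M[R]_(1 + n, 2).
Local Notation E := 'M[R]_(n, 2).
Implicit Types (q : Q) (z : E).
Local Notation X := (rot_gen (@epsX R n)).

Let oQ : open (Qdom : set Q). Proof. exact: open_Qdom. Qed.

Lemma form2_form2m k A eta : form2 k A eta <-> @form2m R (1 + n) k A eta.
Proof. by []. Qed.

(** The square of the factor by which z has to be stretched to reach |z|^2 - |w|^2 = 1. *)
Definition fh q : R := (1 + sqw q) / sqy q.

(* the pullback of the primitive of omega on C^n x C under the retraction of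
   Qdom onto the level set |z|^2 - |w|^2 = 1 *)
Definition lamh q (v : Q) : R :=
  2^-1 * (fh q * omega_st (dsubmx q) (dsubmx v) + omega_st (usubmx q) (usubmx v)).

Definition omh := dform lamh.

Lemma Qdom_neq0 q : Qdom q -> sqy q != 0.
Proof. by move=> Dq; rewrite gt_eqF. Qed.

Lemma Ck_fh k : Ck k Qdom fh.
Proof.
apply: (Ck_mul oQ); last by apply: CkV => //; [exact: Qdom_neq0|apply: Ck_sub (Ck_sqy k)].
by apply: (Ck_add oQ); [exact: Ck_cst|apply: Ck_sub (Ck_sqw k)].
Qed.

Lemma lamh_form1 k : form1 k Qdom lamh.
Proof.
split=> [q Dq a u v|v].
  by rewrite /lamh dsubmx_lin usubmx_lin !omegaDr !omegaZr scaleRE; ring.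
apply: (Ck_scale oQ); apply: (Ck_add oQ); first apply: (Ck_mul oQ).
- exact: Ck_fh.
- by apply: Ck_lin_fun => a x y; rewrite dsubmx_lin omegaDl omegaZl scaleRE.
- by apply: Ck_lin_fun => a x y; rewrite usubmx_lin omegaDl omegaZl scaleRE.
Qed.

Lemma omh_form2 k : form2 k Qdom omh.
Proof.
have [h1 h2 h3] := dform_form2m oQ (lamh_form1 k.+2); split=> // u.
exact: form1_le (h1 u).
Qed.

Lemma omega_J (m : nat) (y v : 'M[R]_(m, 2)) : omega_st (Jmx y) v = - dot y v.
Proof. by rewrite omega_dot JJ dotC (lin_funN (dot_lin _)) dotC. Qed.
Lemma omegaJr (m : nat) (y v : 'M[R]_(m, 2)) : omega_st v (Jmx y) = dot v y.
Proof. by rewrite omega_st_antisym omega_J opprK dotC. Qed.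

(** This constant fixes the scale: c = 1/2 in [trace_level] corresponds to the trace - n vol B_1,
    the contribution of the removed ball. *)
Lemma lamh_X q : Qdom q -> lamh q (X q) = 2^-1.
Proof.
move=> Dq; rewrite /lamh rot_genX (lin_funB dsubmx_lin) (lin_funB usubmx_lin).
rewrite /in_y /in_w !col_mxKd !col_mxKu subr0 sub0r omegaNr !omegaJr !dotzz -/(sqy q) -/(sqw q).
by rewrite /fh divfK ?Qdom_neq0 //; field.
Qed.

Lemma dsqy q v : differentiable (@sqy R n) q /\ 'D_v (@sqy R n) q = 2 * dot (dsubmx q) (dsubmx v).
Proof.
have [d D] := lin_fun_diff q (@dsubmx_lin R n).
have [d' D'] := derive_sqn (dsubmx q) (dsubmx v).
split; first exact: (differentiable_comp d d').
by rewrite (derive_compE v d d') D D'.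
Qed.
Lemma dsqw q v : differentiable (@sqw R n) q /\ 'D_v (@sqw R n) q = 2 * dot (usubmx q) (usubmx v).
Proof.
have [d D] := lin_fun_diff q (@usubmx_lin R n).
have [d' D'] := derive_sqn (usubmx q) (usubmx v).
split; first exact: (differentiable_comp d d').
by rewrite (derive_compE v d d') D D'.
Qed.

Lemma derive_fh q v : Qdom q -> 'D_v fh q =
  2 * dot (usubmx q) (usubmx v) / sqy q - fh q * (2 * dot (dsubmx q) (dsubmx v)) / sqy q.
Proof.
move=> Dq; have y0 := Qdom_neq0 Dq; have [d1 D1] := dsqy q v; have [d2 D2] := dsqw q v.
have E1 : 'D_v (fun q => sqy q * fh q) q = 2 * dot (usubmx q) (usubmx v).
  have dc : differentiable (cst 1 : Q -> R) q by exact: differentiable_cst.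
  rewrite -D2 -[RHS]add0r -(derive_cst (V := Q) (1 : R) q v) -(derive_add v dc d2).
  by apply: (eq_derive _ oQ Dq) => x Dx; rewrite mulrC /fh divfK // Qdom_neq0.
have dF : differentiable fh q by exact: Ck_diff (Ck_fh 1) Dq.
rewrite derive_mul // D1 in E1; rewrite -E1; field; exact: y0.
Qed.

Let half_sub (h a b a' b' x y : R) : 2^-1 * (a * b + h * x + y) - 2^-1 * (a' * b' + h * - x + - y) =
  2^-1 * (a * b - a' * b') + h * x + y.
Proof. by field. Qed.

Lemma omhE q u v : Qdom q -> omh q u v =
  2^-1 * ('D_u fh q * omega_st (dsubmx q) (dsubmx v) - 'D_v fh q * omega_st (dsubmx q) (dsubmx u))
  + fh q * omega_st (dsubmx u) (dsubmx v) + omega_st (usubmx u) (usubmx v).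
Proof.
move=> Dq; have dF : differentiable fh q by exact: Ck_diff (Ck_fh 1) Dq.
have H x y : 'D_x (lamh^~ y) q = 2^-1 * ('D_x fh q * omega_st (dsubmx q) (dsubmx y) +
    fh q * omega_st (dsubmx x) (dsubmx y) + omega_st (usubmx x) (usubmx y)).
  have l1 : lin_fun (fun q : Q => omega_st (dsubmx q) (dsubmx y)).
    by move=> a s t; rewrite dsubmx_lin omegaDl omegaZl scaleRE.
  have l2 : lin_fun (fun q : Q => omega_st (usubmx q) (usubmx y)).
    by move=> a s t; rewrite usubmx_lin omegaDl omegaZl scaleRE.
  have [d1 D1] := lin_fun_diff q l1; have [d2 D2] := lin_fun_diff q l2.
  have d3 := differentiableM dF d1.
  rewrite /lamh derive_mul; [|exact: differentiable_cst|exact: differentiableD].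
  rewrite derive_cst mul0r addr0 derive_add // derive_mul // D1 D2; ring.
rewrite /omh /dform !H (omega_st_antisym (dsubmx v) (dsubmx u)) (omega_st_antisym (usubmx v) (usubmx u)).
exact: half_sub.
Qed.

Lemma omh_X q v : Qdom q -> omh q (X q) v = 0.
Proof.
move=> Dq; have y0 := Qdom_neq0 Dq; rewrite omhE // !derive_fh //.
rewrite rot_genX (lin_funB dsubmx_lin) (lin_funB usubmx_lin).
rewrite /in_y /in_w !col_mxKd !col_mxKu subr0 sub0r (lin_funN (dot_lin _)) !dotJ omegaNl !omega_J.
by rewrite omegaJr dotzz -/(sqy q); field; exact: y0.
Qed.

Let zero_cancel (a b c d : R) : 2^-1 * (a * 0 - b * 0) + c * 0 + d = d.
Proof. by rewrite !mulr0 subrr mulr0 !add0r. Qed.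

Lemma ytrace_omh z : 1 < sqn z -> ytrace omh (iota z) = n%:R.
Proof.
move=> z1; have Dz : Qdom (iota z : Q) by rewrite /Qdom /= iota_sqy (lt_trans ltr01).
have f1 : fh (iota z : Q) = 1.
  by rewrite /fh iota_sqw ?ltW // iota_sqy addrC subrK divff // gt_eqF // (lt_trans ltr01).
have z0 : sqn z != 0 by rewrite gt_eqF // (lt_trans ltr01).
rewrite /ytrace.
have o0 m (x : 'M[R]_(m, 2)) : omega_st x 0 = 0 by exact: (lin_fun0 (omega_lin_r x)).
have -> : omh (iota z) Uw Vw = 1.
  have dw (w : 'M[R]_(1, 2)) : dsubmx (in_w w : Q) = 0 by exact: col_mxKd.
  have uw (w : 'M[R]_(1, 2)) : usubmx (in_w w : Q) = w by exact: col_mxKu.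
  rewrite omhE // (dw (delta_mx 0 0)) (dw (delta_mx 0 1)) !uw o0 o0.
  by apply: etrans (zero_cancel _ _ _ _) _; rewrite omega_ef eqxx.
have H k : omh (iota z) (in_y (delta_mx k 0)) (in_y (delta_mx k 1)) = 1 - csq z k / sqn z.
  rewrite omhE // !derive_fh // f1 iota_sqy iota_y iota_w /in_y !col_mxKd !col_mxKu.
  rewrite !(lin_fun0 (dot_lin _)) !o0 omega_ef eqxx omega_delta0 omega_delta1 dot_e0 dot_e1.
  by rewrite /csq /=; field; exact: z0.
rewrite (eq_bigr _ (fun k _ => H k)) sumrB sumr_const card_ord -mulr_suml -/(sqn z) divff //.
by rewrite subrK.
Qed.

(** Invariance under X again trades J z for a multiple of Vw, which turns the poles of [diota] into
    the single term on (Uw, Vw). *)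
Lemma ytrace_iota (eta : Q -> Q -> Q -> R) z : 1 < sqn z ->
  (forall u, lin_fun (eta (iota z) u)) -> (forall u v, eta (iota z) u v = - eta (iota z) v u) ->
  (forall v, eta (iota z) (X (iota z)) v = 0) ->
  ytrace eta (iota z) = \sum_(k < n) eta (iota z) (diota z (delta_mx k 0)) (diota z (delta_mx k 1)).
Proof.
move=> z1 le an iX; have w0 : cut_wr z != 0 by rewrite gt_eqF // cut_wr_gt0.
have E1 u v : eta (iota z) (diota z u) (diota z v) = eta (iota z) (in_y u) (in_y v) +
    (dot z u / cut_wr z * eta (iota z) Uw (in_y v) - dot z v / cut_wr z * eta (iota z) Uw (in_y u)).
  have UU : eta (iota z) Uw Uw = 0 by have := an Uw Uw; lra.
  rewrite /diota le scaleRE (an _ Uw) (an _ (in_y v)) !le !scaleRE UU (an (in_y v) Uw) (an (in_y v) (in_y u)).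
  ring.
rewrite (eq_bigr _ (fun k _ => E1 _ _)) big_split /=; congr (_ + _).
transitivity ((cut_wr z)^-1 * eta (iota z) Uw (in_y (Jmx z))).
  have -> : in_y (Jmx z) = X (iota z) + cut_wr z *: Vw by rewrite rot_genX_iota subrK.
  by rewrite (lin_funD (le _)) (lin_funZ (le _)) scaleRE (an Uw (X (iota z))) iX oppr0 add0r mulKf.
rewrite J_sum (lin_fun_sum in_y_lin) (lin_fun_sum (le _)) mulr_sumr; apply: eq_bigr => k _.
rewrite (lin_funB in_y_lin) !(lin_funZ in_y_lin) (lin_funB (le _)) !(lin_funZ (le _)) !scaleRE.
by rewrite dot_e0 dot_e1; ring.
Qed.

End ReducedForm.

(** * Restriction to C x C^2 *)

Section Slice.
Context {R : realType} {k : nat}.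
Local Notation n := (2 + k)%N.
Local Notation Q := 'M[R]_(1 + n, 2).
Local Notation Q2 := 'M[R]_(1 + 2, 2).
Implicit Types (q u v : Q2).

(** The class is already visible on one line of the exceptional divisor, that is, on two of the
    coordinates of z; there quaternionic fields exist and four-forms have top degree on the
    quotient. *)
Definition slice q : Q := col_mx (usubmx q) (col_mx (dsubmx q) (0 : 'M[R]_(k, 2)) : 'M[R]_(2 + k, 2)).

Lemma slice_lin : lin_fun slice.
Proof.
move=> a u v; rewrite /slice usubmx_lin dsubmx_lin scale_col_mx add_col_mx; congr col_mx.
by rewrite scale_col_mx add_col_mx scaler0 addr0.
Qed.

Lemma slice_w q : usubmx (slice q) = usubmx q. Proof. exact: col_mxKu. Qed.
Lemma slice_y q : dsubmx (slice q) = col_mx (dsubmx q) (0 : 'M[R]_(k, 2)) :> 'M[R]_(2 + k, 2).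
Proof. exact: col_mxKd. Qed.

Lemma slice_sqw q : sqw (slice q) = sqw q. Proof. by rewrite /sqw slice_w. Qed.
Lemma slice_wre q : wre (slice q) = wre q. Proof. by rewrite /wre slice_w. Qed.

Lemma csq_col (a b : nat) (x : 'M[R]_(a, 2)) (y : 'M[R]_(b, 2)) : sqn (col_mx x y) = sqn x + sqn y.
Proof.
rewrite /sqn big_split_ord /=; congr (_ + _); apply: eq_bigr => i _.
  by rewrite /csq !col_mxEu.
by rewrite /csq !col_mxEd.
Qed.

Lemma slice_sqy q : sqy (slice q) = sqy q.
Proof.
rewrite /sqy slice_y; apply: etrans (csq_col _ _) _.
by rewrite [X in _ + X]big1 ?addr0 // => i _; rewrite /csq !mxE expr0n addr0.
Qed.

Lemma slice_dom q : Qdom q -> Qdom (slice q).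
Proof. by rewrite /Qdom /= slice_sqy. Qed.

Lemma slice_in_w w : slice (in_w w) = in_w w.
Proof.
rewrite /slice /in_w col_mxKu col_mxKd; congr col_mx.
by apply/matrixP => i j; rewrite [RHS]mxE; case: (split_ordP i) => a ->; rewrite ?col_mxEu ?col_mxEd mxE.
Qed.

Lemma Jmx_col (a b : nat) (x : 'M[R]_(a, 2)) (y : 'M[R]_(b, 2)) :
  Jmx (col_mx x y) = col_mx (Jmx x) (Jmx y).
Proof.
apply: mxP2 => i; rewrite Jmx0 Jmx1; case: (split_ordP i) => j ->.
  by rewrite !col_mxEu Jmx0 Jmx1.
by rewrite !col_mxEd Jmx0 Jmx1.
Qed.

Lemma slice_X q : slice (rot_gen (@epsX R 2) q) = rot_gen (@epsX R n) (slice q).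
Proof.
rewrite !rot_genX slice_w slice_y (lin_funB slice_lin) slice_in_w; congr (_ - _).
rewrite /slice /in_y col_mxKu col_mxKd; congr col_mx.
by rewrite [RHS](@Jmx_col 2 k) (lin_fun0 Jmx_lin).
Qed.

Lemma derive_slice (F : Q -> R) q v : differentiable F (slice q) ->
  'D_v (fun q => F (slice q)) q = 'D_(slice v) F (slice q).
Proof.
move=> dF; have [d D] := lin_fun_diff q slice_lin.
by rewrite (derive_compE v d dF) D.
Qed.

Lemma Ck_slice l (A : set Q) (B : set Q2) (F : Q -> R) : open B ->
  (forall q, B q -> A (slice q)) -> Ck l A F -> Ck l B (fun q => F (slice q)).
Proof.
move=> oB BA cF; apply: (Ck_comp oB _ cF BA) => i j.
by apply: Ck_lin_fun => a u v; rewrite slice_lin !mxE.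
Qed.

Let oQ2 : open (Qdom : set Q2). Proof. exact: open_Qdom. Qed.

Lemma slice_form1 l (b : Q -> Q -> R) : form1 l Qdom b -> form1 l Qdom (fun q v => b (slice q) (slice v)).
Proof.
move=> [lb cb]; split=> [q Dq a u v|v].
  by rewrite slice_lin (lb _ (slice_dom Dq)).
by apply: (Ck_slice oQ2 slice_dom (cb _)).
Qed.

Lemma slice_form2 (eta : Q -> Q -> Q -> R) : form2 1 Qdom eta ->
  form2 1 Qdom (fun q u v => eta (slice q) (slice u) (slice v)).
Proof.
move=> [h1 h2 h3]; split=> [u|q u v Dq|q u v w Dq].
- exact: slice_form1 (h1 (slice u)).
- by apply: h2; exact: slice_dom.
have d (x y : Q) : differentiable (fun q' : Q => eta q' x y) (slice q) by exact: Ck_diff ((h1 x).2 y) (slice_dom Dq).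
rewrite (derive_slice u (d _ _)) (derive_slice v (d _ _)) (derive_slice w (d _ _)).
by apply: h3; exact: slice_dom.
Qed.

Lemma slice_shiftU L s q : slice (shiftU L s q) = shiftU L s (slice q).
Proof. by rewrite /shiftU (lin_funD slice_lin) (lin_funZ slice_lin) slice_in_w. Qed.

Lemma slice_prim L (eta : Q -> Q -> Q -> R) q v :
  prim_form L (fun q u v => eta (slice q) (slice u) (slice v)) q v = prim_form L eta (slice q) (slice v).
Proof.
rewrite /prim_form /prim; congr (_ * _); apply: eq_int01 => s _.
by rewrite slice_shiftU slice_in_w.
Qed.

Variables (eta1 eta2 : Q -> Q -> Q -> R) (l : R).
Hypothesis l0 : 0 < l.
Hypothesis f1 : form2 1 Qdom eta1.
Hypothesis f2 : form2 1 Qdom eta2.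
Hypothesis eta10 : forall (q u v : Q), Qdom q -> l ^+ 2 < sqw q -> eta1 q u v = 0.
Hypothesis eta20 : forall (q u v : Q), Qdom q -> l ^+ 2 < sqw q -> eta2 q u v = 0.
Hypothesis iX1 : forall (q v : Q), Qdom q -> eta1 q (rot_gen epsX q) v = 0.
Hypothesis iX2 : forall (q v : Q), Qdom q -> eta2 q (rot_gen epsX q) v = 0.
Hypothesis alt : forall q : Q, Qdom q ->
  (forall u v : Q, eta1 q u v = 0) \/ (forall u v : Q, eta2 q u v = omh q u v).

Let L : R := 6 * l.
Let n_gt0 : (0 < n)%N. Proof. by []. Qed.
Let tube : set Q2 := Qdom `&` [set q | sqw q < (5 * l) ^+ 2].
Let o_tube : open tube. Proof. by apply: openI; [exact: open_Qdom|exact: open_sqw]. Qed.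
Let tube_slice q : tube q -> (Qdom `&` [set q | sqw q < (5 * l) ^+ 2]) (slice q).
Proof. by move=> [h1 h2]; split; [exact: slice_dom|rewrite /= slice_sqw]. Qed.

Let sub_sub (a b c d : R) : a - b - (c - d) = a - c - (b - d).
Proof. by ring. Qed.

(** Primitives commute with [slice], so the constants c1 and c2 computed on the slice are those that
    govern the traces in dimension n. The form [gam] is [lamh] minus the primitive of eta2, hence a
    = 1/2 - c2. *)
Lemma trace_dichotomy : lint (on_out (fun z => ytrace eta1 (iota z))) = 0 \/
  lint (on_out (fun z => ytrace eta2 (iota z))) = - (n%:R * @ball_vol R n).
Proof.
have [c1 [G1 cG1 bX1]] := prim_gauge f1 l0 eta10 iX1 n_gt0.
have [c2 [G2 cG2 bX2]] := prim_gauge f2 l0 eta20 iX2 n_gt0.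
have T1 := trace_prim f1 l0 eta10 iX1 cG1 bX1.
have T2 := trace_prim f2 l0 eta20 iX2 cG2 bX2.
have X0 q : slice (rot_gen epsX q) = rot_gen epsX (slice q) := slice_X q.
pose eta q u v := eta1 (slice q) (slice u) (slice v).
have fe : form2 1 Qdom eta by exact: slice_form2.
have e0 q u v : Qdom q -> l ^+ 2 < sqw q -> eta q u v = 0.
  by move=> Dq hq; apply: eta10; [exact: slice_dom|rewrite slice_sqw].
have iX q v : Qdom q -> eta q (rot_gen epsX q) v = 0.
  by move=> Dq; rewrite /eta X0 iX1 //; exact: slice_dom.
pose b := prim_form L eta.
pose b2 (q v : Q2) := prim_form L eta2 (slice q) (slice v).
pose gam q v := lamh (slice q) (slice v) - b2 q v.
have fb2 : form1 1 Qdom b2 by apply: slice_form1; exact: prim_form1.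
have flam : form1 1 Qdom (fun q v => lamh (slice q) (slice v)) by apply: slice_form1; exact: lamh_form1.
have fgam : form1 1 Qdom gam.
  split=> [q Dq a u v|v].
    by rewrite /gam (flam.1 q Dq) (fb2.1 q Dq) !scaleRE; ring.
  by apply: (Ck_minus oQ2); [exact: flam.2|exact: fb2.2].
have diff_slice (F : Q -> R) q v : Qdom q -> Ck 1 Qdom F -> 'D_v (fun q => F (slice q)) q = 'D_(slice v) F (slice q).
  by move=> Dq cF; apply: derive_slice; exact: Ck_diff cF (slice_dom Dq).
have dgam q u v : Qdom q -> - (5 * l) < wre q ->
    dform gam q u v = omh (slice q) (slice u) (slice v) - eta2 (slice q) (slice u) (slice v).
  move=> Dq wq; rewrite -(dprim_form f2 l0 eta20) ?slice_wre //; last exact: slice_dom.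
  have h x y : 'D_x (gam^~ y) q = 'D_(slice x) (lamh^~ (slice y)) (slice q) -
      'D_(slice x) ((prim_form L eta2)^~ (slice y)) (slice q).
    rewrite derive_sub; [|exact: Ck_diff (flam.2 y) Dq|exact: Ck_diff (fb2.2 y) Dq].
    apply: (f_equal2 (fun x y : R => x - y)).
      exact: (diff_slice (lamh^~ (slice y)) q x Dq ((lamh_form1 1).2 (slice y))).
    exact: (diff_slice ((prim_form L eta2)^~ (slice y)) q x Dq ((prim_form1 l f2).2 (slice y))).
  apply: etrans (f_equal2 (fun x y : R => x - y) (h u v) (h v u)) _; rewrite /omh /dform.
  exact: sub_sub.
have cGs (G : Q -> R) : Ck 1 (Qdom `&` [set q | sqw q < (5 * l) ^+ 2]) G -> Ck 1 tube (fun q => G (slice q)).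
  by move=> cG; apply: (Ck_slice o_tube tube_slice cG).
have DG (G : Q -> R) q v : Ck 1 (Qdom `&` [set q | sqw q < (5 * l) ^+ 2]) G -> tube q ->
    'D_v (fun q => G (slice q)) q = 'D_(slice v) G (slice q).
  by move=> cG tq; apply: derive_slice; exact: Ck_diff cG (tube_slice tq).
have [] := @gauge_dichotomy R b gam eta l c1 (2^-1 - c2) (fun q => G1 (slice q)) (fun q => - G2 (slice q)) l0.
- exact: prim_form1.
- exact: fe.
- by move=> q u Dq; have [h _ _] := fe; exact: (h u).1.
- by move=> q u v Dq wq; exact: (dprim_form fe l0 e0).
- exact: e0.
- by move=> q Dq; exact: (prim_form_U l fe Dq).
- by move=> q Dq lq wq; exact: (prim_avg0 fe l0 e0 Dq lq wq).
- exact: iX.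
- exact: cGs.
- move=> q [Dq hq]; rewrite /b slice_prim X0 bX1 ?slice_sqw //; last exact: slice_dom.
  by rewrite (DG G1 q _ cG1 (conj Dq hq)) X0.
- exact: fgam.
- by apply: (Ck_opp o_tube); exact: cGs.
- move=> q [Dq hq]; rewrite /gam /b2 X0 lamh_X; last exact: slice_dom.
  rewrite bX2 ?slice_sqw //; last exact: slice_dom.
  have -> : 'D_(rot_gen epsX q) (fun q => - G2 (slice q)) q = - 'D_(rot_gen epsX (slice q)) G2 (slice q).
    rewrite -X0 -(DG G2 q _ cG2 (conj Dq hq)) -[fun q => - _]/(- (fun q => G2 (slice q))).
    rewrite deriveN //; apply: diff_derivable.
    exact: Ck_diff (cGs _ cG2) (conj Dq hq).
  by rewrite opprD addrA.
- move=> q [Dq hq]; case: (alt (slice_dom Dq)) => h; [left => u v; exact: h|right => u v].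
  rewrite dgam ?h ?subrr //.
  exact: (tube_wre l0 hq).
- move=> h; right; rewrite T2; move/eqP: h; rewrite subr_eq0 => /eqP <-.
  by congr (- (_ * _)); field.
- by move=> h; left; rewrite T1 h mulr0 mul0r oppr0.
Qed.

End Slice.

(** * Local inverses of symplectic maps *)

Section SymplecticInverse.
Context {R : realType} {n : nat}.
Local Notation E := 'M[R]_(n, 2).
Implicit Types (x y v : E).

(** The symplectic adjoint: coordinates of y in the basis moved by L are read off by pairing. This
    inverse is linear in L, which gives the regularity of local inverses without Cramer's rule. *)
Definition symp_inv (L : E -> E) y : E := \matrix_(i, j)
  (if j == 0 then omega_st y (L (delta_mx i 1)) else - omega_st y (L (delta_mx i 0))).

Lemma symp_inv_lin L : lin_fun (symp_inv L).
Proof.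
by move=> a u v; apply: mxP2 => k; rewrite !mxE /= !omegaDl !omegaZl; split; ring.
Qed.

Lemma symp_invK L : symp_lin L -> cancel L (symp_inv L).
Proof.
move=> [_ sL] x; apply: mxP2 => k; rewrite !mxE /= !sL omega_delta0 omega_delta1.
by rewrite opprK.
Qed.

Lemma symp_invVK L : symp_lin L -> cancel (symp_inv L) L.
Proof.
move=> sL y; have [T tT LT] := symp_transv sL.
have [S tS TS] := transv_inv tT; have [S' _ SS'] := transv_inv tS.
have LS x : L (S x) = x by rewrite LT -[T (S x)]SS' TS SS'.
by rewrite -{1}(LS y) symp_invK.
Qed.

Lemma sqn_le_norm x : sqn x <= (2 * n)%:R * `|x| ^+ 2.
Proof.
apply: (@le_trans _ _ (\sum_(j < n) 2 * `|x| ^+ 2)).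
  apply: ler_sum => j _; rewrite /csq mulrDl mul1r; apply: lerD.
    by rewrite -real_normK ?num_real // lerXn2r ?nnegrE //; exact: mx_coord_le.
  by rewrite -real_normK ?num_real // lerXn2r ?nnegrE //; exact: mx_coord_le.
by rewrite sumr_const card_ord -[X in X <= _]mulr_natl mulrA natrM [n%:R * 2]mulrC.
Qed.

Lemma derive_at_min (f : E -> R) x v (r : R) : 0 < r -> differentiable f x ->
  (forall h, `|h| < r -> f x <= f (x + h)) -> 'D_v f x = 0.
Proof.
move=> r0 df fmin; have H w : 0 <= 'D_w f x.
  rewrite leNgt; apply/negP => D0; have [w0|w0] := eqVneq w 0.
    by move: D0; rewrite w0 derive0 ltxx.
  have e0 : 0 < - 'D_w f x / (2 * `|w|) by rewrite divr_gt0 ?oppr_gt0 // mulr_gt0 // normr_gt0.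
  have /near0_ball[d d0 dP] := derive_expand df e0.
  pose t := Num.min d r / (2 * `|w|).
  have m0 : 0 < Num.min d r by rewrite lt_min d0.
  have w1 : 0 < `|w| by rewrite normr_gt0.
  have t0 : 0 < t by rewrite divr_gt0 // mulr_gt0.
  have tw : `|t *: w| < Num.min d r.
    rewrite normrZ gtr0_norm // /t invfM mulrA mulfVK ?gt_eqF //.
    by rewrite ltr_pdivrMr // ltr_pMr // ltr1n.
  move: tw; rewrite lt_min => /andP[td tr].
  have := fmin _ tr; have := dP _ td.
  rewrite (lin_funZ (derive_lin_fun df)) scaleRE normrZ gtr0_norm // ler_norml => /andP[_].
  have -> : - 'D_w f x / (2 * `|w|) * (t * `|w|) = - (t * 'D_w f x) / 2 by field; rewrite gt_eqF.
  have : t * 'D_w f x < 0 by rewrite pmulr_rlt0.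
  lra.
apply/eqP; rewrite eq_le H andbT -oppr_ge0.
by rewrite -(lin_funN (derive_lin_fun df)) H.
Qed.

Variables (A : set E) (F : E -> E).
Hypothesis oA : open A.
Hypothesis cF : forall k i j, Ck k A (fun x => F x i j).
Hypothesis iF : forall x y, A x -> A y -> F x = F y -> x = y.
Hypothesis sF : forall x v w, A x -> omega_st ('D_v F x) ('D_w F x) = omega_st v w.

Let dF x : A x -> differentiable F x.
Proof. by move=> Ax; apply: differentiable_mx => i j; exact: Ck_diff (cF 1 i j) Ax. Qed.

Let sDF x : A x -> symp_lin (fun v => 'D_v F x).
Proof. by move=> Ax; split=> [|v w]; [exact: derive_lin_fun (dF Ax)|exact: sF]. Qed.

Let B x := symp_inv (fun v => 'D_v F x).

Let lower x : A x -> exists2 C : R, 0 < C & exists2 d : R, 0 < d &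
  (forall y, `|y - x| < d -> A y) /\
  forall h, `|h| < d -> `|h| <= C * `|F (x + h) - F x| /\
    `|B x (F (x + h) - F x) - h| <= `|h| / 2.
Proof.
move=> Ax; have [C C0 CP] := lin_fun_bound (symp_inv_lin (fun v => 'D_v F x)).
have e0 : 0 < (2 * C)^-1 by rewrite invr_gt0 mulr_gt0.
have /near0_ball[d d0 dP] := derive_expand (dF Ax) e0.
have [r r0 rA] := near_ball_open oA Ax.
exists (2 * C); first by rewrite mulr_gt0.
exists (Num.min d r); first by rewrite lt_min d0.
split=> [y|h]; first by rewrite lt_min => /andP[_]; exact: rA.
rewrite lt_min => /andP[hd hr]; have H := dP h hd.
have H2 : `|B x (F (x + h) - F x) - h| <= `|h| / 2.
  rewrite -{2}(symp_invK (sDF Ax) h) -(lin_funB (symp_inv_lin _)).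
  apply: le_trans (CP _) _; apply: le_trans (ler_wpM2l (ltW C0) H) _.
  by rewrite invfM mulrA mulrCA mulfV ?gt_eqF // mulr1 mulrC.
split=> //.
have h1 : `|h| <= `|B x (F (x + h) - F x)| + `|h| / 2.
  rewrite -{1}(subKr (B x (F (x + h) - F x)) h); apply: le_trans (ler_normB _ _) _.
  by rewrite lerD2l.
have h2 := CP (F (x + h) - F x).
have : `|B x (F (x + h) - F x)| <= C * `|F (x + h) - F x| by [].
rewrite -mulrA; lra.
Qed.

(** Minimizes the squared Euclidean distance from F to y on a closed ball. For y close to F x the
    minimum is interior, hence a critical point, and since the differential is onto the distance
    there is zero. *)
Lemma symp_open_map x (r : R) : A x -> 0 < r -> exists2 d : R, 0 < d &
  forall y, `|y - F x| < d -> exists2 x', A x' /\ `|x' - x| < r & F x' = y.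
Proof.
move=> Ax r0; have [C C0 [d d0 [dA dP]]] := lower Ax.
pose s := Num.min d r / 2; have m0 : 0 < Num.min d r by rewrite lt_min d0.
have s0 : 0 < s by rewrite divr_gt0.
have sm : s < Num.min d r by rewrite ltr_pdivrMr // ltr_pMr // ltr1n.
have [sd sr] : s < d /\ s < r by move: sm; rewrite lt_min => /andP[].
pose mu := s / C; have mu0 : 0 < mu by rewrite divr_gt0.
pose N : R := (2 * n)%:R; have N0 : 0 <= N by [].
(* Balls are in the maximum norm, but the function minimized is the Euclidean [sqn], at most N times
   the squared maximum norm. With this e the value at the centre is at most N e^2, and on the
   boundary at least (N + 1)^2 e^2. *)
pose e := mu / (N + 2); have N2 : 0 < N + 2 by rewrite ltr_wpDl.
have e0 : 0 < e by rewrite divr_gt0.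
have mE : mu = (N + 2) * e by rewrite /e mulrC divfK // gt_eqF.
exists e => // y ye.
pose f x' := sqn (F x' - y).
have df x' : A x' -> differentiable f x' /\ forall v, 'D_v f x' = 2 * dot (F x' - y) ('D_v F x').
  move=> Ax'; have dG : differentiable (fun x => F x - y) x'.
    by apply: differentiableB; [exact: dF|exact: differentiable_cst].
  have [d1 _] := derive_sqn (F x' - y) 0.
  split=> [|v]; first exact: (differentiable_comp dG d1).
  rewrite (derive_compE v dG d1); have [_ ->] := derive_sqn (F x' - y) ('D_v (fun x => F x - y) x').
  congr (2 * dot _ _); rewrite -[fun x => _]/(F - cst y).
  rewrite deriveB; [|exact: diff_derivable (dF Ax')|exact: derivable_cst].
  by rewrite derive_cst subr0.
pose K := [set h : E | `|h| <= s].
have K0 : K !=set0 by exists 0; rewrite /K /= normr0 ltW.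
have AK h : K h -> A (x + h).
  by move=> hK; apply: dA; rewrite addrC addKr; exact: le_lt_trans hK sd.
have cf : {within K, continuous (fun h => f (x + h))}.
  apply: continuous_in_subspaceT => h /[!inE] hK.
  have cx : continuous (fun h : E => x + h).
    move=> h'; have dx : differentiable (cst x + @id E) h'.
      by apply: differentiableD; [exact: differentiable_cst|exact: ex_diff].
    exact: (differentiable_continuous dx).
  apply: (@continuous_comp _ _ _ (fun h => x + h) f); first exact: cx.
  by apply: differentiable_continuous; have [] := df _ (AK _ hK).
have [h hK hmin] := compact_EVT_min K0 (compact_norm_ball (ltW s0)) cf.
rewrite inE in hK.
have fh : f (x + h) < (N + 1) ^+ 2 * e ^+ 2.
  have := hmin 0; rewrite inE addr0 => /(_ _)/le_lt_trans; apply.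
    by rewrite /K /= normr0 ltW.
  apply: le_lt_trans (sqn_le_norm _) _; rewrite distrC -/N.
  have h1 : `|y - F x| ^+ 2 < e ^+ 2 by rewrite ltrXn2r ?nnegrE // ltW.
  apply: (@le_lt_trans _ _ (N * e ^+ 2)); first by rewrite ler_wpM2l // ltW.
  rewrite ltr_pM2r ?exprn_gt0 //; nra.
have hs : `|h| < s.
  rewrite lt_neqAle hK andbT; apply/eqP => hs.
  have [h1 _] := dP h (le_lt_trans hK sd).
  have h2 : mu <= `|F (x + h) - F x| by rewrite /mu ler_pdivrMr // mulrC -hs.
  have h3 : (N + 1) * e <= `|F (x + h) - y|.
    have : `|F (x + h) - F x| <= `|F (x + h) - y| + `|y - F x|.
      by rewrite -{1}(subrKA y); exact: ler_normD.
    rewrite mE in h2; lra.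
  have h4 : ((N + 1) * e) ^+ 2 <= f (x + h).
    apply: le_trans (norm_sqn _); apply: lerXn2r h3; rewrite nnegrE //.
    by rewrite mulr_ge0 ?addr_ge0 // ltW.
  by move: fh; rewrite ltNge -exprMn h4.
have Ah := AK _ hK; exists (x + h); last first.
  have D0 v : 'D_v f (x + h) = 0.
    apply: (@derive_at_min f (x + h) v (s - `|h|)); first by rewrite subr_gt0.
      by have [] := df _ Ah.
    move=> k hk; rewrite -addrA; apply: hmin; rewrite inE /K /=.
    by apply: le_trans (ler_normD _ _) _; rewrite -lerBrDl ltW.
  have := D0 (B (x + h) (F (x + h) - y)); have [_ ->] := df _ Ah.
  rewrite (symp_invVK (sDF Ah)) dotzz => /eqP; rewrite mulf_eq0 pnatr_eq0 /= => /eqP w0.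
  apply/eqP; rewrite -subr_eq0; apply/negP => /negP /sqn_gt0.
  by rewrite w0 ltxx.
split=> //; rewrite addrC addKr; exact: lt_trans hs sr.
Qed.

Lemma symp_open_image : open (F @` A).
Proof.
rewrite openE => _ [x Ax <-]; have [d d0 dP] := symp_open_map Ax ltr01.
apply/nbhs_ballP; exists d => // y; rewrite -ball_normE /= distrC => /dP[x' [Ax' _] <-].
by exists x'.
Qed.

Definition loc_inv y : E := get [set x | A x /\ F x = y].

Lemma loc_invP y : (F @` A) y -> A (loc_inv y) /\ F (loc_inv y) = y.
Proof. by move=> [x Ax <-]; exact: (@getPex _ [set x' | A x' /\ F x' = F x] (ex_intro _ x (conj Ax erefl))). Qed.

Lemma loc_invK x : A x -> loc_inv (F x) = x.
Proof.
move=> Ax; have [Ai Fi] := loc_invP (ex_intro2 _ _ x Ax erefl).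
exact: iF.
Qed.

Lemma loc_inv_diff y : (F @` A) y -> differentiable loc_inv y /\
  forall v, 'D_v loc_inv y = B (loc_inv y) v.
Proof.
move=> [x Ax <-]; rewrite loc_invK //.
apply: (expand_diff (symp_inv_lin _)) => e e0.
have [C C0 [d d0 [dA dP]]] := lower Ax.
have [M M0 MP] := lin_fun_bound (symp_inv_lin (fun v => 'D_v F x)).
have e1 : 0 < e / (M * C) by rewrite divr_gt0 // mulr_gt0.
have /near0_ball[r r0 rP] := derive_expand (dF Ax) e1.
have m0 : 0 < Num.min d r by rewrite lt_min d0.
have [t t0 tP] := symp_open_map Ax m0.
apply/near0_ball; exists t => // k kt.
have [|x' [Ax' x'm] Fx'] := tP (F x + k); first by rewrite addrC addKr.
rewrite -Fx' !loc_invK //; pose h := x' - x.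
have x'E : x' = x + h by rewrite /h addrC subrK.
have [hd hr] : `|h| < d /\ `|h| < r by move: x'm; rewrite lt_min => /andP[].
have kE : k = F (x + h) - F x by rewrite -x'E Fx' addrC addKr.
rewrite x'E [x + h]addrC addrK; have [h1 _] := dP h hd; rewrite -kE in h1.
have -> : h - B x k = - B x (F (x + h) - F x - 'D_h F x).
  by rewrite -kE /B (lin_funB (symp_inv_lin (fun v => 'D_v F x))) (symp_invK (sDF Ax)) opprB.
rewrite normrN; apply: le_trans (MP _) _.
apply: le_trans (ler_wpM2l (ltW M0) (rP h hr)) _.
apply: (@le_trans _ _ (M * (e / (M * C) * (C * `|k|)))).
  by rewrite !ler_pM2l.
by rewrite le_eqVlt; apply/orP; left; apply/eqP; field; rewrite !gt_eqF.
Qed.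

Lemma loc_inv_symp y v w : (F @` A) y -> omega_st ('D_v loc_inv y) ('D_w loc_inv y) = omega_st v w.
Proof.
move=> Fy; have [d D] := loc_inv_diff Fy; have [Ay _] := loc_invP Fy.
by rewrite !D -[LHS](sF _ _ Ay) !(symp_invVK (sDF Ay)).
Qed.

Let DFE x v i j : A x -> ('D_v F x) i j = 'D_v (fun x => F x i j) x.
Proof.
by move=> Ax; rewrite derive_mxE ?mxE // => a b; exact: Ck_diff (cF 1 a b) Ax.
Qed.

Lemma loc_inv_coord_diff y i j : (F @` A) y -> differentiable (fun y => loc_inv y i j) y.
Proof.
move=> Fy; have [d _] := loc_inv_diff Fy.
have lc : lin_fun (fun x : E => x i j) by move=> a u v; rewrite !mxE.
have [d2 _] := lin_fun_diff (loc_inv y) lc.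
exact: (differentiable_comp d d2).
Qed.

(** Bootstrap: the derivative of the inverse is [symp_inv] of the differential at the inverse point,
    as regular as the inverse itself by induction. *)
Lemma Ck_loc_inv k i j : Ck k (F @` A) (fun y => loc_inv y i j).
Proof.
have oI := symp_open_image.
elim: k i j => [|k IH] i j.
  by move=> y Fy; apply: differentiable_continuous; exact: loc_inv_coord_diff.
split=> [y Fy|v]; first exact: loc_inv_coord_diff.
have c1 w a b : Ck k (F @` A) (fun y => ('D_w F (loc_inv y)) a b).
  apply: (@Ck_comp R E n 2 k (F @` A) A (fun x => ('D_w F x) a b) loc_inv oI IH); last first.
    by move=> y /loc_invP[].
  apply: (Ck_ext oA (f := fun x => 'D_w (fun x => F x a b) x)).
    by move=> x /[!inE] Ax; rewrite DFE.
  exact: Ck_derive (cF k.+1 a b).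
have c2 w : Ck k (F @` A) (fun y => omega_st v ('D_w F (loc_inv y))).
  apply: (Ck_fsum _ oI) => a _; apply: (Ck_minus oI); exact: (Ck_scale oI).
apply: (Ck_ext oI (f := fun y => B (loc_inv y) v i j)).
  move=> y /[!inE] Fy; have [d D] := loc_inv_diff Fy.
  by rewrite -D derive_mxE ?mxE // => a b; exact: loc_inv_coord_diff.
rewrite /B; move: j; apply: ord2P.
  by under eq_fun do rewrite mxE /=; exact: c2.
by under eq_fun do rewrite mxE /=; apply: (Ck_opp oI); exact: c2.
Qed.

End SymplecticInverse.

(** * The projection to the blowup *)

Section ReducedPoint.
Context {R : realType} {n : nat}.
Local Notation Q := 'M[R]_(1 + n, 2).
Local Notation E := 'M[R]_(n, 2).
Implicit Types (q : Q) (z : E).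

(* the point of the blowup represented by the projection of q to the level set
   |z|^2 - |w|^2 = 1 *)
Definition zlift q : E := Num.sqrt (fh q) *: dsubmx q.
Definition pt q : set E := cut_class (zlift q) (wre q) (wim q).

Lemma fh_gt0 q : Qdom q -> 0 < fh q.
Proof. by move=> Qq; rewrite divr_gt0 // ltr_pwDl // sqn_ge0. Qed.

Lemma zlift_sqn q : Qdom q -> sqn (zlift q) = 1 + sqw q.
Proof.
move=> Qq; rewrite sqnZ sqr_sqrtr ?(ltW (fh_gt0 Qq)) // -[sqn _]/(sqy q).
by rewrite /fh divfK // Qdom_neq0.
Qed.

Lemma zlift_level q : Qdom q -> cut_level (zlift q) (wre q) (wim q).
Proof. by move=> Qq; rewrite /cut_level zlift_sqn // -sqwE addrK. Qed.

Lemma usub_rot s q : usubmx (rot_by epsX s q) =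
  crot (cos (2 * pi * s)) (- sin (2 * pi * s)) (usubmx q).
Proof.
apply: mxP2 => k; rewrite crot0 crot1 !mxE /= /epsX splitl_ !mulrN1 !mulNr cosN sinN.
by rewrite ![lshift _ _]/(lshift n k); split; ring.
Qed.

Lemma dsub_rot s q : dsubmx (rot_by epsX s q) =
  crot (cos (2 * pi * s)) (sin (2 * pi * s)) (dsubmx q).
Proof. by apply: mxP2 => k; rewrite crot0 crot1 !mxE /= /epsX splitr_ mulr1. Qed.

Lemma crotZ (c s r : R) z : crot c s (r *: z) = r *: crot c s z.
Proof. by apply: mxP2 => k; rewrite !crot0 !crot1 !mxE /= ; split; ring. Qed.

Lemma Qdom_rot s q : Qdom q -> Qdom (rot_by epsX s q).
Proof. by rewrite /Qdom /= sqy_rot. Qed.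

Lemma pt_rot s q : Qdom q -> pt (rot_by epsX s q) = pt q.
Proof.
move=> Qq; have cs := cos2Dsin2 (2 * pi * s).
rewrite [RHS](esym (cut_class_act (zlift_level Qq) cs)) /pt /zlift /fh sqw_rot sqy_rot dsub_rot crotZ.
by rewrite /wre /wim usub_rot crot0 crot1; congr (cut_class _ _ _); ring.
Qed.

Definition rescale (r : R) q : Q := col_mx (usubmx q) (r *: dsubmx q).

Lemma sqy_rescale r q : sqy (rescale r q) = r ^+ 2 * sqy q.
Proof. by rewrite /sqy /rescale col_mxKd sqnZ. Qed.

Lemma sqw_rescale r q : sqw (rescale r q) = sqw q.
Proof. by rewrite /sqw /rescale col_mxKu. Qed.

Lemma Qdom_rescale r q : 0 < r -> Qdom q -> Qdom (rescale r q).
Proof. by move=> r0; rewrite /Qdom /= sqy_rescale pmulr_rgt0 // exprn_gt0. Qed.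

Lemma zlift_rescale r q : 0 < r -> Qdom q -> zlift (rescale r q) = zlift q.
Proof.
move=> r0 Qq; rewrite /zlift /fh sqy_rescale sqw_rescale /rescale col_mxKd.
rewrite invfM mulrCA sqrtrM ?invr_ge0 ?exprn_ge0 ?ltW // sqrtrV ?exprn_ge0 ?ltW //.
rewrite sqrtr_sqr gtr0_norm // scalerA; congr (_ *: _).
by rewrite mulrC mulrA mulfV ?gt_eqF // mul1r.
Qed.

Lemma pt_rescale r q : 0 < r -> Qdom q -> pt (rescale r q) = pt q.
Proof. by move=> r0 Qq; rewrite /pt zlift_rescale // /wre /wim /rescale col_mxKu. Qed.

Lemma pt_rep q : Qdom q -> exists c s, [/\ c ^+ 2 + s ^+ 2 = 1, 1 <= sqn (crot c s (zlift q)),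
  c * wre q + s * wim q = cut_wr (crot c s (zlift q)), - s * wre q + c * wim q = 0 &
  pt q = collapse (crot c s (zlift q))].
Proof. by move=> Qq; exact: cut_classP (zlift_level Qq). Qed.

(** Anything invariant under the circle may be computed on q instead of a collapsed representative;
    this transfers domains and charts of the blowup to Q. *)
Lemma pt_invariant T (F : E -> R -> R -> T) q z : act_invariant F -> Qdom q -> 1 <= sqn z ->
  pt q = collapse z -> F z (cut_wr z) 0 = F (zlift q) (wre q) (wim q).
Proof.
move=> iF Qq z1; have [c [s [cs z'1 w0 w1 ->]]] := pt_rep Qq.
move=> cz; rewrite -(iF (zlift q) (wre q) (wim q) _ _ cs) w0 w1; apply: (invariantE iF z'1).
by rewrite cz; exact: collapse_refl.
Qed.

Lemma pt_set q : Qdom q -> blowup_set R n (pt q).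
Proof.
move=> Qq; have [c [s [_ z1 _ _ ->]]] := pt_rep Qq.
by rewrite blowup_setE; exists (crot c s (zlift q)).
Qed.

Lemma pt_dom a q : Qdom q -> blowup_dom a (pt q) <-> cut_nz a (zlift q) (wre q) (wim q).
Proof.
move=> Qq; rewrite blowup_domE; split.
  move=> [z [z1 nz] zq].
  by rewrite -(pt_invariant (@cut_nz_invariant R n a) Qq z1 (esym zq)).
move=> nz; have [c [s [cs z1 w0 w1 pq]]] := pt_rep Qq.
exists (crot c s (zlift q)) => //; split=> //.
by rewrite (pt_invariant (@cut_nz_invariant R n a) Qq z1 pq).
Qed.

Lemma pt_chart a q : Qdom q -> cut_nz a (zlift q) (wre q) (wim q) ->
  blowup_chart a (pt q) = cut_coord a (zlift q) (wre q) (wim q).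
Proof.
move=> Qq nz; have [c [s [cs z1 w0 w1 pq]]] := pt_rep Qq.
rewrite pq chart_collapse // ?(pt_invariant (@cut_nz_invariant R n a) Qq z1 pq) //.
exact: (pt_invariant (@cut_coord_invariant R n a) Qq z1 pq).
Qed.

Lemma unit_angle (c s : R) : c ^+ 2 + s ^+ 2 = 1 ->
  exists t : R, cos (2 * pi * t) = c /\ sin (2 * pi * t) = s.
Proof.
move=> cs; have c1 : -1 <= c <= 1.
  by rewrite -ler_norml -(@ler_pXn2r _ 2) ?nnegrE // expr1n real_normK ?num_real // -cs lerDl sqr_ge0.
have pi0 : pi != 0 :> R by rewrite gt_eqF // pi_gt0.
have E t : 2 * pi * (t / (2 * pi)) = t :> R.
  by rewrite mulrC divfK // mulf_neq0.
have sE : Num.sqrt (1 - c ^+ 2) = `|s|.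
  by rewrite -cs addrC addKr sqrtr_sqr.
case: (leP 0 s) => s0.
  exists (acos c / (2 * pi)); rewrite E acosK ?in_itv //= sin_acos // sE.
  by rewrite ger0_norm.
exists (- acos c / (2 * pi)); rewrite E cosN sinN acosK ?in_itv //= sin_acos // sE.
by rewrite ltr0_norm // opprK.
Qed.

Lemma pt_iota z : 1 <= sqn z -> pt (iota z) = collapse z.
Proof.
move=> z1; rewrite -(cut_class_lift z1) /pt /zlift /fh iota_sqw // iota_sqy iota_y.
rewrite addrC subrK divff ?gt_eqF ?(lt_le_trans ltr01) // sqrtr1 scale1r iota_wre.
by rewrite /wim iota_w !mxE /= mulr0.
Qed.

(** The fibres of the projection are orbits of the circle and of the positive stretchings of z; in
    particular they are connected. *)
Lemma pt_orbit q q' : Qdom q -> Qdom q' -> pt q = pt q' ->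
  exists t r : R, 0 < r /\ q' = rescale r (rot_by epsX t q).
Proof.
move=> Qq Qq' pp.
have [c [s [cs z1 w0 w1 pq]]] := pt_rep Qq.
have [c' [s' [cs' z1' w0' w1' pq']]] := pt_rep Qq'.
have [C [S [CS zE wE0 wE1]]] : exists C S : R, [/\ C ^+ 2 + S ^+ 2 = 1,
    zlift q' = crot C S (zlift q), wre q' = C * wre q + S * wim q &
    wim q' = - S * wre q + C * wim q].
  have inv z : crot c' (- s') (crot c' s' z) = z.
    rewrite crotM !mulNr opprK -!expr2 cs' [s' * c']mulrC subrr; exact: crot_id.
  have wr_inv (x y a b : R) : c' * x + s' * y = a -> - s' * x + c' * y = b ->
      x = c' * a - s' * b /\ y = s' * a + c' * b.
    by move=> <- <-; rewrite -{1}[x]mul1r -{3}[y]mul1r -cs'; split; ring.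
  have [x0 y0] := wr_inv _ _ _ _ w0' w1'.
  have : collapse (crot c s (zlift q)) (crot c' s' (zlift q')).
    by rewrite -pq pp pq'; exact: collapse_refl.
  (* Off the unit sphere the representatives are equal. On it they differ by a Hopf rotation, and
     then w = 0 for both points. *)
  move=> [zz|[/enorm_eq1 e1 [a [b [ab zz]]]]].
    exists (c' * c + s' * s), (c' * s - s' * c); split.
    - by rewrite -[RHS]mulr1 -{1}cs -cs'; ring.
    - by rewrite -(inv (zlift q')) zz crotM; congr crot; ring.
    - by rewrite x0 zz -w0 -w1; ring.
    - by rewrite y0 zz -w0 -w1; ring.
  have wr0 : cut_wr (crot c s (zlift q)) = 0 by rewrite /cut_wr e1 subrr sqrtr0.
  have sqw0 : wre q ^+ 2 + wim q ^+ 2 = 0.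
    by rewrite -(csqw _ _ cs) w0 w1 wr0 !expr0n addr0.
  have [a0 b0] := sq_eq0 sqw0.
  have wr0' : cut_wr (crot c' s' (zlift q')) = 0.
    by rewrite zz /cut_wr sqn_crot // e1 subrr sqrtr0.
  rewrite wr0' !mulr0 subrr addr0 in x0 y0.
  exists (c' * (a * c - b * s) + s' * (a * s + b * c)),
    (c' * (a * s + b * c) - s' * (a * c - b * s)); split.
  - have <- : (c' ^+ 2 + s' ^+ 2) * ((a ^+ 2 + b ^+ 2) * (c ^+ 2 + s ^+ 2)) = 1.
      by rewrite cs' ab cs !mulr1.
    by ring.
  - by rewrite -(inv (zlift q')) zz !crotM; congr crot; ring.
  - by rewrite x0 a0 b0 !mulr0 addr0.
  - by rewrite y0 a0 b0 !mulr0 addr0.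
have [t [ct st]] := unit_angle CS.
have [f0 f0'] := (fh_gt0 Qq, fh_gt0 Qq').
exists t, (Num.sqrt (fh q) / Num.sqrt (fh q')); split; first by rewrite divr_gt0 // sqrtr_gt0.
rewrite -[LHS]vsubmxK /rescale usub_rot dsub_rot ct st; congr col_mx.
  apply: mxP2 => k; rewrite !crot0 !crot1 !ord1; move: wE0 wE1; rewrite /wre /wim => -> ->.
  by split; ring.
have y' : dsubmx q' = (Num.sqrt (fh q'))^-1 *: zlift q'.
  by rewrite /zlift scalerA mulVf ?scale1r // gt_eqF // sqrtr_gt0.
by rewrite y' zE /zlift crotZ scalerA mulrC.
Qed.

End ReducedPoint.

Section Wedge.
Context {R : realType} {V : normedModType R}.
Implicit Types (f g : V -> R).

Definition wedge q (v w : V) f g : R := 'D_v f q * 'D_w g q - 'D_v g q * 'D_w f q.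

Lemma eq_wedge (A : set V) q v w f f' g g' : open A -> A q ->
  (forall y, A y -> f y = f' y) -> (forall y, A y -> g y = g' y) ->
  wedge q v w f g = wedge q v w f' g'.
Proof. by move=> oA Aq ff gg; rewrite /wedge !(eq_derive _ oA Aq ff) !(eq_derive _ oA Aq gg). Qed.

Lemma wedge0r (A : set V) q v w f g : open A -> A q -> (forall y, A y -> g y = 0) ->
  wedge q v w f g = 0.
Proof.
by move=> oA Aq g0; rewrite /wedge !(derive_near0 _ oA Aq g0) mulr0 mul0r subrr.
Qed.

Let rot_form (C S C1 S1 C2 S2 x y x1 y1 x2 y2 t1 t2 : R) :
  C ^+ 2 + S ^+ 2 = 1 -> C1 = - (S * t1) -> S1 = C * t1 -> C2 = - (S * t2) -> S2 = C * t2 ->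
  (C * x1 + C1 * x - (S * y1 + S1 * y)) * (S * x2 + S2 * x + (C * y2 + C2 * y)) -
  (S * x1 + S1 * x + (C * y1 + C1 * y)) * (C * x2 + C2 * x - (S * y2 + S2 * y)) =
  (x1 * y2 - y1 * x2) + t2 * (x * x1 + y * y1) - t1 * (x * x2 + y * y2).
Proof. by move=> CS -> -> -> ->; rewrite -[RHS]mul1r -CS; ring. Qed.

Let unit_speed (C S C1 S1 : R) : C ^+ 2 + S ^+ 2 = 1 -> C * C1 + S * S1 = 0 ->
  C1 = - (S * (C * S1 - S * C1)) /\ S1 = C * (C * S1 - S * C1).
Proof.
move=> CS h; split; rewrite -[LHS]mul1r -CS.
  rewrite (_ : _ * C1 = C * (C * C1 + S * S1) - S * (C * S1 - S * C1)); last by ring.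
  by rewrite h; ring.
rewrite (_ : _ * S1 = S * (C * C1 + S * S1) + C * (C * S1 - S * C1)); last by ring.
by rewrite h; ring.
Qed.

(** The differential of the angle of the unit vector (c, s). *)
Definition turn (c s : V -> R) q v := c q * 'D_v s q - s q * 'D_v c q.

(** Turning (f, g) by a variable angle adds the product of d((f^2 + g^2) / 2) with the differential
    of the angle. *)
Lemma wedge_rot (c s f g : V -> R) q v w : differentiable c q -> differentiable s q ->
  differentiable f q -> differentiable g q -> c q ^+ 2 + s q ^+ 2 = 1 ->
  (forall v, c q * 'D_v c q + s q * 'D_v s q = 0) ->
  wedge q v w (fun q => c q * f q - s q * g q) (fun q => s q * f q + c q * g q) =
  wedge q v w f g + turn c s q w * (f q * 'D_v f q + g q * 'D_v g q)
    - turn c s q v * (f q * 'D_w f q + g q * 'D_w g q).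
Proof.
move=> dc ds df dg cs dcs.
have D v' : 'D_v' (fun q => c q * f q - s q * g q) q = c q * 'D_v' f q + 'D_v' c q * f q -
    (s q * 'D_v' g q + 'D_v' s q * g q).
  by rewrite derive_sub ?derive_mul //; exact: differentiableM.
have D' v' : 'D_v' (fun q => s q * f q + c q * g q) q = s q * 'D_v' f q + 'D_v' s q * f q +
    (c q * 'D_v' g q + 'D_v' c q * g q).
  by rewrite derive_add ?derive_mul //; exact: differentiableM.
have [C1 S1] := unit_speed cs (dcs v); have [C2 S2] := unit_speed cs (dcs w).
apply: etrans (f_equal4 (fun p q r t : R => p * q - r * t) (D v) (D' w) (D' v) (D w)) _.
exact: rot_form cs C1 S1 C2 S2.
Qed.

End Wedge.

(** * The charts of the blowup in terms of Q *)

Section ReducedChart.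
Context {R : realType} {n : nat}.
Local Notation Q := 'M[R]_(1 + n, 2).
Local Notation E := 'M[R]_(n, 2).
Implicit Types (q v w : Q) (z : E).
Let oQ : open (Qdom : set Q) := @open_Qdom R n.

Let zl (k : 'I_n) (l : 'I_2) (q : Q) : R := zlift q k l.

Let s_lin (f : Q -> R) : lin_fun f -> smooth Qdom f.
Proof. by move=> lf k; exact: Ck_lin_fun. Qed.

Let wim_lin : lin_fun (@wim R n).
Proof. by move=> a u v; rewrite /wim usubmx_lin !mxE. Qed.

Let s_re : smooth Qdom (@wre R n).
Proof. exact: s_lin (@wre_lin R n). Qed.

Let s_im : smooth Qdom (@wim R n).
Proof. exact: s_lin wim_lin. Qed.

Let s_zl k l : smooth Qdom (zl k l).
Proof.
have h : smooth Qdom (fun q => Num.sqrt (fh q) * dsubmx q k l).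
  apply: (smoothM oQ).
    by apply: (smooth_sqrt oQ); [move=> q; exact: fh_gt0|move=> j; exact: Ck_fh].
  by apply: s_lin => a u v; rewrite dsubmx_lin !mxE.
by apply: (smooth_ext oQ _ h) => q _; rewrite /zl /zlift [RHS]mxE.
Qed.

Let d_zl k l q : Qdom q -> differentiable (zl k l) q.
Proof. by move=> Qq; exact: Ck_diff (s_zl k l 1) Qq. Qed.

Let d_zlift q : Qdom q -> differentiable (@zlift R n) q.
Proof. by move=> Qq; apply: differentiable_mx => i j; exact: d_zl. Qed.

Let D_zlE q v k l : Qdom q -> 'D_v (zl k l) q = ('D_v (@zlift R n) q) k l.
Proof. by move=> Qq; rewrite derive_mxE ?mxE // => i j; exact: d_zl. Qed.

Let D_wre q v : 'D_v (@wre R n) q = wre v.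
Proof. by have [_ ->] := lin_fun_diff q (@wre_lin R n). Qed.

Let D_wim q v : 'D_v (@wim R n) q = wim v.
Proof. by have [_ ->] := lin_fun_diff q wim_lin. Qed.

Let D_level q v : Qdom q -> dot (zlift q) ('D_v (@zlift R n) q) = wre q * wre v + wim q * wim v.
Proof.
move=> Qq; have h : 'D_v (fun q => sqn (zlift q)) q = 'D_v (fun q : Q => sqw q + 1) q.
  by apply: (eq_derive _ oQ Qq) => y Qy; rewrite zlift_sqn // addrC.
have [d1 _] := derive_sqn (zlift q) 0.
move: h; rewrite (derive_compE v (d_zlift Qq) d1).
have [_ ->] := derive_sqn (zlift q) ('D_v (@zlift R n) q).
have [dw Dw] := dsqw q v.
rewrite derive_add //; rewrite Dw derive_cst addr0 => h.
have {}h : dot (zlift q) ('D_v (@zlift R n) q) = dot (usubmx q) (usubmx v).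
  by apply: (mulfI (_ : (2 : R) != 0)).
by rewrite h /dot big_ord1.
Qed.

Let omega_alg (gv gw g a b c W : R) : gv * (gw * 0) + gv * (g * a) + (g * (gw * - b) + g * (g * c)) + W =
  2^-1 * (2 * g * gv * a - 2 * g * gw * b) + g * g * c + W.
Proof. by field. Qed.

(** The left-hand side is the standard form of C^n x C pulled back by the retraction to the level
    set; stretching z by sqrt(fh) changes lamh only through fh. *)
Lemma omega_zlift q v w : Qdom q ->
  omega_st ('D_v (@zlift R n) q) ('D_w (@zlift R n) q) + (wre v * wim w - wim v * wre w) =
  omh q v w.
Proof.
move=> Qq; have cfh := @Ck_fh R n 1; have fq := fh_gt0 Qq.
have sq : Ck 1 Qdom (fun q => Num.sqrt (fh q)).
  by apply: Ck_sqrt => // x; exact: fh_gt0.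
have dsq : differentiable (fun q => Num.sqrt (fh q)) q := Ck_diff sq Qq.
set g := Num.sqrt (fh q); have g2 : g * g = fh q by rewrite -expr2 sqr_sqrtr // ltW.
have Dg v' : 2 * g * 'D_v' (fun q => Num.sqrt (fh q)) q = 'D_v' (@fh R n) q.
  have -> : 'D_v' (@fh R n) q = 'D_v' (fun q => Num.sqrt (fh q) * Num.sqrt (fh q)) q.
    by apply: (eq_derive _ oQ Qq) => y Qy; rewrite -expr2 sqr_sqrtr // ltW // fh_gt0.
  by rewrite derive_mul //; rewrite -/g; ring.
have Dz v' : 'D_v' (@zlift R n) q =
    'D_v' (fun q => Num.sqrt (fh q)) q *: dsubmx q + g *: dsubmx v'.
  apply/matrixP => i j; rewrite -D_zlE //.
  have ld : lin_fun (fun q : Q => dsubmx q i j) by move=> a u u'; rewrite dsubmx_lin !mxE.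
  have [dd Dd] := lin_fun_diff q ld.
  have -> : zl i j = (fun q => Num.sqrt (fh q) * dsubmx q i j).
    by apply/funext => x; rewrite /zl /zlift mxE.
  rewrite derive_mul // Dd !mxE -/g /=; ring.
rewrite omhE // !Dz -!Dg -g2 !(omegaDl, omegaDr, omegaZl, omegaZr) omegaxx.
rewrite (omega_st_antisym (dsubmx v) (dsubmx q)).
rewrite [omega_st (usubmx v) _]/omega_st big_ord1 -/(wre v) -/(wim v) -/(wre w) -/(wim w).
exact: omega_alg.
Qed.

Section Chart.
Variable a : option 'I_n.

Definition pt_nz : set Q := [set q | Qdom q /\ cut_nz a (zlift q) (wre q) (wim q)].
Definition pt_coord q : E := cut_coord a (zlift q) (wre q) (wim q).

Let sq (q : Q) : R := cut_sq a (zlift q) (wre q) (wim q).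
Let A := pt_nz.

Let s_sq : smooth Qdom sq.
Proof.
have h : smooth Qdom (fun q => if a is Some j then zl j 0 q * zl j 0 q + zl j 1 q * zl j 1 q
    else wre q * wre q + wim q * wim q).
  by case: a => [j|]; apply: (smoothD oQ); apply: (smoothM oQ);
    (exact: s_zl || exact: s_re || exact: s_im).
by apply: (smooth_ext oQ _ h) => q _; rewrite /sq /cut_sq; case: a => [j|]; rewrite /csq !expr2.
Qed.

Lemma open_pt_nz : open pt_nz.
Proof.
rewrite (_ : pt_nz = [set q | Qdom q /\ sq q != 0]); first exact: smooth_open_neq0 oQ s_sq.
by apply/seteqP; split=> q [Qq h]; split=> //; move: h; rewrite cut_nzE.
Qed.

Let oA : open A := open_pt_nz.
Let AQ : A `<=` Qdom. Proof. by move=> q []. Qed.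

Let sq_gt0 q : A q -> 0 < sq q.
Proof.
move=> [_]; rewrite cut_nzE -/(sq q) lt_def => ->; rewrite /sq /cut_sq; case: a => [j|].
  exact: csq_ge0.
by rewrite addr_ge0 // sqr_ge0.
Qed.

Let sm : smooth A (fun q => (Num.sqrt (sq q))^-1).
Proof.
apply: smoothV => //; first by move=> u Au; rewrite gt_eqF // sqrtr_gt0 sq_gt0.
by apply: smooth_sqrt => //; apply: smooth_sub AQ s_sq.
Qed.

Let c (q : Q) : R := phc a (zlift q) (wre q) (wim q).
Let s (q : Q) : R := phs a (zlift q) (wre q) (wim q).

Let aw : smooth A (@wre R n) := smooth_sub AQ s_re.
Let ai : smooth A (@wim R n) := smooth_sub AQ s_im.
Let az k l : smooth A (zl k l) := smooth_sub AQ (s_zl k l).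

Let sc : smooth A c.
Proof.
move: (sm); rewrite /c /sq; case: a => [j|] h.
  exact: smoothM oA (az j 0) h.
exact: smoothM oA aw h.
Qed.

Let ss : smooth A s.
Proof.
move: (sm); rewrite /s /sq; case: a => [j|] h.
  exact: smoothN oA (smoothM oA (az j 1) h).
exact: smoothM oA ai h.
Qed.

Let P k q := c q * zl k 0 q - s q * zl k 1 q.
Let P' k q := s q * zl k 0 q + c q * zl k 1 q.
Let W q := c q * wre q + s q * wim q.
Let W' q : R := - s q * wre q + c q * wim q.

Let sP k : smooth A (P k).
Proof. exact: smoothB oA (smoothM oA sc (az k 0)) (smoothM oA ss (az k 1)). Qed.
Let sP' k : smooth A (P' k).
Proof. exact: smoothD oA (smoothM oA ss (az k 0)) (smoothM oA sc (az k 1)). Qed.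
Let sW : smooth A W.
Proof. exact: smoothD oA (smoothM oA sc aw) (smoothM oA ss ai). Qed.
Let sW' : smooth A W'.
Proof. exact: smoothD oA (smoothM oA (smoothN oA ss) aw) (smoothM oA sc ai). Qed.

Let coordE k q : pt_coord q k 0 = (if a is Some j then if k == j then W q else P k q else P k q) /\
  pt_coord q k 1 = (if a is Some j then if k == j then W' q else P' k q else P' k q).
Proof.
rewrite /pt_coord /cut_coord /W /W' /P /P' /c /s /zl; case: a => [j|].
  by split; rewrite mxE; case: (k == j) => //=; rewrite ?crot0 ?crot1.
by rewrite crot0 crot1.
Qed.

Lemma smooth_pt_coord : smooth_mx pt_nz pt_coord.
Proof.
move=> k; apply: ord2P.
  apply: (smooth_ext (f := if a is Some j then if k == j then W else P k else P k) oA).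
    by move=> q _; have [-> _] := coordE k q; case: a => [j|] //; case: (k == j).
  by case: a => [j|] //; case: (k == j).
apply: (smooth_ext (f := if a is Some j then if k == j then W' else P' k else P' k) oA).
  by move=> q _; have [_ ->] := coordE k q; case: a => [j|] //; case: (k == j).
by case: a => [j|] //; case: (k == j).
Qed.

Let cs q : A q -> c q ^+ 2 + s q ^+ 2 = 1.
Proof. by move=> [_ nu]; exact: ph_unit. Qed.

Let dc q : A q -> differentiable c q := fun Aq => Ck_diff (sc 1) Aq.
Let ds q : A q -> differentiable s q := fun Aq => Ck_diff (ss 1) Aq.

Let dcs q : A q -> forall v, c q * 'D_v c q + s q * 'D_v s q = 0.
Proof.
move=> Aq v; have : 'D_v (fun y => c y * c y + s y * s y) q = 0.
  rewrite (eq_derive (g := cst (1 : R)) v oA Aq); first by rewrite derive_cst.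
  move=> y Ay.
  by rewrite -!expr2 cs.
have [d1 d2] := (dc Aq, ds Aq).
rewrite derive_add ?derive_mul //; try exact: differentiableM.
by move=> h; lra.
Qed.

Let P'0 j q : a = Some j -> A q -> P' j q = 0.
Proof.
move=> aj [Qq nz]; rewrite /P' /c /s /zl aj /= ; ring.
Qed.

Let W'0 q : a = None -> W' q = 0.
Proof. by move=> aN; rewrite /W' /c /s aN /=; ring. Qed.

Let turn_opp q v : A q -> turn c (fun q => - s q) q v = - turn c s q v.
Proof.
move=> Aq; have [_ d2] := (dc Aq, ds Aq).
have -> : (fun q => - s q) = (fun q => 0 - s q) by apply/funext => x; rewrite sub0r.
rewrite /turn derive_sub //.
by rewrite derive_cst; ring.
Qed.

Let cancel_sum (X Y p r t1 t2 : R) : X + t2 * p - t1 * r + (Y + - t2 * p - - t1 * r) = X + Y.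
Proof. by ring. Qed.

Lemma pt_coord_symp q v w : A q -> omega_st ('D_v pt_coord q) ('D_w pt_coord q) = omh q v w.
Proof.
move=> Aq; have Qq := AQ Aq; rewrite -omega_zlift //.
have dP k l : differentiable (fun q => pt_coord q k l) q := Ck_diff (smooth_pt_coord k l 1) Aq.
have DP v' k l : ('D_v' pt_coord q) k l = 'D_v' (fun q => pt_coord q k l) q.
  by rewrite derive_mxE ?mxE.
have -> : omega_st ('D_v pt_coord q) ('D_w pt_coord q) =
    \sum_(k < n) wedge q v w (fun q => pt_coord q k 0) (fun q => pt_coord q k 1).
  by apply: eq_bigr => k _; congr (_ * _ - _ * _); exact: DP.
have -> : \sum_(k < n) wedge q v w (fun q => pt_coord q k 0) (fun q => pt_coord q k 1) =
    \sum_(k < n) wedge q v w (P k) (P' k) + wedge q v w W W'.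
  case ea : a => [j|]; last first.
    rewrite (wedge0r v w W oA Aq (g := W')) ?addr0; last by move=> y _; exact: W'0.
    apply: eq_bigr => k _; apply: (eq_wedge _ _ oA Aq) => y _.
      by have [-> _] := coordE k y; rewrite ea.
    by have [_ ->] := coordE k y; rewrite ea.
  rewrite (bigD1 j) //= [in RHS](bigD1 j) //=.
  rewrite (wedge0r v w (P j) oA Aq (g := P' j)) ?add0r; last by move=> y; exact: P'0.
  rewrite addrC; congr (_ + _).
    apply: eq_bigr => k kj; apply: (eq_wedge _ _ oA Aq) => y _.
      by have [-> _] := coordE k y; rewrite ea (negPf kj).
    by have [_ ->] := coordE k y; rewrite ea (negPf kj).
  apply: (eq_wedge _ _ oA Aq) => y _.
    by have [-> _] := coordE j y; rewrite ea eqxx.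
  by have [_ ->] := coordE j y; rewrite ea eqxx.
have ez k : wedge q v w (P k) (P' k) = wedge q v w (zl k 0) (zl k 1) +
    turn c s q w * (zl k 0 q * 'D_v (zl k 0) q + zl k 1 q * 'D_v (zl k 1) q) -
    turn c s q v * (zl k 0 q * 'D_w (zl k 0) q + zl k 1 q * 'D_w (zl k 1) q).
  apply: wedge_rot; [exact: dc|exact: ds|exact: d_zl|exact: d_zl|exact: cs|exact: dcs].
have lev v' : \sum_(k < n) (zl k 0 q * 'D_v' (zl k 0) q + zl k 1 q * 'D_v' (zl k 1) q) =
    wre q * wre v' + wim q * wim v'.
  by rewrite -D_level //; apply: eq_bigr => k _; rewrite !D_zlE.
rewrite (eq_bigr _ (fun k _ => ez k)) sumrB big_split.
have ts t v' : \sum_(k < n) t * (zl k 0 q * 'D_v' (zl k 0) q + zl k 1 q * 'D_v' (zl k 1) q) =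
    t * (wre q * wre v' + wim q * wim v') by rewrite -lev mulr_sumr.
rewrite [X in _ + X - _](ts _ v) [X in _ - X](ts _ w).
have -> : wedge q v w W W' = wre v * wim w - wim v * wre w +
    - turn c s q w * (wre q * wre v + wim q * wim v)
    - - turn c s q v * (wre q * wre w + wim q * wim w).
  have [dr di] := (Ck_diff (aw 1) Aq, Ck_diff (ai 1) Aq).
  have := @wedge_rot R Q c (fun q => - s q) (@wre R n) (@wim R n) q v w (dc Aq).
  rewrite !turn_opp // /wedge !D_wre !D_wim => <- //.
  - have -> // : W = (fun q => c q * wre q - - s q * wim q).
    by apply/funext => x; rewrite /W mulNr opprK.
  - have -> : (fun q => - s q) = (fun q => 0 - s q) by apply/funext => x; rewrite sub0r.
    by apply: differentiableB; [exact: differentiable_cst|exact: ds].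
  - by rewrite sqrrN; exact: cs.
  - move=> v'; have -> : (fun q => - s q) = (fun q => 0 - s q) by apply/funext => x; rewrite sub0r.
    rewrite derive_sub; [|exact: differentiable_cst|exact: ds].
    by rewrite derive_cst sub0r mulrNN dcs.
rewrite cancel_sum; congr (_ + _); apply: eq_bigr => k _.
by rewrite /wedge !D_zlE.
Qed.

End Chart.

End ReducedChart.

(** * The lift of a shell embedding *)

Lemma open_preim (R : realType) (V W : normedModType R) (A : set V) (B : set W) (g : V -> W) :
  open A -> open B -> (forall x, A x -> {for x, continuous g}) -> open [set x | A x /\ B (g x)].
Proof.
move=> oA oB cg; rewrite openE => x [Ax Bx].
have h1 : \forall y \near x, A y by exact: open_nbhs_nbhs.
have h2 : \forall y \near x, B (g y) by apply: (cg x Ax); exact: open_nbhs_nbhs.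
by apply: filterS2 h1 h2 => y Ay By; split.
Qed.

Lemma derive_comp_mx (R : realType) (m n p k : nat) (g : 'M[R]_(m, n) -> 'M[R]_(p, k))
    (r s : nat) (f : 'M[R]_(p, k) -> 'M[R]_(r, s)) x v :
  differentiable g x -> (forall i j, differentiable (fun y => f y i j) (g x)) ->
  'D_v (fun y => f (g y)) x = 'D_('D_v g x) f (g x).
Proof.
move=> dg df; apply/matrixP => i j.
have dfg i' j' : differentiable (fun y => f (g y) i' j') x.
  exact: (differentiable_comp dg (df i' j')).
rewrite (derive_mxE v dfg) [LHS]mxE (derive_mxE ('D_v g x) df) [RHS]mxE.
exact: (derive_compE v dg (df i j)).
Qed.

Definition annulus {R : realType} {n : nat} (a b : R) : set 'M[R]_(n, 2) :=
  [set x | a < sqn x /\ sqn x < b].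

Lemma open_annulus (R : realType) (n : nat) (a b : R) : open (annulus a b : set 'M[R]_(n, 2)).
Proof. by apply: openI; [exact: open_out|exact: open_in]. Qed.

(** * Connectedness of annuli *)

Section AnnulusConnected.
Context {R : realType} {n : nat}.
Local Notation E := 'M[R]_(n, 2).
Implicit Types (x y : E).

Lemma sphere_angle x y : 0 < sqn x -> sqn x = sqn y -> exists (e : E) (c s : R),
  [/\ dot x e = 0, sqn e = sqn x, c ^+ 2 + s ^+ 2 = 1 & y = c *: x + s *: e].
Proof.
set t := sqn x => t0 ty; pose c := dot x y / t; pose r := y - c *: x.
have yE : y = c *: x + r by rewrite /r addrC subrK.
have xr : dot x r = 0.
  rewrite /r (lin_funB (dot_lin x)) (lin_funZ (dot_lin x)) dotzz scaleRE -/t.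
  by rewrite /c divfK ?subrr // gt_eqF.
have tE : t = c ^+ 2 * t + sqn r.
  by rewrite {1}ty yE sqnD sqnZ dotZl xr !mulr0 addr0.
have [r0|rn0] := eqVneq r 0.
  exists (Jmx x), c, 0; split; first exact: dotJ.
  - exact: sqn_J.
  - apply: (mulIf (_ : t != 0)); first by rewrite gt_eqF.
    by rewrite mul1r expr0n addr0 {2}tE r0 -dotzz (lin_fun0 (dot_lin _)) addr0.
  - by rewrite scale0r {1}yE r0.
have rp := sqn_gt0 rn0.
pose s := Num.sqrt (sqn r / t); have s0 : 0 < s by rewrite sqrtr_gt0 divr_gt0.
have s2 : s ^+ 2 = sqn r / t by rewrite sqr_sqrtr // divr_ge0 // ltW.
exists (s^-1 *: r), c, s; split.
- by rewrite dotZr xr mulr0.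
- by rewrite sqnZ exprVn s2 invf_div divfK // gt_eqF.
- apply: (mulIf (_ : t != 0)); first by rewrite gt_eqF.
  by rewrite s2 mulrDl divfK ?gt_eqF // mul1r -tE.
- by rewrite scalerA divff ?gt_eqF // scale1r.
Qed.

Variables (a b : R) (g : E -> R).
Hypothesis a0 : 0 <= a.
Hypothesis dg : forall x, annulus a b x -> differentiable g x.
Hypothesis Dg : forall x v, annulus a b x -> 'D_v g x = 0.

Let const_on_sphere x y : annulus a b x -> sqn x = sqn y -> g x = g y.
Proof.
move=> ax xy; have x0 : 0 < sqn x by exact: le_lt_trans a0 ax.1.
have [e [c [s [xe ex cs yE]]]] := sphere_angle x0 xy.
have [t [ct st]] := unit_angle cs.
pose Lp (q : 'M[R]_(1, 2)) : E := q 0 0 *: x + q 0 1 *: e.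
have lL : lin_fun Lp.
  by move=> r u v; rewrite /Lp !mxE !scalerDl !scalerDr -!scalerA addrACA.
have dL q : differentiable Lp q by have [] := lin_fun_diff q lL.
have sL q : csq q 0 = 1 -> annulus a b (Lp q).
  rewrite /annulus /=; have -> : sqn (Lp q) = csq q 0 * sqn x.
    by rewrite sqnD !sqnZ dotZl dotZr xe ex /csq; ring.
  by move=> ->; rewrite mul1r.
pose eps (i : 'I_1) : R := t; pose q0 : 'M[R]_(1, 2) := delta_mx 0 0.
have q01 s' : csq (rot_by eps s' q0) 0 = 1.
  rewrite /csq /rot_by !mxE /= mulr1 mulr0 subr0 mulr1 mulr0 addr0.
  exact: cos2Dsin2.
have h : g (Lp (rot_by eps 1 q0)) = g (Lp (rot_by eps 0 q0)).
  apply: (derive0_const (g := fun s => g (Lp (rot_by eps s q0)))) => s' _.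
  have aq := sL _ (q01 s').
  have d : differentiable (fun q => g (Lp q)) (rot_by eps s' q0).
    exact: (differentiable_comp (dL _) (dg aq)).
  have := is_derive_along_rot d; rewrite (derive_compE _ (dL _) (dg aq)) Dg // mulr0.
  exact.
have E0 : Lp (rot_by eps 0 q0) = x.
  by rewrite rot_by0 /Lp !mxE /= scale1r scale0r addr0.
have E1 : Lp (rot_by eps 1 q0) = y.
  by rewrite yE /Lp /rot_by !mxE /= /eps !mulr1 !mulr0 subr0 addr0 ct st.
by rewrite -E0 -h E1.
Qed.

(** A radial segment changes the norm, and a rotation in the plane of [sphere_angle] moves within a
    sphere; both stay in the annulus. *)
Lemma const_on_annulus x y : annulus a b x -> annulus a b y -> g x = g y.
Proof.
move=> ax ay; have [x0 y0] : 0 < sqn x /\ 0 < sqn y.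
  by split; [exact: le_lt_trans a0 ax.1|exact: le_lt_trans a0 ay.1].
pose r := Num.sqrt (sqn y / sqn x).
have r0 : 0 < r by rewrite sqrtr_gt0 divr_gt0.
have rx : sqn (r *: x) = sqn y.
  by rewrite sqnZ sqr_sqrtr ?divfK ?gt_eqF // divr_ge0 // ltW.
have arx : annulus a b (r *: x) by rewrite /annulus /= rx.
rewrite -(const_on_sphere arx rx).
have xE : r *: x = x + (r - 1) *: x by rewrite -{2}[x]scale1r -scalerDl addrC subrK.
have seg t : 0 <= t <= 1 -> annulus a b (x + t *: ((r - 1) *: x)).
  move=> /andP[t0 t1]; rewrite scalerA -{1}[x]scale1r -scalerDl.
  have m0 : 0 < 1 + t * (r - 1) by nra.
  have r2 : sqn y = r ^+ 2 * sqn x by rewrite -rx sqnZ.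
  move: ax ay; rewrite /annulus /= sqnZ r2; move: (sqn x) x0 => X X0 [h1 h2] [h3 h4].
  have [r1|r1] := leP 1 r.
    have l1 : 1 <= (1 + t * (r - 1)) ^+ 2 by rewrite exprn_ege1 // lerDl mulr_ge0 // subr_ge0.
    have l2 : (1 + t * (r - 1)) ^+ 2 <= r ^+ 2.
      by rewrite lerXn2r ?nnegrE ?(ltW m0) ?(ltW r0) //; nra.
    by split; nra.
  have l1 : (1 + t * (r - 1)) ^+ 2 <= 1 by rewrite exprn_ile1 ?(ltW m0) //; nra.
  have l2 : r ^+ 2 <= (1 + t * (r - 1)) ^+ 2.
    by rewrite lerXn2r ?nnegrE ?(ltW m0) ?(ltW r0) //; nra.
  by split; nra.
rewrite xE; apply/esym/const_on_segment => t /seg at1; first exact: dg.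
exact: Dg.
Qed.

End AnnulusConnected.

(** * The inverse of the embedding on Q *)

Section AnnulusLift.
Context {R : realType} {n : nat}.
Local Notation Q := 'M[R]_(1 + n, 2).
Local Notation E := 'M[R]_(n, 2).
Implicit Types (q : Q) (x z : E).
Let oQ : open (Qdom : set Q) := @open_Qdom R n.

Variables (a0 b0 tau : R) (f : E -> set E).
Let O : set E := annulus a0 b0.
Let A a := O `&` f @^-1` blowup_dom a.
Hypothesis fi : forall x y, O x -> O y -> f x = f y -> x = y.
Hypothesis oA : forall a, open (A a).
Hypothesis sF : forall a, smooth_mx (A a) (blowup_chart a \o f).
Hypothesis fs : forall a x v w, A a x -> omega_st ('D_v (blowup_chart a \o f) x)
  ('D_w (blowup_chart a \o f) x) = omega_st v w.
Hypothesis fU : forall x, O x -> blowup_ball_set n tau (f x).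

Definition lift_dom : set Q := [set q | Qdom q /\ exists2 x, annulus a0 b0 x & f x = pt q].
Definition lift q : E := get [set x | annulus a0 b0 x /\ f x = pt q].
Local Notation Qf := lift_dom.
Local Notation u := lift.

Lemma lift_dom_sub : Qf `<=` Qdom. Proof. by move=> q []. Qed.

Lemma liftP q : Qf q -> annulus a0 b0 (u q) /\ f (u q) = pt q.
Proof.
by move=> [_ [x Ox fx]]; exact: (@getPex _ [set x | annulus a0 b0 x /\ f x = pt q] (ex_intro _ x (conj Ox fx))).
Qed.

Lemma lift_eq q x : Qdom q -> annulus a0 b0 x -> f x = pt q -> Qf q /\ u q = x.
Proof.
move=> Qq Ox fx; have Qfq : Qf q by split=> //; exists x.
split=> //; have [Ou fu] := liftP Qfq.
by apply: fi => //; rewrite fu.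
Qed.

Let F a x := blowup_chart a (f x).

Let iF a x y : A a x -> A a y -> F a x = F a y -> x = y.
Proof.
move=> [Ox dx] [Oy dy] /(congr1 (blowup_par a)).
by rewrite !blowup_chartK //; exact: fi.
Qed.

Let cF a k i j : Ck k (A a) (fun x => F a x i j).
Proof. exact: sF. Qed.

Let sympF a x v w : A a x -> omega_st ('D_v (F a) x) ('D_w (F a) x) = omega_st v w.
Proof. exact: fs. Qed.

Let Qa a : set Q := [set q | pt_nz a q /\ (F a @` A a) (pt_coord a q)].

Let coord_cont a q : pt_nz a q -> {for q, continuous (@pt_coord R n a)}.
Proof.
move=> nq; apply: differentiable_continuous; apply: differentiable_mx => i j.
exact: Ck_diff (smooth_pt_coord a i j 1) nq.
Qed.

Let oQa a : open (Qa a).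
Proof.
apply: (open_preim (@open_pt_nz R n a) _ (@coord_cont a)).
exact: symp_open_image (@oA a) (cF a) (sympF (a := a)).
Qed.

Let QaP a q : Qa a q -> Qf q /\ u q = loc_inv (A a) (F a) (pt_coord a q).
Proof.
move=> [[Qq nz] im]; have Qq' := Qq; have [Ax Fx] := loc_invP im.
set x := loc_inv _ _ _ in Ax Fx *; apply: lift_eq Qq' Ax.1 _.
have e : blowup_chart a (f x) = blowup_chart a (pt q) by rewrite (pt_chart Qq nz) -[LHS]/(F a x) Fx.
rewrite -(blowup_chartK Ax.2) e.
by rewrite blowup_chartK //; apply/pt_dom.
Qed.

Let Qf_nz a q : Qf q -> pt_nz a q -> Qa a q.
Proof.
move=> Qfq nq; split=> //; have [Ou fu] := liftP Qfq; have [Qq nz] := nq.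
have Au : A a (u q) by split=> //; rewrite /preimage /= fu; apply/(pt_dom a Qq).
by exists (u q) => //; rewrite /F fu (pt_chart Qq nz).
Qed.

Let Qf_cover q : Qdom q -> exists a, pt_nz a q.
Proof.
move=> Qq; have := pt_set Qq; rewrite blowup_cover => -[a _ da].
by exists a; split=> //; exact/pt_dom.
Qed.

Lemma open_lift_dom : open Qf.
Proof.
rewrite (_ : Qf = \bigcup_(a in setT) Qa a); first by apply: bigcup_open => a _; exact: oQa.
apply/seteqP; split=> q.
  by move=> Qfq; have [a na] := Qf_cover Qfq.1; exists a => //; exact: Qf_nz.
by move=> [a _ /QaP[]].
Qed.

Lemma Ck_lift k i j : Ck k Qf (fun q => u q i j).
Proof.
apply: Ck_bigcup => q Qfq; have [a na] := Qf_cover Qfq.1; exists (Qa a); first exact: Qf_nz.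
apply: (Ck_ext (@oQa a) (f := fun q => loc_inv (A a) (F a) (pt_coord a q) i j)).
  by move=> y /[!inE] /QaP[_ ->].
apply: (@Ck_comp R Q n 2 k (Qa a) (F a @` A a) (fun y => loc_inv (A a) (F a) y i j)
  (@pt_coord R n a) (@oQa a)) => //.
- by move=> i' j'; apply: Ck_sub (smooth_pt_coord a i' j' k) => y [].
- exact: Ck_loc_inv (@oA a) (cF a) (iF (a := a)) (sympF (a := a)) _ _ _.
- by move=> y [].
Qed.

Lemma lift_symp q v w : Qf q -> omega_st ('D_v u q) ('D_w u q) = omh q v w.
Proof.
move=> Qfq; have [a na] := Qf_cover Qfq.1; have Qaq := Qf_nz Qfq na.
rewrite -(pt_coord_symp v w na); have [_ im] := Qaq.
have dP : differentiable (@pt_coord R n a) q.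
  by apply: differentiable_mx => i j; exact: Ck_diff (smooth_pt_coord a i j 1) na.
have dL i j := loc_inv_coord_diff (@oA a) (cF a) (iF (a := a)) (sympF (a := a)) i j im.
have Du v' : 'D_v' u q = 'D_('D_v' (@pt_coord R n a) q) (loc_inv (A a) (F a)) (pt_coord a q).
  rewrite -(derive_comp_mx v' dP dL); apply: near_eq_derive.
  have : \forall y \near q, Qa a y by exact: open_nbhs_nbhs.
  by apply: filterS => y /QaP[].
by rewrite !Du; exact: loc_inv_symp (@oA a) (cF a) (iF (a := a)) (sympF (a := a)) _ _ _ im.
Qed.

Lemma lift_rot s q : Qf q -> Qf (rot_by epsX s q) /\ u (rot_by epsX s q) = u q.
Proof.
move=> Qfq; have [Ou fu] := liftP Qfq.
by apply: lift_eq (Qdom_rot s Qfq.1) Ou _; rewrite pt_rot //; exact: Qfq.1.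
Qed.

Lemma lift_rescale r q : 0 < r -> Qf q -> Qf (rescale r q) /\ u (rescale r q) = u q.
Proof.
move=> r0 Qfq; have [Ou fu] := liftP Qfq.
by apply: lift_eq (Qdom_rescale r0 Qfq.1) Ou _; rewrite pt_rescale //; exact: Qfq.1.
Qed.

(** The only place where the target U_tau enters: on the level set |w|^2 = |z|^2 - 1, so the size of
    the ball bounds w. *)
Lemma lift_sqw q : Qf q -> sqw q < (1 + tau) ^+ 2 - 1.
Proof.
move=> Qfq; have [Ou fu] := liftP Qfq; have [z [zt /negP z1] fz] := fU Ou.
have z1' : 1 <= sqn z by rewrite -enorm_ge1 leNgt.
have e0 : 0 <= enorm z := sqrtr_ge0 _.
have iS : act_invariant (fun (z : E) (_ _ : R) => sqn z).
  by move=> z' w0 w1 c s cs; rewrite sqn_crot.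
rewrite fu in fz; have := pt_invariant iS Qfq.1 z1' (esym fz).
rewrite (zlift_sqn (lift_dom_sub Qfq)) => E1; rewrite ltrBrDl -E1 -enorm2.
by rewrite ltrXn2r ?nnegrE //; apply: le_trans e0 (ltW zt).
Qed.

Lemma atlas_near (V : normedModType R) (D : set V) (g : V -> set E) (B : set (set E)) (a : option 'I_n) (x : V) :
  atlas_open (@blowup_dom R n) (@blowup_chart R n) B -> open D -> D x ->
  (forall y, D y -> blowup_dom a (g y)) -> {for x, continuous (blowup_chart a \o g)} ->
  B (g x) -> \forall y \near x, B (g y).
Proof.
move=> oB oD Dx Dg cg Bx.
have h1 : \forall y \near x, D y by exact: open_nbhs_nbhs.
have h2 : \forall y \near x, [set blowup_chart a p | p in blowup_dom a `&` B] (blowup_chart a (g y)).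
  apply: (cg); apply: open_nbhs_nbhs; split; first exact: oB.
  by exists (g x) => //; split=> //; exact: Dg.
apply: filterS2 h1 h2 => y Dy [p [dp Bp] pg].
by rewrite -(blowup_chartK (Dg _ Dy)) -pg blowup_chartK.
Qed.

Lemma compact_sqn (a b : R) : compact [set x : E | a <= sqn x /\ sqn x <= b].
Proof.
have cs : Ck 0 setT (@sqn R n).
  by move=> x _; apply: differentiable_continuous; have [] := derive_sqn x 0.
apply: (@subclosed_compact _ _ [set x : E | `|x| <= 1 + `|b|]).
- apply: closedI; first exact: (closed_Ck_le (Ck_cst 0 setT a) cs).
  exact: (closed_Ck_le cs (Ck_cst 0 setT b)).
- by apply: compact_norm_ball; rewrite addr_ge0.
- move=> x [_ xb]; apply: norm_le_sqn; first by rewrite addr_ge0.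
  apply: le_trans xb _; have := ler_norm b; have := normr_ge0 b; move: `|b| => B; nra.
Qed.

Let fset x : O x -> blowup_set R n (f x).
Proof. by move=> /fU[z [_ z1] <-]; exists z. Qed.

Let f_cover x : O x -> exists a, A a x.
Proof.
by move=> Ox; have := fset Ox; rewrite blowup_cover => -[a _ da]; exists a.
Qed.

Let near_dist (V : normedModType R) (P : V -> Prop) (x : V) : (\forall y \near x, P y) ->
  exists2 d : R, 0 < d & forall y, `|y - x| < d -> P y.
Proof.
move=> /nbhs_ballP[d /= d0 dP]; exists d => // y yd; apply: dP.
by rewrite -ball_normE /= distrC.
Qed.

(** The image of a closed subshell is compact, hence closed in the Hausdorff blowup. Objects
    supported in the subshell can therefore be extended by zero from Qf to all of [Qdom]. *)
Lemma lift_closed (a b : R) : a0 < a -> b < b0 ->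
  open [set q | Qdom q /\ ~ (Qf q /\ a <= sqn (u q) /\ sqn (u q) <= b)].
Proof.
move=> aa bb; rewrite openE => q0 [Qq0 nq0].
pose P (y : E) (r : R) := forall q, `|q - q0| < r -> Qdom q -> pt q <> f y.
have KO x : a <= sqn x /\ sqn x <= b -> O x.
  by move=> [h1 h2]; split; [exact: lt_le_trans aa h1|exact: le_lt_trans h2 bb].
have [|d d0 dP] := @compact_uniform R E P _ (@compact_sqn a b).
  move=> x Kx; have Ox := KO x Kx; have [i Ai] := f_cover Ox; have [j nj] := Qf_cover Qq0.
  have ne : f x <> pt q0.
    by move=> fp; apply: nq0; have [Qfq uq] := lift_eq Qq0 Ox fp; rewrite uq; split.
  have [U1 [U2 [oU1 oU2 Ux Uq UU]]] := blowup_hausdorff (fset Ox) (pt_set Qq0) ne.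
  have [|d1 d10 d1P] := @near_dist E (fun y => U1 (f y)) x.
    apply: (atlas_near oU1 (@oA i) Ai (a := i) _ _ Ux); first by move=> y [].
    apply: differentiable_continuous; apply: differentiable_mx => k l.
    exact: Ck_diff (cF i 1 k l) Ai.
  have [|d2 d20 d2P] := @near_dist Q (fun q => U2 (pt q)) q0.
    apply: (atlas_near oU2 (@open_pt_nz R n j) nj (a := j) _ _ Uq).
      by move=> y [Qy nz]; apply/pt_dom.
    apply: differentiable_continuous; apply: differentiable_mx => k l.
    apply: (near_eq_differentiable (f := fun q => pt_coord j q k l)).
      have : \forall y \near q0, pt_nz j y by apply: open_nbhs_nbhs; split=> //; exact: open_pt_nz.
      by apply: filterS => y [Qy nz]; rewrite /= pt_chart.
    exact: Ck_diff (smooth_pt_coord j k l 1) nj.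
  exists (Num.min d1 d2); first by rewrite lt_min d10.
  move=> y; rewrite lt_min => /andP[y1 y2] r /andP[r0]; rewrite lt_min => /andP[r1 r2] q qr Qq pf.
  have : (U1 `&` U2) (f y) by split; [exact: d1P|rewrite -pf; apply: d2P; exact: lt_trans qr r2].
  by rewrite UU.
have [r r0 rP] := near_ball_open oQ Qq0.
apply/nbhs_ballP; exists (Num.min r (d / 2)); first by rewrite /= lt_min r0 divr_gt0.
move=> q; rewrite -ball_normE /= distrC lt_min => /andP[/rP Qq qd]; split; first exact: Qq.
move=> [Qfq Ku].
have dd : 0 < d / 2 < d by rewrite divr_gt0 //= ltr_pdivrMr // ltr_pMr // ltr1n.
by apply: (dP (u q) Ku _ dd q qd Qq); have [_ ->] := liftP Qfq.
Qed.

Section Descent.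
Variable phi : Q -> R.
Hypothesis dphi : forall q, Qf q -> differentiable phi q.
Hypothesis Dphi : forall q v, Qf q -> 'D_v phi q = 0.
Hypothesis a0_ge0 : 0 <= a0.

Let phi_rot t q : Qf q -> phi (rot_by epsX t q) = phi q.
Proof.
move=> Qfq; pose eps i := t * @epsX R n i.
have rE s : rot_by eps s q = rot_by epsX (t * s) q.
  apply/matrixP => i j; rewrite !mxE /eps.
  by rewrite (_ : 2 * pi * (t * epsX i) * s = 2 * pi * epsX i * (t * s)) //; ring.
have := @derive0_const R (fun s => phi (rot_by eps s q)); rewrite !rE mulr1 mulr0 rot_by0.
apply=> s _; have [Qr _] := lift_rot (t * s) Qfq; rewrite -rE in Qr.
by have := is_derive_along_rot (dphi Qr); rewrite Dphi // mulr0.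
Qed.

Let phi_rescale r q : 0 < r -> Qf q -> phi (rescale r q) = phi q.
Proof.
move=> r0 Qfq; pose h := in_y ((r - 1) *: dsubmx q).
have E1 t : q + t *: h = rescale (1 + t * (r - 1)) q.
  rewrite {1}(q_split q) /rescale /h /in_w /in_y scale_col_mx !add_col_mx !scaler0 !addr0 add0r.
  by rewrite scalerA scalerDl scale1r.
have -> : rescale r q = q + h by rewrite -[h]scale1r E1 mul1r addrC subrK.
have seg t : 0 <= t <= 1 -> Qf (q + t *: h).
  move=> /andP[t0 t1]; rewrite E1; have m0 : 0 < 1 + t * (r - 1) by nra.
  by have [] := lift_rescale m0 Qfq.
by apply: const_on_segment => t /seg Qt; [exact: dphi|exact: Dphi].
Qed.

Let phi_fibre q q' : Qf q -> Qf q' -> u q = u q' -> phi q = phi q'.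
Proof.
move=> Qfq Qfq' uu; have [_ fq] := liftP Qfq; have [_ fq'] := liftP Qfq'.
have pp : pt q = pt q' by rewrite -fq uu.
have [t [r [r0 ->]]] := pt_orbit Qfq.1 Qfq'.1 pp.
have [Qr _] := lift_rot t Qfq.
by rewrite (phi_rescale r0 Qr) (phi_rot t Qfq).
Qed.

Let sec_w a (y : E) : 'M[R]_(1, 2) :=
  \matrix_(i, j) (if j == 0 then cut_w0 a y else cut_w1 a y).
(** A local section of the projection over the chart a, through which functions on Qf descend to
    differentiable functions on the annulus. *)
Let sec a (y : E) : Q := col_mx (sec_w a y) (cut_z a y).

Let chart_dom a x : A a x -> cut_dom a (F a x).
Proof.
move=> [Ox]; rewrite /preimage /= blowup_domE => -[z [z1 nz] fz].
have [h _ _ _] := cut_of_coord (cut_level_lift z1) nz.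
by rewrite /F -fz chart_collapse.
Qed.

Let sec_ok a x : A a x -> Qf (sec a (F a x)) /\ u (sec a (F a x)) = x.
Proof.
move=> Ax; have cd := chart_dom Ax; have lev := cut_levelP cd.
set y := F a x in cd lev *; rewrite /cut_level in lev.
have s1 : sqy (sec a y) = sqn (cut_z a y) by rewrite /sqy /sec col_mxKd.
have s2 : sqw (sec a y) = cut_w0 a y ^+ 2 + cut_w1 a y ^+ 2.
  by rewrite /sqw /sec col_mxKu /sqn big_ord1 /csq !mxE.
have z1 : sqn (cut_z a y) = 1 + sqw (sec a y) by rewrite s2 -lev subrK.
have Qs : Qdom (sec a y) by rewrite /Qdom /= s1 z1 ltr_pwDl // sqn_ge0.
apply: lift_eq Qs Ax.1 _; rewrite /pt /zlift /fh s1 z1 divff ?sqrtr1; last first.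
  by rewrite gt_eqF // ltr_pwDl // sqn_ge0.
rewrite scale1r /wre /wim /sec col_mxKu col_mxKd !mxE /= -[RHS]/(blowup_par a y).
by rewrite blowup_chartK //; have [] := Ax.
Qed.

Let sec_diff a x : A a x -> differentiable (fun x => sec a (F a x)) x.
Proof.
move=> Ax; apply: differentiable_mx => i j.
have comp (g : E -> R) : smooth (cut_dom a) g -> differentiable (fun x => g (F a x)) x.
  move=> sg; have dF : differentiable (F a) x.
    by apply: differentiable_mx => k l; exact: Ck_diff (cF a 1 k l) Ax.
  exact: (differentiable_comp dF (Ck_diff (sg 1) (chart_dom Ax))).
case: (fintype.split_ordP i) => k ->.
  have -> : (fun x => sec a (F a x) (lshift n k) j) =
      (fun x => if j == 0 then cut_w0 a (F a x) else cut_w1 a (F a x)).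
    by apply/funext => x'; rewrite col_mxEu mxE.
  case: (j == 0); apply: comp; [exact: smooth_cut_w0|exact: smooth_cut_w1].
have -> : (fun x => sec a (F a x) (rshift 1 k) j) = (fun x => cut_z a (F a x) k j).
  by apply/funext => x'; rewrite col_mxEd.
exact: (comp (fun y => cut_z a y k j) (@smooth_cut_z R n a k j)).
Qed.

Let psi x := phi (get [set q | Qf q /\ u q = x]).

Let psiE q : Qf q -> psi (u q) = phi q.
Proof.
move=> Qfq; have [Qg ug] := @getPex _ [set q' | Qf q' /\ u q' = u q] (ex_intro _ q (conj Qfq erefl)).
exact: phi_fibre.
Qed.

Let psi_sec a x : A a x -> psi x = phi (sec a (F a x)).
Proof. by move=> Ax; have [Qs us] := sec_ok Ax; rewrite -{1}us psiE. Qed.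

Let psi_derive x v : O x -> differentiable psi x /\ 'D_v psi x = 0.
Proof.
move=> Ox; have [a Ax] := f_cover Ox; have [Qs us] := sec_ok Ax.
have ds := sec_diff Ax; have near_eq : \forall y \near x, phi (sec a (F a y)) = psi y.
  have : \forall y \near x, A a y by apply: open_nbhs_nbhs; split=> //; exact: oA.
  by apply: filterS => y Ay; rewrite (psi_sec Ay).
split; first exact: near_eq_differentiable near_eq (differentiable_comp ds (dphi Qs)).
rewrite -(near_eq_derive v near_eq) (derive_compE v ds (dphi Qs)).
exact: Dphi.
Qed.

(** The function is constant on fibres by [pt_orbit], so it descends to the annulus, which is
    connected. *)
Lemma lift_const q q' : Qf q -> Qf q' -> phi q = phi q'.
Proof.
move=> Qfq Qfq'; rewrite -(psiE Qfq) -(psiE Qfq').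
have [Oq _] := liftP Qfq; have [Oq' _] := liftP Qfq'.
apply: (const_on_annulus a0_ge0 _ _ Oq Oq') => x; first by move=> Ox; have [] := psi_derive 0 Ox.
by move=> v Ox; have [] := psi_derive v Ox.
Qed.

End Descent.

Lemma lift_surj x : annulus a0 b0 x -> exists2 q, Qf q & u q = x.
Proof.
move=> Ox; have := fset Ox; rewrite blowup_setE => -[z z1 fz].
have Qz : Qdom (iota z : Q) by rewrite /Qdom /= iota_sqy (lt_le_trans ltr01).
by exists (iota z); have [] := lift_eq Qz Ox (_ : f x = pt (iota z)); rewrite ?pt_iota.
Qed.

(** The section [iota] misses the exceptional divisor; when w = 0 at the point found, openness of Qf
    allows a shift of w. *)
Lemma lift_iota x : annulus a0 b0 x -> exists z : E, 1 < sqn z /\ Qf (iota z).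
Proof.
move=> /lift_surj[q Qfq _].
have [q' Qfq' w0] : exists2 q', Qf q' & 0 < sqw q'.
  have [w0|wn0] := eqVneq (sqw q) 0; last first.
    by exists q => //; rewrite lt_def wn0 sqn_ge0.
  have [d d0 dP] := near_ball_open open_lift_dom Qfq.
  have E1 : sqw (q + (d / 2) *: Uw) = (d / 2) ^+ 2.
    move: w0; rewrite !sqwE => /sq_eq0[w0 w1]; rewrite /wre /wim in w0 w1 *.
    have ul : lin_fun (usubmx : Q -> 'M[R]_(1, 2)) := @usubmx_lin R n.
    have wE j : usubmx (q + (d / 2) *: Uw) 0 j =
        usubmx q 0 j + d / 2 * (delta_mx 0 0 : 'M[R]_(1, 2)) 0 j.
      by rewrite (lin_funD ul) (lin_funZ ul) /Uw /in_w col_mxKu mxE [X in _ + X]mxE.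
    by rewrite !wE w0 w1 !mxE /= !add0r mulr1 mulr0 expr0n addr0.
  exists (q + (d / 2) *: Uw); last by rewrite E1 exprn_gt0 // divr_gt0.
  apply: dP; rewrite addrC addKr normrZ gtr0_norm ?divr_gt0 //.
  apply: (@le_lt_trans _ _ (d / 2 * 1)).
    apply: ler_wpM2l; first by rewrite ltW // divr_gt0.
    by apply: norm_col => //; rewrite ?mx_delta_norm ?normr0.
  by rewrite mulr1 ltr_pdivrMr // ltr_pMr // ltr1n.
have [Qq' _] := Qfq'; have [c [s [cs z1 _ _ pq]]] := pt_rep Qq'.
set z := crot _ _ _ in z1 pq; have zE : sqn z = 1 + sqw q' by rewrite sqn_crot // zlift_sqn.
exists z; split; first by rewrite zE ltrDl.
have Qz : Qdom (iota z : Q) by rewrite /Qdom /= iota_sqy (lt_le_trans ltr01).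
have [Ou fu] := liftP Qfq'.
by have [] := lift_eq Qz Ou (_ : f (u q') = pt (iota z)); rewrite ?pt_iota // fu.
Qed.

Lemma lift_iota_inj z z' : 1 < sqn z -> 1 < sqn z' -> Qf (iota z) -> Qf (iota z') ->
  u (iota z) = u (iota z') -> z = z'.
Proof.
move=> z1 z'1 Qz Qz' uu; have [_ fz] := liftP Qz; have [_ fz'] := liftP Qz'.
have : collapse z z'.
  rewrite -(pt_iota (ltW z1)) -fz uu fz' (pt_iota (ltW z'1)); exact: collapse_refl.
move=> [->//|[/enorm_eq1 e1]]; by rewrite e1 ltxx in z1.
Qed.

End AnnulusLift.

(** * Cutoff forms *)

Section FormLocality.
Context {R : realType} {m : nat}.
Local Notation E := 'M[R]_(m, 2).

Lemma form2m_ext k (A : set E) (eta eta' : E -> E -> E -> R) :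
  open A -> (forall q, A q -> eta q = eta' q) -> form2m k A eta -> form2m k A eta'.
Proof.
move=> oA ee [f1 anti clo]; split.
- move=> u; have [lin ck] := f1 u; split=> [q Aq|v]; first by rewrite -ee //; exact: lin.
  by apply: Ck_ext (ck v) => // q /[!inE] Aq; rewrite ee.
- by move=> q u v Aq; rewrite -ee //; exact: anti.
- move=> q u v w Aq; rewrite -(clo q u v w Aq); congr (_ + _ + _);
    by apply: (eq_derive _ oA Aq) => y Ay; rewrite ee.
Qed.

Lemma form2m_union k (A B : set E) (eta : E -> E -> E -> R) :
  form2m k A eta -> form2m k B eta -> form2m k (A `|` B) eta.
Proof.
move=> [f1 anti clo] [f1' anti' clo']; split.
- move=> u; have [lin ck] := f1 u; have [lin' ck'] := f1' u; split=> [q [/lin|/lin']|v] //.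
  by apply: Ck_union; [exact: ck|exact: ck'].
- by move=> q u v [/anti|/anti'].
- by move=> q u v w [/clo|/clo'].
Qed.

End FormLocality.

Section Cutoff.
Context {R : realType} {n : nat}.
Local Notation Q := 'M[R]_(1 + n, 2).
Local Notation E := 'M[R]_(n, 2).
Implicit Types (q v w : Q) (x z : E).
Let oQ : open (Qdom : set Q) := @open_Qdom R n.

Variables (u : Q -> E) (Qf : set Q) (a0 b0 l a b : R).
Hypothesis oQf : open Qf.
Hypothesis QfQ : Qf `<=` Qdom.
Hypothesis cu : forall k i j, Ck k Qf (fun q => u q i j).
Hypothesis su : forall q v w, Qf q -> omega_st ('D_v u q) ('D_w u q) = omh q v w.
Hypothesis ru : forall s q, Qf q -> Qf (rot_by epsX s q) /\ u (rot_by epsX s q) = u q.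
Hypothesis wu : forall q, Qf q -> sqw q < l ^+ 2.
Hypothesis cl : forall a b, a0 < a -> b < b0 ->
  open [set q | Qdom q /\ ~ (Qf q /\ a <= sqn (u q) /\ sqn (u q) <= b)].
Hypothesis cst_lift : forall phi : Q -> R, (forall q, Qf q -> differentiable phi q) ->
  (forall q v, Qf q -> 'D_v phi q = 0) -> forall q q', Qf q -> Qf q' -> phi q = phi q'.
Hypothesis l0 : 0 < l.
Hypothesis nonempty : exists q, Qf q.
Hypothesis aa : a0 < a.
Hypothesis ab : a < b.
Hypothesis bb : b < b0.

Let K : set Q := [set q | Qf q /\ a <= sqn (u q) /\ sqn (u q) <= b].
Let Kc : set Q := [set q | Qdom q /\ ~ K q].
Let oK : open Kc := cl aa bb.
Let KQ : Kc `<=` Qdom. Proof. by move=> q []. Qed.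
Let cover q : Qdom q -> Qf q \/ Kc q.
Proof. by move=> Qq; case: (pselect (Qf q)) => h; [left|right; split=> // -[]]. Qed.

Definition rho (t : R) := 1 - plateau a b t.

Let r q := rho (sqn (u q)).

Lemma Ck_rho : Ck 2 setT rho.
Proof. by apply: (Ck_minus openT); [exact: Ck_cst|exact: Ck_plateau]. Qed.

Lemma is_derive_rho t : is_derive t (1 : R) rho (st' ((t - a) / (b - a)) / (b - a)).
Proof. by have := is_derive_1sub (is_derive_plateau a b t); rewrite opprK. Qed.

Let c_sqn k : Ck k Qf (fun q => sqn (u q)).
Proof. exact: Ck_sqn oQf (cu k). Qed.

Let d_sqn q : Qf q -> differentiable (fun q => sqn (u q)) q.
Proof. exact: Ck_diff (c_sqn 1). Qed.

Let cr : Ck 2 Qf r.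
Proof. exact: Ck_comp1 oQf (c_sqn 2) Ck_rho. Qed.

Let ab0 : 0 < b - a. Proof. by rewrite subr_gt0. Qed.

Let Dr0 q v : Qf q -> ~ K q -> 'D_v r q = 0.
Proof.
move=> Qfq nK; rewrite /r (derive_comp1 v (d_sqn Qfq) (is_derive_rho _)).
suff -> : st' ((sqn (u q) - a) / (b - a)) = 0 by rewrite !mul0r.
case: (leP (sqn (u q)) a) => h.
  by apply: st'_0; rewrite pmulr_lle0 ?invr_gt0 // subr_le0.
apply: st'_1; rewrite ler_pdivlMr // mul1r lerD2r leNgt; apply/negP => h'.
by apply: nK; split=> //; split; exact: ltW.
Qed.

(** The differential of rho(|u|^2), extended by zero: it vanishes off the closed subshell, so this
    is a closed one-form on all of [Qdom]. *)
Let al v q : R := if `[< Qf q >] then 'D_v r q else 0.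

Let al_in v q : Qf q -> al v q = 'D_v r q.
Proof. by move=> Qfq; rewrite /al asboolT. Qed.

Let al_out v q : ~ Qf q -> al v q = 0.
Proof. by move=> nQ; rewrite /al asboolF. Qed.

Let al_K v q : Kc q -> al v q = 0.
Proof.
move=> [Qq nK]; case: (pselect (Qf q)) => h; last exact: al_out.
by rewrite al_in // Dr0.
Qed.

Let c_al v : Ck 1 Qdom (al v).
Proof.
apply: (@Ck_sub R Q 1 (Qf `|` Kc) Qdom); first by move=> q /cover.
apply: Ck_union.
  apply: Ck_ext (Ck_derive v cr) => // q /[!inE] Qfq; by rewrite al_in.
apply: Ck_ext (Ck_cst 1 Kc 0) => // q /[!inE] Kq; by rewrite al_K.
Qed.

Let al_swap v w q : Qdom q -> 'D_v (al w) q = 'D_w (al v) q.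
Proof.
move=> Qq; have [Qfq|Kq] := cover Qq.
  apply: etrans (eq_derive v oQf Qfq (al_in w)) _.
  apply: etrans (derive_swap v w oQf cr Qfq) _.
  exact: esym (eq_derive w oQf Qfq (al_in v)).
exact: etrans (derive_near0 v oK Kq (al_K w)) (esym (derive_near0 w oK Kq (al_K v))).
Qed.

Let al_far v q : l ^+ 2 < sqw q -> al v q = 0.
Proof. by move=> h; apply: al_out => /wu; rewrite ltNge ltW. Qed.

Let L : R := 6 * l.
Let chi0 := prim L (al Uw).

Let c_chi0 : Ck 1 Qdom chi0 := Ck_prim L (c_al Uw).

Let wre_far q : l < `|wre q| -> l ^+ 2 < sqw q.
Proof.
move=> h; rewrite sqwE -[wre q ^+ 2]real_normK ?num_real //.
apply: lt_le_trans (_ : `|wre q| ^+ 2 <= _); last by rewrite lerDl sqr_ge0.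
by rewrite ltrXn2r ?nnegrE // ltW.
Qed.

Let wim_far q : l < `|wim q| -> l ^+ 2 < sqw q.
Proof.
move=> h; rewrite sqwE -[wim q ^+ 2]real_normK ?num_real //.
apply: lt_le_trans (_ : `|wim q| ^+ 2 <= _); last by rewrite lerDr sqr_ge0.
by rewrite ltrXn2r ?nnegrE // ltW.
Qed.

Let d_chi0 q v : Qdom q -> - (5 * l) < wre q -> 'D_v chi0 q = al v q.
Proof.
move=> Qq wq; rewrite /chi0 (derive_prim L v (c_al Uw) Qq).
rewrite (eq_prim (G := fun x : Q => 'D_(Uw : Q) (al v) x)); last first.
  by move=> s _; apply: al_swap; exact: shiftU_dom.
rewrite (prim_deriveU L (c_al v) Qq) (al_far v (q := shiftU L 1 q)) ?subr0 //.
apply: wre_far; rewrite shiftU_wre mulr1 /L; apply: lt_le_trans (ler_norm _); move: wq; lra.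
Qed.

(** Moving in the direction of Im w away from 0 stays in |w| > l, where the differential vanishes,
    and reaches points from which the whole path of integration has |Im w| > l. *)
Let chi0_far q : Qdom q -> l ^+ 2 < sqw q -> - (5 * l) < wre q -> chi0 q = 0.
Proof.
move=> Qq sq wq.
have im0 q' : l < `|wim q'| -> chi0 q' = 0.
  by move=> h; apply: prim_eq0 => s _; apply: al_far; apply: wim_far; rewrite shiftU_wim.
pose sg : R := if 0 <= wim q then 1 else -1.
pose h := (2 * l * sg) *: Vw : Q.
have hy t : dsubmx (q + t *: h) = dsubmx q.
  rewrite (lin_funD (@dsubmx_lin R n)) !(lin_funZ (@dsubmx_lin R n)) /Vw /in_w col_mxKd.
  by rewrite !scaler0 addr0.
have hw t j : usubmx (q + t *: h) 0 j = usubmx q 0 j + t * (2 * l * sg * (j == 1)%:R).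
  rewrite (lin_funD (@usubmx_lin R n)) !(lin_funZ (@usubmx_lin R n)) /Vw /in_w col_mxKu.
  by rewrite [LHS]mxE [X in _ + X]mxE [X in _ + _ * X]mxE [X in _ + _ * (_ * X)]mxE eqxx.
have hre t : wre (q + t *: h) = wre q by rewrite /wre hw /= !mulr0 addr0.
have him t : wim (q + t *: h) = wim q + t * (2 * l * sg) by rewrite /wim hw /= mulr1.
have hQ t : Qdom (q + t *: h) by rewrite /Qdom /= /sqy hy.
have him2 t : 0 <= t -> wim q ^+ 2 <= wim (q + t *: h) ^+ 2.
  move=> t0; have tl : 0 <= t * l by rewrite mulr_ge0 // ltW.
  rewrite him /sg; case: (leP 0 (wim q)) => w0; nra.
have hs t : 0 <= t -> l ^+ 2 < sqw (q + t *: h).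
  by move=> t0; apply: lt_le_trans sq _; rewrite !sqwE hre lerD2l him2.
rewrite -(@const_on_segment R Q chi0 q h).
- rewrite -[h]scale1r; apply: im0; rewrite him mul1r /sg.
  case: (leP 0 (wim q)) => w0.
    apply: lt_le_trans (ler_norm _); have := l0; lra.
  rewrite ltr0_norm; have := l0; lra.
- by move=> t _; exact: Ck_diff c_chi0 (hQ t).
- by move=> t /andP[t0 _]; rewrite d_chi0 ?hre // al_far // hs.
Qed.

Lemma gauge_potential : exists chi : Q -> R, [/\ Ck 1 Qdom chi,
  forall q v, Qf q -> 'D_v chi q = 'D_v r q,
  forall q v, Kc q -> 'D_v chi q = 0 &
  forall q, Qdom q -> l ^+ 2 < sqw q -> chi q = 0].
Proof.
(* [chi0] is a primitive only for Re w > - 5 l. It is already zero for l < |w| < 2 l and is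
   continued by zero. *)
pose chi q := if sqw q < 4 * l ^+ 2 then chi0 q else 0.
have ll : 0 < l ^+ 2 by rewrite exprn_gt0.
have w_in q : sqw q < 4 * l ^+ 2 -> - (5 * l) < wre q.
  move=> h; apply: (tube_wre l0); apply: lt_le_trans h _; rewrite exprMn.
  by apply: ler_wpM2r; [exact: ltW|rewrite expr2; lra].
pose B1 : set Q := Qdom `&` [set q | sqw q < 4 * l ^+ 2].
pose B2 : set Q := Qdom `&` [set q | l ^+ 2 < sqw q].
have oB1 : open B1 by apply: openI => //; exact: open_sqw.
have oB2 : open B2.
  by apply: openI => //; exact: open_Ck_lt (Ck_cst 0 setT (l ^+ 2)) (@Ck_sqw R n 0).
have chi1 q : B1 q -> chi q = chi0 q by move=> [_ h]; rewrite /chi h.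
have chi2 q : B2 q -> chi q = 0.
  by move=> [Qq h]; rewrite /chi; case: ifP => // h'; apply: chi0_far => //; exact: w_in.
have cov q : Qdom q -> B1 q \/ B2 q.
  move=> Qq; case: (ltP (sqw q) (4 * l ^+ 2)) => h; [left|right]; split=> //=.
  by apply: lt_le_trans h; move: (l ^+ 2) ll => X; lra.
have D q v : Qdom q -> 'D_v chi q = al v q.
  move=> Qq; have [h|h] := cov _ Qq.
    rewrite (eq_derive v oB1 h chi1) d_chi0 //; apply: w_in; exact: h.2.
  by rewrite (derive_near0 v oB2 h chi2) al_far //; exact: h.2.
exists chi; split.
- apply: (@Ck_sub R Q 1 (B1 `|` B2) Qdom); first by move=> q /cov.
  apply: Ck_union.
    apply: (Ck_ext oB1 _ (f := chi0)); first by move=> q /[!inE] /chi1.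
    by apply: Ck_sub c_chi0 => q [].
  by apply: Ck_ext (Ck_cst 1 B2 0) => // q /[!inE] /chi2.
- by move=> q v Qfq; rewrite D ?al_in //; exact: QfQ.
- by move=> q v Kq; rewrite D ?al_K //; exact: KQ.
- by move=> q Qq h; apply: chi2.
Qed.

Section Potential.
Variable chi : Q -> R.
Hypothesis c_chi : Ck 1 Qdom chi.
Hypothesis D_in : forall q v, Qf q -> 'D_v chi q = 'D_v r q.
Hypothesis D_out : forall q v, Kc q -> 'D_v chi q = 0.
Hypothesis chi_far : forall q, Qdom q -> l ^+ 2 < sqw q -> chi q = 0.

Let chi_loc q : Kc q -> exists2 d : R, 0 < d & forall y, `|y - q| < d -> Kc y /\ chi y = chi q.
Proof.
move=> Kq; have [d d0 dP] := near_ball_open oK Kq; exists d => // y yd; split; first exact: dP.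
have seg t : 0 <= t <= 1 -> Kc (q + t *: (y - q)).
  move=> /andP[t0 t1]; apply: dP; rewrite addrC addKr normrZ ger0_norm //.
  by apply: le_lt_trans yd; rewrite ler_piMl.
rewrite -{1}(subrK q y) [y - q + q]addrC; apply: const_on_segment => t /seg Kt.
  exact: Ck_diff c_chi (KQ Kt).
exact: D_out.
Qed.

(** The region far from the shell, where chi = 0, must touch it from one of its sides, and there rho
    is 0 or 1. For any other constant the far region would be open and closed without being
    everything. *)
Lemma potential_const : exists c0 : R, (forall q, Qf q -> chi q = r q + c0) /\ (c0 = 0 \/ c0 = -1).
Proof.
have [q1 Q1] := nonempty; pose phi q := chi q - r q.
have dchi q : Qf q -> differentiable chi q by move=> Qfq; exact: Ck_diff c_chi (QfQ Qfq).
have dr q : Qf q -> differentiable r q by move=> Qfq; exact: Ck_diff cr Qfq.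
have chiE q : Qf q -> chi q = r q + phi q1.
  move=> Qfq; suff -> : phi q1 = phi q by rewrite /phi addrC subrK.
  apply: cst_lift => // q' h; first by apply: differentiableB; [exact: dchi|exact: dr].
  move=> h'; apply: etrans (derive_sub h (dchi _ h') (dr _ h')) _.
  by rewrite (D_in h h') subrr.
exists (phi q1); split=> //; set c := phi q1 in chiE *.
apply: contrapT => /not_orP[c_0 c_1].
(* Indicator of the zeros of chi outside the closed subshell; locally constant if c0 is neither 0
   nor -1, equal to 1 far away and to 0 on Qf. *)
pose F q : R := (`[< chi q = 0 /\ ~ K q >])%:R.
have F_in q : Qf q -> F q = 0.
  move=> Qfq; rewrite /F asboolF // => -[]; rewrite chiE // /r /rho.
  case: (leP (sqn (u q)) a) => h1.
    by rewrite plateau1 // subrr add0r => /c_0.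
  case: (leP b (sqn (u q))) => h2.
    by rewrite plateau0 // subr0 => h _; apply: c_1; rewrite -[RHS]addr0 -h addKr.
  by move=> _; apply; split=> //; rewrite !ltW.
have F_out q : Kc q -> exists2 d : R, 0 < d & forall y, `|y - q| < d -> F y = F q.
  move=> Kq; have [d d0 dP] := chi_loc Kq; exists d => // y /dP[Ky E].
  rewrite /F; congr (_ %:R); rewrite E; congr (nat_of_bool _); apply: asbool_equiv_eq.
  by split=> -[h _]; split=> //; [exact: Kq.2|exact: Ky.2].
have F_loc q : Qdom q -> \forall y \near q, F q = F y.
  move=> Qq; have [Qfq|Kq] := cover Qq.
    have : \forall y \near q, Qf y by exact: open_nbhs_nbhs.
    by apply: filterS => y Qy; rewrite !F_in.
  have [d d0 dP] := F_out _ Kq; apply/nbhs_ballP; exists d => // y.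
  by rewrite -ball_normE /= distrC => /dP ->.
have dF q : Qdom q -> differentiable F q.
  move=> Qq; apply: (near_eq_differentiable (f := cst (F q))); first exact: F_loc.
  exact: differentiable_cst.
have DF q v : Qdom q -> 'D_v F q = 0.
  by move=> Qq; rewrite -(near_eq_derive v (F_loc _ Qq)) derive_cst.
pose q2 : Q := col_mx ((2 * l) *: delta_mx 0 0) (dsubmx q1).
have w2 : sqw q2 = (2 * l) ^+ 2.
  by rewrite /sqw col_mxKu sqnZ /sqn big_ord1 /csq !mxE /= expr1n expr0n addr0 mulr1.
have Q2 : Qdom q2 by rewrite /Qdom /= /sqy col_mxKd; exact: QfQ Q1.
have ll : 0 < l ^+ 2 by rewrite exprn_gt0.
have w2l : l ^+ 2 < sqw q2 by rewrite w2 exprMn; move: (l ^+ 2) ll => X; lra.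
have nf : ~ Qf q2 by move=> /wu; rewrite ltNge (ltW w2l).
have F2 : F q2 = 1 by rewrite /F asboolT //; split; [exact: chi_far|move=> -[]].
have : F q1 = F q2.
  apply: (@const_on_tube R n ((5 * l) ^+ 2)) => //.
  - by move=> q Qq _; exact: dF.
  - by move=> q v Qq _; exact: DF.
  - exact: QfQ.
  - by apply: lt_trans (wu Q1) _; rewrite exprMn; move: (l ^+ 2) ll => X; lra.
  - by rewrite w2 !exprMn; move: (l ^+ 2) ll => X; lra.
by rewrite F2 F_in // => /eqP; rewrite eq_sym oner_eq0.
Qed.

Variable c0 : R.
Hypothesis chiE : forall q, Qf q -> chi q = r q + c0.

Section Profile.
Variable kappa : R -> R.
Hypothesis c_kappa : Ck 2 setT kappa.
Hypothesis kappa0 : kappa 0 = 0.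

Definition profile (t : R) := kappa (rho t + c0).

Lemma Ck_profile : Ck 2 setT profile.
Proof.
apply: (Ck_comp1 openT _ c_kappa); apply: (Ck_add openT); first exact: Ck_rho.
exact: Ck_cst.
Qed.

Definition profile' (t : R) := 'D_1 profile t.

Lemma is_derive_profile t : is_derive t (1 : R) profile (profile' t).
Proof. by apply: DeriveDef => //; apply: diff_derivable; exact: (Ck_diff Ck_profile (I : setT t)). Qed.

Lemma Ck_profile' : Ck 1 setT profile'.
Proof. exact: Ck_derive Ck_profile. Qed.

Lemma profile'_out t : t <= a \/ b <= t -> profile' t = 0.
Proof.
move=> h; have [dk Dk] := is_derive_diff (is_derive_rho t).
have dr : differentiable (fun t => rho t + c0) t.
  by apply: differentiableD => //; exact: differentiable_cst.
have [dkap _] := is_derive_diff (DeriveDef (diff_derivable (v := (1 : R)) (Ck_diff c_kappa (I : setT (rho t + c0)))) erefl).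
have ik := DeriveDef (diff_derivable (v := (1 : R)) (Ck_diff c_kappa (I : setT (rho t + c0)))) erefl.
rewrite /profile' /profile (derive_comp1 (1 : R) dr ik).
rewrite (derive_add (1 : R) dk (differentiable_cst _ _)) derive_cst addr0 Dk mul1r.
suff -> : st' ((t - a) / (b - a)) = 0 by rewrite mul0r mulr0.
case: h => h.
  by apply: st'_0; rewrite pmulr_lle0 ?invr_gt0 // subr_le0.
by apply: st'_1; rewrite ler_pdivlMr // mul1r lerD2r.
Qed.

Definition level_fun q := kappa (chi q).
Let psi := level_fun.

Let c_psi : Ck 1 Qdom psi.
Proof. by apply: (Ck_comp1 oQ c_chi); exact: CkW. Qed.

Lemma level_fun_lift q : Qf q -> psi q = profile (sqn (u q)).
Proof. by move=> Qfq; rewrite /psi /level_fun chiE. Qed.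

Let c_psi2 : Ck 2 Qf psi.
Proof.
apply: (Ck_ext oQf (f := fun q => profile (sqn (u q)))).
  by move=> q /[!inE] /level_fun_lift.
exact: Ck_comp1 oQf (c_sqn 2) Ck_profile.
Qed.

Let d_psi q : Qf q -> differentiable psi q := fun h => Ck_diff c_psi2 h.

Let D_psi_K q v : Kc q -> 'D_v psi q = 0.
Proof.
move=> Kq; have dc := Ck_diff c_chi (KQ Kq).
have ik := DeriveDef (diff_derivable (v := (1 : R)) (Ck_diff c_kappa (I : setT (chi q)))) erefl.
by rewrite /psi /level_fun (derive_comp1 v dc ik) D_out // mulr0.
Qed.

Lemma level_fun_far q : Qdom q -> l ^+ 2 < sqw q -> psi q = 0.
Proof. by move=> Qq h; rewrite /psi /level_fun chi_far. Qed.

Let du q : Qf q -> forall i j, differentiable (fun q => u q i j) q.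
Proof. by move=> Qfq i j; exact: Ck_diff (cu 1 i j) Qfq. Qed.

Let duE q : Qf q -> differentiable u q.
Proof. by move=> Qfq; apply: differentiable_mx; exact: du. Qed.

Lemma derive_level_fun q v : Qf q ->
  'D_v psi q = profile' (sqn (u q)) * (2 * dot (u q) ('D_v u q)).
Proof.
move=> Qfq; rewrite (eq_derive v oQf Qfq level_fun_lift).
rewrite (derive_comp1 v (d_sqn Qfq) (is_derive_profile _)).
have [d1 _] := derive_sqn (u q) 0.
rewrite (derive_compE v (duE Qfq) d1).
by have [_ ->] := derive_sqn (u q) ('D_v u q).
Qed.

Definition cut_form q v w : R := psi q * omh q v w +
  if `[< Qf q >] then 2^-1 * ('D_v psi q * omega_st (u q) ('D_w u q) -
    'D_w psi q * omega_st (u q) ('D_v u q)) else 0.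

Let half_u q : E := (2^-1 * psi q) *: u q.

Let c_half : forall i j, Ck 2 Qf (fun q => half_u q i j).
Proof.
move=> i j; apply: (Ck_ext oQf (f := fun q => 2^-1 * psi q * u q i j)).
  by move=> q _; rewrite /half_u mxE.
by apply: (Ck_mul oQf); [exact: (Ck_scale oQf)|exact: cu].
Qed.

Let cu4 : forall i j, Ck 4 Qf (fun q => u q i j) := cu 4.

Let D_half q v : Qf q -> 'D_v half_u q = (2^-1 * 'D_v psi q) *: u q + (2^-1 * psi q) *: 'D_v u q.
Proof.
move=> Qfq; apply/matrixP => i j.
have dh i' j' : differentiable (fun q => half_u q i' j') q := Ck_diff (c_half i' j') Qfq.
rewrite (derive_mxE v dh) [LHS]mxE.
have -> : (fun q => half_u q i j) = (fun q => (2^-1 * psi q) * u q i j).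
  by apply/funext => x; rewrite /half_u mxE.
have dp : differentiable (fun q => 2^-1 * psi q) q.
  by apply: differentiableM; [exact: differentiable_cst|exact: d_psi].
rewrite derive_mul //; last exact: du.
have -> : 'D_v (fun q => 2^-1 * psi q) q = 2^-1 * 'D_v psi q.
  rewrite (derive_mul (f := fun=> 2^-1)) ?derive_cst ?mul0r ?addr0 //; exact: d_psi.
rewrite (derive_mxE v (du Qfq)) [RHS]mxE [X in _ = X + _]mxE [X in _ = _ + X]mxE [X in _ = _ + _ * X]mxE.
by rewrite addrC; congr (_ + _).
Qed.

Let half_alg (p pv pw x y z : R) :
  2^-1 * pv * y + 2^-1 * p * x - (2^-1 * pw * z + 2^-1 * p * - x) = p * x + 2^-1 * (pv * y - pw * z).
Proof. by field. Qed.

Let cut_form_in q : Qf q -> dform (pform u half_u) q = cut_form q.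
Proof.
move=> Qfq; apply/funext => v; apply/funext => w.
have c1 i j : Ck 1 Qf (fun q => half_u q i j) := CkW (c_half i j).
have h (x y : Q) : omega_st ('D_x half_u q) ('D_y u q) =
    2^-1 * 'D_x psi q * omega_st (u q) ('D_y u q) + 2^-1 * psi q * omega_st ('D_x u q) ('D_y u q).
  by rewrite (D_half x Qfq) omegaDl omegaZl omegaZl.
apply: etrans (dform_pform oQf cu4 v w Qfq c1) _; apply: etrans (f_equal2 (fun s t : R => s - t) (h v w) (h w v)) _.
rewrite (omega_st_antisym ('D_w u q) ('D_v u q)) (su v w Qfq) /cut_form (asboolT Qfq).
exact: half_alg.
Qed.

Let flat_alg (p x y : R) : p + 2^-1 * (0 * x - 0 * y) = p.
Proof. by rewrite !mul0r subrr mulr0 addr0. Qed.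

Let cut_form_out q : Kc q -> (fun v w => psi q * omh q v w) = cut_form q.
Proof.
move=> Kq; apply/funext => v; apply/funext => w; rewrite /cut_form.
case: ifP; last by rewrite addr0.
by rewrite (D_psi_K v Kq) (D_psi_K w Kq) flat_alg.
Qed.

(** On Qf the form is the differential of [pform u half_u], and elsewhere psi is locally constant in
    front of the closed form [omh]; the two descriptions cover [Qdom]. *)
Lemma cut_form2 : form2 1 Qdom cut_form.
Proof.
apply/form2_form2m.
have f1 : @form2m R (1 + n) 1 Qf cut_form.
  apply: (form2m_ext oQf cut_form_in); apply: (dform_form2m oQf).
  exact: (@pform_form1 R (1 + n) n Qf u half_u oQf cu4 2).
have f2 : @form2m R (1 + n) 1 Kc cut_form.
  apply: (form2m_ext oK cut_form_out).
  have [oh1 oh2 oh3] := @omh_form2 R n 1.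
  have cpK : Ck 1 Kc psi by apply: Ck_sub c_psi; exact: KQ.
  have co v w : Ck 1 Kc (fun q => omh q v w).
    by have [_ h] := oh1 v; apply: Ck_sub (h w); exact: KQ.
  split.
  - move=> v; split=> [q Kq c x y|w]; last exact: (Ck_mul oK).
    by have [h _] := oh1 v; rewrite (h q (KQ Kq)) mulrDr !scaleRE mulrCA.
  - by move=> q v w Kq; rewrite oh2 ?mulrN //; exact: KQ.
  - move=> q v w x Kq.
    have D s t p : 'D_s (fun q => psi q * omh q t p) q = psi q * 'D_s (fun q => omh q t p) q.
      rewrite derive_mul; [|exact: Ck_diff cpK Kq|exact: Ck_diff (co t p) Kq].
      by rewrite D_psi_K // mul0r addr0.
    by rewrite !D -!mulrDr oh3 ?mulr0 //; exact: KQ.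
have [h1 h2 h3] := form2m_union f1 f2; have sub : Qdom `<=` Qf `|` Kc by move=> q /cover.
split.
- by move=> v; apply: form1_sub (h1 v).
- by move=> q v w /sub; exact: h2.
- by move=> q v w x /sub; exact: h3.
Qed.

Lemma derive_lift_X q : Qf q -> 'D_(rot_gen epsX q) u q = 0.
Proof.
move=> Qfq; apply/matrixP => i j; rewrite (derive_mxE _ (du Qfq)) [LHS]mxE [RHS]mxE.
have q0 : rot_by epsX 0 q = q by rewrite rot_by0.
have d0 : differentiable (fun q => u q i j) (rot_by epsX 0 q) by rewrite q0; exact: du.
have h := is_derive_along_rot d0.
have h' : is_derive (0 : R) (1 : R) (fun s => u (rot_by epsX s q) i j) 0.
  have -> : (fun s => u (rot_by epsX s q) i j) = cst (u q i j).
    by apply/funext => s; have [_ ->] := ru s Qfq.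
  exact: is_derive_cst.
have : 2 * pi * 'D_(rot_gen epsX q) (fun q => u q i j) q = 0.
  by rewrite -{1 2}q0 -(@derive_val _ _ _ _ _ _ _ h) (@derive_val _ _ _ _ _ _ _ h').
by move/eqP; rewrite !mulf_eq0 pnatr_eq0 /= gt_eqF ?pi_gt0 //= => /eqP.
Qed.

Lemma cut_form_X q v : Qdom q -> cut_form q (rot_gen epsX q) v = 0.
Proof.
move=> Qq; rewrite /cut_form omh_X // mulr0 add0r; case: ifP => // /asboolP Qfq.
have l0' : dot (u q) 0 = 0 by exact: (lin_fun0 (dot_lin (u q))).
have o0 : omega_st (u q) 0 = 0 by exact: (lin_fun0 (omega_lin_r (u q))).
by rewrite derive_lift_X // derive_level_fun // derive_lift_X // l0' o0 !mulr0 mul0r subrr mulr0.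
Qed.

Lemma cut_form_far q v w : Qdom q -> l ^+ 2 < sqw q -> cut_form q v w = 0.
Proof.
move=> Qq h; rewrite /cut_form level_fun_far // mul0r add0r asboolF //.
by move=> /wu; rewrite ltNge ltW.
Qed.

Lemma cut_form_flat q (c : R) v w : Qdom q -> (forall v, 'D_v psi q = 0) ->
  psi q = c -> cut_form q v w = c * omh q v w.
Proof.
move=> Qq D0 pc; rewrite /cut_form pc (D0 v) (D0 w).
by case: ifP => _; [exact: flat_alg|rewrite addr0].
Qed.

Definition lift_fun (G : E -> R) z : R := if `[< Qf (iota z) >] then G (u (iota z)) else 0.

Lemma omh_diota z (v w : E) : 1 < sqn z -> omh (iota z : Q) (diota z v) (diota z w) = omega_st v w.
Proof.
move=> z1; have z0 : sqn z != 0 by rewrite gt_eqF // (lt_trans ltr01).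
have Qz : Qdom (iota z : Q) by rewrite /Qdom /= iota_sqy (lt_trans ltr01).
have dy x : dsubmx (diota z x : Q) = x.
  rewrite /diota (lin_funD (@dsubmx_lin R n)) (lin_funZ (@dsubmx_lin R n)) /Uw /in_w /in_y.
  by rewrite !col_mxKd scaler0 add0r.
have dw x : usubmx (diota z x : Q) = (dot z x / cut_wr z) *: delta_mx 0 0.
  rewrite /diota (lin_funD (@usubmx_lin R n)) (lin_funZ (@usubmx_lin R n)) /Uw /in_w /in_y.
  by rewrite !col_mxKu addr0.
have f1 : fh (iota z : Q) = 1.
  by rewrite /fh iota_sqw ?ltW // iota_sqy addrC subrK divff.
have Df x : 'D_(diota z x) (@fh R n) (iota z) = 0.
  rewrite derive_fh // f1 iota_y iota_w iota_sqy dy dw dotZl dotZr.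
  have -> : dot (delta_mx 0 0 : 'M[R]_(1, 2)) (delta_mx 0 0) = 1.
    by rewrite /dot big_ord1 !mxE /= mulr1 mulr0 addr0.
  rewrite mulr1 [cut_wr z * _]mulrC divfK ?mul1r ?subrr // gt_eqF //.
  exact: cut_wr_gt0.
rewrite omhE // !Df !mul0r subrr mulr0 add0r f1 mul1r !dy !dw omegaZl omegaZr omegaxx.
by rewrite !mulr0 addr0.
Qed.

Let trace_alg (s p1 p2 p3 p4 : R) :
  2^-1 * (2 * s * p1 * p2 - 2 * s * p3 * p4) = s * (p1 * p2 - p3 * p4).
Proof. by field. Qed.

(** The part psi omh has trace n psi. For the other part u composed with [iota] is symplectic, so
    the trace of d psi times the radial form is computed in the standard basis at x = u(iota z),
    giving |x|^2 profile'(|x|^2). *)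
Lemma ytrace_cut_form z : 1 < sqn z -> ytrace cut_form (iota z) =
  n%:R * psi (iota z) + lift_fun (fun x => sqn x * profile' (sqn x)) z.
Proof.
move=> z1; have Qz : Qdom (iota z : Q) by rewrite /Qdom /= iota_sqy (lt_trans ltr01).
have [f1 f2 _] := cut_form2; have [oh1 oh2 _] := @omh_form2 R n 1.
rewrite ytrace_iota //; [|by move=> v; have [h _] := f1 v; exact: h|by move=> v w; exact: f2|
  by move=> v; exact: cut_form_X].
have oE : \sum_(k < n) omh (iota z : Q) (diota z (delta_mx k 0)) (diota z (delta_mx k 1)) = n%:R.
  rewrite -ytrace_iota ?ytrace_omh //; [by move=> v; have [h _] := oh1 v; exact: h|
    by move=> v w; exact: oh2|by move=> v; exact: omh_X].
rewrite big_split /= -mulr_sumr oE mulrC; congr (_ + _); rewrite /lift_fun.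
case: ifP => [/asboolP Qfz|_]; last by rewrite big1.
pose Lz (v : E) := 'D_(diota z v) u (iota z).
have sL : symp_lin Lz.
  split=> [c v w|v w]; last by rewrite su // omh_diota.
  by rewrite /Lz (diota_lin z c v w); exact: (derive_lin_fun (duE Qfz)).
set x := u (iota z); set s := profile' (sqn x).
have Dp (v : E) : 'D_(diota z v) psi (iota z) = 2 * s * omega_st (- Jmx x) (Lz v).
  rewrite derive_level_fun // -/x -/s omegaNl omega_dot JJ.
  have -> : dot (- x) (Lz v) = - dot x (Lz v) by rewrite dotC (lin_funN (dot_lin _)) dotC.
  by rewrite opprK mulrA [s * 2]mulrC.
have -> : sqn x * s = s * omega_st (- Jmx x) x.
  by rewrite mulrC; congr (_ * _); rewrite omegaNl omega_dot JJ dotC (lin_funN (dot_lin _)) opprK dotzz.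
rewrite -(omega_trace (- Jmx x) x sL) mulr_sumr; apply: eq_bigr => k _.
rewrite (Dp (delta_mx k 0)) (Dp (delta_mx k 1)); exact: trace_alg.
Qed.

End Profile.

End Potential.

End Cutoff.

(** * The volume of the lift *)

Section Bump.
Context {R : realType}.

(** A difference of two steps, so that sums over integer translates telescope: this gives at once a
    partition of unity and a lattice sum that is exactly 1. *)
Definition bump1 (t : R) : R := st (t + 1) - st t.

Lemma bump1_ge0 t : 0 <= bump1 t.
Proof.
rewrite /bump1; case: (leP t 0) => t0; first by rewrite (st0 t0) subr0 st_ge0.
by rewrite (st1 (x := t + 1)) ?subr_ge0 ?st_le1 // lerDr ltW.
Qed.

Lemma bump1_le1 t : bump1 t <= 1.
Proof. by rewrite /bump1 lerBlDr; apply: le_trans (st_le1 _) _; rewrite lerDl st_ge0. Qed.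

Lemma bump1_far t : 1 < `|t| -> bump1 t = 0.
Proof.
rewrite ltr_normr /bump1 => /orP[h|h].
  by rewrite !st1 ?subrr //; lra.
by rewrite !st0 ?subrr //; lra.
Qed.

Lemma Ck_bump1 : Ck 1 setT bump1.
Proof.
have c1 : Ck 1 setT (fun t : R => t + 1).
  apply: (Ck_add openT); last exact: Ck_cst.
  exact: (Ck_is_derive (f' := fun=> 1)) (fun x => is_derive_id x 1) (Ck_cst 0 setT 1).
apply: (Ck_minus openT); last exact: CkW Ck_st.
exact: Ck_comp1 openT c1 (CkW Ck_st).
Qed.

Lemma telescope_st (N : nat) (s : R) : \sum_(i < N) bump1 (s - i%:R) = st (s + 1) - st (s + 1 - N%:R).
Proof.
elim: N => [|N IH]; first by rewrite big_ord0 subr0 subrr.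
rewrite big_ord_recr /= IH /bump1 (_ : s - N%:R + 1 = s + 1 - N%:R); last by ring.
rewrite -natr1 (_ : s + 1 - (N%:R + 1) = s - N%:R); last by ring.
ring.
Qed.

Lemma sum_bump1_lattice (k : nat) : (0 < k)%N ->
  \sum_(i < (2 * k ^ 2).+1) bump1 ((i%:R - (k ^ 2)%:R) / k%:R) = k%:R.
Proof.
move=> k0; set N := (2 * k ^ 2).+1; have kp : 0 < k%:R :> R by rewrite ltr0n.
pose g (i : nat) : R := st ((i%:R - (k ^ 2)%:R) / k%:R).
have bE i : bump1 ((i%:R - (k ^ 2)%:R) / k%:R) = g (i + k)%N - g i.
  rewrite /bump1 /g natrD; congr (st _ - _).
  by field; rewrite gt_eqF.
rewrite (eq_bigr (fun i : 'I_N => g (i + k)%N - g i)) => [|i _]; last exact: bE.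
rewrite sumrB.
have lo : \sum_(i < k) g i = 0.
  apply: big1 => i _; apply: st0; rewrite pmulr_lle0 ?invr_gt0 // subr_le0 ler_nat.
  by apply: leq_trans (ltnW (ltn_ord i)) _; rewrite -{1}(expn1 k) leq_pexp2l.
have hi : \sum_(i < k) g (N + i)%N = k%:R.
  rewrite (eq_bigr (fun=> 1)) ?sumr_const ?card_ord // => i _; apply: st1.
  rewrite ler_pdivlMr // mul1r lerBrDr -natrD ler_nat /N.
  by apply: leq_trans (leq_addr _ _); move: (k ^ 2)%N (leq_pexp2l k0 (isT : (1 <= 2)%N)) => K; rewrite expn1 mul2n -addnn -addnS => kK; rewrite leq_add // ltnW.
have e1 : \sum_(i < N + k) g i = \sum_(i < N) g i + \sum_(i < k) g (N + i)%N.
  by rewrite big_split_ord.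
have e2 : \sum_(i < k + N) g i = \sum_(i < k) g i + \sum_(i < N) g (k + i)%N.
  by rewrite big_split_ord.
have e3 : \sum_(i < N) g (i + k)%N = \sum_(i < N) g (k + i)%N.
  by apply: eq_bigr => i _; rewrite addnC.
move: e2; rewrite addnC e1 lo hi add0r -e3 => <-; ring.
Qed.

Context {m : nat}.
Local Notation E := 'M[R]_(m, 2).

Definition bump (x : E) : R := \prod_(ij : 'I_m * 'I_2) bump1 (x ij.1 ij.2).

Lemma bump_ge0 x : 0 <= bump x.
Proof. by apply: prodr_ge0 => ij _; exact: bump1_ge0. Qed.

Lemma bump_le1 x : bump x <= 1.
Proof. by apply: prodr_ile1 => ij _; rewrite bump1_ge0 bump1_le1. Qed.

Lemma bump_supp : supp_in 1 bump.
Proof.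
move=> x x1; have [i [j xij]] : exists i j, 1 < `|x i j|.
  apply: contrapT => no; move: x1; rewrite ltNge => /negP; apply.
  apply/mx_norm_leP => // i j; rewrite leNgt; apply/negP => h; apply: no; exists i, j; exact: h.
by rewrite /bump (bigD1 (i, j)) //= bump1_far // mul0r.
Qed.

Lemma Ck_prod (V : normedModType R) k (A : set V) (I : Type) (s : seq I) (F : I -> V -> R) :
  open A -> (forall i, Ck k A (F i)) -> Ck k A (fun x => \prod_(i <- s) F i x).
Proof.
move=> oA cF; elim: s => [|i s IH].
  by apply: Ck_ext (Ck_cst k A 1) => // x _; rewrite big_nil.
by apply: Ck_ext (Ck_mul oA (cF i) IH) => // x _; rewrite big_cons.
Qed.

Lemma C1c_bump : C1c bump.
Proof.
split; last by exists 1; exact: bump_supp.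
apply: (Ck_prod _ openT) => -[i j]; apply: (Ck_comp1 openT _ Ck_bump1).
exact: Ck_id_coord.
Qed.

Lemma lint_bump : lint bump = 1.
Proof.
rewrite /lint -[RHS](ulim_cst 1); congr (ulim _); apply/funext => k.
rewrite (lattice_sum_prod k.+1 bump1) sum_bump1_lattice //.
by rewrite mulVf ?expr1n // pnatr_eq0.
Qed.

Lemma bump_partition (k : nat) (x : E) : (0 < k)%N -> `|x| <= k%:R ->
  \sum_c bump (k%:R *: (x - @grid_pt R m k c)) = 1.
Proof.
move=> k0 xk; have kp : 0 < k%:R :> R by rewrite ltr0n.
pose s (ij : 'I_m * 'I_2) := k%:R * x ij.1 ij.2 + (k ^ 2)%:R.
have bE c : bump (k%:R *: (x - @grid_pt R m k c)) =
    \prod_(ij : 'I_m * 'I_2) bump1 (s ij - (c ij)%:R).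
  apply: eq_bigr => -[i j] _; rewrite /s /= !mxE; congr bump1.
  by field; rewrite gt_eqF.
rewrite (eq_bigr _ (fun c _ => bE c)).
rewrite -(bigA_distr_bigA (fun (ij : 'I_m * 'I_2) (a : 'I_(2 * k ^ 2).+1) => bump1 (s ij - a%:R))).
apply: big1 => ij _; rewrite telescope_st.
have sk : - (k ^ 2)%:R <= k%:R * x ij.1 ij.2 <= (k ^ 2)%:R.
  rewrite -ler_norml normrM gtr0_norm // natrX expr2 ler_pM2l //.
  exact: le_trans (mx_coord_le _ _ _) xk.
move: sk => /andP[h1 h2]; rewrite st1 ?st0 ?subr0 // /s.
  by rewrite -natr1 natrM; lra.
by lra.
Qed.

End Bump.

(** * Preservation of volume *)

Section LiftVolume.
Context {R : realType} {n : nat}.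
Local Notation Q := 'M[R]_(1 + n, 2).
Local Notation E := 'M[R]_(n, 2).
Implicit Types (q : Q) (x y z v w : E) (G F : E -> R).
Let oQ : open (Qdom : set Q) := @open_Qdom R n.

Variables (u : Q -> E) (Qf : set Q) (a0 b0 l : R).
Hypothesis oQf : open Qf.
Hypothesis QfQ : Qf `<=` Qdom.
Hypothesis cu : forall k i j, Ck k Qf (fun q => u q i j).
Hypothesis su : forall q (v w : Q), Qf q -> omega_st ('D_v u q) ('D_w u q) = omh q v w.
Hypothesis ru : forall s q, Qf q -> Qf (rot_by epsX s q) /\ u (rot_by epsX s q) = u q.
Hypothesis wu : forall q, Qf q -> sqw q < l ^+ 2.
Hypothesis au : forall q, Qf q -> annulus a0 b0 (u q).
Hypothesis cl : forall a b, a0 < a -> b < b0 ->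
  open [set q | Qdom q /\ ~ (Qf q /\ a <= sqn (u q) /\ sqn (u q) <= b)].
Hypothesis inj_u : forall z z', 1 < sqn z -> 1 < sqn z' -> Qf (iota z) -> Qf (iota z') ->
  u (iota z) = u (iota z') -> z = z'.
Hypothesis l0 : 0 < l.
Hypothesis a0_ge0 : 0 <= a0.

(** The integral of G against the push-forward of the volume by u; the aim is to show that it is
    [lint] on the shell. *)
Definition lift_int G : R := lint (on_out (lift_fun u Qf G)).
Local Notation Lam := lift_int.

Let du q : Qf q -> forall i j, differentiable (fun q => u q i j) q.
Proof. by move=> Qfq i j; exact: Ck_diff (cu 1 i j) Qfq. Qed.

Let duE q : Qf q -> differentiable u q.
Proof. by move=> Qfq; apply: differentiable_mx; exact: du. Qed.

Definition bounded_fun G := exists M : R, forall x, `|G x| <= M.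

Lemma lift_adm G : bounded_fun G -> adm (on_out (lift_fun u Qf G)).
Proof.
move=> [M MP]; split.
  exists (Num.max M 0) => z; rewrite /on_out /lift_fun; case: ifP => _; last by rewrite normr0 le_max lexx orbT.
  by case: ifP => _; [rewrite le_max MP|rewrite normr0 le_max lexx orbT].
exists (1 + l) => z zl; rewrite /on_out; case: ifP => // z1; rewrite /lift_fun asboolF //.
move=> /wu; rewrite iota_sqw ?ltW // => h.
have := norm_sqn z; have := l0; move: zl h; move: `|z| (sqn z) => N S; nra.
Qed.

Lemma C1c_bounded G : C1c G -> bounded_fun G.
Proof. by move=> /C1c_adm[]. Qed.

Lemma lift_intD G F : bounded_fun G -> bounded_fun F -> Lam (fun x => G x + F x) = Lam G + Lam F.
Proof.
move=> bG bF; rewrite /Lam -lintD; [|exact: lift_adm|exact: lift_adm].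
congr lint; apply/funext => z; rewrite /on_out /lift_fun; case: ifP => _; last by rewrite addr0.
by case: ifP => _ //; rewrite addr0.
Qed.

Lemma lift_intZ a G : bounded_fun G -> Lam (fun x => a * G x) = a * Lam G.
Proof.
move=> bG; rewrite /Lam -lintZ; last exact: lift_adm.
congr lint; apply/funext => z; rewrite /on_out /lift_fun; case: ifP => _; last by rewrite mulr0.
by case: ifP => _ //; rewrite mulr0.
Qed.

Lemma bounded_funZ a G : bounded_fun G -> bounded_fun (fun x => a * G x).
Proof.
by move=> [M MP]; exists (`|a| * M) => x; rewrite normrM ler_wpM2l.
Qed.

Lemma bounded_funD G F : bounded_fun G -> bounded_fun F -> bounded_fun (fun x => G x + F x).
Proof.
move=> [M MP] [N NP]; exists (M + N) => x.
by apply: le_trans (ler_normD _ _) _; apply: lerD.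
Qed.

Lemma lift_intB G F : bounded_fun G -> bounded_fun F -> Lam (fun x => G x - F x) = Lam G - Lam F.
Proof.
move=> bG bF; have -> : (fun x => G x - F x) = (fun x => G x + (-1) * F x).
  by apply/funext => x; rewrite mulN1r.
rewrite lift_intD ?lift_intZ ?mulN1r //; exact: bounded_funZ.
Qed.

Lemma lift_int_sum (I : Type) (s : seq I) (F : I -> E -> R) : (forall i, bounded_fun (F i)) ->
  Lam (fun x => \sum_(i <- s) F i x) = \sum_(i <- s) Lam (F i).
Proof.
move=> bF; have b0' : bounded_fun (fun _ : E => 0) by exists 0 => x; rewrite normr0.
have bS s' : bounded_fun (fun x => \sum_(i <- s') F i x).
  elim: s' => [|i s' IH]; first by under eq_fun do rewrite big_nil.
  by under eq_fun do rewrite big_cons; exact: bounded_funD.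
elim: s => [|i s IH].
  rewrite big_nil; under eq_fun do rewrite big_nil.
  by rewrite -[X in Lam X](_ : (fun x => 0 * 0) = _) ?lift_intZ ?mul0r //; apply/funext => x; rewrite mul0r.
by rewrite big_cons -IH -lift_intD //; congr lift_int; apply/funext => x; rewrite big_cons.
Qed.

Definition lift_mass : R := Lam (fun=> 1).

Lemma lift_mass_ge0 : 0 <= lift_mass.
Proof.
apply: lint_ge0; first by apply: lift_adm; exists 1 => x; rewrite normr1.
by move=> z; rewrite /on_out /lift_fun; case: ifP => // _; case: ifP.
Qed.

Lemma lift_int_le G (M : R) : bounded_fun G -> 0 <= M -> (forall x, annulus a0 b0 x -> `|G x| <= M) ->
  `|Lam G| <= M * lift_mass.
Proof.
move=> bG M0 GM; have b1 : bounded_fun (fun _ : E => 1) by exists 1 => x; rewrite normr1.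
rewrite -lift_intZ //; apply: lint_norm_le; [exact: lift_adm|exact/lift_adm/bounded_funZ|].
move=> z; rewrite /on_out /lift_fun; case: ifP => _; last by rewrite normr0.
by case: ifP => [/asboolP Qz|_]; rewrite ?mulr1 ?normr0 //; apply: GM; exact: au.
Qed.

Section Derivative.
Variables (G : E -> R) (a b : R) (v : E).
Hypothesis aa : a0 < a.
Hypothesis bb : b < b0.
Hypothesis cG : Ck 1 setT G.
Hypothesis G0 : forall x, ~ (a <= sqn x /\ sqn x <= b) -> G x = 0.

Let K : set Q := [set q | Qf q /\ a <= sqn (u q) /\ sqn (u q) <= b].
Let Kc : set Q := [set q | Qdom q /\ ~ K q].
Let oK : open Kc := cl aa bb.
Let cover q : Qdom q -> Qf q \/ Kc q.
Proof. by move=> Qq; case: (pselect (Qf q)) => h; [left|right; split=> // -[]]. Qed.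

Let c q : E := G (u q) *: v.
Let alpha q (w : Q) : R := if `[< Qf q >] then pform u c q w else 0.

Let alpha_in q : Qf q -> alpha q = pform u c q.
Proof. by move=> Qfq; apply/funext => w; rewrite /alpha asboolT. Qed.

Let alpha_out q : Kc q -> forall w : Q, alpha q w = 0.
Proof.
move=> [Qq nK] w; rewrite /alpha; case: ifP => // /asboolP Qfq.
by rewrite /pform /c G0 ?scale0r ?omega0l // => h; apply: nK.
Qed.

Let c_Gu : Ck 1 Qf (fun q => G (u q)).
Proof. exact: (Ck_comp oQf (cu 1) cG). Qed.

Let cc i j : Ck 1 Qf (fun q => c q i j).
Proof.
apply: (Ck_ext oQf (f := fun q => G (u q) * v i j)).
  by move=> q _; rewrite /c mxE.
by apply: (Ck_mul oQf c_Gu); exact: Ck_cst.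
Qed.

Let D_c q (w : Q) : Qf q -> 'D_w c q = 'D_('D_w u q) G (u q) *: v.
Proof.
move=> Qfq; have dG : differentiable G (u q) := Ck_diff cG (I : setT (u q)).
have dc i' j' : differentiable (fun q => c q i' j') q := Ck_diff (cc i' j') Qfq.
apply/matrixP => i j; rewrite (derive_mxE w dc) [LHS]mxE [RHS]mxE.
have -> : (fun q => c q i j) = (fun q => G (u q) * v i j) by apply/funext => x; rewrite /c mxE.
rewrite (derive_mul (f := fun q => G (u q)) (g := fun=> v i j) w (Ck_diff c_Gu Qfq)); last first.
  exact: differentiable_cst.
by rewrite derive_cst mulr0 add0r (derive_compE w (duE Qfq) dG).
Qed.

Let f_alpha : form1 1 Qdom alpha.
Proof.
have f1 : form1 1 Qf (pform u c) := pform_form1 oQf (cu 4) (isT : (1 <= 3)%N) cc.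
split=> [q Qq|w].
  have [Qfq|Kq] := cover Qq; first by rewrite alpha_in //; have [h _] := f1; exact: h.
  by move=> s x y; rewrite !alpha_out // scaler0 addr0.
apply: (@Ck_sub R Q 1 (Qf `|` Kc) Qdom); first by move=> q /cover.
apply: Ck_union.
  have [_ h] := f1; apply: (Ck_ext oQf _ (h w)) => q /[!inE] Qfq; by rewrite alpha_in.
by apply: (Ck_ext oK _ (Ck_cst 1 Kc 0)) => q /[!inE] Kq; rewrite alpha_out.
Qed.

Let dalpha q (x y : Q) : Qf q -> dform alpha q x y =
  'D_('D_x u q) G (u q) * omega_st v ('D_y u q) - 'D_('D_y u q) G (u q) * omega_st v ('D_x u q).
Proof.
move=> Qfq; have h (s t : Q) : omega_st ('D_s c q) ('D_t u q) =
    'D_('D_s u q) G (u q) * omega_st v ('D_t u q) by rewrite (D_c s Qfq) omegaZl.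
have e : dform alpha q x y = dform (pform u c) q x y.
  by rewrite /dform; congr (_ - _); apply: (eq_derive _ oQf Qfq) => q' Q'; rewrite alpha_in.
apply: etrans e _; apply: etrans (dform_pform oQf (cu 4) x y Qfq cc) _.
exact: (f_equal2 (fun s t : R => s - t) (h x y) (h y x)).
Qed.

Let dalpha_out q (x y : Q) : Kc q -> dform alpha q x y = 0.
Proof. by move=> Kq; apply: (dform_near0 _ _ oK Kq) => q' /alpha_out. Qed.

Let D0 x : 'D_(0 : E) G x = 0.
Proof. exact: derive0. Qed.

Let D_X q : Qf q -> 'D_(rot_gen epsX q) u q = 0.
Proof. exact: (derive_lift_X cu ru). Qed.

Let omega_r0 x : omega_st x (0 : E) = 0.
Proof. exact: (lin_fun0 (omega_lin_r x)). Qed.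

Let dalpha_X q (y : Q) : Qdom q -> dform alpha q (rot_gen epsX q) y = 0.
Proof.
move=> Qq; have [Qfq|Kq] := cover Qq; last exact: dalpha_out.
by rewrite dalpha // D_X // D0 omega_r0 mul0r mulr0 subrr.
Qed.

Let grad x : E := \matrix_(k, j)
  (if j == 0 then 'D_(delta_mx k 1) G x else - 'D_(delta_mx k 0) G x).

Let gradP x w : 'D_w G x = omega_st (grad x) w.
Proof.
have lG := derive_lin_fun (Ck_diff cG (I : setT x)).
apply/eqP; rewrite -subr_eq0; apply/eqP.
have lh : lin_fun (fun w => 'D_w G x - omega_st (grad x) w).
  move=> s p q; rewrite (lG s p q) omegaDr omegaZr !scaleRE; ring.
rewrite (lin_fun_coord lh w) big1 // => -[k j] _ /=; move: j; apply: ord2P.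
  by rewrite omega_delta0 mxE /= opprK subrr scaler0.
by rewrite omega_delta1 mxE /= subrr scaler0.
Qed.

Let dalpha_grad q (x y : Q) : Qf q -> dform alpha q x y =
  omega_st (grad (u q)) ('D_x u q) * omega_st v ('D_y u q) -
  omega_st (grad (u q)) ('D_y u q) * omega_st v ('D_x u q).
Proof.
move=> Qfq; apply: etrans (dalpha x y Qfq) _.
exact: (f_equal2 (fun s t => s * omega_st v ('D_y u q) - t * omega_st v ('D_x u q)) (gradP _ _) (gradP _ _)).
Qed.

(** Stokes replaces the change of variables: the one-form with c = G(u) v vanishes on X, so
    [trace_level] applies with constant 0, and its trace is the derivative of G along v at the
    lifted point. *)
Lemma lift_int_derive : Lam (fun x => 'D_v G x) = 0.
Proof.
have r1 : 0 < (1 : R) by [].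
have := @trace_level R n alpha l 1 0 (fun=> 0) f_alpha (ltW l0) _ _ r1 (Ck_cst _ _ _) _.
rewrite mulr0 mul0r oppr0 => <-.
- congr lint; apply/funext => z; rewrite /on_out; case: ifP => // z1.
  have Qz : Qdom (iota z : Q) by rewrite /Qdom /= iota_sqy (lt_trans ltr01).
  rewrite /lift_fun; have [Qfz|Kz] := cover Qz; last first.
    rewrite /ytrace big1 ?add0r ?dalpha_out // => [|k _]; last by rewrite dalpha_out.
    case: ifP => // /asboolP Qfz.
    have cs : Ck 0 setT (@sqn R n).
      by move=> x _; apply: differentiable_continuous; have [] := derive_sqn x 0.
    apply: (@derive_near0 R E (~` [set x | a <= sqn x /\ sqn x <= b])).
    - apply: closed_openC; apply: closedI; first exact: (closed_Ck_le (Ck_cst 0 setT a) cs).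
      exact: (closed_Ck_le cs (Ck_cst 0 setT b)).
    - by move=> h; apply: Kz.2; split.
    - by move=> x; exact: G0.
  rewrite asboolT // ytrace_iota //.
  + have sL : symp_lin (fun w => 'D_(diota z w) u (iota z)).
      split=> [s x y|x y]; last by rewrite su // omh_diota.
      by rewrite (diota_lin z s x y); exact: (derive_lin_fun (duE Qfz)).
    rewrite gradP -(omega_trace (grad (u (iota z))) v sL).
    by apply: eq_bigr => k _; exact: esym (dalpha_grad _ _ Qfz).
  + by move=> w; exact: dform_lin f_alpha oQ Qz.
  + by move=> x y; exact: dformC.
  + by move=> y; exact: dalpha_X.
- move=> q Qq wq w; rewrite /alpha asboolF // => /wu; rewrite ltNge sqwE => /negP; apply.
  have := l0; have := sqr_ge0 (wim q); nra.
- by move=> q Qq _ y; exact: dalpha_X.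
- move=> q Qq _; rewrite derive_cst addr0 /alpha; case: ifP => // /asboolP Qfq.
  by rewrite /pform D_X // omega_r0.
Qed.

End Derivative.

Section Translation.
Variables (G : E -> R) (a b d : R).
Hypothesis aa : a0 < a.
Hypothesis bb : b < b0.
Hypothesis cG : C1c G.
Hypothesis sG : supp_in d G.

Definition lift_conv x : R := Lam (fun y => G (y - x)).

Let shift_diff x y h : differentiable (fun y => y - x) y /\ 'D_h (fun y => y - x) y = h.
Proof.
have d1 : differentiable (@id E - cst x) y.
  by apply: differentiableB; [exact: ex_diff|exact: differentiable_cst].
split; first exact: d1.
rewrite -[fun y => y - x]/(@id E - cst x) deriveB; [|exact: derivable_id|exact: derivable_cst].
by rewrite derive_id derive_cst subr0.
Qed.

Let D_shift x y h : 'D_h (fun y => G (y - x)) y = 'D_h G (y - x).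
Proof.
have [d1 e1] := shift_diff x y h.
by rewrite (derive_compE h d1 (C1c_diff (y - x) cG)) e1.
Qed.

Let c_shift x : Ck 1 setT (fun y => G (y - x)).
Proof.
apply: (@Ck_comp R E n 2 1 setT setT G (fun y => y - x) openT) => //; last exact: cG.1.
move=> i j; apply: (Ck_ext openT (f := fun y : E => y i j - x i j)).
  by move=> y _; rewrite !mxE.
by apply: (Ck_minus openT); [exact: Ck_id_coord|exact: Ck_cst].
Qed.

Let b_shift x : bounded_fun (fun y => G (y - x)).
Proof. by have [M MP] := C1c_bounded cG; exists M => y. Qed.

Let bD h : bounded_fun (fun y => 'D_h G y).
Proof. by have [[M MP] _] := C0c_adm (C1c_derive h cG); exists M. Qed.

Variable W : set E.
Hypothesis WP : forall x y, W x -> `|y - x| <= d -> a <= sqn y /\ sqn y <= b.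

(** The derivative in x falls on the translated G, and its push-forward integral is zero as long as
    the translate stays in the shell: the push-forward has constant density. *)
Lemma lift_conv_derive x v : W x -> differentiable lift_conv x /\ 'D_v lift_conv x = 0.
Proof.
move=> Wx; have Gx0 y : ~ (a <= sqn y /\ sqn y <= b) -> G (y - x) = 0.
  by move=> no; apply: sG; rewrite ltNge; apply/negP => h; apply: no; exact: WP h.
have D0 h : Lam (fun y => 'D_h G (y - x)) = 0.
  rewrite -(lift_int_derive h aa bb (c_shift x) Gx0); congr lift_int.
  by apply/funext => y; rewrite D_shift.
have l00 : lin_fun (fun _ : E => 0 : R) by move=> s p q; rewrite scaler0 addr0.
have V0 := lift_mass_ge0; have V1 : 0 < lift_mass + 1 by rewrite ltr_wpDl.
have [|df Df] := expand_diff l00 (f := lift_conv) (x := x); last by split=> //; rewrite Df.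
move=> e e0; have e1 : 0 < e / (lift_mass + 1) by rewrite divr_gt0.
have [r r0 rP] := C1c_uniform cG e1.
apply/near0_ball; exists r => // h hr; rewrite subr0.
have -> : lift_conv (x + h) - lift_conv x =
    Lam (fun y => G (y - (x + h)) - G (y - x) - 'D_(- h) G (y - x)).
  rewrite [RHS]lift_intB ?D0 ?subr0 ?lift_intB //.
    have -> : (fun y => G (y - (x + h)) - G (y - x)) = (fun y => G (y - (x + h)) + (-1) * G (y - x)).
      by apply/funext => y; rewrite mulN1r.
    by apply: bounded_funD => //; exact: bounded_funZ.
  by have [M MP] := bD (- h); exists M => y.
apply: (@le_trans _ _ (e / (lift_mass + 1) * `|h| * lift_mass)).
  apply: lift_int_le; last first.
  - move=> y _; have := rP (y - x) (- h); rewrite normrN => /(_ hr).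
    by rewrite (_ : y - x - h = y - (x + h)) // opprD addrA.
  - by rewrite mulr_ge0 // ltW.
  have [M MP] := C1c_bounded cG; have [N NP] := bD (- h).
  exists (M + M + N) => y; apply: le_trans (ler_normB _ _) _; apply: lerD => //.
  by apply: le_trans (ler_normB _ _) _; apply: lerD.
rewrite mulrAC; apply: ler_wpM2r => //; rewrite mulrAC ler_pdivrMr // ler_pM2l //; lra.
Qed.

End Translation.

Lemma near_shell (a b : R) : a0 < a -> b < b0 -> exists a' b' d : R, [/\ 0 < d, a0 < a', b' < b0 &
  forall x y, annulus a b x -> `|y - x| <= d -> a' <= sqn y /\ sqn y <= b'].
Proof.
move=> aa bb; pose a' := (a0 + a) / 2; pose b' := (b + b0) / 2.
have cs : Ck 0 setT (@sqn R n).
  by move=> x _; apply: differentiable_continuous; have [] := derive_sqn x 0.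
have e0 : 0 < Num.min (a - a') (b' - b) by rewrite lt_min /a' /b'; apply/andP; split; lra.
have [d d0 dP] := C0_uniform openT cs (@compact_sqn R n a b) (fun _ _ => I) e0.
exists a', b', (d / 2); split; first by rewrite divr_gt0.
- by rewrite /a'; lra.
- by rewrite /b'; lra.
move=> x y [xa xb] yx; have [|_] := dP x (y - x) (conj (ltW xa) (ltW xb)).
  by apply: le_lt_trans yx _; rewrite ltr_pdivrMr // ltr_pMr // ltr1n.
have -> : x + (y - x) = y by rewrite addrC subrK.
move: (sqn x) (sqn y) xa xb => X Y xa xb; rewrite le_min !ler_norml.
by move=> /andP[/andP[h1 h2] /andP[h3 h4]]; split; lra.
Qed.

Lemma lift_conv_const (G : E -> R) (a b a' b' d : R) x y : a0 < a' -> b' < b0 -> 0 <= a ->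
  (forall x y, annulus a b x -> `|y - x| <= d -> a' <= sqn y /\ sqn y <= b') ->
  C1c G -> supp_in d G -> annulus a b x -> annulus a b y -> lift_conv G x = lift_conv G y.
Proof.
move=> aa bb a_ge0 WP cG sG ax ay.
apply: (const_on_annulus a_ge0 _ _ ax ay) => [x' ax'|x' v ax'].
  by have [] := lift_conv_derive aa bb cG sG WP 0 ax'.
by have [] := lift_conv_derive aa bb cG sG WP v ax'.
Qed.

Definition scaled_bump (k : R) x : R := bump (k *: x).

Lemma C1c_scaled_bump k : 0 < k -> C1c (scaled_bump k).
Proof.
move=> k0; apply: (C1c_comp (@C1c_bump R n)).
  move=> i j; apply: (Ck_ext openT (f := fun x : E => k * x i j)); first by move=> x _; rewrite mxE.
  by apply: (Ck_scale openT); exact: Ck_id_coord.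
move=> r; exists (r / k) => x; rewrite ltr_pdivrMr // normrZ gtr0_norm //.
by rewrite mulrC.
Qed.

Lemma scaled_bump_supp k : 0 < k -> supp_in k^-1 (scaled_bump k).
Proof.
move=> k0 x; rewrite -[k^-1]mul1r ltr_pdivrMr // => h; apply: bump_supp.
by rewrite normrZ gtr0_norm // mulrC.
Qed.

(** * The density at one point *)

Section Linearization.
Variable z0 : E.
Hypothesis z01 : 1 < sqn z0.
Hypothesis Qz0 : Qf (iota z0).

Let M0 : set E := [set z | 1 < sqn z /\ Qf (iota z)].
Let h z := u (iota z).
Let x0 := h z0.

Let oM : open M0.
Proof.
apply: (open_preim (@open_out R n 1) oQf) => z z1.
by have [d _] := iota_derive 0 z1; exact: differentiable_continuous.
Qed.

Let ch k i j : Ck k M0 (fun z => h z i j).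
Proof.
by apply: (Ck_comp_iota (A := Qf) (F := fun q => u q i j) oM) => // z [].
Qed.

Let dh z : M0 z -> differentiable h z.
Proof. by move=> Mz; apply: differentiable_mx => i j; exact: Ck_diff (ch 1 i j) Mz. Qed.

Let sh z v w : M0 z -> omega_st ('D_v h z) ('D_w h z) = omega_st v w.
Proof.
move=> [z1 Qz]; have [di _] := iota_derive 0 z1.
have D v' : 'D_v' h z = 'D_(diota z v') u (iota z).
  rewrite /h (derive_comp_mx v' di (du Qz)); congr (derive u _ _).
  by have [_ ->] := iota_derive v' z1.
by rewrite !D su // omh_diota.
Qed.

Let M00 : M0 z0. Proof. by []. Qed.

Let L v := 'D_v h z0.
Let sL : symp_lin L.
Proof. by split=> [|v w]; [exact: derive_lin_fun (dh M00)|exact: sh]. Qed.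

Let inverse_bound : exists2 C : R, 0 < C & forall v, `|v| <= C * `|L v|.
Proof.
have [C C0 CP] := lin_fun_bound (symp_inv_lin L); exists C => // v.
by rewrite -{1}(symp_invK sL v); exact: CP.
Qed.

Let open_ball (z : E) (r : R) : open [set y : E | `|y - z| < r].
Proof.
have -> : [set y : E | `|y - z| < r] = ball z r; last exact: ball_open.
by rewrite -ball_normE; apply/seteqP; split=> y; rewrite /= distrC.
Qed.

Let open_far (z : E) (r : R) : open [set y : E | r < `|y - z|].
Proof.
rewrite openE => y /= yr; apply/nbhs_ballP; exists (`|y - z| - r); first by rewrite /= subr_gt0.
move=> y'; rewrite -ball_normE /= ltrBrDl -ltrBrDr => h1; apply: lt_le_trans h1 _.
rewrite lerBlDr; apply: le_trans (ler_distD y' y z) _.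
by rewrite addrC lerD2l.
Qed.

Let le_half (s t : R) : t <= s + t / 2 -> t <= 2 * s.
Proof. lra. Qed.

(* The rescaled bumps around x0 are pulled back to a neighbourhood of z0, where
   they are compared with the bump of the linearization of the lift at z0. *)
Lemma scaled_bump_mass (e : R) : 0 < e -> exists2 K : R, 0 < K & forall k : R, K < k ->
  `|k ^+ (n * 2) * lift_conv (scaled_bump k) x0 - 1| <= e.
Proof.
move=> e0; have [C C0 CP] := inverse_bound.
have [CL CL0 CLP] := lin_fun_bound sL.1.
have [C2 C20 C2P] := @lint_bound R n (2 * C).
have e1 : 0 < (2 * C)^-1 by rewrite invr_gt0 mulr_gt0.
have /near0_ball[r1 r10 r1P] := derive_expand (dh M00) e1.
have [r2 r20 r2P] := near_ball_open oM M00.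
pose r := Num.min r1 r2; have r0 : 0 < r by rewrite lt_min r10.
have rr2 : 0 < r / 2 by rewrite divr_gt0.
have r2r : r / 2 < r by rewrite ltr_pdivrMr // ltr_pMr // ltr1n.
have [dl dl0 dlP] := symp_open_map oM ch sh M00 rr2.
have eC : 0 < e / C2 by rewrite divr_gt0.
have cb := C1c_C0c (@C1c_bump R n).
have CC0 : 0 <= CL * (2 * C) by rewrite !mulr_ge0 // ltW.
have [de de0 deP] := C0_uniform openT cb.1 (@compact_norm_ball R n 2 _ CC0) (fun _ _ => I) eC.
have e2 : 0 < de / (4 * C) by rewrite divr_gt0 // mulr_gt0.
have /near0_ball[r3 r30 r3P] := derive_expand (dh M00) e2.
have m0 : 0 < Num.min r r3 by rewrite lt_min r0.
exists (dl^-1 + 2 * C / Num.min r r3).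
  by rewrite addr_gt0 ?invr_gt0 // divr_gt0 // mulr_gt0.
move=> k kK; have q0 : 0 < 2 * C / Num.min r r3 by rewrite divr_gt0 // mulr_gt0.
have d0 : 0 < dl^-1 by rewrite invr_gt0.
have k0 : 0 < k by apply: lt_trans kK; exact: addr_gt0.
have kd : k^-1 < dl by rewrite invf_plt ?posrE //; apply: lt_trans kK; rewrite ltrDl.
have kr : 2 * C / k < Num.min r r3.
  have kq : 2 * C / Num.min r r3 < k by apply: lt_trans kK; rewrite ltrDr.
  by rewrite ltr_pdivrMr // [X in _ < X]mulrC -ltr_pdivrMr.
pose F := on_out (lift_fun u Qf (fun y => scaled_bump k (y - x0))).
have F_in z : M0 z -> F z = scaled_bump k (h z - x0).
  by move=> [z1 Qz]; rewrite /F /on_out z1 /lift_fun asboolT.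
have F_neq0 z : F z != 0 -> [/\ M0 z, `|z - z0| < r / 2 & `|h z - x0| <= k^-1].
  move=> Fz; have Mz : M0 z.
    move: Fz; rewrite /F /on_out; case: ifP => [z1|_]; last by rewrite eqxx.
    by rewrite /lift_fun; case: ifP => [/asboolP Qz _|_]; [split|rewrite eqxx].
  have hk : `|h z - x0| <= k^-1.
    rewrite leNgt; apply/negP => lt; move: Fz.
    by rewrite F_in // (scaled_bump_supp k0 lt) eqxx.
  have [z' [Mz' z'r] hz'] := dlP (h z) (le_lt_trans hk kd).
  split=> //; have -> // : z = z'.
  by case: Mz Mz' => z1 Qz [z'1 Qz']; apply: inj_u.
have sF : supp_in (`|z0| + r) F.
  move=> z zr; apply/eqP; apply: contrapT => /negP /F_neq0[_ zz _]; move: zr.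
  rewrite ltNge => /negP; apply; rewrite -(subrK z0 z) [`|z0| + r]addrC.
  apply: le_trans (ler_normD _ _) _; rewrite lerD2r; exact: le_trans (ltW zz) (ltW r2r).
have rr2' z : `|z - z0| < r -> M0 z.
  by move=> zr; apply: r2P; apply: lt_le_trans zr _; rewrite ge_min lexx orbT.
have cF : C1c F.
  split; last by exists (`|z0| + r).
  apply: (@Ck_sub R E 1 ([set z | `|z - z0| < r] `|` [set z | r / 2 < `|z - z0|])).
    by move=> z _; case: (ltP `|z - z0| r) => hz; [left|right; exact: lt_le_trans r2r hz].
  apply: Ck_union.
    apply: (Ck_ext (f := fun z => scaled_bump k (h z - x0)) (@open_ball z0 r)).
      by move=> z /[!inE] zr; rewrite F_in //; exact: rr2'.
    apply: (@Ck_comp R E n 2 1 [set z | `|z - z0| < r] setT (scaled_bump k)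
      (fun z => h z - x0) (@open_ball z0 r)) => //; last exact: (C1c_scaled_bump k0).1.
    move=> i j; apply: (Ck_ext (f := fun z => h z i j - x0 i j) (@open_ball z0 r)).
      by move=> z _; rewrite !mxE.
    apply: (Ck_minus (@open_ball z0 r)); last exact: Ck_cst.
    by apply: Ck_sub (ch 1 i j) => z; exact: rr2'.
  apply: (Ck_ext (f := fun=> 0) (@open_far z0 (r / 2))); last exact: Ck_cst.
  move=> z /[!inE] /= zr; apply/esym/eqP; apply: contrapT => /negP /F_neq0[_ zz _].
  by move: zr; rewrite ltNge (ltW zz).
have cFs : C1c (fun z => F (z + z0)).
  apply: (C1c_comp cF).
    move=> i j; apply: (Ck_ext openT (f := fun z : E => z i j + z0 i j)).
      by move=> z _; rewrite !mxE.
    by apply: (Ck_add openT); [exact: Ck_id_coord|exact: Ck_cst].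
  move=> s; exists (s + `|z0|) => z zs; rewrite -(ltrD2r `|z0|).
  apply: lt_le_trans zs _; rewrite -{1}(addrK z0 z) -[X in _ <= _ + X]normrN; exact: ler_normD.
pose H z := F (k^-1 *: z + z0).
have kV : 0 < k^-1 by rewrite invr_gt0.
have lF : k ^+ (n * 2) * lint F = lint H.
  rewrite -(lint_translate z0 cF) -(lint_scale kV cFs) mulrA -exprMn mulfV ?gt_eqF //.
  by rewrite expr1n mul1r.
have cH : C1c H.
  apply: (C1c_comp cFs).
    move=> i j; apply: (Ck_ext openT (f := fun z : E => k^-1 * z i j)).
      by move=> z _; rewrite !mxE.
    by apply: (Ck_scale openT); exact: Ck_id_coord.
  move=> s; exists (s * k) => z; rewrite -ltr_pdivlMr // normrZ gtr0_norm //.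
  by rewrite mulrC.
have cbL : C1c (fun z => bump (L z)).
  apply: (C1c_comp (@C1c_bump R n)).
    by move=> i j; apply: Ck_lin_fun; move=> s v w; rewrite sL.1 !mxE.
  move=> s; exists (C * s) => z; have := CP z => h1 h2.
  by rewrite -(ltr_pM2l C0); exact: lt_le_trans h2 h1.
have lb : lint (fun z => bump (L z)) = 1 by rewrite (lint_symp sL (@C1c_bump R n)) lint_bump.
rewrite /lift_conv /lift_int -/F lF -lb -lintB; [|exact: C1c_adm|exact: C1c_adm].
have far z : 2 * C < `|z| -> H z = 0 /\ bump (L z) = 0.
  move=> zC; split; last first.
    apply: bump_supp; have := lt_le_trans zC (CP z); rewrite mulrC ltr_pM2l //; exact: lt_trans (ltr1n _ 2).
  apply/eqP; apply: contrapT => /negP /F_neq0[_ zr hk]; move: zr hk.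
  rewrite addrK [_ + z0]addrC => zr hk.
  have zr1 : `|k^-1 *: z| < r1.
    apply: lt_le_trans zr _; apply: le_trans (_ : r <= _); first exact: ltW.
    by rewrite ge_min lexx.
  have := r1P _ zr1; have := CP (k^-1 *: z); rewrite -/x0 -/(L _).
  set X := h (z0 + _) - x0 in hk *; set Y := L _ => h1 h2.
  have h3 : `|Y| <= k^-1 + (2 * C)^-1 * `|k^-1 *: z|.
    rewrite -(subKr X Y); apply: le_trans (ler_normB _ _) _; exact: lerD.
  have h4 : `|k^-1 *: z| <= C * k^-1 + `|k^-1 *: z| / 2.
    apply: le_trans h1 _; rewrite -(ler_pM2l C0) in h3; apply: le_trans h3 _.
    by rewrite mulrDr invfM mulrA mulrA [C * 2^-1]mulrC mulfK ?gt_eqF // [2^-1 * _]mulrC.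
  move: h4; rewrite normrZ gtr0_norm // => h4.
  have h5 : k * (k^-1 * `|z|) <= k * (C * k^-1 + k^-1 * `|z| / 2) by rewrite ler_pM2l.
  move: h5; rewrite mulrDr !mulrA mulfV ?gt_eqF // mul1r [k * C]mulrC mulfK ?gt_eqF //.
  by move=> /le_half; rewrite leNgt zC.
have := C2P (fun z => H z - bump (L z)) (e / C2); rewrite divfK ?gt_eqF //; apply.
- exact: ltW.
- by move=> z /far[-> ->]; rewrite subrr.
move=> z; case: (ltP (2 * C) `|z|) => [/far[-> ->]|zC]; first by rewrite subrr normr0 ltW.
have nz : `|k^-1 *: z| <= 2 * C / k.
  by rewrite normrZ gtr0_norm // mulrC ler_pM2r.
have := le_lt_trans nz kr; rewrite lt_min => /andP[nr nr3].
have Mz : M0 (k^-1 *: z + z0) by apply: rr2'; rewrite addrK.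
rewrite /H F_in // /scaled_bump [_ + z0]addrC.
have Lz : `|L z| <= CL * (2 * C).
  by apply: le_trans (CLP z) _; rewrite ler_pM2l.
have := r3P _ nr3; rewrite -/x0 -/(L _); set X := h _ - x0 => h1.
have Lk : k *: L (k^-1 *: z) = L z by rewrite (lin_funZ sL.1) scalerA divff ?gt_eqF // scale1r.
have h2 : `|k *: X - L z| < de.
  rewrite -Lk -scalerBr normrZ gtr0_norm //.
  apply: le_lt_trans (ler_wpM2l (ltW k0) h1) _.
  apply: (@le_lt_trans _ _ (k * (de / (4 * C) * (2 * C / k)))).
    by rewrite !ler_pM2l.
  have -> : k * (de / (4 * C) * (2 * C / k)) = de / 2 by field; rewrite !gt_eqF.
  by rewrite ltr_pdivrMr // ltr_pMr // ltr1n.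
have [_] := deP _ _ Lz h2.
by have -> : L z + (k *: X - L z) = k *: X by rewrite addrC subrK.
Qed.

(* Cutting G by the lattice partition of unity, the lift of each bump has the
   same mass, so that the lift of G is a Riemann sum of G up to a factor. *)
Lemma lift_int_lattice (G : E -> R) (a b e : R) : a0 < a -> b < b0 -> C1c G ->
  (forall x, ~ (a <= sqn x /\ sqn x <= b) -> G x = 0) -> 0 < e ->
  \forall k \near \oo, `|Lam G - lattice_sum k.+1 G| <= e.
Proof.
move=> aa bb cG G0 e0; have [x0a x0b] : annulus a0 b0 x0 := au Qz0.
pose a1 := (a0 + Num.min a (sqn x0)) / 2; pose b1 := (b0 + Num.max b (sqn x0)) / 2.
have [a01 a1a a1x] : [/\ a0 < a1, a1 < a & a1 < sqn x0].
  have hm : a0 < Num.min a (sqn x0) by rewrite lt_min aa.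
  have h1 : Num.min a (sqn x0) <= a by rewrite ge_min lexx.
  have h2 : Num.min a (sqn x0) <= sqn x0 by rewrite ge_min lexx orbT.
  by rewrite /a1; split; lra.
have [b01 b1b b1x] : [/\ b1 < b0, b < b1 & sqn x0 < b1].
  have hm : Num.max b (sqn x0) < b0 by rewrite gt_max bb.
  have h1 : b <= Num.max b (sqn x0) by rewrite le_max lexx.
  have h2 : sqn x0 <= Num.max b (sqn x0) by rewrite le_max lexx orbT.
  by rewrite /b1; split; lra.
have a1_ge0 : 0 <= a1 := le_trans a0_ge0 (ltW a01).
have [a' [b' [d [d0 aa' bb' shell]]]] := near_shell a01 b01.
have V0 := lift_mass_ge0; have V1 : 0 < lift_mass + 1 by rewrite ltr_wpDl.
have [S SP] := adm_bounded_seq (C1c_adm cG).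
have S0 : 0 <= S := le_trans (normr_ge0 _) (SP 0%N).
have eV : 0 < e / (2 * (lift_mass + 1)) by rewrite divr_gt0 // mulr_gt0.
have eS : 0 < e / (2 * (S + 1)) by rewrite divr_gt0 // mulr_gt0 // ltr_wpDl.
have [K K0 KP] := scaled_bump_mass eS.
have bc : 0 <= `|b0| + 1 by rewrite addr_ge0.
have [d2 d20 d2P] := C0_uniform openT (C1c_C0c cG).1 (@compact_norm_ball R n 2 _ bc) (fun _ _ => I) eV.
have [k0 k0P] : exists k0 : nat, K + d^-1 + d2^-1 + (`|b0| + 1) < k0.+1%:R.
  by exists (Num.truncn (K + d^-1 + d2^-1 + (`|b0| + 1))); exact: truncnS_gt.
exists k0 => // k /= kk0; set c : R := k.+1%:R.
have ck : K + d^-1 + d2^-1 + (`|b0| + 1) < c by apply: lt_le_trans k0P _; rewrite ler_nat ltnS.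
have dV : 0 < d^-1 by rewrite invr_gt0.
have d2V : 0 < d2^-1 by rewrite invr_gt0.
have cK : K < c by move: ck bc; lra.
have c0 : 0 < c by apply: lt_trans cK.
have cd : c^-1 <= d by rewrite invf_ple ?posrE // ltW //; move: ck bc; lra.
have cd2 : c^-1 < d2 by rewrite invf_plt ?posrE //; move: ck bc; lra.
have cb : `|b0| + 1 <= c by move: ck; lra.
have cB := C1c_scaled_bump c0.
have sB : supp_in d (scaled_bump c) by apply: supp_in_le (scaled_bump_supp c0).
pose mu := lift_conv (scaled_bump c) x0.
have muP x : a1 < sqn x -> sqn x < b1 -> lift_conv (scaled_bump c) x = mu.
  by move=> h1 h2; exact: (lift_conv_const aa' bb' a1_ge0 shell cB sB).
have in_norm x : annulus a0 b0 x -> `|x| <= `|b0| + 1.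
  move=> [_ xb]; apply: norm_le_sqn => //; apply: le_trans (ltW xb) _.
  have := ler_norm b0; have := normr_ge0 b0; move: `|b0| => B; nra.
pose th g x := scaled_bump c (x - @grid_pt R n k.+1 g).
have part x : annulus a0 b0 x -> \sum_g th g x = 1.
  by move=> ax; apply: bump_partition => //; apply: le_trans (in_norm _ ax) _.
have th0 g x : 0 <= th g x := bump_ge0 _.
have bth g : bounded_fun (th g).
  by exists 1 => x; rewrite ger0_norm // bump_le1.
pose G1 x := \sum_g G (grid_pt g) * th g x.
have LG1 : Lam G1 = mu * c ^+ (n * 2) * lattice_sum k.+1 G.
  rewrite /G1 lift_int_sum; last by move=> g; exact: bounded_funZ.
  have cc : c ^+ (n * 2) * c^-1 ^+ (n * 2) = 1 by rewrite -exprMn mulfV ?expr1n // gt_eqF.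
  rewrite /lattice_sum -/c -mulrA [c ^+ _ * _]mulrA cc mul1r mulr_sumr; apply: eq_bigr => g _; rewrite lift_intZ // [RHS]mulrC.
  have [->|Gn] := eqVneq (G (grid_pt g)) 0; first by rewrite !mul0r.
  have [h1 h2] : a <= sqn (@grid_pt R n k.+1 g) /\ sqn (@grid_pt R n k.+1 g) <= b.
    by apply: contrapT => /G0 /eqP; exact/negP.
  by congr (_ * _); apply: muP; [exact: lt_le_trans a1a h1|exact: le_lt_trans h2 b1b].
have bG1 : bounded_fun G1.
  exists (\sum_g `|G (@grid_pt R n k.+1 g)|) => x; apply: le_trans (ler_norm_sum _ _ _) _.
  apply: ler_sum => g _; rewrite normrM ler_piMr // ger0_norm //; exact: bump_le1.
have bG := C1c_bounded cG.
have h1 : `|Lam G - Lam G1| <= e / (2 * (lift_mass + 1)) * lift_mass.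
  rewrite -lift_intB //; apply: lift_int_le; [|exact: ltW|].
    have -> : (fun x => G x - G1 x) = (fun x => G x + (-1) * G1 x).
      by apply/funext => x; rewrite mulN1r.
    by apply: bounded_funD => //; exact: bounded_funZ.
  move=> x ax; have -> : G x - G1 x = \sum_g (G x - G (grid_pt g)) * th g x.
    rewrite -[G x in LHS]mulr1 -(part x ax) mulr_sumr -sumrB.
    by apply: eq_bigr => g _; rewrite mulrBl.
  apply: le_trans (ler_norm_sum _ _ _) _.
  rewrite -[X in _ <= X]mulr1 -[X in _ <= _ * X](part x ax) mulr_sumr; apply: ler_sum => g _.
  rewrite normrM [`|th g x|]ger0_norm //.
  have [hx|hx] := leP `|x - @grid_pt R n k.+1 g| c^-1; last first.
    by rewrite (scaled_bump_supp c0 hx : th g x = 0) !mulr0.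
  apply: ler_wpM2r => //; rewrite distrC.
  have [|_] := d2P x (@grid_pt R n k.+1 g - x) (in_norm _ ax).
    by rewrite distrC; exact: le_lt_trans hx cd2.
  by rewrite (_ : x + (@grid_pt R n k.+1 g - x) = @grid_pt R n k.+1 g) // addrCA subrr addr0.
have h2 : `|Lam G1 - lattice_sum k.+1 G| <= e / (2 * (S + 1)) * S.
  rewrite LG1 -[X in _ - X]mul1r -mulrBl normrM [mu * _]mulrC.
  by apply: ler_pM => //; exact: KP.
have -> : Lam G - lattice_sum k.+1 G = (Lam G - Lam G1) + (Lam G1 - lattice_sum k.+1 G).
  by rewrite subrKA.
apply: le_trans (ler_normD _ _) _; apply: le_trans (lerD h1 h2) _.
have half (X : R) : 0 <= X -> e / (2 * (X + 1)) * X <= e / 2.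
  move=> X0; have X1 : 0 < X + 1 by rewrite ltr_wpDl.
  rewrite invfM mulrA -mulrA ler_piMr ?(ltW (divr_gt0 e0 _)) // ler_pdivrMl // mulr1; lra.
by have := half _ V0; have := half _ S0; lra.
Qed.

(** The lattice sums of G approximate both sides. That the common mass of small bumps is the right
    one needs to be known at the single point u(iota z0), where the differential of the lift is
    symplectic. *)
Lemma lift_int_eq (G : E -> R) (a b : R) : a0 < a -> b < b0 -> C1c G ->
  (forall x, ~ (a <= sqn x /\ sqn x <= b) -> G x = 0) -> Lam G = lint G.
Proof.
move=> aa bb cG G0; have bs := adm_bounded_seq (C1c_adm cG).
have bc (x : R) : bounded_seq (fun _ : nat => x) by exists `|x|.
apply/eqP; rewrite eq_le; apply/andP; split; apply/ler_addgt0Pr => e e0.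
  rewrite -lerBlDr -(ulim_cst (Lam G - e)); apply: ulim_le => //.
  apply: filterS (lift_int_lattice aa bb cG G0 e0) => k; rewrite ler_norml => /andP[h1 h2]; lra.
rewrite -(ulim_cst (Lam G + e)); apply: ulim_le => //.
apply: filterS (lift_int_lattice aa bb cG G0 e0) => k; rewrite ler_norml => /andP[h1 h2]; lra.
Qed.

End Linearization.

End LiftVolume.

(** * The obstruction *)

Section RadialIntegrals.
Context {R : realType} {n : nat}.
Local Notation Q := 'M[R]_(1 + n, 2).
Local Notation E := 'M[R]_(n, 2).

Lemma Ck_idR j : Ck j setT (@id R).
Proof.
apply: (Ck_ext openT (f := fun t : R => (t - 0) / (1 - 0))); last exact: Ck_affine.
by move=> t _; rewrite !subr0 divr1.
Qed.

(** The divergence theorem for the field x, of trace 2n, applied to phi(|x|^2). *)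
Lemma lint_radial_field (phi phi' : R -> R) (b : R) : (forall t, is_derive t (1 : R) phi (phi' t)) ->
  Ck 1 setT phi -> (forall t, b <= t -> phi t = 0) ->
  lint (fun x : E => sqn x * phi' (sqn x)) = - (n%:R * lint (fun x : E => phi (sqn x))).
Proof.
move=> dphi cphi phi0; have cF := @C1c_radial R n phi b cphi phi0.
have lid : lin_fun (@id E) by [].
have := lint_lin_field lid cF.
have -> : ltrace (@id E) = 2 * n%:R.
  rewrite /ltrace (eq_bigr (fun=> 1)) => [|[i j] _]; last by rewrite mxE !eqxx.
  by rewrite sumr_const card_prod !card_ord mulnC natrM.
have -> : (fun x : E => 'D_x (fun x : E => phi (sqn x)) x) = (fun x => 2 * (sqn x * phi' (sqn x))).
  by apply/funext => x; rewrite (derive_radial x (dphi (sqn x))) dotzz; ring.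
have -> : (fun x : E => 2 * (sqn x * phi' (sqn x))) = (fun x : E => (phi' (sqn x) * (2 * sqn x))).
  by apply/funext => x; ring.
move=> h; have aG : adm (fun x : E => phi' (sqn x) * (2 * sqn x)).
  have -> : (fun x : E => phi' (sqn x) * (2 * sqn x)) = (fun x => \sum_ij x ij.1 ij.2 * 'D_(delta_mx ij.1 ij.2) (fun x : E => phi (sqn x)) x).
    apply/funext => x; rewrite -[2 * sqn x](_ : 2 * dot x x = _) ?dotzz //.
    by rewrite -(derive_radial x (dphi (sqn x))) (derive_coord x (C1c_diff x cF)).
  apply: adm_sum => -[i j]; apply: C0c_adm; apply: C0cM; first exact: Ck_id_coord.
  exact: C1c_derive.
have -> : (fun x : E => sqn x * phi' (sqn x)) = (fun x => 2^-1 * (phi' (sqn x) * (2 * sqn x))).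
  by apply/funext => x; field.
by rewrite lintZ // h; field.
Qed.

Lemma on_out_iota_adm (psi : Q -> R) (l : R) : 0 <= l -> (forall q, 0 <= psi q <= 1) ->
  (forall q, Qdom q -> l ^+ 2 < sqw q -> psi q = 0) -> adm (on_out (fun z : E => psi (iota z))).
Proof.
move=> l0 psi01 psi0; split.
  exists 1 => z; rewrite /on_out; case: ifP => _; last by rewrite normr0.
  by have /andP[h0 h1] := psi01 (iota z); rewrite ger0_norm.
exists (1 + l) => z zl; rewrite /on_out; case: ifP => // z1; apply: psi0.
  by rewrite /Qdom /= iota_sqy (lt_trans ltr01).
rewrite iota_sqw ?ltW //; have := norm_sqn z; have := l0; move: zl; move: `|z| (sqn z) => N S; nra.
Qed.

(** The bound is the volume of the spherical layer 1 < |z|^2 <= 1 + l^2; for 1 + l^2 = (1 + tau)^2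
    this is the volume of U_tau. The indicator of the layer is approached by plateaus of width d. *)
Lemma on_out_vol (psi : Q -> R) (l : R) : 0 <= l -> (forall q, 0 <= psi q <= 1) ->
  (forall q, Qdom q -> l ^+ 2 < sqw q -> psi q = 0) ->
  0 <= lint (on_out (fun z : E => psi (iota z))) <= @ball_vol R n * ((1 + l ^+ 2) ^+ n - 1).
Proof.
move=> l0 psi01 psi0; have adm_psi := on_out_iota_adm l0 psi01 psi0.
apply/andP; split.
  apply: lint_ge0 => // z; rewrite /on_out; case: ifP => // _.
  by have /andP[] := psi01 (iota z).
set s := 1 + l ^+ 2; have s1 : 1 <= s by rewrite lerDl sqr_ge0.
have s0 : 0 < s by apply: lt_le_trans s1.
pose err (d : R) := @ball_vol R n * ((s + d) ^+ n - (1 - d) ^+ n).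
have -> : @ball_vol R n * (s ^+ n - 1) = err 0 by rewrite /err addr0 subr0 expr1n.
have cid : Ck 0 setT (@id R) := Ck_idR 0.
have cX (f : R -> R) : Ck 0 setT f -> Ck 0 setT (fun d => f d ^+ n).
  move=> cf; elim: n => [|k IH].
    by apply: (Ck_ext openT (f := fun=> 1)); [move=> x _; rewrite expr0|exact: Ck_cst].
  apply: (Ck_ext openT (f := fun d => f d * f d ^+ k)); first by move=> x _; rewrite exprS.
  exact: (Ck_mul openT).
have cerr : Ck 0 setT err.
  apply: (Ck_scale openT); apply: (Ck_minus openT); apply: cX.
    by apply: (Ck_add openT) => //; exact: Ck_cst.
  by apply: (Ck_minus openT) => //; exact: Ck_cst.
apply: (@le_at_right0 R _ 1 err (cerr 0 I) ltr01) => d /andP[d0 d1].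
have ds : s < s + d by rewrite ltrDl.
have d11 : 1 - d < 1 by rewrite ltrBlDr ltrDl.
have d10 : 0 < 1 - d by rewrite subr_gt0.
have /andP[_ up] := @plateau_vol R n s (s + d) s0 ds.
have /andP[lo _] := @plateau_vol R n (1 - d) 1 d10 d11.
have c1 := @C1c_radial R n _ (s + d) (CkW (Ck_plateau s (s + d))) (fun t => plateau0 ds).
have c2 := @C1c_radial R n _ 1 (CkW (Ck_plateau (1 - d) 1)) (fun t => plateau0 d11).
apply: (@le_trans _ _ (lint (fun z : E => plateau s (s + d) (sqn z) - plateau (1 - d) 1 (sqn z)))).
  apply: lint_le => //; first by apply: admB; exact: C1c_adm.
  move=> z; rewrite /on_out; case: (ltP 1 (sqn z)) => z1; last first.
    rewrite [plateau s _ _]plateau1 // ?(le_trans z1 s1) // subr_ge0; exact: plateau_le1.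
  rewrite [plateau (1 - d) _ _]plateau0 ?subr0 ?(ltW z1) //.
  have /andP[p0 p1] := psi01 (iota z).
  case: (leP (sqn z) s) => zs; first by rewrite plateau1.
  rewrite psi0 ?plateau_ge0 //; first by rewrite /Qdom /= iota_sqy (lt_trans ltr01).
  by rewrite iota_sqw ?ltW // ltrBrDl.
rewrite lintB; [|exact: C1c_adm|exact: C1c_adm].
rewrite /err mulrBr ![_ * _ ^+ n]mulrC; exact: lerB.
Qed.

End RadialIntegrals.

(** * Comparison of volumes *)

Section Obstruction.
Context {R : realType} {k : nat}.
Local Notation n := (2 + k)%N.
Local Notation Q := 'M[R]_(1 + n, 2).
Local Notation E := 'M[R]_(n, 2).
Implicit Types (q : Q) (x z : E).

Variables (u : Q -> E) (Qf : set Q) (a0 b0 l a b : R).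
Hypothesis oQf : open Qf.
Hypothesis QfQ : Qf `<=` Qdom.
Hypothesis cu : forall k i j, Ck k Qf (fun q => u q i j).
Hypothesis su : forall q (v w : Q), Qf q -> omega_st ('D_v u q) ('D_w u q) = omh q v w.
Hypothesis ru : forall s q, Qf q -> Qf (rot_by epsX s q) /\ u (rot_by epsX s q) = u q.
Hypothesis wu : forall q, Qf q -> sqw q < l ^+ 2.
Hypothesis au : forall q, Qf q -> annulus a0 b0 (u q).
Hypothesis cl : forall a b, a0 < a -> b < b0 ->
  open [set q | Qdom q /\ ~ (Qf q /\ a <= sqn (u q) /\ sqn (u q) <= b)].
Hypothesis cst_lift : forall phi : Q -> R, (forall q, Qf q -> differentiable phi q) ->
  (forall q v, Qf q -> 'D_v phi q = 0) -> forall q q', Qf q -> Qf q' -> phi q = phi q'.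
Hypothesis inj_u : forall z z', 1 < sqn z -> 1 < sqn z' -> Qf (iota z) -> Qf (iota z') ->
  u (iota z) = u (iota z') -> z = z'.
Hypothesis nonempty : exists z, 1 < sqn z /\ Qf (iota z).
Hypothesis l0 : 0 < l.
Hypothesis a0_ge0 : 0 <= a0.
Hypothesis aa : a0 < a.
Hypothesis ab : a < b.
Hypothesis bb : b < b0.

(* Near every point, step 3 vanishes or step 0 equals 1. These are functions of
   x^2 since chi is 1 or -1 on the other side of the shell. *)
Definition step (e x : R) : R := st (4 * x ^+ 2 - e).

Lemma Ck_step e : Ck 2 setT (step e).
Proof.
apply: (Ck_comp1 openT _ Ck_st); apply: (Ck_minus openT); last exact: Ck_cst.
apply: (Ck_scale openT); apply: (Ck_sqr openT).
exact: Ck_idR.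
Qed.

Lemma derive_step_flat e (chi : Q -> R) q v : differentiable chi q ->
  4 * chi q ^+ 2 - e <= 0 \/ 1 <= 4 * chi q ^+ 2 - e -> 'D_v (fun q => step e (chi q)) q = 0.
Proof.
move=> dc h; have dg : differentiable (fun q => 4 * chi q ^+ 2 - e) q.
  apply: differentiableB; last exact: differentiable_cst.
  apply: differentiableM; first exact: differentiable_cst.
  by have -> : (fun q => chi q ^+ 2) = chi * chi by []; exact: differentiableM.
rewrite /step (derive_comp1 v dg (is_derive_st _)).
by case: h => h; [rewrite (st'_0 h)|rewrite (st'_1 h)]; rewrite mul0r.
Qed.

Let v1 := @ball_vol R n.
Let v1_gt0 : 0 < v1 := @ball_vol_gt0 R n.
Let a_gt0 : 0 < a := le_lt_trans a0_ge0 aa.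
Let n0 : 0 < n%:R :> R. Proof. by rewrite ltr0n. Qed.

(** The volume on the side of the shell where chi is nonzero, smoothed across the shell. [tr] is the
    cohomological quantity to which the dichotomy applies. *)
Let Psi e chi : R := lint (on_out (fun z : E => level_fun chi (step e) (iota z : Q))).
Let tr e chi : R := lint (on_out (fun z => ytrace (cut_form u Qf chi (step e)) (iota z))).

Let step01 e chi q : 0 <= @level_fun R n chi (step e) q <= 1.
Proof. by rewrite st_ge0 st_le1. Qed.

Section Level.
Variables (e : R) (chi : Q -> R) (c0 : R).
Hypothesis e01 : 0 <= e <= 3.
Hypothesis c_chi : Ck 1 Qdom chi.
Hypothesis D_out : forall q v, Qdom q /\ ~ (Qf q /\ a <= sqn (u q) /\ sqn (u q) <= b) -> 'D_v chi q = 0.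
Hypothesis chi_far : forall q, Qdom q -> l ^+ 2 < sqw q -> chi q = 0.
Hypothesis chiE : forall q, Qf q -> chi q = rho a b (sqn (u q)) + c0.

Let step0 : step e 0 = 0.
Proof. by apply: st0; rewrite expr0n mulr0; have := e01; lra. Qed.

Let prof := profile a b c0 (step e).
Let prof' := profile' a b c0 (step e).

Let step1 (x : R) : x ^+ 2 = 1 -> step e x = 1.
Proof. by move=> x1; apply: st1; rewrite x1; have := e01; lra. Qed.

Let rho_lo t : t <= a -> rho a b t = 0.
Proof. by move=> ta; rewrite /rho plateau1 // subrr. Qed.

Let rho_hi t : b <= t -> rho a b t = 1.
Proof. by move=> ta; rewrite /rho plateau0 // subr0. Qed.

Lemma trace_level_form : tr e chi = n%:R * Psi e chi + lint (fun x : E => sqn x * prof' (sqn x)).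
Proof.
have cs := Ck_step e; have [z0 [z01 Qz0]] := nonempty.
have c' : Ck 1 setT (fun t : R => t * prof' t).
  apply: (Ck_mul openT); last exact: Ck_profile'.
  exact: Ck_idR.
have p0 t : b <= t -> t * prof' t = 0.
  by move=> tb; rewrite /prof' (profile'_out ab c0 cs) ?mulr0 //; right.
have cG := @C1c_radial R n _ b c' p0.
have G0 x : ~ (a <= sqn x /\ sqn x <= b) -> sqn x * prof' (sqn x) = 0.
  move=> h; rewrite /prof' (profile'_out ab c0 cs) ?mulr0 //.
  case: (leP (sqn x) a) => xa; [by left|right].
  by rewrite leNgt; apply/negP => xb; apply: h; split; exact: ltW.
rewrite -(lift_int_eq oQf cu su ru wu au cl inj_u l0 a0_ge0 z01 Qz0 aa bb cG G0).
rewrite /lift_int -lintZ; last exact: on_out_iota_adm (ltW l0) (step01 e chi) (level_fun_far chi_far step0).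
rewrite -lintD; last first.
- by apply: (lift_adm u wu l0); exact: C1c_bounded.
- by apply: admZ; exact: on_out_iota_adm (ltW l0) (step01 e chi) (level_fun_far chi_far step0).
congr lint; apply/funext => z; rewrite /on_out; case: ifP => z1; last by rewrite mulr0 addr0.
exact: (ytrace_cut_form oQf cu su ru cl aa bb c_chi D_out chiE cs z1).
Qed.

Let c_prof : Ck 1 setT prof. Proof. exact: CkW (Ck_profile a b c0 (Ck_step e)). Qed.

(** The shell sits as expected: psi is 1 on its inner side and 0 on its outer side. X is the volume
    of the ball that would fill the shell up to the cutoff. *)
Lemma level_mass_down : c0 = -1 -> exists2 X : R, a ^+ n * v1 <= X <= b ^+ n * v1 &
  tr e chi = n%:R * (Psi e chi - X).
Proof.
move=> c01; have lo t : t <= a -> prof t = 1.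
  by move=> ta; rewrite /prof /profile rho_lo // add0r c01 step1 // sqrrN expr1n.
have hi t : b <= t -> prof t = 0.
  by move=> tb; rewrite /prof /profile rho_hi // c01 subrr.
exists (lint (fun x : E => prof (sqn x))); last first.
  rewrite trace_level_form (lint_radial_field (is_derive_profile a b c0 (Ck_step e)) c_prof hi).
  by rewrite mulrBr.
rewrite (lint_radial_ge c_prof hi) //=; last by move=> t /lo ->.
  apply: (lint_radial_le c_prof hi); rewrite ?(lt_trans a_gt0 ab) //.
    by move=> t; exact: st_le1.
  by move=> t /ltW /hi ->.
by move=> t; exact: st_ge0.
Qed.

(** The shell is inside out: psi is 1 beyond its outer sphere. The enclosed volume and that of the
    inner ball now add up instead of being subtracted. *)
Lemma level_mass_up : c0 = 0 -> 0 < tr e chi.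
Proof.
move=> c00; pose phi t := 1 - prof t.
have dphi t : is_derive t (1 : R) phi (- prof' t).
  exact: is_derive_1sub (is_derive_profile a b c0 (Ck_step e) t).
have cphi : Ck 1 setT phi by apply: (Ck_minus openT); [exact: Ck_cst|exact: c_prof].
have lo t : t <= a -> phi t = 1.
  by move=> ta; rewrite /phi /prof /profile rho_lo // add0r c00 step0 subr0.
have hi t : b <= t -> phi t = 0.
  by move=> tb; rewrite /phi /prof /profile rho_hi // c00 addr0 step1 ?expr1n // subrr.
have h := lint_radial_ge cphi hi _ a_gt0 _.
have {}h : a ^+ n * v1 <= lint (fun x : E => phi (sqn x)).
  by apply: h => [t|t /lo ->] //; rewrite subr_ge0 st_le1.
have /andP[p0 _] := on_out_vol (ltW l0) (step01 e chi) (level_fun_far chi_far step0).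
rewrite trace_level_form; have := @lint_radial_field R n phi _ b dphi cphi hi.
have -> : (fun x : E => sqn x * - prof' (sqn x)) = (fun x => (-1) * (sqn x * prof' (sqn x))).
  by apply/funext => x; ring.
rewrite lintZ; last first.
  have c' : Ck 1 setT (fun t : R => t * prof' t).
    apply: (Ck_mul openT); last exact: Ck_profile' (Ck_step e).
    exact: Ck_idR.
  apply: C1c_adm; apply: (@C1c_radial R n _ b c') => t tb.
  by rewrite /prof' (profile'_out ab c0 (Ck_step e)) ?mulr0 //; right.
have an : 0 < a ^+ n * v1 by rewrite mulr_gt0 // exprn_gt0.
rewrite /Psi; move: (lint (on_out _)) p0 (lint (fun x : E => sqn x * prof' (sqn x))) => P p0 I1.
rewrite mulN1r => /oppr_inj ->.
by rewrite ltr_wpDl ?mulr_ge0 ?(ltW n0) // mulr_gt0 // (lt_le_trans an).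
Qed.

End Level.

Lemma annulus_obstruction : (1 + l ^+ 2) ^+ n - 1 < a ^+ n ->
  b < 1 \/ 1 + l ^+ 2 < a -> False.
Proof.
move=> H1 H2; have [z0 [z01 Qz0]] := nonempty.
have ne : exists q, Qf q by exists (iota z0).
have [chi [c_chi D_in D_out chi_far]] := gauge_potential oQf QfQ cu wu cl l0 aa ab bb.
have [c0 [chiE c01]] := potential_const oQf QfQ cu wu cl cst_lift l0 ne aa ab bb c_chi D_in D_out chi_far.
have e3 : 0 <= (3 : R) <= 3 by rewrite lexx andbT.
have e0 : 0 <= (0 : R) <= 3 by rewrite lexx /=.
have s0 e : 0 <= e <= 3 -> step e 0 = 0.
  by move=> /andP[h _]; apply: st0; rewrite expr0n mulr0; lra.
have f2 e := cut_form2 oQf cu su cl aa bb c_chi D_out chiE (Ck_step e).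
have far e he := cut_form_far u wu chi_far (s0 e he).
have iX e := cut_form_X oQf cu ru chiE (Ck_step e).
have alt q : Qdom q -> (forall v w : Q, cut_form u Qf chi (step 3) q v w = 0) \/
    (forall v w : Q, cut_form u Qf chi (step 0) q v w = omh q v w).
  move=> Qq; have dc := Ck_diff c_chi Qq.
  (* [step 3] vanishes with its derivative for chi^2 <= 3/4, and [step 0] is flat with value 1 for
     chi^2 >= 1/4; any threshold in between will do. *)
  case: (leP (chi q ^+ 2) 2^-1) => h; [left|right] => v w.
    have h3 : 4 * chi q ^+ 2 - 3 <= 0 by lra.
    rewrite (@cut_form_flat R n u Qf chi (step 3) q 0) ?mul0r //; last exact: st0.
    by move=> v'; apply: (derive_step_flat v' dc); left.
  have h0 : 1 <= 4 * chi q ^+ 2 - 0 by lra.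
  rewrite (@cut_form_flat R n u Qf chi (step 0) q 1) ?mul1r //; last exact: st1.
  by move=> v'; apply: (derive_step_flat v' dc); right.
have dich := trace_dichotomy l0 (f2 3) (f2 0) (far 3 e3) (far 0 e0) (iX 3) (iX 0) alt.
have up e he := @level_mass_up e chi c0 he c_chi D_out chi_far chiE.
have down e he := @level_mass_down e chi c0 he c_chi D_out chi_far chiE.
case: c01 => c0E.
  (* Inside out: the traces are positive, whereas the dichotomy makes one of them 0 or negative. *)
  case: dich => h; first by have := up 3 e3 c0E; rewrite /tr h ltxx.
  by have := up 0 e0 c0E; rewrite /tr h oppr_gt0 ltNge mulr_ge0 ?(ltW n0) ?(ltW v1_gt0).
have vol e he := on_out_vol (ltW l0) (step01 e chi) (level_fun_far chi_far (s0 e he)).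
case: dich => h.
  (* The exceptional class lies outside: the enclosed volume is that of a full ball, more than U_tau
     contains. *)
  have [X /andP[aX _]] := down 3 e3 c0E; rewrite /tr h => /esym /eqP.
  rewrite mulf_eq0 (gt_eqF n0) /= subr_eq0 => /eqP PX.
  have /andP[_] := vol 3 e3; rewrite -/(Psi 3 chi) PX leNgt => /negP; apply.
  by apply: lt_le_trans aX; rewrite mulrC ltr_pM2r.
have [X /andP[aX Xb]] := down 0 e0 c0E; rewrite /tr h -mulrN => /(mulfI (lt0r_neq0 n0)) PX.
have /andP[p0 p1] := vol 0 e0; rewrite -/(Psi 0 chi) in p0 p1.
have PE : Psi 0 chi = X - v1 by rewrite -[LHS](subrK X) -PX addrC.
(* The exceptional class lies inside: the enclosed volume is X - v1, negative if b < 1 and larger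
   than that of U_tau if a > (1 + tau)^2. *)
case: H2 => h2.
  move: p0; rewrite PE subr_ge0 leNgt => /negP; apply; apply: le_lt_trans Xb _.
  rewrite -[X in _ < X]mul1r ltr_pM2r // exprn_ilt1 // ltW //; exact: lt_trans ab.
move: p1; rewrite PE leNgt => /negP; apply.
rewrite mulrBr mulr1 ltrD2r; apply: lt_le_trans aX; rewrite mulrC ltr_pM2r //.
have s1 : 0 <= 1 + l ^+ 2 by rewrite addr_ge0 // sqr_ge0.
by rewrite ltrXn2r ?nnegrE // ltW.
Qed.

End Obstruction.

(** * Inclusions and shrinking of shells *)

Section ShellCapacity.
Context {R : realType} {n : nat}.
Local Notation E := 'M[R]_(n, 2).
Implicit Types (x y z v w : E).

Lemma sqnE_enorm (r : R) z : 0 <= r -> (enorm z < r) = (sqn z < r ^+ 2).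
Proof. by move=> r0; rewrite -enorm2 ltr_pXn2r ?nnegrE ?sqrtr_ge0. Qed.

Lemma closed_shellP (tau r : R) z : 0 < r -> 0 <= tau ->
  closed_shell n tau r z <-> r ^+ 2 <= sqn z /\ sqn z <= (r * (1 + tau)) ^+ 2.
Proof.
move=> r0 t0; have t1 : 0 <= 1 + tau by rewrite addr_ge0.
have r2 : 0 < r ^+ 2 by rewrite exprn_gt0.
have e0 x : 0 <= enorm x by exact: sqrtr_ge0.
split.
  move=> [x [xt x1] <-]; move/negP: x1; rewrite /eball /= -leNgt enorm_ge1 => x1.
  have xt' : sqn x <= (1 + tau) ^+ 2 by rewrite -enorm2 lerXn2r ?nnegrE.
  by rewrite sqnZ exprMn ler_pMr // ler_pM2l.
move=> [h1 h2]; exists (r^-1 *: z); last by rewrite scalerA divff ?scale1r // gt_eqF.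
have zE : sqn (r^-1 *: z) = sqn z / r ^+ 2 by rewrite sqnZ exprVn mulrC.
split.
  rewrite /ecball /= -(@ler_pXn2r _ 2) ?nnegrE // enorm2 zE ler_pdivrMr //.
  by rewrite mulrC -exprMn.
apply/negP; rewrite -leNgt enorm_ge1 zE ler_pdivlMr // mul1r.
exact: h1.
Qed.

Lemma inclusion_embedding (t : R) : 0 < t ->
  symplectic_embedding (blowup_ball n t) (annulus 1 ((1 + t) ^+ 2)) (@collapse R n).
Proof.
move=> t0; have t1 : 0 <= 1 + t by rewrite addr_ge0 // ltW.
set O := annulus _ _; have oO : open O := @open_annulus R n _ _.
have U_O x : O x -> blowup_ball_set n t (collapse x).
  move=> [x1 xt]; exists x => //; split; first by rewrite /eball /= sqnE_enorm.
  by apply/negP; rewrite -leNgt enorm_ge1 ltW.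
have nz x : O x -> cut_nz None x (cut_wr x) 0.
  by move=> [x1 _]; rewrite /= expr0n addr0 expf_neq0 // gt_eqF // cut_wr_gt0.
have inj x y : O x -> collapse x = collapse y -> x = y.
  move=> [x1 _] xy; have : collapse x y by rewrite xy; exact: collapse_refl.
  by move=> [//|[/enorm_eq1 x1']]; rewrite x1' ltxx in x1.
have cut x : O x -> cut_dom None x by move=> [x1 _]; rewrite /cut_dom /= subr_gt0.
have parE x : O x -> blowup_par None x = collapse x.
  by move=> [x1 _]; rewrite /blowup_par /= -(cut_class_lift (ltW x1)) /cut_wr enorm2.
have domP i x : O x -> blowup_dom i (collapse x) <-> cut_overlap None i x.
  move=> Ox; have x1 : 1 <= sqn x by have [/ltW] := Ox.
  have [h3 h4 h5] : [/\ cut_z None x = x, cut_w0 None x = cut_wr x & cut_w1 None x = 0].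
    by rewrite /= /cut_wr enorm2.
  rewrite /cut_overlap /= blowup_domE; split.
    move=> [z [z1 zn] zx]; split; first exact: cut Ox.
    rewrite -/(cut_w0 None x) -/(cut_w1 None x) -/(cut_z None x) h3 h4 h5.
    rewrite (invariantE (@cut_nz_invariant R n i) z1 (z' := x)) //.
    by rewrite zx; exact: collapse_refl.
  move=> [_]; rewrite -/(cut_w0 None x) -/(cut_w1 None x) -/(cut_z None x) h3 h4 h5.
  by exists x.
have oA i : open (O `&` cut_overlap None i) by apply: openI => //; exact: open_overlap.
have domE i : O `&` @collapse R n @^-1` sm_dom (blowup_ball n t) i = O `&` cut_overlap None i.
  apply/seteqP; split=> x [Ox h]; split=> //; first by apply/domP => //; exact: h.1.
  by split; [exact/domP|exact: U_O].
have T_eq i x : O x -> blowup_chart i (collapse x) = (blowup_chart i \o blowup_par None) x.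
  by move=> Ox; rewrite /= parE.
split.
- by move=> _ [x Ox <-]; exact: U_O.
- by move=> x y; rewrite !inE => Ox _; exact: inj.
- move=> i; rewrite domE; split; first exact: oA.
  move=> k l; apply: (smooth_ext (f := fun x => (blowup_chart i \o blowup_par None) x k l)) => //.
    by move=> x /[!inE] -[Ox _]; rewrite -T_eq.
  by apply: smooth_sub (@smooth_transition R n None i k l) => x [].
- move=> A oAA AO; exists (@collapse R n @` A); last first.
    apply/seteqP; split=> [_ [x Ax <-]|p []//]; split; first by exists x.
    by exists x => //; exact: AO.
  split; first by move=> _ [x /AO/U_O Ux <-].
  move=> i; rewrite (_ : [set _ | _ in _] =
      [set y | cut_overlap i None y /\ A ((blowup_chart None \o blowup_par i) y)]).
    apply: (open_preim (@open_overlap R n i None) oAA) => y oy.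
    apply: differentiable_continuous; apply: differentiable_mx => k l.
    exact: Ck_diff (@smooth_transition R n i None k l 1) oy.
  have chN x : O x -> blowup_chart None (collapse x) = x.
    move=> Ox; have cx := cut x Ox; have nx := cut_nz_cut cx.
    by rewrite -(parE x Ox) (chart_par cx nx) (cut_coord_cut cx).
  have dN x : O x -> blowup_dom None (collapse x).
    by move=> Ox; apply/domP => //; split; [exact: cut|apply: cut_nz_cut; exact: cut].
  apply/seteqP; split.
    move=> _ [p [[dp _] [x Ax xp]] <-]; have Ox := AO _ Ax; rewrite -xp in dp *.
    have dx := dN x Ox; have dp' : blowup_dom i (collapse x) := dp.
    have e : (blowup_chart None \o blowup_par i) (blowup_chart i (collapse x)) = x.
      by apply: etrans (chN x Ox); congr blowup_chart; exact: blowup_chartK.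
    have ov : [set blowup_chart i p | p in blowup_dom i `&` blowup_dom None] (blowup_chart i (collapse x)).
      by exists (collapse x).
    by rewrite overlapE in ov; split; [exact: ov|rewrite e].
  move=> y [oy Ay]; have := oy; rewrite -overlapE => -[p [dp pN] py].
  have e : (blowup_chart None \o blowup_par i) y = blowup_chart None p.
    by rewrite -py; congr blowup_chart; exact: blowup_chartK.
  rewrite e in Ay; have Oy := AO _ Ay.
  have pE : p = collapse (blowup_chart None p) by rewrite -(parE _ Oy) blowup_chartK.
  exists p => //; split; last by exists (blowup_chart None p).
  by split=> //; rewrite pE; exact: U_O.
- move=> i x Ox [dx _] v w; have ox : cut_overlap None i x by apply/domP.
  have near_eq v' : 'D_v' (blowup_chart i \o @collapse R n) x =
      'D_v' (blowup_chart i \o blowup_par None) x.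
    apply: near_eq_derive; have : \forall y \near x, O y by exact: open_nbhs_nbhs.
    by apply: filterS => y Oy; exact: T_eq.
  by rewrite -[LHS]/(omega_st _ _) !near_eq; exact: (transition_symplectic v w ox).
Qed.

Lemma inclusion_shell (tau t r : R) : 0 < tau -> 1 < r -> r * (1 + tau) < 1 + t ->
  shell_embeds tau (blowup_ball n t) r.
Proof.
move=> tau0 r1 rt; have r0 : 0 < r by apply: lt_trans r1.
have rt0 : 0 < r * (1 + tau) by rewrite mulr_gt0 // addr_gt0.
have t0 : 0 < t by nra.
exists (annulus 1 ((1 + t) ^+ 2)), (@collapse R n); split.
- exact: open_annulus.
- move=> z /(closed_shellP z r0 (ltW tau0))[h1 h2]; split.
    by apply: lt_le_trans h1; rewrite exprn_egt1.
  apply: le_lt_trans h2 _; rewrite ltrXn2r ?nnegrE ?(ltW rt0) //.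
- exact: inclusion_embedding.
Qed.

Lemma closed_shell_compact (tau r : R) : 0 < r -> 0 <= tau -> compact (closed_shell n tau r).
Proof.
move=> r0 t0; rewrite (_ : closed_shell n tau r =
    [set x : E | r ^+ 2 <= sqn x /\ sqn x <= (r * (1 + tau)) ^+ 2]); first exact: compact_sqn.
by apply/seteqP; split=> x /closed_shellP; apply.
Qed.

(** The embedding lives on an open neighbourhood of the compact shell, which contains all slightly
    smaller shells. This brings the radius 1 into the range of radii below 1. *)
Lemma shell_embeds_shrink (M : symplecticManifold R n) (tau r : R) : 0 < r -> 0 <= tau ->
  shell_embeds tau M r -> exists2 d : R, 0 < d & forall s : R, r - d < s -> s <= r -> 0 < s ->
    shell_embeds tau M s.
Proof.
move=> r0 t0 [ O [f [ oO sO emb]]].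
have [|d d0 dP] := @compact_uniform R E (fun x e => O ((1 - e) *: x)) _ (closed_shell_compact r0 t0).
  move=> x Kx; have [e e0 eP] := near_ball_open oO (sO _ Kx).
  have x2 : 0 < 2 + `|x| by rewrite ltr_wpDr.
  exists (Num.min 1 (e / (2 + `|x|))).
    by rewrite lt_min ltr01 divr_gt0.
  move=> y; rewrite lt_min => /andP[y1 ye] s /andP[s0]; rewrite lt_min => /andP[s1 se].
  apply: eP; rewrite scalerBl scale1r addrAC; apply: le_lt_trans (ler_normB _ _) _.
  rewrite normrZ gtr0_norm //.
  have yx : `|y| <= 1 + `|x|.
    by rewrite -(subrK x y); apply: le_trans (ler_normD _ _) _; rewrite lerD2r ltW.
  have h : s * `|y| <= s * (1 + `|x|) by rewrite ler_pM2l.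
  have sX : s * (2 + `|x|) < e by rewrite -ltr_pdivlMr.
  move: ye; rewrite ltr_pdivlMr // => ye.
  rewrite -(ltr_pM2r x2) mulrDl.
  have h2 : s * `|y| * (2 + `|x|) <= s * (2 + `|x|) * (1 + `|x|).
    by rewrite mulrAC; apply: ler_wpM2l => //; rewrite mulr_ge0 // ltW.
  have h3 : s * (2 + `|x|) * (1 + `|x|) < e * (1 + `|x|) by rewrite ltr_pM2r // ltr_pwDl.
  move: ye h2 h3; set A := _ * (2 + _); set B := s * _ * _; set C := s * _ * _; lra.
exists (r * d); first by rewrite mulr_gt0.
move=> s sd sr s0; exists O, f; split=> // z /(closed_shellP z s0 t0)[h1 h2].
have [E0|rs] := eqVneq s r; first by apply: sO; apply/closed_shellP => //; rewrite -E0.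
have sr' : s < r by rewrite lt_neqAle rs.
have q0 : 0 < s / r by rewrite divr_gt0.
have e01 : 0 < 1 - s / r < d.
  rewrite subr_gt0 ltr_pdivrMr // mul1r sr' /= ltrBlDl -ltrBlDr ltr_pdivlMr //.
  by rewrite mulrBl mul1r [d * r]mulrC.
have Kz : closed_shell n tau r ((s / r)^-1 *: z).
  apply/closed_shellP => //; rewrite sqnZ exprVn.
  have q2 : 0 < (s / r) ^+ 2 by rewrite exprn_gt0.
  rewrite ler_pdivlMl // ler_pdivrMl // -!exprMn.
  have -> : s / r * r = s by rewrite divfK // gt_eqF.
  by rewrite mulrA divfK ?gt_eqF.
by have := dP _ Kz _ e01; rewrite opprB addrC subrK scalerA divff ?scale1r // gt_eqF.
Qed.

End ShellCapacity.

(** * Shells in U_tau *)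

Section ShellObstruction.
Context {R : realType} {k : nat}.
Local Notation n := (2 + k)%N.
Local Notation E := 'M[R]_(n, 2).

Lemma sqn_delta (m : nat) (i : 'I_m) : sqn (delta_mx i 0 : 'M[R]_(m, 2)) = 1.
Proof. by rewrite -dotzz dot_e0 mxE !eqxx. Qed.

Lemma shell_obstruction (tau r a b : R) : 0 < tau -> 0 < r -> r ^+ 2 < a -> a < b ->
  b < (r * (1 + tau)) ^+ 2 -> (1 + tau) ^+ (2 * n) - 1 < a ^+ n ->
  b < 1 \/ (1 + tau) ^+ 2 < a -> ~ shell_embeds tau (blowup_ball n tau) r.
Proof.
move=> t0 r0 ra ab br H1 H2 [ O [f [oO sO [fM fi fsm _ fs]]]].
set a0 := r ^+ 2 in ra; set b0 := (r * (1 + tau)) ^+ 2 in br.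
have subO (x : E) : annulus a0 b0 x -> O x.
  by move=> [h1 h2]; apply: sO; apply/(closed_shellP x r0 (ltW t0)); split; exact: ltW.
have fU (x : E) : annulus a0 b0 x -> blowup_ball_set n tau (f x).
  by move=> /subO Ox; apply: fM; exists x.
have inj (x y : E) : annulus a0 b0 x -> annulus a0 b0 y -> f x = f y -> x = y.
  by move=> /subO Ox /subO Oy; apply: fi; rewrite inE.
have domE (i : option 'I_n) : annulus a0 b0 `&` f @^-1` blowup_dom i =
    annulus a0 b0 `&` (O `&` f @^-1` sm_dom (blowup_ball n tau) i).
  apply/seteqP; split=> x; last by move=> [ax [_ [dx _]]].
  by move=> [ax dx]; split=> //; split; [exact: subO|split=> //; exact: fU].
have oA (i : option 'I_n) : open (annulus a0 b0 `&` f @^-1` blowup_dom i).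
  by rewrite domE; apply: openI; [exact: open_annulus|have [] := fsm i].
have sF (i : option 'I_n) : smooth_mx (annulus a0 b0 `&` f @^-1` blowup_dom i) (blowup_chart i \o f).
  have [_ h] := fsm i; move=> p q; apply: smooth_sub (h p q).
  by rewrite domE => x [].
have fs' (i : option 'I_n) (x v w : E) : (annulus a0 b0 `&` f @^-1` blowup_dom i) x ->
    omega_st ('D_v (blowup_chart i \o f) x) ('D_w (blowup_chart i \o f) x) = omega_st v w.
  by rewrite domE => -[_ [Ox dx]]; exact: fs.
have s1 : 1 < (1 + tau) ^+ 2 by rewrite exprn_egt1 // ltrDl.
(* The bound of |w| on the lift of U_tau. *)
pose l := Num.sqrt ((1 + tau) ^+ 2 - 1).
have l0 : 0 < l by rewrite sqrtr_gt0 subr_gt0.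
have l2 : l ^+ 2 = (1 + tau) ^+ 2 - 1 by rewrite sqr_sqrtr // subr_ge0 ltW.
have l2' : 1 + l ^+ 2 = (1 + tau) ^+ 2 by rewrite l2 addrC subrK.
have a00 : 0 <= a0 by exact: sqr_ge0.
have m0 : 0 <= (a + b) / 2 by rewrite divr_ge0 // addr_ge0 // (le_trans a00) // ltW // (lt_trans ra).
pose x0 : E := Num.sqrt ((a + b) / 2) *: delta_mx 0 0.
have ax0 : annulus a0 b0 x0.
  by rewrite /annulus /= /x0 sqnZ sqn_delta mulr1 sqr_sqrtr //; split; lra.
apply: (@annulus_obstruction R k (lift a0 b0 f) (lift_dom a0 b0 f) a0 b0 l a b).
- exact: open_lift_dom inj oA sF fs'.
- exact: lift_dom_sub.
- exact: Ck_lift inj oA sF fs'.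
- by move=> q v w Qq; exact: (lift_symp inj oA sF fs' v w Qq).
- by move=> s q Qq; exact: (lift_rot inj s Qq).
- by move=> q Qq; rewrite l2; exact: (lift_sqw fU Qq).
- by move=> q /liftP[].
- by move=> a' b' h1 h2; exact: (lift_closed inj oA sF fU h1 h2).
- by move=> phi dphi Dphi q q' Qq Qq'; exact: (lift_const inj oA sF fU dphi Dphi a00 Qq Qq').
- exact: lift_iota_inj.
- have [z hz] := lift_iota inj oA sF fs' fU ax0; by exists z.
- exact: l0.
- exact: a00.
- exact: ra.
- exact: ab.
- exact: br.
- by rewrite l2' -exprM.
- by rewrite l2'.
Qed.

Lemma bernoulli (x : R) (m : nat) : 0 <= x <= 1 -> 1 - m%:R * x <= (1 - x) ^+ m.
Proof.
move=> /andP[x0 x1]; elim: m => [|m IH]; first by rewrite mul0r subr0 expr0.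
rewrite exprS; have h : (1 - x) * (1 - m%:R * x) <= (1 - x) * (1 - x) ^+ m.
  by apply: ler_wpM2l => //; rewrite subr_ge0.
apply: le_trans h; rewrite -natr1; have : 0 <= m%:R * (x * x) by rewrite !mulr_ge0.
move: (m%:R : R) => M; nra.
Qed.

(** Above radius 1 the squared radii a < b are taken beyond (1 + tau)^2, near the outer sphere; up
    to radius 1, after shrinking, they are taken below 1, near the inner sphere. In both cases a^n
    exceeds (1 + tau)^(2n) - 1. *)
Lemma shell_bound (tau : R) : 0 < tau -> (1 + tau) ^+ (2 * n) < 2 ->
  exists2 p : R, 0 <= p < 1 & forall r, p < r -> ~ shell_embeds tau (blowup_ball n tau) r.
Proof.
move=> t0 t2; set X := (1 + tau) ^+ (2 * n) - 1.
have X0 : 0 < X by rewrite subr_gt0 exprn_egt1 // ltrDl.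
have X1 : X < 1 by rewrite /X; lra.
have N0 : 0 < (2 * n)%:R :> R by rewrite ltr0n.
have N1 : 1 <= (2 * n)%:R :> R by rewrite ler1n.
(* Bernoulli's inequality then gives (1 - x)^(2n) >= X, so 1 - x can serve as the bound p without
   extracting a root. *)
pose x := (1 - X) / (2 * n)%:R.
have x0 : 0 < x by rewrite divr_gt0 // subr_gt0.
have x1 : x <= 1 by rewrite ler_pdivrMr // mul1r; lra.
have pX : X <= (1 - x) ^+ (2 * n).
  have := @bernoulli x (2 * n) _; rewrite (ltW x0) x1 => /(_ isT); apply: le_trans.
  by rewrite /x mulrC divfK ?gt_eqF //; lra.
exists (1 - x); first by apply/andP; split; lra.
move=> r rp emb; have r0 : 0 < r by lra.
have s1 : 1 < 1 + tau by rewrite ltrDl.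
have below r' a : 1 - x < r' -> r' ^+ 2 < a -> X < a ^+ n.
  move=> pr ra; apply: le_lt_trans pX _.
  have p0 : 0 <= 1 - x by lra.
  rewrite exprM; apply: (@lt_trans _ _ ((r' ^+ 2) ^+ n)).
    by rewrite ltrXn2r ?nnegrE ?sqr_ge0 // ltrXn2r ?nnegrE //; lra.
  by rewrite ltrXn2r ?nnegrE ?sqr_ge0 // ltW //; apply: le_lt_trans ra; exact: sqr_ge0.
case: (ltP 1 r) => r1.
  set m := Num.max (r ^+ 2) ((1 + tau) ^+ 2).
  have h1 : r ^+ 2 <= m by rewrite le_max lexx.
  have h2 : (1 + tau) ^+ 2 <= m by rewrite le_max lexx orbT.
  have h3 : m < (r * (1 + tau)) ^+ 2.
    rewrite exprMn gt_max ltr_pMr ?exprn_gt0 // ltr_pMl ?exprn_gt0 ?(lt_trans ltr01) //.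
    by rewrite !exprn_egt1.
  set M := (r * (1 + tau)) ^+ 2 in h3.
  apply: (@shell_obstruction tau r (m + (M - m) / 3) (m + 2 * (M - m) / 3)) emb => //; rewrite -?/M; try lra.
    by apply: (below r) => //; lra.
(* For r = 1 no subshell with b < 1 exists; a slightly smaller radius r' above 1 - x creates the
   room. *)
have [d d0 dP] := shell_embeds_shrink r0 (ltW t0) emb.
pose r' := (Num.max (r - d) (1 - x) + r) / 2.
have h1 : r - d <= Num.max (r - d) (1 - x) by rewrite le_max lexx.
have h2 : 1 - x <= Num.max (r - d) (1 - x) by rewrite le_max lexx orbT.
have h3 : Num.max (r - d) (1 - x) < r by rewrite gt_max rp andbT; lra.
have [q1 q2 q3] : [/\ r - d < r', 1 - x < r' & r' < r] by rewrite /r'; split; lra.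
have r'0 : 0 < r' by lra.
have {}emb := dP r' q1 (ltW q3) r'0.
set M := Num.min 1 ((r' * (1 + tau)) ^+ 2).
have M1 : M <= 1 by rewrite ge_min lexx.
have M2 : M <= (r' * (1 + tau)) ^+ 2 by rewrite ge_min lexx orbT.
have M3 : r' ^+ 2 < M.
  have r'1 : r' < 1 by lra.
  have e : (r' * (1 + tau)) ^+ 2 = r' ^+ 2 * (1 + tau) ^+ 2 := exprMn _ _ _.
  have r'2 : 0 < r' ^+ 2 by rewrite exprn_gt0.
  by rewrite lt_min e (ltr_pMr _ r'2) exprn_egt1 // andbT exprn_ilt1 // ltW.
set m := r' ^+ 2 in M3.
apply: (@shell_obstruction tau r' (m + (M - m) / 3) (m + 2 * (M - m) / 3)) emb => //; rewrite -?/m; try lra.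
  by apply: (below r') => //; rewrite -/m; lra.
Qed.

End ShellObstruction.

(** The jump is between a capacity below pi at tau and values at least pi for every t > tau,
    realized by inclusions of shells of radius slightly above 1. *)
Theorem theorem1p4 (R : realType) (n : nat) (tau : R)
    (n_ge2 : (2 <= n)%N) (tau_gt0 : 0 < tau)
    (tau_lt : tau < 2 `^ ((2 * n)%:R^-1) - 1) :
  ~ (shell_capacity tau (blowup_ball n t) @[t --> within `]0, +oo[ (nbhs tau)]
       --> shell_capacity tau (blowup_ball n tau)).
Proof.
have [k nE] : exists k, n = (2 + k)%N by exists (n - 2)%N; rewrite subnKC.
subst n => cvg_cap.
have t2 : (1 + tau) ^+ (2 * (2 + k)) < 2.
  have N0 : (2 * (2 + k))%:R != 0 :> R by rewrite pnatr_eq0.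
  have h : 1 + tau < 2 `^ ((2 * (2 + k))%:R^-1) by move: tau_lt; lra.
  have h0 : 0 <= 1 + tau by rewrite addr_ge0 // ltW.
  have -> : (2 : R) = (2 `^ ((2 * (2 + k))%:R^-1)) ^+ (2 * (2 + k)).
    by rewrite -powR_mulrn ?powR_ge0 // -powRrM mulVf // powRr1.
  by rewrite ltrXn2r ?nnegrE ?powR_ge0.
have [p /andP[p0 p1] pP] := shell_bound tau_gt0 t2.
(* The supremum is at most pi p^2, and p < 1 leaves a gap below pi. *)
have cap_lt : (shell_capacity tau (blowup_ball (2 + k) tau) < (pi : R)%:E)%E.
  rewrite ltNge; apply/negP => cap.
  have pp : ((pi * p ^+ 2)%:E < shell_capacity tau (blowup_ball (2 + k) tau))%E.
    by apply: lt_le_trans cap; rewrite lte_fin gtr_pMr ?pi_gt0 // exprn_ilt1.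
  have [_ [r [r0 emb] <-]] := ereal_sup_gt pp.
  rewrite lte_fin ltr_pM2l ?pi_gt0 // ltr_pXn2r ?nnegrE ?(ltW r0) // => pr.
  exact: pP r pr emb.
have := cvg_cap _ (open_nbhs_nbhs (conj (@open_ereal_lt_ereal R (pi : R)%:E) cap_lt)).
rewrite /nbhs /= /within /= => /nbhs_ballP[e /= e0 eP].
pose t := tau + e / 2.
have tt : tau < t by rewrite ltrDl divr_gt0.
have t0 : 0 < t by apply: lt_trans tt.
have te : ball tau e t.
  rewrite /ball /= /t opprD addrA subrr add0r normrN gtr0_norm ?divr_gt0 //.
  by rewrite ltr_pdivrMr // ltr_pMr // ltr1n.
have := eP t te; rewrite in_itv /= andbT => /(_ t0); rewrite ltNge => /negP; apply.
(* The midpoint of 1 and (1 + t) / (1 + tau): the closed shell then lies strictly between the unit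
   sphere and the boundary of B_(1+t). *)
pose r := (1 + (1 + t) / (1 + tau)) / 2.
have s0 : 0 < 1 + tau by rewrite addr_gt0.
have q1 : 1 < (1 + t) / (1 + tau) by rewrite ltr_pdivlMr // mul1r ltrD2l.
have r1 : 1 < r by rewrite /r; lra.
have rt : r * (1 + tau) < 1 + t by rewrite -ltr_pdivlMr // /r; lra.
apply: (@le_trans _ _ (pi * r ^+ 2)%:E).
  by rewrite lee_fin ler_pMr ?pi_gt0 // exprn_ege1 // ltW.
apply: ereal_sup_ubound; exists r => //; split; first exact: lt_trans r1.
exact: inclusion_shell.
Qed.
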